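(* Let $s=\sigma+it$ with $\sigma<1$ and $|s-1|\ge 4\pi$. Then for every integer $k\ge m$ the identity $$\mathcal{R}(s)=\chi(s)\Bigl\{\zeta(1-s)-\sum_{n=1}^{k}n^{s-1}-\eta^{s-1}e^{-\pi i\eta^2}\Bigl[\frac{\sqrt2\,e^{3\pi i/8}\sin\pi\eta-(-1)^k e^{2\pi i\eta-2\pi i(\eta-k)^2}}{2\cos 2\pi\eta}+\sum_{j=m+1}^{k}(-1)^{j-1}e^{-2\pi i(j-\eta)^2}w(j-\eta)+R\Bigr]\Bigr\}$$ holds (for $s\ne0$), with $R:=\int_{m\searrow m+1}\frac{e^{-2\pi i(x-\eta)^2}}{e^{\pi i x}-e^{-\pi i x}}w(x-\eta)\,dx$ satisfying $$|R|\le\frac{\min(4,\,29e^{-\pi\eta_2})}{|\eta|}+15\,\frac{e^{-\frac{\pi}{32}|\eta|^2}}{|\eta|}.$$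
   Context: $\mathcal{R}(s)=\int_{0\swarrow 1}\frac{x^{-s}e^{\pi i x^2}}{e^{\pi i x}-e^{-\pi i x}}\,dx$, where $0\swarrow1$ is a straight line of direction $e^{-3\pi i/4}$ crossing the real axis in $(0,1)$; $a\searrow b$ denotes a straight line of direction $e^{-\pi i/4}$ crossing the real axis in $(a,b)$. $\chi(s)=\pi^{s-1/2}\Gamma(\frac{1-s}{2})/\Gamma(\frac s2)$. For $\sigma<1$: $\eta:=\sqrt{(s-1)/(2\pi i)}$ with $-\pi/4<\arg\eta<3\pi/4$, $\eta_1=\Re\eta$, $\eta_2=\Im\eta$, $m=\lfloor\eta_1+\eta_2\rfloor$, and $w(z):=\exp\{2\pi i\eta^2(\log(1+z/\eta)-z/\eta+\frac12(z/\eta)^2)\}-1$. Principal branches are used for powers and logarithms. *)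

(* Defs.v *)
From Stdlib Require Import Reals List ZArith.
From Coquelicot Require Import Coquelicot.
Open Scope R_scope.

Definition cexp (z : C) : C :=
  (exp (Re z) * cos (Im z), exp (Re z) * sin (Im z)).

Definition carg (z : C) : R :=
  if Req_EM_T (Cmod z) 0 then 0
  else if Rle_dec 0 (Im z) then acos (Re z / Cmod z)
       else - acos (Re z / Cmod z).

Definition clog (z : C) : C := (ln (Cmod z), carg z).

Definition cpow (a b : C) : C := cexp (b * clog a)%C.

Definition csqrt (z : C) : C := cpow z (RtoC (/2)).

Definition ci : C := (0, 1).

Definition csin (z : C) : C := ((cexp (ci * z) - cexp (- (ci * z))) / (2 * ci))%C.
Definition ccos (z : C) : C := ((cexp (ci * z) + cexp (- (ci * z))) / 2)%C.

Definition Clim (u : nat -> C) : C :=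
  (real (Lim_seq (fun n => Re (u n))), real (Lim_seq (fun n => Im (u n)))).

(** finite sums of complex numbers over an integer range a..b (empty if b < a) *)
Definition CsumZ (f : Z -> C) (a b : Z) : C :=
  fold_right Cplus (RtoC 0)
    (map (fun i => f (a + Z.of_nat i)%Z) (seq 0 (Z.to_nat (b - a + 1)))).

Definition CInt_line (f : R -> C) : C :=
  @RInt_gen C_R_CompleteNormedModule f
    (Rbar_locally m_infty) (Rbar_locally p_infty).

Definition line_integral (c : R) (d : C) (f : C -> C) : C :=
  CInt_line (fun u => (f (RtoC c + RtoC u * d) * d)%C).

Definition dir_SW : C := cexp (RtoC (-3 * PI / 4) * ci)%C.
Definition dir_SE : C := cexp (RtoC (- PI / 4) * ci)%C.

Fixpoint Cprod_shift (z : C) (n : nat) : C :=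
  match n with
  | O => z
  | S n' => (Cprod_shift z n' * (z + RtoC (INR n)))%C
  end.

(** Euler's Gamma function via Gauss's limit formula
    Gamma(z) = lim n! n^z / (z (z+1) ... (z+n))   (z not in 0,-1,-2,...) *)
Definition CGamma (z : C) : C :=
  Clim (fun n => (RtoC (INR (fact n)) * cpow (RtoC (INR n)) z / Cprod_shift z n)%C).

(** 1/Gamma (entire), via the same Gauss formula *)
Definition CinvGamma (z : C) : C :=
  Clim (fun n => (Cprod_shift z n / (RtoC (INR (fact n)) * cpow (RtoC (INR n)) z))%C).

Definition chi (s : C) : C :=
  (cpow (RtoC PI) (s - RtoC (/2)) * CGamma ((1 - s) / 2) * CinvGamma (s / 2))%C.

(** Riemann zeta in the half plane Re w > 0, w <> 1 (analytic continuation),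
    zeta(w) = lim_N ( sum_{n=1}^N n^{-w} - N^{1-w}/(1-w) ). *)
Definition zeta (w : C) : C :=
  Clim (fun N => (CsumZ (fun n => cpow (RtoC (IZR n)) (- w)) 1 (Z.of_nat N)
                  - cpow (RtoC (INR N)) (1 - w) / (1 - w))%C).

(** R(s) = int_{0 \swarrow 1} x^{-s} e^{pi i x^2} / (e^{pi i x} - e^{-pi i x}) dx,
    the line crossing the real axis at c in (0,1). *)
Definition Rcal (c : R) (s : C) : C :=
  line_integral c dir_SW
    (fun x => (cpow x (- s) * cexp (RtoC PI * ci * x * x)
               / (cexp (RtoC PI * ci * x) - cexp (- (RtoC PI * ci * x))))%C).

Definition eta (s : C) : C := csqrt ((s - 1) / (2 * RtoC PI * ci))%C.

Definition mZ (s : C) : Z := Int_part (Re (eta s) + Im (eta s)).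

Definition wfun (s z : C) : C :=
  let e := eta s in
  (cexp (2 * RtoC PI * ci * e * e *
         (clog (1 + z / e) - z / e + (z / e) * (z / e) / 2)) - 1)%C.

(** R := int_{m \searrow m+1} e^{-2 pi i (x-eta)^2}/(e^{pi i x}-e^{-pi i x}) w(x-eta) dx,
    the line crossing the real axis at c in (m, m+1). *)
Definition Rrem (c : R) (s : C) : C :=
  let e := eta s in
  line_integral c dir_SE
    (fun x => (cexp (- (2 * RtoC PI * ci * (x - e) * (x - e)))
               / (cexp (RtoC PI * ci * x) - cexp (- (RtoC PI * ci * x)))
               * wfun s (x - e))%C).

(* Main.v *)
(* Write w = 1 - s. The integral of [x^{-w} exp(-pi i x^2) / (exp(pi i x) - exp(-pi i x))] over a line of direction SE
   through (0,1), times Gamma(w), is a Mellin transform of Mordell integrals in Y = exp(-pi i/4) e^t, which have a closed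
   form; comparing with Gamma(w) n^{-w} = int e^{wt - nY} and integrating by parts shows that Gamma(w) (w-1)
   (zeta(w) - integral) is an explicit multiple of int x^{w-1} h'(x) dx over the half-line of direction exp(pi i/4), with
   h(x) = x exp(pi i x^2) / (exp(pi i x) - exp(-pi i x)). The odd function h' has no singularity at 0, so R(s) reduces to the
   same integral by moving its line to the origin, and chi(s) is the ratio of the two constants:
   R(s) = chi(s) (zeta(w) - integral).

   Moving the SE line across 1, ..., m produces the sum of n^{s-1}. On the line through (m, m+1) the saddle point of the
   numerator is eta, and the numerator is exactly a constant times exp(-2 pi i (x-eta)^2) (1 + w(x-eta)). The Gaussian part is moved
   on to (k, k+1) and is again a Mordell integral; the other part is R.

   For the bound let the line pass at distance at most 1/4 from eta and cross the axis at distance at least 1/4 from the integers.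
   With z = x - eta and q = z/eta, log(1+q) - q + q^2/2 is the integral of v^2/(1+v) over [0, q]. On the line
   |v/(1+v)| <= S < 2, so the exponent of w is at most pi S |z|^2 in modulus and the Gaussian dominates it; it is also at most
   a constant times |z|^3/|eta|, which gives the factor 1/|eta|. One takes S = 3/2 for |eta| >= 5/2; for smaller |eta| the value
   S = 8/5 suffices because of the second term of the bound. *)

Require Import Defs.
From Stdlib Require Import Reals ZArith Lra Lia Psatz FunctionalExtensionality IndefiniteDescription.
From Coquelicot Require Import Coquelicot.
Open Scope R_scope.

(** Integration by parts is forced by the origin: h tends to 1/(2 pi i) there, so the Mellin
    integral of h that appears first converges only for Re w > 1, whereas h' is bounded and its
    Mellin integral converges for Re w > 0. The price is the factor w - 1, hence s <> 0. Residues
    are replaced by a model pole, a Gaussian over x, whose integrals on either side of 0 come from a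
    Mellin integral; what remains after subtracting it is bounded, and dominated convergence makes
    its jump vanish. Every integral is given the form of an absolutely convergent integral over R:
    half-lines become lines under x = exp t, and rotating a half-line becomes translating t by a
    complex number. In the final estimate |v/(1+v)| <= S says that the line stays outside an
    Apollonius circle. For large |eta| and eta near an axis this needs S >= sqrt 2, while exp(-2 pi
    v^2) absorbs exp(pi S v^2) only for S < 2. The values S = 3/2 from |eta| = 5/2 on and S = 8/5
    from |eta| = 1.4 on barely meet the first condition. *)

Section Continuity.

(** * Continuity of complex-valued functions *)

Context {U : UniformSpace}.

Lemma continuous_ReIm (f : U -> C) (x : U) :
  continuous (fun y => Re (f y)) x -> continuous (fun y => Im (f y)) x ->
  continuous f x.
Proof.
  intros H1 H2. apply filterlim_locally. intros eps.
  apply (filterlim_locally (fun y => Re (f y))) with (eps := eps) in H1.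
  apply (filterlim_locally (fun y => Im (f y))) with (eps := eps) in H2.
  generalize (filter_and _ _ H1 H2). apply filter_imp.
  intros y [A B]. split; assumption.
Qed.

Lemma continuous_Re (f : U -> C) (x : U) :
  continuous f x -> continuous (fun y => Re (f y)) x.
Proof.
  intros H. apply filterlim_locally. intros eps.
  apply (filterlim_locally f) with (eps := eps) in H.
  revert H. apply filter_imp. intros y [A B]. exact A.
Qed.

Lemma continuous_Im (f : U -> C) (x : U) :
  continuous f x -> continuous (fun y => Im (f y)) x.
Proof.
  intros H. apply filterlim_locally. intros eps.
  apply (filterlim_locally f) with (eps := eps) in H.
  revert H. apply filter_imp. intros y [A B]. exact B.
Qed.

Lemma continuous_RtoC (f : U -> R) (x : U) :
  continuous f x -> continuous (fun y => RtoC (f y)) x.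
Proof.
  intros H. apply continuous_ReIm; simpl; [exact H | apply continuous_const].
Qed.

Lemma continuous_Rplus (f g : U -> R) x :
  continuous f x -> continuous g x -> continuous (fun y => f y + g y) x.
Proof. intros. now apply (continuous_plus (V := R_NormedModule) f g). Qed.

Lemma continuous_Rmult (f g : U -> R) x :
  continuous f x -> continuous g x -> continuous (fun y => f y * g y) x.
Proof. intros. now apply (continuous_mult (K := R_AbsRing) f g). Qed.

Lemma continuous_Ropp (f : U -> R) x :
  continuous f x -> continuous (fun y => - f y) x.
Proof. intros. now apply (continuous_opp (V := R_NormedModule) f). Qed.

Lemma continuous_Rminus (f g : U -> R) x :
  continuous f x -> continuous g x -> continuous (fun y => f y - g y) x.
Proof. intros. now apply (continuous_minus (V := R_NormedModule) f g). Qed.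

Lemma continuous_Rcomp (g : R -> R) (f : U -> R) x :
  continuous f x -> continuity_pt g (f x) -> continuous (fun y => g (f y)) x.
Proof.
  intros. apply (continuous_comp f g); auto. now apply continuity_pt_filterlim.
Qed.

Lemma continuous_Rinv_comp' (f : U -> R) x :
  continuous f x -> f x <> 0 -> continuous (fun y => / f y) x.
Proof.
  intros. apply (continuous_Rcomp Rinv); auto.
  apply continuity_pt_inv; auto. apply continuity_pt_id.
Qed.

Lemma continuous_Cplus (f g : U -> C) x :
  continuous f x -> continuous g x -> continuous (fun y => (f y + g y)%C) x.
Proof.
  intros. apply continuous_ReIm; simpl.
  - now apply continuous_Rplus; apply continuous_Re.
  - now apply continuous_Rplus; apply continuous_Im.
Qed.

Lemma continuous_Copp (f : U -> C) x :
  continuous f x -> continuous (fun y => (- f y)%C) x.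
Proof.
  intros. apply continuous_ReIm; simpl.
  - now apply continuous_Ropp; apply continuous_Re.
  - now apply continuous_Ropp; apply continuous_Im.
Qed.

Lemma continuous_Cminus (f g : U -> C) x :
  continuous f x -> continuous g x -> continuous (fun y => (f y - g y)%C) x.
Proof. intros. apply continuous_Cplus; auto. now apply continuous_Copp. Qed.

Lemma continuous_Cmult (f g : U -> C) x :
  continuous f x -> continuous g x -> continuous (fun y => (f y * g y)%C) x.
Proof.
  intros. apply continuous_ReIm; simpl.
  - apply continuous_Rminus; apply continuous_Rmult;
      [now apply (continuous_Re f) | now apply (continuous_Re g)
      | now apply (continuous_Im f) | now apply (continuous_Im g)].
  - apply continuous_Rplus; apply continuous_Rmult;
      [now apply (continuous_Re f) | now apply (continuous_Im g)
      | now apply (continuous_Im f) | now apply (continuous_Re g)].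
Qed.

Lemma continuous_Cinv (f : U -> C) x :
  continuous f x -> f x <> 0%C -> continuous (fun y => (/ f y)%C) x.
Proof.
  intros H H0.
  assert (D : fst (f x) ^ 2 + snd (f x) ^ 2 <> 0).
  { intros E. apply H0. destruct (f x) as [a b]; simpl in *.
    assert (a = 0) by nra. assert (b = 0) by nra. now subst. }
  assert (G : continuous (fun y => fst (f y) ^ 2 + snd (f y) ^ 2) x).
  { pose proof (continuous_Re f x H) as A. pose proof (continuous_Im f x H) as B.
    unfold Re, Im in A, B. simpl.
    apply continuous_Rplus; apply continuous_Rmult; auto;
      apply continuous_Rmult; auto; apply continuous_const. }
  apply continuous_ReIm; simpl.
  - apply continuous_Rmult; [now apply (continuous_Re f)|].
    now apply continuous_Rinv_comp'.
  - apply continuous_Rmult; [apply continuous_Ropp; now apply (continuous_Im f)|].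
    now apply continuous_Rinv_comp'.
Qed.

Lemma continuous_Cdiv (f g : U -> C) x :
  continuous f x -> continuous g x -> g x <> 0%C -> continuous (fun y => (f y / g y)%C) x.
Proof. intros. apply continuous_Cmult; auto. now apply continuous_Cinv. Qed.

Lemma continuous_cexp (f : U -> C) x :
  continuous f x -> continuous (fun y => cexp (f y)) x.
Proof.
  intros. apply continuous_ReIm; simpl; apply continuous_Rmult.
  - apply (continuous_Rcomp exp); [now apply continuous_Re|].
    apply derivable_continuous_pt, derivable_pt_exp.
  - apply (continuous_Rcomp cos); [now apply continuous_Im|].
    apply continuity_cos.
  - apply (continuous_Rcomp exp); [now apply continuous_Re|].
    apply derivable_continuous_pt, derivable_pt_exp.
  - apply (continuous_Rcomp sin); [now apply continuous_Im|].
    apply continuity_sin.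
Qed.

Lemma continuous_csin (f : U -> C) x :
  continuous f x -> continuous (fun y => csin (f y)) x.
Proof.
  intros. unfold csin. apply continuous_Cdiv;
    [ | apply continuous_const | intro E; inversion E; lra].
  apply continuous_Cminus; apply continuous_cexp;
   [|apply continuous_Copp]; apply continuous_Cmult; auto; apply continuous_const.
Qed.

Lemma continuous_ccos (f : U -> C) x :
  continuous f x -> continuous (fun y => ccos (f y)) x.
Proof.
  intros. unfold ccos. apply continuous_Cdiv;
    [ | apply continuous_const | intro E; inversion E; lra].
  apply continuous_Cplus; apply continuous_cexp;
   [|apply continuous_Copp]; apply continuous_Cmult; auto; apply continuous_const.
Qed.
End Continuity.

(** The uniform structure on C is that of a product, with squares as balls; the factor sqrt 2
    converts between squares and discs. *)
Lemma continuous_Cmod_eps {U : UniformSpace} (f : U -> C) (x : U) :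
  continuous f x <->
  forall eps : R, 0 < eps -> locally x (fun y => Cmod (f y - f x)%C < eps).
Proof.
  split.
  - intros H eps He.
    assert (Hp : 0 < eps / sqrt 2) by (apply Rdiv_lt_0_compat; [lra | apply sqrt_lt_R0; lra]).
    apply (filterlim_locally f) with (eps := mkposreal _ Hp) in H.
    revert H. apply filter_imp. intros y Hy.
    pose proof (C_NormedModule_mixin_compat2 (f x) (f y) (mkposreal _ Hp) Hy) as K.
    simpl in K. replace (sqrt 2 * (eps / sqrt 2)) with eps in K.
    exact K. field. apply Rgt_not_eq, sqrt_lt_R0; lra.
  - intros H. apply filterlim_locally. intros eps.
    generalize (H eps (cond_pos eps)). apply filter_imp. intros y Hy.
    now apply (C_NormedModule_mixin_compat1 (f x) (f y)).
Qed.

Ltac ccont_step :=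
  match goal with
  | |- continuous (fun _ => ?c) _ => apply continuous_const
  | |- continuous (fun y => y) _ => apply continuous_id
  | |- continuous (fun y => RtoC (@?f y)) _ => apply (continuous_RtoC f)
  | |- continuous (fun y => Cminus (@?f y) (@?g y)) _ => apply (continuous_Cminus f g)
  | |- continuous (fun y => Cplus (@?f y) (@?g y)) _ => apply (continuous_Cplus f g)
  | |- continuous (fun y => Copp (@?f y)) _ => apply (continuous_Copp f)
  | |- continuous (fun y => Cmult (@?f y) (@?g y)) _ => apply (continuous_Cmult f g)
  | |- continuous (fun y => Cdiv (@?f y) (@?g y)) _ => apply (continuous_Cdiv f g)
  | |- continuous (fun y => Cinv (@?f y)) _ => apply (continuous_Cinv f)
  | |- continuous (fun y => cexp (@?f y)) _ => apply (continuous_cexp f)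
  | |- continuous cexp ?z => apply (continuous_cexp (fun y => y))
  | |- continuous csin ?z => apply (continuous_csin (fun y => y))
  | |- continuous ccos ?z => apply (continuous_ccos (fun y => y))
  | |- continuous (fun y => csin (@?f y)) _ => apply (continuous_csin f)
  | |- continuous (fun y => ccos (@?f y)) _ => apply (continuous_ccos f)
  | |- continuous (fun y => Rminus (@?f y) (@?g y)) _ => apply (continuous_Rminus f g)
  | |- continuous (fun y => Rplus (@?f y) (@?g y)) _ => apply (continuous_Rplus f g)
  | |- continuous (fun y => Ropp (@?f y)) _ => apply (continuous_Ropp f)
  | |- continuous (fun y => Rmult (@?f y) (@?g y)) _ => apply (continuous_Rmult f g)
  | |- continuous (fun y => exp (@?f y)) _ =>
      apply (continuous_Rcomp exp f);
      [ | apply derivable_continuous_pt, derivable_pt_exp]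
  | |- continuous _ _ => assumption
  end.
Ltac ccont := repeat ccont_step.

Ltac cring :=
  match goal with |- ?a = ?b => change (@eq C a b) end;
  try change (UniformSpace.sort R_UniformSpace) with R; ring.

(** * Complex exponential *)

Lemma cexp_plus (a b : C) : cexp (a + b) = (cexp a * cexp b)%C.
Proof.
  unfold cexp, Re, Im, Cmult, Cplus; simpl.
  rewrite exp_plus, cos_plus, sin_plus. f_equal; ring.
Qed.

Lemma cexp_0 : cexp 0 = 1%C.
Proof. unfold cexp; simpl. rewrite exp_0, cos_0, sin_0. apply injective_projections; simpl; ring. Qed.

Lemma cexp_neg_mult (a : C) : (cexp (- a) * cexp a)%C = 1%C.
Proof. rewrite <- cexp_plus. replace (- a + a)%C with (RtoC 0) by ring. apply cexp_0. Qed.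

Lemma cexp_neq_0 (a : C) : cexp a <> 0%C.
Proof.
  intros E. pose proof (cexp_neg_mult a) as H. rewrite E, Cmult_0_r in H.
  inversion H. lra.
Qed.

Lemma cexp_opp (a : C) : cexp (- a) = (/ cexp a)%C.
Proof.
  pose proof (cexp_neq_0 a). pose proof (cexp_neg_mult a).
  rewrite <- (Cmult_1_r (cexp (- a))), <- (Cinv_r (cexp a)) by auto.
  rewrite Cmult_assoc, H0. ring.
Qed.

Lemma cexp_minus (a b : C) : cexp (a - b) = (cexp a / cexp b)%C.
Proof. unfold Cminus, Cdiv. now rewrite cexp_plus, cexp_opp. Qed.

Lemma Cmod_cexp (a : C) : Cmod (cexp a) = exp (Re a).
Proof.
  unfold Cmod, cexp; simpl.
  replace (_ + _) with (exp (Re a) ^ 2 * ((sin (Im a))² + (cos (Im a))²)) by (unfold Rsqr; ring).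
  rewrite sin2_cos2, Rmult_1_r. rewrite sqrt_pow2; auto. left; apply exp_pos.
Qed.

Lemma cexp_R (x : R) : cexp x = RtoC (exp x).
Proof. unfold cexp, RtoC; simpl. rewrite cos_0, sin_0. f_equal; ring. Qed.

Lemma im_le_Cmod (c : C) : Rabs (Im c) <= Cmod c.
Proof. eapply Rle_trans; [apply Rmax_r | apply (Rmax_Cmod c)]. Qed.

Lemma Cmod_le_Re_Im (c : C) : Cmod c <= Rabs (Re c) + Rabs (Im c).
Proof.
  destruct c as [a b]; simpl. unfold Cmod; simpl.
  pose proof (Rabs_pos a). pose proof (Rabs_pos b).
  rewrite <- (sqrt_pow2 (Rabs a + Rabs b)) by lra.
  apply sqrt_le_1_alt. rewrite !Rmult_1_r.
  assert (a * a = Rabs a * Rabs a) by (rewrite <- Rabs_mult; rewrite Rabs_pos_eq; nra).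
  assert (b * b = Rabs b * Rabs b) by (rewrite <- Rabs_mult; rewrite Rabs_pos_eq; nra).
  simpl. nra.
Qed.

Lemma Cmod_triangle_rev (a b : C) : Cmod a - Cmod b <= Cmod (a - b).
Proof.
  pose proof (Cmod_triangle (a - b) b) as H.
  replace (a - b + b)%C with a in H by ring. lra.
Qed.

Lemma Cmod_minus_le (a b : C) : Cmod (a - b) <= Cmod a + Cmod b.
Proof. unfold Cminus. eapply Rle_trans; [apply Cmod_triangle|]. rewrite Cmod_opp. lra. Qed.

(** * Complex differentiability *)

(** A Frechet derivative rather than a limit of difference quotients: nothing is divided by [h], so
    [h = 0] needs no exception, and the rules of differentiation become inequalities. *)
Definition holo (f : C -> C) (z l : C) : Prop :=
  forall eps : R, 0 < eps -> exists del : R, 0 < del /\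
    forall h : C, Cmod h < del -> Cmod (f (z + h) - f z - l * h)%C <= eps * Cmod h.

Lemma holo_eq f z l l' : holo f z l' -> l' = l -> holo f z l.
Proof. now intros H <-. Qed.

Lemma holo_ext_loc f g z l : 
  (exists r, 0 < r /\ forall h, Cmod h < r -> f (z + h)%C = g (z + h)%C) ->
  holo f z l -> holo g z l.
Proof.
  intros [r [Hr E]] H eps He. destruct (H eps He) as [d [Hd K]].
  exists (Rmin d r). split; [now apply Rmin_pos|]. intros h Hh.
  assert (Cmod h < d) by (eapply Rlt_le_trans; [exact Hh | apply Rmin_l]).
  assert (Cmod h < r) by (eapply Rlt_le_trans; [exact Hh | apply Rmin_r]).
  rewrite <- E by auto.
  replace (g z) with (f z). auto.
  replace z with (z + 0)%C by ring. apply E. now rewrite Cmod_0.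
Qed.

Lemma holo_ext f g z l : (forall x, f x = g x) -> holo f z l -> holo g z l.
Proof. intros E. apply holo_ext_loc. exists 1. split; [lra | auto]. Qed.

Lemma holo_const a z : holo (fun _ => a) z 0.
Proof.
  intros eps He. exists 1. split; [lra|]. intros h _.
  replace (a - a - 0 * h)%C with (RtoC 0) by ring. rewrite Cmod_0.
  pose proof (Cmod_ge_0 h). nra.
Qed.

Lemma holo_id z : holo (fun x => x) z 1.
Proof.
  intros eps He. exists 1. split; [lra|]. intros h _.
  replace (z + h - z - 1 * h)%C with (RtoC 0) by ring. rewrite Cmod_0.
  pose proof (Cmod_ge_0 h). nra.
Qed.

Lemma holo_plus f g z a b :
  holo f z a -> holo g z b -> holo (fun x => f x + g x)%C z (a + b)%C.
Proof.
  intros H1 H2 eps He.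
  destruct (H1 (eps / 2)) as [d1 [D1 K1]]; [lra|].
  destruct (H2 (eps / 2)) as [d2 [D2 K2]]; [lra|].
  exists (Rmin d1 d2). split; [now apply Rmin_pos|]. intros h Hh.
  assert (Cmod h < d1) by (eapply Rlt_le_trans; [exact Hh | apply Rmin_l]).
  assert (Cmod h < d2) by (eapply Rlt_le_trans; [exact Hh | apply Rmin_r]).
  replace (f (z + h) + g (z + h) - (f z + g z) - (a + b) * h)%C with
    ((f (z + h) - f z - a * h) + (g (z + h) - g z - b * h))%C by ring.
  eapply Rle_trans; [apply Cmod_triangle|].
  specialize (K1 h H). specialize (K2 h H0). lra.
Qed.

Lemma holo_bound f z l : holo f z l ->
  exists del, 0 < del /\ forall h, Cmod h < del -> Cmod (f (z + h) - f z)%C <= (Cmod l + 1) * Cmod h.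
Proof.
  intros H. destruct (H 1) as [d [D K]]; [lra|]. exists d; split; auto.
  intros h Hh. specialize (K h Hh).
  replace (f (z + h) - f z)%C with ((f (z + h) - f z - l * h) + l * h)%C by ring.
  eapply Rle_trans; [apply Cmod_triangle|]. rewrite Cmod_mult. lra.
Qed.

Lemma div_succ_le_1 (x : R) : 0 <= x -> x / (x + 1) <= 1.
Proof.
  intros H. apply (Rmult_le_reg_r (x + 1)); [lra|].
  unfold Rdiv. rewrite Rmult_assoc, Rinv_l; lra.
Qed.

Lemma scale_le_1 (x y : R) : x <= 1 -> 0 <= y -> x * y <= y.
Proof. intros. nra. Qed.

Lemma holo_comp f g z a b :
  holo g z b -> holo f (g z) a -> holo (fun x => f (g x)) z (a * b)%C.
Proof.
  intros Hg Hf eps He.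
  destruct (holo_bound _ _ _ Hg) as [d0 [D0 K0]].
  set (B := Cmod b + 1) in *.
  assert (HB : 0 < B) by (unfold B; pose proof (Cmod_ge_0 b); lra).
  pose proof (Cmod_ge_0 a) as Ha.
  destruct (Hf (eps / 2 / B)) as [d1 [D1 K1]].
  { apply Rdiv_lt_0_compat; lra. }
  destruct (Hg (eps / 2 / (Cmod a + 1))) as [d2 [D2 K2]].
  { apply Rdiv_lt_0_compat; lra. }
  exists (Rmin d0 (Rmin d2 (d1 / B))). split.
  { repeat apply Rmin_pos; auto. now apply Rdiv_lt_0_compat. }
  intros h Hh.
  assert (L0 : Cmod h < d0) by (eapply Rlt_le_trans; [exact Hh | apply Rmin_l]).
  assert (L2 : Cmod h < d2) by (eapply Rlt_le_trans; [exact Hh | eapply Rle_trans; [apply Rmin_r|apply Rmin_l]]).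
  assert (L1 : Cmod h < d1 / B) by (eapply Rlt_le_trans; [exact Hh | eapply Rle_trans; [apply Rmin_r|apply Rmin_r]]).
  set (k := (g (z + h) - g z)%C).
  assert (Kk : Cmod k <= B * Cmod h) by (apply K0; auto).
  assert (Kd : Cmod k < d1).
  { eapply Rle_lt_trans; [exact Kk|]. apply (Rmult_lt_compat_l B) in L1; auto.
    replace (B * (d1 / B)) with d1 in L1 by (field; lra). lra. }
  replace (f (g (z + h)) - f (g z) - a * b * h)%C with
    ((f (g z + k) - f (g z) - a * k) + a * (g (z + h) - g z - b * h))%C.
  2: { unfold k. replace (g z + (g (z + h) - g z))%C with (g (z + h)%C) by ring. ring. }
  eapply Rle_trans; [apply Cmod_triangle|].
  rewrite Cmod_mult. specialize (K1 k Kd). specialize (K2 h L2).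
  assert (E1 : eps / 2 / B * Cmod k <= eps / 2 * Cmod h).
  { replace (eps / 2 * Cmod h) with (eps / 2 / B * (B * Cmod h)) by (field; lra).
    apply Rmult_le_compat_l; auto. left. apply Rdiv_lt_0_compat; lra. }
  assert (E2 : Cmod a * Cmod (g (z + h) - g z - b * h)%C <= eps / 2 * Cmod h).
  { eapply Rle_trans; [apply Rmult_le_compat_l; [exact Ha | exact K2]|].
    replace (Cmod a * (eps / 2 / (Cmod a + 1) * Cmod h)) with
      ((Cmod a / (Cmod a + 1)) * (eps / 2 * Cmod h)) by (field; lra).
    assert (Cmod a / (Cmod a + 1) <= 1) by (apply div_succ_le_1; lra).
    apply scale_le_1; auto. apply Rmult_le_pos; [lra | apply Cmod_ge_0]. }
  lra.
Qed.

Lemma holo_mult f g z a b :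
  holo f z a -> holo g z b -> holo (fun x => f x * g x)%C z (a * g z + f z * b)%C.
Proof.
  intros Hf Hg eps He.
  destruct (holo_bound _ _ _ Hf) as [d0 [D0 K0]].
  set (F := Cmod (f z)). set (G := Cmod (g z)). set (A := Cmod a + 1) in *.
  assert (0 <= F) by apply Cmod_ge_0. assert (0 <= G) by apply Cmod_ge_0.
  assert (HA : 0 < A) by (unfold A; pose proof (Cmod_ge_0 a); lra).
  destruct (holo_bound _ _ _ Hg) as [d3 [D3 K3]].
  set (B := Cmod b + 1) in *.
  assert (HB : 0 < B) by (unfold B; pose proof (Cmod_ge_0 b); lra).
  destruct (Hf (eps / 3 / (G + 1))) as [d1 [D1 K1]]; [apply Rdiv_lt_0_compat; lra|].
  destruct (Hg (eps / 3 / (F + 1))) as [d2 [D2 K2]]; [apply Rdiv_lt_0_compat; lra|].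
  set (d4 := eps / 3 / (A * B)).
  assert (D4 : 0 < d4) by (apply Rdiv_lt_0_compat; [lra | now apply Rmult_lt_0_compat]).
  exists (Rmin (Rmin d0 d1) (Rmin d2 (Rmin d3 d4))). split.
  { repeat apply Rmin_pos; auto. }
  intros h Hh.
  pose proof (Rmin_l (Rmin d0 d1) (Rmin d2 (Rmin d3 d4))).
  pose proof (Rmin_r (Rmin d0 d1) (Rmin d2 (Rmin d3 d4))).
  pose proof (Rmin_l d0 d1). pose proof (Rmin_r d0 d1).
  pose proof (Rmin_l d2 (Rmin d3 d4)). pose proof (Rmin_r d2 (Rmin d3 d4)).
  pose proof (Rmin_l d3 d4). pose proof (Rmin_r d3 d4).
  specialize (K0 h ltac:(lra)). specialize (K1 h ltac:(lra)).
  specialize (K2 h ltac:(lra)). specialize (K3 h ltac:(lra)).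
  pose proof (Cmod_ge_0 h) as Hh0.
  replace (f (z + h) * g (z + h) - f z * g z - (a * g z + f z * b) * h)%C with
    ((f (z + h) - f z - a * h) * g z + f z * (g (z + h) - g z - b * h)
      + (f (z + h) - f z) * (g (z + h) - g z))%C by ring.
  eapply Rle_trans; [apply Cmod_triangle|].
  eapply Rle_trans; [apply Rplus_le_compat_r, Cmod_triangle|].
  rewrite !Cmod_mult. fold F G.
  assert (E1 : Cmod (f (z + h) - f z - a * h)%C * G <= eps / 3 * Cmod h).
  { eapply Rle_trans; [apply Rmult_le_compat_r; [auto | exact K1]|].
    replace (eps / 3 / (G + 1) * Cmod h * G) with ((G / (G + 1)) * (eps / 3 * Cmod h)) by (field; lra).
    assert (G / (G + 1) <= 1) by (apply div_succ_le_1; lra).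
    apply scale_le_1; auto. apply Rmult_le_pos; [lra | apply Cmod_ge_0]. }
  assert (E2 : F * Cmod (g (z + h) - g z - b * h)%C <= eps / 3 * Cmod h).
  { eapply Rle_trans; [apply Rmult_le_compat_l; [auto | exact K2]|].
    replace (F * (eps / 3 / (F + 1) * Cmod h)) with ((F / (F + 1)) * (eps / 3 * Cmod h)) by (field; lra).
    assert (F / (F + 1) <= 1) by (apply div_succ_le_1; lra).
    apply scale_le_1; auto. apply Rmult_le_pos; [lra | apply Cmod_ge_0]. }
  assert (E3 : Cmod (f (z + h) - f z)%C * Cmod (g (z + h) - g z)%C <= eps / 3 * Cmod h).
  { eapply Rle_trans; [apply Rmult_le_compat; [apply Cmod_ge_0 | apply Cmod_ge_0 | exact K0 | exact K3]|].
    assert (Cmod h <= d4) by lra.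
    replace (A * Cmod h * (B * Cmod h)) with (A * B * Cmod h * Cmod h) by ring.
    apply Rmult_le_compat_r; auto.
    apply (Rmult_le_compat_l (A * B)) in H9; [|nra].
    replace (A * B * d4) with (eps / 3) in H9; auto. unfold d4. field. nra. }
  lra.
Qed.

Lemma holo_scal f z a k : holo f z a -> holo (fun x => k * f x)%C z (k * a)%C.
Proof.
  intros H. eapply holo_eq; [apply holo_mult; [apply holo_const | exact H]|]. cbv beta; ring.
Qed.

Lemma holo_opp f z a : holo f z a -> holo (fun x => - f x)%C z (- a)%C.
Proof.
  intros H. apply (holo_ext (fun x => (- (1)) * f x)%C); [intros; ring|].
  eapply holo_eq; [apply holo_scal; exact H|]. cbv beta; ring.
Qed.

Lemma holo_minus f g z a b :
  holo f z a -> holo g z b -> holo (fun x => f x - g x)%C z (a - b)%C.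
Proof. intros. apply holo_plus; auto. now apply holo_opp. Qed.

Lemma holo_Cinv (z : C) : z <> 0%C -> holo Cinv z (- / (z * z))%C.
Proof.
  intros Hz eps He. apply Cmod_gt_0 in Hz as Hm.
  set (m := Cmod z) in *.
  exists (Rmin (m / 2) (eps * m * m * m / 2)). split.
  { apply Rmin_pos; [lra|]. repeat apply Rmult_lt_0_compat; lra. }
  intros h Hh.
  pose proof (Rmin_l (m / 2) (eps * m * m * m / 2)).
  pose proof (Rmin_r (m / 2) (eps * m * m * m / 2)).
  pose proof (Cmod_triangle_rev z (- h)) as T. rewrite Cmod_opp in T.
  replace (z - - h)%C with (z + h)%C in T by ring. fold m in T.
  assert (Hzh : (z + h)%C <> 0%C) by (apply Cmod_gt_0; lra).
  replace (/ (z + h) - / z - - / (z * z) * h)%C with ((h * h) / ((z + h) * (z * z)))%C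
    by (field; auto).
  rewrite Cmod_div by (repeat apply Cmult_neq_0; auto).
  rewrite !Cmod_mult. fold m.
  pose proof (Cmod_ge_0 h).
  assert (P : 0 < Cmod (z + h) * (m * m)) by (apply Rmult_lt_0_compat; nra).
  apply (Rmult_le_reg_r (Cmod (z + h) * (m * m))); auto.
  unfold Rdiv. rewrite Rmult_assoc, Rinv_l, Rmult_1_r by lra.
  assert (Cmod h <= eps * (Cmod (z + h) * (m * m))).
  { apply Rle_trans with (eps * (m / 2 * (m * m))); [lra|].
    apply Rmult_le_compat_l; [lra|]. apply Rmult_le_compat_r; nra. }
  nra.
Qed.

Lemma holo_inv f z a : holo f z a -> f z <> 0%C ->
  holo (fun x => / f x)%C z (- a / (f z * f z))%C.
Proof.
  intros H H0. eapply holo_eq; [apply (holo_comp Cinv f); [exact H | now apply holo_Cinv]|]. cbv beta.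
  field; auto.
Qed.

Lemma holo_div f g z a b : holo f z a -> holo g z b -> g z <> 0%C ->
  holo (fun x => f x / g x)%C z ((a * g z - f z * b) / (g z * g z))%C.
Proof.
  intros H1 H2 H3. eapply holo_eq; [apply holo_mult; [exact H1|apply holo_inv; [exact H2| auto]]|]. cbv beta.
  field; auto.
Qed.

Lemma locally_C_ball (z : C) (P : C -> Prop) (r : R) : 0 < r ->
  (forall y, Cmod (y - z) < r -> P y) -> locally z P.
Proof.
  intros Hr H. 
  assert (Hp : 0 < r / sqrt 2) by (apply Rdiv_lt_0_compat; [lra | apply sqrt_lt_R0; lra]).
  exists (mkposreal _ Hp). intros y Hy. apply H.
  pose proof (C_NormedModule_mixin_compat2 z y (mkposreal _ Hp) Hy) as K.
  simpl in K. replace (sqrt 2 * (r / sqrt 2)) with r in K.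
  exact K. field. apply Rgt_not_eq, sqrt_lt_R0; lra.
Qed.

Lemma holo_continuous f z l : holo f z l -> continuous f z.
Proof.
  intros H. apply continuous_Cmod_eps. intros eps He.
  destruct (holo_bound _ _ _ H) as [d [D K]].
  set (B := Cmod l + 1) in *.
  assert (HB : 0 < B) by (unfold B; pose proof (Cmod_ge_0 l); lra).
  assert (HE : 0 < eps / B) by now apply Rdiv_lt_0_compat.
  apply locally_C_ball with (Rmin d (eps / B)); [now apply Rmin_pos|].
  intros y Hy. specialize (K (y - z)%C).
  replace (z + (y - z))%C with y in K by ring.
  pose proof (Rmin_l d (eps / B)). pose proof (Rmin_r d (eps / B)).
  eapply Rle_lt_trans; [apply K; lra|].
  replace eps with (B * (eps / B)) by (field; lra).
  apply Rmult_lt_compat_l; lra.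
Qed.

Lemma derive_little_o (f : R -> R) x l : is_derive f x l ->
  forall eps, 0 < eps -> exists d, 0 < d /\ forall h, Rabs h < d ->
    Rabs (f (x + h) - f x - l * h) <= eps * Rabs h.
Proof.
  intros H eps He. apply is_derive_Reals in H. destruct (H eps He) as [d K].
  exists d. split; [apply cond_pos|]. intros h Hh.
  destruct (Req_dec h 0) as [->|N].
  { rewrite Rplus_0_r. replace (f x - f x - l * 0) with 0 by ring. rewrite Rabs_R0. lra. }
  specialize (K h N Hh).
  replace (f (x + h) - f x - l * h) with (((f (x + h) - f x) / h - l) * h) by (field; auto).
  rewrite Rabs_mult. apply Rmult_le_compat_r; [apply Rabs_pos | lra].
Qed.

(** Splitting into real and imaginary parts reduces this to the real derivatives of exp, cos and sin
    at 0; the functional equation then moves the result to any point. *)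
Lemma holo_cexp_0 : holo cexp 0 1.
Proof.
  intros eps He.
  destruct (derive_little_o exp 0 1) with (eps := Rmin 1 (eps / 8)) as [d1 [D1 K1]].
  { replace 1 with (exp 0) by apply exp_0. apply is_derive_Reals, derivable_pt_lim_exp. }
  { apply Rmin_pos; lra. }
  destruct (derive_little_o cos 0 0) with (eps := eps / 12) as [d2 [D2 K2]].
  { replace 0 with (- sin 0) at 2 by (rewrite sin_0; ring). apply is_derive_Reals, derivable_pt_lim_cos. }
  { lra. }
  destruct (derive_little_o sin 0 1) with (eps := Rmin 1 (eps / 12)) as [d3 [D3 K3]].
  { replace 1 with (cos 0) by apply cos_0. apply is_derive_Reals, derivable_pt_lim_sin. }
  { apply Rmin_pos; lra. }
  exists (Rmin (Rmin d1 (Rmin d2 d3)) (Rmin 1 (eps / 16))). split.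
  { repeat apply Rmin_pos; lra. }
  intros h Hh.
  pose proof (Rmin_l (Rmin d1 (Rmin d2 d3)) (Rmin 1 (eps / 16))).
  pose proof (Rmin_r (Rmin d1 (Rmin d2 d3)) (Rmin 1 (eps / 16))).
  pose proof (Rmin_l d1 (Rmin d2 d3)). pose proof (Rmin_r d1 (Rmin d2 d3)).
  pose proof (Rmin_l d2 d3). pose proof (Rmin_r d2 d3).
  pose proof (Rmin_l 1 (eps / 16)). pose proof (Rmin_r 1 (eps / 16)).
  pose proof (re_le_Cmod h) as Ra. pose proof (im_le_Cmod h) as Rb.
  specialize (K1 (Re h) ltac:(lra)). specialize (K2 (Im h) ltac:(lra)). specialize (K3 (Im h) ltac:(lra)).
  rewrite Rplus_0_l, exp_0 in K1. rewrite Rplus_0_l, cos_0 in K2. rewrite Rplus_0_l, sin_0 in K3.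
  replace (RtoC 0 + h)%C with h by ring. rewrite cexp_0.
  eapply Rle_trans; [apply Cmod_le_Re_Im|].
  set (a := Re h) in *. set (b := Im h) in *. 
  pose proof (Rmin_l 1 (eps / 8)). pose proof (Rmin_r 1 (eps / 8)).
  pose proof (Rmin_l 1 (eps / 12)). pose proof (Rmin_r 1 (eps / 12)).
  pose proof (Rabs_pos a). pose proof (Rabs_pos b). pose proof (Cmod_ge_0 h) as C0.
  assert (E1 : Rabs (exp a - 1) <= 2 * Rabs a).
  { replace (exp a - 1) with ((exp a - 1 - 1 * a) + a) by ring.
    eapply Rle_trans; [apply Rabs_triang|]. nra. }
  assert (E2 : Rabs (exp a) <= 3).
  { replace (exp a) with ((exp a - 1) + 1) by ring.
    eapply Rle_trans; [apply Rabs_triang|]. rewrite Rabs_R1. lra. }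
  assert (E3 : Rabs (sin b) <= 2 * Rabs b).
  { replace (sin b) with ((sin b - 0 - 1 * b) + b) by ring.
    eapply Rle_trans; [apply Rabs_triang|]. nra. }
  replace (Re (cexp h - 1 - 1 * h)%C) with ((exp a - 1 - 1 * a) + exp a * (cos b - 1 - 0 * b))
    by (unfold a, b, Re, Im, cexp; simpl; unfold Re, Im; ring).
  replace (Im (cexp h - 1 - 1 * h)%C) with ((exp a - 1) * sin b + (sin b - 0 - 1 * b))
    by (unfold a, b, Re, Im, cexp; simpl; unfold Re, Im; ring).
  assert (F1 : Rabs (exp a - 1 - 1 * a + exp a * (cos b - 1 - 0 * b)) <= eps / 8 * Cmod h + eps / 4 * Cmod h).
  { eapply Rle_trans; [apply Rabs_triang|]. rewrite Rabs_mult.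
    assert (Rabs (exp a - 1 - 1 * a) <= eps / 8 * Cmod h) by nra.
    assert (Rabs (exp a) * Rabs (cos b - 1 - 0 * b) <= 3 * (eps / 12 * Cmod h)).
    { apply Rmult_le_compat; try apply Rabs_pos; nra. }
    lra. }
  assert (F2 : Rabs ((exp a - 1) * sin b + (sin b - 0 - 1 * b)) <= eps / 4 * Cmod h + eps / 12 * Cmod h).
  { eapply Rle_trans; [apply Rabs_triang|]. rewrite Rabs_mult.
    assert (Rabs (sin b - 0 - 1 * b) <= eps / 12 * Cmod h) by nra.
    assert (Rabs (exp a - 1) * Rabs (sin b) <= (2 * Cmod h) * (2 * Cmod h)).
    { apply Rmult_le_compat; try apply Rabs_pos; nra. }
    nra. }
  nra.
Qed.

Lemma holo_cexp z : holo cexp z (cexp z).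
Proof.
  apply (holo_ext (fun x => cexp z * cexp (x - z))%C).
  { intros x. rewrite <- cexp_plus. f_equal. ring. }
  eapply holo_eq.
  { apply holo_scal. apply (holo_comp cexp (fun x => x - z)%C).
    - apply holo_minus; [apply holo_id | apply holo_const].
    - replace (z - z)%C with (RtoC 0) by ring. apply holo_cexp_0. }
  ring.
Qed.

Lemma holo_cexp_comp f z l : holo f z l -> holo (fun x => cexp (f x)) z (cexp (f z) * l)%C.
Proof. intros H. apply (holo_comp cexp f); auto. apply holo_cexp. Qed.

Lemma ci_sqr : (ci * ci)%C = (- (1))%C.
Proof. unfold ci. apply injective_projections; simpl; ring. Qed.

Lemma ci_neq_0 : ci <> RtoC 0.
Proof. intros E. inversion E. lra. Qed.

Lemma C2_neq_0 : RtoC 2 <> RtoC 0.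
Proof. intros E. inversion E. lra. Qed.

Lemma holo_csin_comp f z l : holo f z l -> holo (fun x => csin (f x)) z (ccos (f z) * l)%C.
Proof.
  intros H. unfold csin, ccos. eapply holo_eq.
  { apply holo_div; [|apply holo_const|].
    - apply holo_minus; apply holo_cexp_comp; [|apply holo_opp]; apply holo_scal; exact H.
    - apply Cmult_neq_0; [apply C2_neq_0 | apply ci_neq_0]. }
  cbv beta. field; repeat split; first [apply C2_neq_0 | apply ci_neq_0].
Qed.

Lemma holo_ccos_comp f z l : holo f z l -> holo (fun x => ccos (f x)) z (- csin (f z) * l)%C.
Proof.
  intros H. unfold csin, ccos. eapply holo_eq.
  { apply holo_div; [|apply holo_const|].
    - apply holo_plus; apply holo_cexp_comp; [|apply holo_opp]; apply holo_scal; exact H.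
    - apply C2_neq_0. }
  cbv beta.
  set (A := cexp (ci * f z)). set (B := cexp (- (ci * f z))).
  transitivity (ci * ci * ((A - B) / (2 * ci) * l))%C.
  { field; repeat split; first [apply ci_neq_0 | apply C2_neq_0]. }
  rewrite ci_sqr. ring.
Qed.

Ltac holo_step :=
  match goal with
  | H : holo ?f ?z _ |- holo ?f ?z _ => exact H
  | |- holo (fun _ => ?c) _ _ => apply holo_const
  | |- holo (fun y => y) _ _ => apply holo_id
  | |- holo cexp _ _ => apply holo_cexp
  | |- holo csin _ _ => apply (holo_csin_comp (fun y => y))
  | |- holo ccos _ _ => apply (holo_ccos_comp (fun y => y))
  | |- holo (fun y => cexp (@?f y)) _ _ => apply (holo_cexp_comp f)
  | |- holo (fun y => csin (@?f y)) _ _ => apply (holo_csin_comp f)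
  | |- holo (fun y => ccos (@?f y)) _ _ => apply (holo_ccos_comp f)
  | |- holo (fun y => Cminus (@?f y) (@?g y)) _ _ => apply (holo_minus f g)
  | |- holo (fun y => Cplus (@?f y) (@?g y)) _ _ => apply (holo_plus f g)
  | |- holo (fun y => Copp (@?f y)) _ _ => apply (holo_opp f)
  | |- holo (fun y => Cmult ?k (@?g y)) _ _ => apply (holo_scal g)
  | |- holo (fun y => Cmult (@?f y) (@?g y)) _ _ => apply (holo_mult f g)
  | |- holo (fun y => Cdiv (@?f y) (@?g y)) _ _ => apply (holo_div f g)
  | |- holo (fun y => Cinv (@?f y)) _ _ => apply (holo_inv f)
  end.
Ltac holo_tac := repeat holo_step.

(** * Complex Riemann integrals *)

Notation RIntC := (@RInt C_R_CompleteNormedModule).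
Notation ex_RIntC := (@ex_RInt C_R_NormedModule).
Notation is_RIntC := (@is_RInt C_R_NormedModule).

Lemma is_RIntC_ReIm (f : R -> C) a b (l : C) :
  is_RInt (fun t => Re (f t)) a b (Re l) -> is_RInt (fun t => Im (f t)) a b (Im l) ->
  is_RIntC f a b l.
Proof.
  intros H1 H2. destruct l as [x y].
  apply (is_RInt_fct_extend_pair (U := R_NormedModule) (V := R_NormedModule)); assumption.
Qed.

Lemma is_RIntC_Re (f : R -> C) a b (l : C) :
  is_RIntC f a b l -> is_RInt (fun t => Re (f t)) a b (Re l).
Proof. intros H. destruct l as [x y]. apply (is_RInt_fct_extend_fst (U := R_NormedModule) (V := R_NormedModule)) in H. exact H. Qed.

Lemma is_RIntC_Im (f : R -> C) a b (l : C) :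
  is_RIntC f a b l -> is_RInt (fun t => Im (f t)) a b (Im l).
Proof. intros H. destruct l as [x y]. apply (is_RInt_fct_extend_snd (U := R_NormedModule) (V := R_NormedModule)) in H. exact H. Qed.

Lemma ex_RIntC_cont (f : R -> C) a b : (forall t, continuous f t) -> ex_RIntC f a b.
Proof. intros H. apply (ex_RInt_continuous (V := C_R_CompleteNormedModule)). intros; apply H. Qed.

Lemma RIntC_correct (f : R -> C) a b : (forall t, continuous f t) -> is_RIntC f a b (RIntC f a b).
Proof. intros H. apply (RInt_correct (V := C_R_CompleteNormedModule)). now apply ex_RIntC_cont. Qed.

Lemma RIntC_unique (f : R -> C) a b l : is_RIntC f a b l -> RIntC f a b = l.
Proof. intros H. now apply (is_RInt_unique (V := C_R_CompleteNormedModule)). Qed.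

Lemma C_R_norm (z : C) : @norm R_AbsRing C_R_NormedModule z = Cmod z.
Proof. symmetry; apply Cmod_norm. Qed.

Lemma RIntC_bound (f : R -> C) (g : R -> R) a b lf lg : a <= b ->
  (forall t, a <= t <= b -> Cmod (f t) <= g t) ->
  is_RIntC f a b lf -> is_RInt g a b lg -> Cmod lf <= lg.
Proof.
  intros Hab H Hf Hg. rewrite <- C_R_norm.
  apply (norm_RInt_le f g a b lf lg); auto. intros t Ht. rewrite C_R_norm; auto.
Qed.

(** A complex derivative restricted to a straight line gives real derivatives of both parts, so the
    real fundamental theorem of calculus applies to integrals along lines. *)
Lemma holo_path (f : C -> C) (p d : C) (t : R) (l : C) :
  holo f (p + t * d)%C l ->
  is_derive (fun u : R => Re (f (p + u * d)%C)) t (Re (l * d)) /\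
  is_derive (fun u : R => Im (f (p + u * d)%C)) t (Im (l * d)).
Proof.
  intros H.
  assert (G : forall eps, 0 < eps -> exists del : posreal, forall h, h <> 0 -> Rabs h < del ->
    Cmod ((f (p + (t + h)%R * d) - f (p + t * d)) / h - l * d)%C < eps).
  { intros eps He. set (D := Cmod d + 1).
    assert (HD : 0 < D) by (unfold D; pose proof (Cmod_ge_0 d); lra).
    destruct (H (eps / 2 / D)) as [del [Hdel K]].
    { repeat apply Rdiv_lt_0_compat; lra. }
    assert (Hp : 0 < del / D) by now apply Rdiv_lt_0_compat.
    exists (mkposreal _ Hp). simpl. intros h Hh Hd.
    specialize (K (h * d)%C).
    assert (Hdd : Cmod (h * d) <= Rabs h * D).
    { rewrite Cmod_mult, Cmod_R. apply Rmult_le_compat_l; [apply Rabs_pos | unfold D; lra]. }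
    assert (Cmod (h * d) < del).
    { eapply Rle_lt_trans; [exact Hdd|]. replace del with (del / D * D) by (field; lra).
      apply Rmult_lt_compat_r; auto. }
    specialize (K H0).
    replace (p + (t + h)%R * d)%C with (p + t * d + h * d)%C by (rewrite RtoC_plus; ring).
    assert (HC : RtoC h <> 0) by (intro E; apply Hh; now apply RtoC_inj).
    replace ((f (p + t * d + h * d) - f (p + t * d)) / h - l * d)%C with
      ((f (p + t * d + h * d) - f (p + t * d) - l * (h * d)) / h)%C by (field; auto).
    rewrite Cmod_div by auto. rewrite Cmod_R.
    assert (0 < Rabs h) by now apply Rabs_pos_lt.
    apply (Rmult_lt_reg_r (Rabs h)); auto.
    unfold Rdiv at 1. rewrite Rmult_assoc, Rinv_l, Rmult_1_r by lra.
    eapply Rle_lt_trans; [exact K|].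
    apply Rle_lt_trans with (eps / 2 / D * (Rabs h * D)).
    { apply Rmult_le_compat_l; auto. left. repeat apply Rdiv_lt_0_compat; lra. }
    replace (eps / 2 / D * (Rabs h * D)) with (eps / 2 * Rabs h) by (field; lra). nra. }
  split; apply is_derive_Reals; intros eps He; destruct (G eps He) as [del K]; exists del;
  intros h Hh Hd; specialize (K h Hh Hd).
  - eapply Rle_lt_trans; [|exact K]. eapply Rle_trans; [|apply re_le_Cmod].
    right. f_equal. unfold Cdiv. rewrite <- RtoC_inv by auto. unfold Re; simpl. field; auto.
  - eapply Rle_lt_trans; [|exact K]. eapply Rle_trans; [|apply im_le_Cmod].
    right. f_equal. unfold Cdiv. rewrite <- RtoC_inv by auto. unfold Im; simpl. field; auto.
Qed.

Lemma continuous_path (f : C -> C) (p d : C) (t : R) :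
  continuous f (p + t * d)%C -> continuous (fun u : R => f (p + u * d)%C) t.
Proof. intros H. apply (continuous_comp (fun u : R => (p + u * d)%C) f); auto. ccont. Qed.

Lemma RIntC_FTC (f f' : C -> C) (p d : C) (a b : R) :
  (forall t, Rmin a b <= t <= Rmax a b -> holo f (p + t * d)%C (f' (p + t * d)%C)) ->
  (forall t, Rmin a b <= t <= Rmax a b -> continuous f' (p + t * d)%C) ->
  is_RIntC (fun t => f' (p + t * d) * d)%C a b (f (p + b * d) - f (p + a * d))%C.
Proof.
  intros H1 H2.
  assert (Hc : forall t, Rmin a b <= t <= Rmax a b -> continuous (fun t : R => f' (p + t * d) * d)%C t).
  { intros t Ht. apply continuous_Cmult; [|apply continuous_const]. now apply continuous_path, H2. }
  apply is_RIntC_ReIm.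
  - apply (is_RInt_derive (V := R_CompleteNormedModule) (fun u : R => Re (f (p + u * d)%C))).
    + intros t Ht. now apply holo_path, H1.
    + intros t Ht. now apply (continuous_Re (fun t : R => f' (p + t * d) * d)%C), Hc.
  - apply (is_RInt_derive (V := R_CompleteNormedModule) (fun u : R => Im (f (p + u * d)%C))).
    + intros t Ht. now apply holo_path, H1.
    + intros t Ht. now apply (continuous_Im (fun t : R => f' (p + t * d) * d)%C), Hc.
Qed.

(** There is no mean value equality for complex functions; the inequality comes from integrating the
    derivative along the segment. *)
Lemma holo_MVT (f f' : C -> C) (z h : C) (B : R) :
  (forall t : R, 0 <= t <= 1 -> holo f (z + t * h)%C (f' (z + t * h)%C)) ->
  (forall t : R, 0 <= t <= 1 -> continuous f' (z + t * h)%C) ->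
  (forall t : R, 0 <= t <= 1 -> Cmod (f' (z + t * h)%C) <= B) ->
  Cmod (f (z + h) - f z)%C <= B * Cmod h.
Proof.
  intros H1 H2 H3.
  assert (I := RIntC_FTC f f' z h 0 1).
  rewrite Rmin_left, Rmax_right in I by lra. specialize (I H1 H2).
  replace (z + 1 * h)%C with (z + h)%C in I by ring.
  replace (z + 0 * h)%C with z in I by ring.
  replace (B * Cmod h) with ((1 - 0) * (B * Cmod h)) by ring.
  eapply (RIntC_bound _ (fun _ => B * Cmod h) 0 1); [lra | | exact I | apply (is_RInt_const (V := R_NormedModule))].
  intros t Ht. cbv beta. rewrite (Cmod_mult _ h). apply Rmult_le_compat_r; [apply Cmod_ge_0 | auto].
Qed.

Lemma Cmod_cexp_le (z : C) : Cmod (cexp z) <= exp (Cmod z).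
Proof.
  rewrite Cmod_cexp. pose proof (re_le_Cmod z). pose proof (Rle_abs (Re z)).
  destruct (Rle_lt_or_eq_dec (Re z) (Cmod z)) as [L|E]; [lra| |].
  - left; now apply exp_increasing.
  - rewrite E; lra.
Qed.

Lemma exp_le (x y : R) : x <= y -> exp x <= exp y.
Proof. intros [L| ->]; [left; now apply exp_increasing | lra]. Qed.

Lemma Cmod_cexp_minus_1 (z : C) : Cmod (cexp z - 1) <= Cmod z * exp (Cmod z).
Proof.
  assert (H := holo_MVT cexp cexp 0 z (exp (Cmod z))).
  rewrite cexp_0 in H. replace (RtoC 0 + z)%C with z in H by ring.
  rewrite Rmult_comm. apply H.
  - intros; apply holo_cexp.
  - intros. apply (continuous_cexp (fun x => x)), continuous_id.
  - intros t Ht. eapply Rle_trans; [apply Cmod_cexp_le|]. apply exp_le.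
    replace (RtoC 0 + t * z)%C with (t * z)%C by ring. rewrite Cmod_mult, Cmod_R, Rabs_pos_eq by lra.
    pose proof (Cmod_ge_0 z). nra.
Qed.

Lemma Cmod_cexp_minus_1_z (z : C) : Cmod (cexp z - 1 - z) <= Cmod z * Cmod z * exp (Cmod z).
Proof.
  assert (H := holo_MVT (fun x => cexp x - x)%C (fun x => cexp x - 1)%C 0 z (Cmod z * exp (Cmod z))).
  cbv beta in H. rewrite cexp_0 in H. replace (RtoC 0 + z)%C with z in H by ring.
  replace (cexp z - 1 - z)%C with (cexp z - z - (1 - 0))%C by ring.
  eapply Rle_trans; [apply H|].
  - intros. apply holo_minus; [apply holo_cexp | apply holo_id].
  - intros. apply continuous_Cminus; [apply (continuous_cexp (fun x => x)), continuous_id | apply continuous_const].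
  - intros t Ht. eapply Rle_trans; [apply Cmod_cexp_minus_1|].
    replace (RtoC 0 + t * z)%C with (t * z)%C by ring. rewrite Cmod_mult, Cmod_R, Rabs_pos_eq by lra.
    pose proof (Cmod_ge_0 z). apply Rmult_le_compat; try nra; [left; apply exp_pos|]. apply exp_le; nra.
  - right; ring.
Qed.

(** * Integrals over the real line *)

(** One shape of majorant for all integrands: the class is stable under sums, translations,
    dilations, reflection and the substitution of [exp t] or [- exp t] with its Jacobian, and the
    tails beyond [-A, A] are O(M / A). *)
Definition dom (M : R) (f : R -> C) : Prop :=
  (forall t, continuous f t) /\ forall t, Cmod (f t) <= M / (1 + t * t).

Lemma one_plus_sqr_pos (t : R) : 0 < 1 + t * t.
Proof. nra. Qed.

Lemma dom_pos M f : dom M f -> 0 <= M.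
Proof.
  intros [_ H]. specialize (H 0). pose proof (Cmod_ge_0 (f 0)).
  replace (M / (1 + 0 * 0)) with M in H by field. lra.
Qed.

Lemma is_RInt_tail (M x y : R) : (0 < x /\ 0 < y) \/ (x < 0 /\ y < 0) ->
  is_RInt (fun t => M / (t * t)) x y (M / x - M / y).
Proof.
  intros H.
  assert (N : forall t, Rmin x y <= t <= Rmax x y -> t <> 0).
  { intros t. unfold Rmin, Rmax. destruct (Rle_dec x y); intros; lra. }
  replace (M / x - M / y) with (minus (- M / y) (- M / x)).
  2:{ unfold minus, plus, opp; simpl. field. lra. }
  apply (is_RInt_derive (V := R_CompleteNormedModule) (fun t => - M / t)).
  - intros t Ht. specialize (N t Ht). auto_derive; auto. field; auto.
  - intros t Ht. specialize (N t Ht). apply continuous_Rmult; [apply continuous_const|].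
    apply continuous_Rinv_comp'; [ccont|]. nra.
Qed.

Lemma inv_sqr_le (M t : R) : 0 <= M -> t <> 0 -> M / (1 + t * t) <= M / (t * t).
Proof.
  intros HM Ht. apply Rmult_le_compat_l; auto. apply Rinv_le_contravar; nra.
Qed.

Lemma RIntC_tail_le M f A x y : dom M f -> 0 < A ->
  (A <= x <= y) \/ (x <= y <= - A) -> Cmod (RIntC f x y) <= M / A.
Proof.
  intros D HA H. pose proof (dom_pos _ _ D) as HM. destruct D as [Hc Hb].
  assert (I : M / x - M / y <= M / A).
  { assert (forall u, 0 < u -> A <= u -> M / u <= M / A).
    { intros u Hu Hu'. apply Rmult_le_compat_l; auto. apply Rinv_le_contravar; lra. }
    assert (forall u, 0 < u -> 0 <= M / u).
    { intros u Hu. apply Rmult_le_pos; auto. left; now apply Rinv_0_lt_compat. }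
    destruct H.
    - specialize (H0 x ltac:(lra) ltac:(lra)). specialize (H1 y ltac:(lra)). lra.
    - specialize (H0 (- y) ltac:(lra) ltac:(lra)). specialize (H1 (- x) ltac:(lra)).
      replace (M / - y) with (- (M / y)) in H0 by (field; lra).
      replace (M / - x) with (- (M / x)) in H1 by (field; lra). lra. }
  eapply Rle_trans; [|exact I].
  apply (RIntC_bound f (fun t => M / (t * t)) x y); [lra | | now apply RIntC_correct |].
  - intros t Ht. eapply Rle_trans; [apply Hb|]. apply inv_sqr_le; auto. lra.
  - apply is_RInt_tail. lra.
Qed.

Lemma RIntC_Chasles f a b c : (forall t : R, continuous f t) ->
  (RIntC f a b + RIntC f b c)%C = RIntC f a c.
Proof. intros H. apply (RInt_Chasles (V := C_R_CompleteNormedModule)); now apply ex_RIntC_cont. Qed.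

Lemma RIntC_swap f a b : (forall t : R, continuous f t) -> (- RIntC f a b)%C = RIntC f b a.
Proof. intros H. apply (opp_RInt_swap (V := C_R_CompleteNormedModule)). now apply ex_RIntC_cont. Qed.

Lemma RIntC_tail_le' M f A x y : dom M f -> 0 < A ->
  (A <= x /\ A <= y) \/ (x <= - A /\ y <= - A) -> Cmod (RIntC f x y) <= M / A.
Proof.
  intros D HA H. destruct (Rle_dec x y).
  - apply RIntC_tail_le; auto; lra.
  - rewrite <- RIntC_swap, Cmod_opp by apply D. apply RIntC_tail_le; auto; lra.
Qed.

Lemma RIntC_far M f A a b a' b' : dom M f -> 0 < A ->
  a <= - A -> a' <= - A -> A <= b -> A <= b' ->
  Cmod (RIntC f a b - RIntC f a' b')%C <= 2 * M / A.
Proof.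
  intros D HA H1 H2 H3 H4. destruct (D) as [Hc _].
  rewrite <- (RIntC_Chasles f a a' b), <- (RIntC_Chasles f a' b' b) by auto.
  replace (RIntC f a a' + (RIntC f a' b' + RIntC f b' b) - RIntC f a' b')%C
    with (RIntC f a a' + RIntC f b' b)%C by ring.
  eapply Rle_trans; [apply Cmod_triangle|].
  pose proof (RIntC_tail_le' M f A a a' D HA ltac:(lra)).
  pose proof (RIntC_tail_le' M f A b' b D HA ltac:(lra)).
  unfold Rdiv in *. lra.
Qed.

Lemma dom_ex M f : dom M f ->
  @ex_RInt_gen C_R_NormedModule f (Rbar_locally m_infty) (Rbar_locally p_infty).
Proof.
  intros D. pose proof (dom_pos _ _ D) as HM.
  destruct (proj1 (filterlim_locally_cauchy (U := C_R_CompleteNormedModule)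
     (F := filter_prod (Rbar_locally m_infty) (Rbar_locally p_infty))
     (fun ab => RIntC f (fst ab) (snd ab)))) as [l Hl].
  - intros eps. set (A := 2 * M / eps + 1).
    pose proof (cond_pos eps) as He.
    assert (HA : 0 < A).
    { unfold A. assert (0 <= 2 * M / eps) by (apply Rmult_le_pos; [lra | left; now apply Rinv_0_lt_compat]). lra. }
    exists (fun ab => fst ab < - A /\ A < snd ab). split.
    + apply (Filter_prod _ _ _ (fun a => a < - A) (fun b => A < b)).
      * exists (- A); auto.
      * exists A; auto.
      * simpl; auto.
    + intros [a b] [a' b'] [H1 H2] [H3 H4]; simpl in *.
      apply (norm_compat1 (V := C_R_NormedModule)).
      rewrite C_R_norm. eapply Rle_lt_trans.
      * apply (RIntC_far M f A a' b' a b); auto; lra.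
      * apply (Rmult_lt_reg_r A); auto. unfold Rdiv. rewrite Rmult_assoc, Rinv_l, Rmult_1_r by lra.
        unfold A. replace (eps * (2 * M / eps + 1)) with (2 * M + eps) by (field; lra). lra.
  - exists l. intros P HP. specialize (Hl P HP). revert Hl.
    unfold filtermapi, filtermap. apply filter_imp. intros [a b] Hab; simpl in *.
    exists (RIntC f a b). split; auto. apply RIntC_correct. apply D.
Qed.

Lemma IntR_correct M f : dom M f ->
  @is_RInt_gen C_R_NormedModule f (Rbar_locally m_infty) (Rbar_locally p_infty) (CInt_line f).
Proof.
  intros D. apply (RInt_gen_correct (V := C_R_CompleteNormedModule)).
  now apply (dom_ex M).
Qed.

(** The quantitative form of convergence; later proofs handle the improper integral mostly through
    this estimate and [IntR_unique]. *)
Lemma IntR_approx M f A a b : dom M f -> 0 < A -> a <= - A -> A <= b ->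
  Cmod (RIntC f a b - CInt_line f)%C <= 2 * M / A.
Proof.
  intros D HA Ha Hb. apply le_epsilon. intros eps He.
  assert (Hp : 0 < eps / sqrt 2) by (apply Rdiv_lt_0_compat; [lra | apply sqrt_lt_R0; lra]).
  destruct (IntR_correct M f D (fun y => ball (CInt_line f) (mkposreal _ Hp) y)) as [P Q [m HP] [n HQ] H].
  { exists (mkposreal _ Hp). auto. }
  set (a' := Rmin (- A) (m - 1)). set (b' := Rmax A (n + 1)).
  pose proof (Rmin_l (- A) (m - 1)). pose proof (Rmin_r (- A) (m - 1)).
  pose proof (Rmax_l A (n + 1)). pose proof (Rmax_r A (n + 1)).
  destruct (H a' b') as [y [Hy Hball]].
  { apply HP. unfold a'. lra. } { apply HQ. unfold b'. lra. }
  simpl in Hy. apply RIntC_unique in Hy.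
  pose proof (C_NormedModule_mixin_compat2 _ _ _ Hball) as K.
  change (Cmod (y - CInt_line f)%C < sqrt 2 * (eps / sqrt 2)) in K.
  replace (sqrt 2 * (eps / sqrt 2)) with eps in K by (field; apply Rgt_not_eq, sqrt_lt_R0; lra).
  rewrite <- Hy in K.
  replace (RIntC f a b - CInt_line f)%C with
    ((RIntC f a b - RIntC f a' b') + (RIntC f a' b' - CInt_line f))%C by ring.
  eapply Rle_trans; [apply Cmod_triangle|].
  pose proof (RIntC_far M f A a b a' b' D HA ltac:(lra) ltac:(unfold a'; lra) ltac:(lra) ltac:(unfold b'; lra)).
  lra.
Qed.

Lemma Cmod_eq_of_small (x y : C) : (forall eps, 0 < eps -> Cmod (x - y)%C <= eps) -> x = y.
Proof.
  intros H. assert (Cmod (x - y) = 0).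
  { apply Rle_antisym; [|apply Cmod_ge_0]. apply le_epsilon. intros. rewrite Rplus_0_l. auto. }
  apply Cmod_eq_0 in H0. replace x with (x - y + y)%C by ring. rewrite H0. ring.
Qed.

(** Symmetric truncations suffice to identify the value, because absolute convergence is already
    known from [dom]. *)
Lemma IntR_unique M f l : dom M f ->
  (forall eps, 0 < eps -> exists A0, forall A, A0 <= A -> Cmod (RIntC f (- A) A - l)%C <= eps) ->
  CInt_line f = l.
Proof.
  intros D H. pose proof (dom_pos _ _ D) as HM.
  apply Cmod_eq_of_small. intros eps He.
  destruct (H (eps / 2)) as [A0 K]; [lra|].
  set (A := Rmax (Rmax 1 A0) (4 * M / eps)).
  pose proof (Rmax_l (Rmax 1 A0) (4 * M / eps)). pose proof (Rmax_r (Rmax 1 A0) (4 * M / eps)).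
  pose proof (Rmax_l 1 A0). pose proof (Rmax_r 1 A0).
  fold A in H0, H1.
  specialize (K A ltac:(lra)).
  pose proof (IntR_approx M f A (- A) A D ltac:(lra) ltac:(lra) ltac:(lra)) as L.
  assert (2 * M / A <= eps / 2).
  { apply (Rmult_le_reg_r A); [lra|]. unfold Rdiv at 1. rewrite Rmult_assoc, Rinv_l, Rmult_1_r by lra.
    apply (Rmult_le_compat_l (eps / 2)) in H1; [|lra].
    replace (eps / 2 * (4 * M / eps)) with (2 * M) in H1 by (field; lra). lra. }
  replace (CInt_line f - l)%C with (- (RIntC f (- A) A - CInt_line f) + (RIntC f (- A) A - l))%C by ring.
  eapply Rle_trans; [apply Cmod_triangle|]. rewrite Cmod_opp. lra.
Qed.

Lemma IntR_tail_small M : 0 <= M -> forall eps, 0 < eps -> exists A0, 1 <= A0 /\ forall A, A0 <= A -> 2 * M / A <= eps.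
Proof.
  intros HM eps He. exists (Rmax 1 (2 * M / eps)). split; [apply Rmax_l|].
  intros A HA. pose proof (Rmax_l 1 (2 * M / eps)). pose proof (Rmax_r 1 (2 * M / eps)).
  apply (Rmult_le_reg_r A); [lra|]. unfold Rdiv at 1. rewrite Rmult_assoc, Rinv_l, Rmult_1_r by lra.
  apply Rle_trans with (eps * (2 * M / eps)).
  - right; field; lra.
  - apply Rmult_le_compat_l; lra.
Qed.

Lemma IntR_ext f g : (forall t, f t = g t) -> CInt_line f = CInt_line g.
Proof. intros H. f_equal. now apply functional_extensionality. Qed.

Lemma dom_ext M f g : (forall t, f t = g t) -> dom M f -> dom M g.
Proof. intros H. now replace g with f by now apply functional_extensionality. Qed.

Lemma dom_plus M N f g : dom M f -> dom N g -> dom (M + N) (fun t => f t + g t)%C.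
Proof.
  intros [F1 F2] [G1 G2]. split.
  - intros. now apply continuous_Cplus.
  - intros t. eapply Rle_trans; [apply Cmod_triangle|].
    specialize (F2 t). specialize (G2 t). unfold Rdiv in *. lra.
Qed.

Lemma dom_scal M f (k : C) : dom M f -> dom (Cmod k * M) (fun t => k * f t)%C.
Proof.
  intros [F1 F2]. split.
  - intros. apply continuous_Cmult; [apply continuous_const | auto].
  - intros t. rewrite Cmod_mult. unfold Rdiv. rewrite Rmult_assoc.
    apply Rmult_le_compat_l; [apply Cmod_ge_0 | apply F2].
Qed.

Lemma dom_opp M f : dom M f -> dom M (fun t => - f t)%C.
Proof.
  intros [F1 F2]. split.
  - intros. now apply continuous_Copp.
  - intros t. rewrite Cmod_opp. auto.
Qed.

Lemma dom_minus M N f g : dom M f -> dom N g -> dom (M + N) (fun t => f t - g t)%C.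
Proof. intros. apply dom_plus; auto. now apply dom_opp. Qed.

Lemma RIntC_plus f g a b : (forall t, continuous f t) -> (forall t, continuous g t) ->
  RIntC (fun t => f t + g t)%C a b = (RIntC f a b + RIntC g a b)%C.
Proof.
  intros. apply (RInt_plus (V := C_R_CompleteNormedModule) f g); now apply ex_RIntC_cont.
Qed.

Lemma RIntC_scal f (k : C) a b : (forall t, continuous f t) ->
  RIntC (fun t => k * f t)%C a b = (k * RIntC f a b)%C.
Proof.
  intros H. apply RIntC_unique. pose proof (RIntC_correct f a b H) as I.
  pose proof (is_RIntC_Re _ _ _ _ I) as I1. pose proof (is_RIntC_Im _ _ _ _ I) as I2.
  apply is_RIntC_ReIm.
  - apply (is_RInt_minus (V := R_NormedModule)
      (fun t => Re k * Re (f t)) (fun t => Im k * Im (f t)) a b (Re k * Re (RIntC f a b)) (Im k * Im (RIntC f a b)));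
    now apply (is_RInt_scal (V := R_NormedModule)).
  - apply (is_RInt_plus (V := R_NormedModule)
      (fun t => Re k * Im (f t)) (fun t => Im k * Re (f t)) a b (Re k * Im (RIntC f a b)) (Im k * Re (RIntC f a b)));
    now apply (is_RInt_scal (V := R_NormedModule)).
Qed.

Lemma IntR_plus M N f g : dom M f -> dom N g ->
  CInt_line (fun t => f t + g t)%C = (CInt_line f + CInt_line g)%C.
Proof.
  intros Df Dg. apply (IntR_unique (M + N)); [now apply dom_plus|].
  intros eps He.
  destruct (IntR_tail_small M (dom_pos _ _ Df) (eps / 2)) as [A1 [P1 Q1]]; [lra|].
  destruct (IntR_tail_small N (dom_pos _ _ Dg) (eps / 2)) as [A2 [P2 Q2]]; [lra|].
  exists (Rmax A1 A2). intros A HA.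
  pose proof (Rmax_l A1 A2). pose proof (Rmax_r A1 A2).
  rewrite RIntC_plus by (apply Df || apply Dg).
  pose proof (IntR_approx M f A (- A) A Df ltac:(lra) ltac:(lra) ltac:(lra)).
  pose proof (IntR_approx N g A (- A) A Dg ltac:(lra) ltac:(lra) ltac:(lra)).
  specialize (Q1 A ltac:(lra)). specialize (Q2 A ltac:(lra)).
  replace (RIntC f (- A) A + RIntC g (- A) A - (CInt_line f + CInt_line g))%C with
   ((RIntC f (- A) A - CInt_line f) + (RIntC g (- A) A - CInt_line g))%C by ring.
  eapply Rle_trans; [apply Cmod_triangle|]. lra.
Qed.

Lemma IntR_scal M f (k : C) : dom M f ->
  CInt_line (fun t => k * f t)%C = (k * CInt_line f)%C.
Proof.
  intros D. apply (IntR_unique (Cmod k * M)); [now apply dom_scal|].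
  intros eps He. pose proof (dom_pos _ _ D) as HM. pose proof (Cmod_ge_0 k) as Hk.
  destruct (IntR_tail_small (Cmod k * M)) with (eps := eps) as [A0 [P Q]]; [nra | lra |].
  exists A0. intros A HA. specialize (Q A HA).
  rewrite RIntC_scal by apply D.
  replace (k * RIntC f (- A) A - k * CInt_line f)%C with (k * (RIntC f (- A) A - CInt_line f))%C by ring.
  rewrite Cmod_mult.
  pose proof (IntR_approx M f A (- A) A D ltac:(lra) ltac:(lra) ltac:(lra)).
  apply (Rmult_le_compat_l (Cmod k)) in H; auto.
  eapply Rle_trans; [exact H|]. eapply Rle_trans; [|exact Q]. right. unfold Rdiv; ring.
Qed.

Lemma IntR_opp M f : dom M f -> CInt_line (fun t => - f t)%C = (- CInt_line f)%C.
Proof.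
  intros D. replace (- CInt_line f)%C with ((- (1)) * CInt_line f)%C by ring.
  rewrite <- (IntR_scal M) by auto. apply IntR_ext. intros; ring.
Qed.

Lemma IntR_minus M N f g : dom M f -> dom N g ->
  CInt_line (fun t => f t - g t)%C = (CInt_line f - CInt_line g)%C.
Proof.
  intros Df Dg. unfold Cminus. rewrite <- (IntR_opp N) by auto.
  apply (IntR_plus M N); auto. now apply dom_opp.
Qed.

Lemma IntR_le_of_RInt M f K : dom M f ->
  (forall A, 0 < A -> Cmod (RIntC f (- A) A) <= K) -> Cmod (CInt_line f) <= K.
Proof.
  intros D H. apply le_epsilon. intros eps He.
  destruct (IntR_tail_small M (dom_pos _ _ D) eps He) as [A0 [P Q]].
  specialize (Q A0 ltac:(lra)).
  pose proof (IntR_approx M f A0 (- A0) A0 D ltac:(lra) ltac:(lra) ltac:(lra)).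
  specialize (H A0 ltac:(lra)).
  replace (CInt_line f) with (RIntC f (- A0) A0 - (RIntC f (- A0) A0 - CInt_line f))%C by ring.
  eapply Rle_trans; [apply Cmod_minus_le|]. lra.
Qed.

Lemma is_RInt_atan M a b : is_RInt (fun t => M / (1 + t * t)) a b (M * atan b - M * atan a).
Proof.
  apply (is_RInt_derive (V := R_CompleteNormedModule) (fun t => M * atan t)).
  - intros t _. auto_derive; auto. field. nra.
  - intros t _. apply continuous_Rmult; [apply continuous_const|].
    apply continuous_Rinv_comp'; [ccont | nra].
Qed.

Lemma RIntC_bound_dom M f A : dom M f -> 0 < A -> Cmod (RIntC f (- A) A) <= PI * M.
Proof.
  intros D HA. pose proof (dom_pos _ _ D) as HM. destruct D as [Hc Hb].
  apply Rle_trans with (M * atan A - M * atan (- A)).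
  - apply (RIntC_bound f (fun t => M / (1 + t * t)) (- A) A); auto; [lra | now apply RIntC_correct | apply is_RInt_atan].
  - rewrite atan_opp. pose proof (atan_bound A). nra.
Qed.

Lemma IntR_bound M f : dom M f -> Cmod (CInt_line f) <= PI * M.
Proof. intros D. apply (IntR_le_of_RInt M); auto. intros. now apply RIntC_bound_dom. Qed.

Lemma sqr_shift_le (t a : R) : 1 + t * t <= 2 * (1 + a * a) * (1 + (t + a) * (t + a)).
Proof.
  assert (t * t <= 2 * ((t + a) * (t + a)) + 2 * (a * a)).
  { pose proof (Rle_0_sqr (t + 2 * a)). unfold Rsqr in *. lra. }
  pose proof (Rle_0_sqr (t + a)). pose proof (Rle_0_sqr a). unfold Rsqr in *.
  assert (0 <= (a * a) * ((t + a) * (t + a))) by (apply Rmult_le_pos; lra). lra.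
Qed.

Lemma dom_shift M f a : dom M f -> dom (M * (2 * (1 + a * a))) (fun t => f (t + a)).
Proof.
  intros D. pose proof (dom_pos _ _ D) as HM. destruct D as [Hc Hb]. split.
  - intros t. apply (continuous_comp (fun t => t + a) f); auto. ccont.
  - intros t. eapply Rle_trans; [apply Hb|].
    unfold Rdiv. rewrite (Rmult_assoc M). apply Rmult_le_compat_l; auto.
    pose proof (sqr_shift_le t a). pose proof (one_plus_sqr_pos t). pose proof (one_plus_sqr_pos (t + a)).
    apply (Rmult_le_reg_r (1 + (t + a) * (t + a))); auto. rewrite Rinv_l by lra.
    apply (Rmult_le_reg_r (1 + t * t)); auto.
    replace (2 * (1 + a * a) * / (1 + t * t) * (1 + (t + a) * (t + a)) * (1 + t * t)) with
     (2 * (1 + a * a) * (1 + (t + a) * (t + a))) by (field; lra). lra.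
Qed.

Lemma RIntC_shift f a x y : (forall t, continuous f t) ->
  RIntC (fun t => f (t + a)) x y = RIntC f (x + a) (y + a).
Proof.
  intros H. apply RIntC_unique.
  pose proof (is_RInt_comp_lin (V := C_R_NormedModule) f 1 a x y (RIntC f (x + a) (y + a))) as I.
  rewrite !Rmult_1_l in I. specialize (I (RIntC_correct f _ _ H)).
  eapply is_RInt_ext; [|exact I]. intros t _. cbv beta. rewrite Rmult_1_l. apply (scal_one (V := C_R_NormedModule)).
Qed.

Lemma IntR_shift M f a : dom M f -> CInt_line (fun t => f (t + a)) = CInt_line f.
Proof.
  intros D. pose proof (dom_pos _ _ D) as HM.
  apply (IntR_unique (M * (2 * (1 + a * a)))); [now apply dom_shift|].
  intros eps He. destruct (IntR_tail_small M HM eps He) as [A0 [P Q]].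
  exists (A0 + Rabs a). intros A HA. rewrite RIntC_shift by apply D.
  pose proof (Rle_abs a). pose proof (Rle_abs (- a)). rewrite Rabs_Ropp in H0.
  eapply Rle_trans; [apply (IntR_approx M f A0); auto; lra | apply Q; lra].
Qed.

Lemma dom_scale M f k : 0 < k -> dom M f -> dom (M * (1 + / (k * k))) (fun t => f (k * t)).
Proof.
  intros Hk D. pose proof (dom_pos _ _ D) as HM. destruct D as [Hc Hb]. split.
  - intros t. apply (continuous_comp (fun t => k * t) f); auto. ccont.
  - intros t. eapply Rle_trans; [apply Hb|].
    unfold Rdiv. rewrite (Rmult_assoc M). apply Rmult_le_compat_l; auto.
    pose proof (one_plus_sqr_pos t). pose proof (one_plus_sqr_pos (k * t)).
    assert (0 < / (k * k)) by (apply Rinv_0_lt_compat; nra).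
    apply (Rmult_le_reg_r (1 + (k * t) * (k * t))); auto. rewrite Rinv_l by lra.
    apply (Rmult_le_reg_r (1 + t * t)); auto.
    replace ((1 + / (k * k)) * / (1 + t * t) * (1 + k * t * (k * t)) * (1 + t * t)) with
     (1 + t * t + / (k * k) + k * k * (t * t)) by (field; lra). nra.
Qed.

Lemma IntR_scale M f k : 0 < k -> dom M f -> CInt_line (fun t => f (k * t)) = (/ RtoC k * CInt_line f)%C.
Proof.
  intros Hk D. pose proof (dom_pos _ _ D) as HM.
  apply (IntR_unique (M * (1 + / (k * k)))); [now apply dom_scale|].
  intros eps He. destruct (IntR_tail_small M HM (eps * k)) as [A0 [P Q]]; [nra|].
  exists (A0 / k). intros A HA.
  assert (HA' : A0 <= k * A).
  { apply (Rmult_le_compat_l k) in HA; [|lra]. replace (k * (A0 / k)) with A0 in HA by (field; lra). lra. }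
  assert (HC : RtoC k <> 0) by (intro E; apply RtoC_inj in E; lra).
  replace (RIntC (fun t => f (k * t)) (- A) A) with (/ RtoC k * RIntC f (- (k * A)) (k * A))%C.
  - replace (/ k * RIntC f (- (k * A)) (k * A) - / k * CInt_line f)%C with
      (/ k * (RIntC f (- (k * A)) (k * A) - CInt_line f))%C by ring.
    rewrite Cmod_mult, Cmod_inv, Cmod_R, Rabs_pos_eq by (auto; lra).
    apply (Rmult_le_reg_l k); auto. rewrite <- Rmult_assoc, Rinv_r, Rmult_1_l by lra.
    rewrite (Rmult_comm k eps).
    eapply Rle_trans; [apply (IntR_approx M f (k * A)); auto; lra | apply Q; lra].
  - symmetry. rewrite <- (Cmult_1_l (RIntC (fun t => f (k * t)) (- A) A)).
    rewrite <- (Cinv_l k) by auto. rewrite <- Cmult_assoc. f_equal.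
    assert (Hf : forall t, continuous (fun t => f (k * t)) t).
    { intros t. apply (continuous_comp (fun t => k * t) f); [ccont | apply D]. }
    rewrite <- RIntC_scal by auto.
    apply RIntC_unique.
    pose proof (is_RInt_comp_lin (V := C_R_NormedModule) f k 0 (- A) A (RIntC f (- (k * A)) (k * A))) as I.
    replace (k * - A + 0) with (- (k * A)) in I by ring. rewrite Rplus_0_r in I.
    specialize (I (RIntC_correct f _ _ (proj1 D))).
    eapply is_RInt_ext; [|exact I]. intros t _. cbv beta. rewrite Rplus_0_r.
    unfold scal; simpl. apply injective_projections; simpl; unfold scal, mult; simpl; unfold mult; simpl; ring.
Qed.

Lemma dom_reflect M f : dom M f -> dom M (fun t => f (- t)).
Proof.
  intros [Hc Hb]. split.
  - intros t. apply (continuous_comp (fun t => - t) f); auto. ccont.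
  - intros t. eapply Rle_trans; [apply Hb|]. right. f_equal. ring.
Qed.

Lemma IntR_reflect M f : dom M f -> CInt_line (fun t => f (- t)) = CInt_line f.
Proof.
  intros D. pose proof (dom_pos _ _ D) as HM.
  apply (IntR_unique M); [now apply dom_reflect|].
  intros eps He. destruct (IntR_tail_small M HM eps He) as [A0 [P Q]].
  exists A0. intros A HA.
  replace (RIntC (fun t => f (- t)) (- A) A) with (RIntC f (- A) A).
  { eapply Rle_trans; [apply (IntR_approx M f A0); auto; lra | apply Q; lra]. }
  assert (Hf : forall t, continuous (fun t => f (- t)) t) by apply (dom_reflect _ _ D).
  rewrite <- (RIntC_swap f A (- A)) by apply D.
  pose proof (is_RInt_comp_lin (V := C_R_NormedModule) f (-1) 0 (- A) A (RIntC f A (- A))) as I.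
  replace (-1 * - A + 0) with A in I by ring. replace (-1 * A + 0) with (- A) in I by ring.
  specialize (I (RIntC_correct f _ _ (proj1 D))).
  apply (is_RInt_opp (V := C_R_NormedModule)) in I.
  symmetry. apply RIntC_unique. eapply is_RInt_ext; [|exact I]. intros t _. cbv beta.
  replace (-1 * t + 0) with (- t) by ring. 
  apply injective_projections; simpl; unfold scal, opp, mult; simpl; unfold mult; simpl; ring.
Qed.

Definition cont2 (F : R -> R -> C) : Prop :=
  forall u t, continuous (fun z : R * R => F (fst z) (snd z)) (u, t).

(** The boundary terms vanish because [f] itself is dominated. Integration by parts over a whole
    line is applied in this form. *)
Lemma IntR_total_derivative (f f' : C -> C) (p d : C) M N :
  (forall t : R, holo f (p + t * d)%C (f' (p + t * d)%C)) ->
  (forall t : R, continuous f' (p + t * d)%C) ->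
  (forall t : R, Cmod (f' (p + t * d)%C) <= M / (1 + t * t)) ->
  (forall t : R, Cmod (f (p + t * d)%C) <= N / (1 + t * t)) ->
  CInt_line (fun t => f' (p + t * d) * d)%C = RtoC 0.
Proof.
  intros H1 H2 H3 H4.
  assert (HN : 0 <= N).
  { specialize (H4 0). pose proof (Cmod_ge_0 (f (p + 0 * d)%C)).
    replace (N / (1 + 0 * 0)) with N in H4 by field. lra. }
  apply (IntR_unique (Cmod d * M)).
  { apply (dom_ext _ (fun t => d * f' (p + t * d))%C); [intros; ring|].
    apply dom_scal. split; auto. intros t. now apply continuous_path. }
  intros eps He.
  destruct (IntR_tail_small N HN eps He) as [A0 [P Q]].
  exists A0. intros A HA. specialize (Q A HA).
  rewrite (RIntC_unique _ _ _ _ (RIntC_FTC f f' p d (- A) A (fun t _ => H1 t) (fun t _ => H2 t))).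
  replace (f (p + A * d) - f (p + (- A)%R * d) - 0)%C with (f (p + A * d) - f (p + (- A)%R * d))%C by ring.
  eapply Rle_trans; [apply Cmod_minus_le|].
  pose proof (H4 A) as K1. pose proof (H4 (- A)) as K2.
  replace (- A * - A) with (A * A) in K2 by ring.
  assert (N / (1 + A * A) <= N / A).
  { apply Rmult_le_compat_l; auto. apply Rinv_le_contravar; nra. }
  unfold Rdiv in *. lra.
Qed.

(** * Moving a line of integration across a strip *)

Lemma continuity_2d_pt_Re (F : R -> R -> C) x y :
  continuous (fun z : R * R => F (fst z) (snd z)) (x, y) -> continuity_2d_pt (fun u v => Re (F u v)) x y.
Proof. intros H. apply continuity_2d_pt_filterlim. exact (continuous_Re _ _ H). Qed.

Lemma continuity_2d_pt_Im (F : R -> R -> C) x y :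
  continuous (fun z : R * R => F (fst z) (snd z)) (x, y) -> continuity_2d_pt (fun u v => Im (F u v)) x y.
Proof. intros H. apply continuity_2d_pt_filterlim. exact (continuous_Im _ _ H). Qed.

(** Differentiation under the integral sign turns the derivative in [c] into e / d times the
    integral of a derivative along the line, that is, into end-point values. This is Cauchy's
    theorem for a parallelogram. Only the real part is treated because parametric integrals are
    differentiated over the reals. *)
Lemma strip_derivative_Re (f f' : C -> C) (p e d : C) (a b A x : R) :
  d <> RtoC 0 -> 0 < A -> a < x < b ->
  (forall c u : R, a < c < b -> holo f (p + c * e + u * d)%C (f' (p + c * e + u * d)%C)) ->
  (forall c u : R, a < c < b -> continuous f' (p + c * e + u * d)%C) ->
  is_derive (fun c : R => RInt (fun u : R => Re (f (p + c * e + u * d)%C)) (- A) A) x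
    (Re (e / d * (f (p + x * e + A * d) - f (p + x * e + (- A)%R * d)))%C).
Proof.
  intros Hd HA Hx H1 H2.
  assert (D : forall c u : R, a < c < b -> is_derive (fun c : R => Re (f (p + c * e + u * d)%C)) c (Re (f' (p + c * e + u * d)%C * e)%C)).
  { intros c u Hc.
    apply (is_derive_ext (fun c : R => Re (f (p + u * d + c * e)%C))).
    { intros t. do 2 f_equal. ring. }
    apply holo_path. replace (p + u * d + c * e)%C with (p + c * e + u * d)%C by ring. auto. }
  assert (L : locally x (fun c => a < c < b)).
  { apply (locally_interval _ x a b); simpl; try lra. intros; lra. }
  assert (Cn : forall c u : R, a < c < b -> continuous (fun z : R * R => f' (p + RtoC (fst z) * e + RtoC (snd z) * d)%C) (c, u)).
  { intros c u Hc. apply (continuous_comp (fun z : R * R => (p + RtoC (fst z) * e + RtoC (snd z) * d)%C) f').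
    - ccont. apply continuous_fst. apply continuous_snd.
    - simpl. auto. }
  assert (EX : forall c, a < c < b -> forall y z, ex_RInt (fun u : R => Re (f (p + c * e + u * d)%C)) y z).
  { intros c Hc y z. apply (ex_RInt_continuous (V := R_CompleteNormedModule)). intros u _.
    apply (continuous_Re (fun u : R => f (p + c * e + u * d)%C)). apply continuous_path.
    eapply holo_continuous. now apply H1. }
  replace (Re _) with (RInt (fun u => Derive (fun c : R => Re (f (p + c * e + u * d)%C)) x) (- A) A).
  - apply (is_derive_RInt_param (fun c u => Re (f (p + c * e + u * d)%C)) (- A) A x).
    + revert L. apply filter_imp. intros c Hc u _. eexists. now apply D.
    + intros u _. apply (continuity_2d_pt_ext_loc (fun c u => Re (f' (p + c * e + u * d)%C * e)%C)).
      * destruct L as [del L]. exists del. intros c v Hc _. symmetry. apply is_derive_unique, D. now apply L.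
      * apply (continuity_2d_pt_Re (fun c u => f' (p + c * e + u * d) * e)%C).
        apply continuous_Cmult; [now apply Cn | apply continuous_const].
    + revert L. apply filter_imp. intros c Hc. now apply EX.
  - apply is_RInt_unique.
    apply (is_RInt_ext (fun u => Re (f' (p + x * e + u * d)%C * e)%C)).
    { intros u _. symmetry. apply is_derive_unique, D. auto. }
    pose proof (RIntC_FTC f f' (p + x * e)%C d (- A) A (fun t _ => H1 x t Hx) (fun t _ => H2 x t Hx)) as I.
    assert (Cf : forall t : R, continuous (fun t : R => f' (p + x * e + t * d) * d)%C t).
    { intros t. apply continuous_Cmult; [|apply continuous_const]. apply continuous_path. auto. }
    apply RIntC_unique in I. rewrite <- I, <- RIntC_scal by auto.
    apply (is_RInt_ext (fun u => Re (e / d * (f' (p + x * e + u * d) * d))%C)).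
    { intros u _. f_equal. field. auto. }
    apply (is_RIntC_Re (fun u => (e / d * (f' (p + x * e + u * d) * d))%C)).
    apply RIntC_correct. intros t. apply continuous_Cmult; [apply continuous_const | apply Cf].
Qed.

Lemma strip_MVT_Re (f f' : C -> C) (p e d : C) (a b A c0 c1 K : R) :
  d <> RtoC 0 -> 0 < A -> a < c0 -> c0 <= c1 -> c1 < b ->
  (forall c u : R, a < c < b -> holo f (p + c * e + u * d)%C (f' (p + c * e + u * d)%C)) ->
  (forall c u : R, a < c < b -> continuous f' (p + c * e + u * d)%C) ->
  (forall c : R, c0 <= c <= c1 -> Cmod (f (p + c * e + A * d))%C <= K) ->
  (forall c : R, c0 <= c <= c1 -> Cmod (f (p + c * e + (- A)%R * d))%C <= K) ->
  Rabs (RInt (fun u : R => Re (f (p + c1 * e + u * d)%C)) (- A) A -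
        RInt (fun u : R => Re (f (p + c0 * e + u * d)%C)) (- A) A) <= Cmod (e / d) * (2 * K) * (c1 - c0).
Proof.
  intros Hd HA Ha Hc Hb H1 H2 K1 K2.
  assert (D := fun x Hx => strip_derivative_Re f f' p e d a b A x Hd HA Hx H1 H2).
  destruct (MVT_gen (fun c : R => RInt (fun u : R => Re (f (p + c * e + u * d)%C)) (- A) A) c0 c1 _
    (fun x Hx => D x ltac:(rewrite Rmin_left, Rmax_right in Hx by lra; lra))) as [c [Hc' E]].
  - intros x Hx. rewrite Rmin_left, Rmax_right in Hx by lra.
    apply continuity_pt_filterlim.
    apply (ex_derive_continuous (V := R_NormedModule)
      (fun c : R => RInt (fun u : R => Re (f (p + c * e + u * d)%C)) (- A) A) x).
    eexists. apply D. lra.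
  - rewrite Rmin_left, Rmax_right in Hc' by lra. rewrite E, Rabs_mult, (Rabs_pos_eq (c1 - c0)) by lra.
    apply Rmult_le_compat_r; [lra|]. eapply Rle_trans; [apply re_le_Cmod|]. rewrite Cmod_mult.
    apply Rmult_le_compat_l; [apply Cmod_ge_0|]. eapply Rle_trans; [apply Cmod_minus_le|].
    specialize (K1 c Hc'). specialize (K2 c Hc'). lra.
Qed.

(** The truncated integrals on the two lines differ by the contribution of the short sides, which is
    O(1 / A) by the majorant at [u = A] and [u = - A]. *)
Lemma line_shift_le (f f' : C -> C) (p e d : C) (a b c0 c1 M : R) :
  d <> RtoC 0 -> a < c0 -> c0 <= c1 -> c1 < b ->
  (forall c u : R, a < c < b -> holo f (p + c * e + u * d)%C (f' (p + c * e + u * d)%C)) ->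
  (forall c u : R, a < c < b -> continuous f' (p + c * e + u * d)%C) ->
  (forall c u : R, c0 <= c <= c1 -> Cmod (f (p + c * e + u * d))%C <= M / (1 + u * u)) ->
  CInt_line (fun u => f (p + c0 * e + u * d)%C) = CInt_line (fun u => f (p + c1 * e + u * d)%C).
Proof.
  intros Hd Ha Hc Hb H1 H2 H3.
  assert (Df : forall c, c0 <= c <= c1 -> dom M (fun u : R => f (p + c * e + u * d)%C)).
  { intros c Hc'. split; [|intros; apply H3; auto].
    intros t. apply continuous_path. eapply holo_continuous, H1. lra. }
  pose proof (dom_pos _ _ (Df c0 ltac:(lra))) as HM.
  set (Q := 4 * Cmod (e / d) * (c1 - c0)).
  assert (HQ : 0 <= Q).
  { unfold Q. apply Rmult_le_pos; [|lra]. pose proof (Cmod_ge_0 (e / d)). lra. }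
  apply (IntR_unique M); [apply Df; lra|]. intros eps He.
  destruct (IntR_tail_small M HM (eps / 2)) as [A1 [P1 Q1]]; [lra|].
  destruct (IntR_tail_small (Q * M)) with (eps := eps / 2) as [A2 [P2 Q2]]; [nra | lra |].
  exists (Rmax A1 A2). intros A HA. pose proof (Rmax_l A1 A2). pose proof (Rmax_r A1 A2).
  specialize (Q1 A ltac:(lra)). specialize (Q2 A ltac:(lra)).
  assert (B : forall c, c0 <= c <= c1 -> forall u, u * u = A * A -> Cmod (f (p + c * e + u * d))%C <= M / A).
  { intros c Hc' u Hu. eapply Rle_trans; [apply H3; auto|]. rewrite Hu.
    apply Rmult_le_compat_l; auto. apply Rinv_le_contravar; nra. }
  (* The imaginary part of [f] is the real part of [- ci * f], so the lemma on real parts is used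
     twice. *)
  set (g := fun z => (- ci * f z)%C). set (g' := fun z => (- ci * f' z)%C).
  pose proof (strip_MVT_Re f f' p e d a b A c0 c1 (M / A) Hd ltac:(lra) Ha Hc Hb H1 H2
    (fun c h => B c h A eq_refl) (fun c h => B c h (- A) ltac:(ring))) as E1.
  assert (Mci : forall z, Cmod (- ci * z) = Cmod z).
  { intros z. rewrite Cmod_mult, Cmod_opp. change ci with Ci. rewrite Cmod_Ci. ring. }
  pose proof (strip_MVT_Re g g' p e d a b A c0 c1 (M / A) Hd ltac:(lra) Ha Hc Hb
    (fun c u h => holo_scal _ _ _ _ (H1 c u h))
    (fun c u h => continuous_Cmult _ _ _ (continuous_const _ _) (H2 c u h))
    (fun c h => Rle_trans _ _ _ (Req_le _ _ (Mci _)) (B c h A eq_refl))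
    (fun c h => Rle_trans _ _ _ (Req_le _ _ (Mci _)) (B c h (- A) ltac:(ring)))) as E2.
  set (I0 := RIntC (fun u => f (p + c0 * e + u * d)%C) (- A) A).
  set (I1 := RIntC (fun u => f (p + c1 * e + u * d)%C) (- A) A).
  assert (R0 := RIntC_correct _ (- A) A (proj1 (Df c0 ltac:(lra)))). fold I0 in R0.
  assert (R1 := RIntC_correct _ (- A) A (proj1 (Df c1 ltac:(lra)))). fold I1 in R1.
  rewrite (is_RInt_unique _ _ _ _ (is_RIntC_Re _ _ _ _ R0)), (is_RInt_unique _ _ _ _ (is_RIntC_Re _ _ _ _ R1)) in E1.
  assert (Gi : forall z, Re (- ci * z)%C = Im z) by (intros [x y]; unfold ci; simpl; ring).
  unfold g in E2.
  rewrite (RInt_ext (fun u : R => Re (- ci * f (p + c1 * e + u * d))%C) (fun u : R => Im (f (p + c1 * e + u * d)%C))) in E2 by (intros; apply Gi).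
  rewrite (RInt_ext (fun u : R => Re (- ci * f (p + c0 * e + u * d))%C) (fun u : R => Im (f (p + c0 * e + u * d)%C))) in E2 by (intros; apply Gi).
  rewrite (is_RInt_unique _ _ _ _ (is_RIntC_Im _ _ _ _ R0)), (is_RInt_unique _ _ _ _ (is_RIntC_Im _ _ _ _ R1)) in E2.
  assert (E3 : Cmod (I1 - I0) <= Q * M / A).
  { eapply Rle_trans; [apply Cmod_le_Re_Im|]. 
    replace (Re (I1 - I0)%C) with (Re I1 - Re I0) by reflexivity.
    replace (Im (I1 - I0)%C) with (Im I1 - Im I0) by reflexivity.
    apply Rle_trans with (2 * (Cmod (e / d) * (2 * (M / A)) * (c1 - c0))); [lra|].
    right. unfold Q. field. lra. }
  pose proof (IntR_approx M _ A (- A) A (Df c1 ltac:(lra)) ltac:(lra) ltac:(lra) ltac:(lra)) as E4.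
  fold I1 in E4.
  replace (I0 - CInt_line (fun u => f (p + c1 * e + u * d)%C))%C with
    (- (I1 - I0) + (I1 - CInt_line (fun u => f (p + c1 * e + u * d)%C)))%C by ring.
  eapply Rle_trans; [apply Cmod_triangle|]. rewrite Cmod_opp.
  unfold Rdiv in *. pose proof (Cmod_ge_0 (I1 - I0)). lra.
Qed.

(* The dominating constant may blow up at the edges of the strip. *)
Lemma line_shift (f f' : C -> C) (p e d : C) (a b c0 c1 : R) :
  d <> RtoC 0 -> a < c0 < b -> a < c1 < b ->
  (forall c u : R, a < c < b -> holo f (p + c * e + u * d)%C (f' (p + c * e + u * d)%C)) ->
  (forall c u : R, a < c < b -> continuous f' (p + c * e + u * d)%C) ->
  (forall x y, a < x -> y < b -> exists M, forall c u : R, x <= c <= y ->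
     Cmod (f (p + c * e + u * d))%C <= M / (1 + u * u)) ->
  CInt_line (fun u => f (p + c0 * e + u * d)%C) = CInt_line (fun u => f (p + c1 * e + u * d)%C).
Proof.
  intros Hd Hc0 Hc1 H1 H2 H3.
  destruct (Rle_dec c0 c1).
  - destruct (H3 c0 c1) as [M HM]; try lra.
    apply (line_shift_le f f' p e d a b c0 c1 M); auto; lra.
  - destruct (H3 c1 c0) as [M HM]; try lra.
    symmetry. apply (line_shift_le f f' p e d a b c1 c0 M); auto; lra.
Qed.

(** * Dominated convergence *)

(** Local smallness becomes uniform by compactness of the segment; indefinite description turns the
    local radii into a function, as the covering theorem demands. *)
Lemma small_on_compact (Phi : R -> R -> C) (a b eta : R) :
  (forall u, a <= u <= b -> exists r, 0 < r /\ forall del u', 0 < del < r -> Rabs (u' - u) < r ->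
     Cmod (Phi del u') <= eta) ->
  exists r, 0 < r /\ forall del u, 0 < del < r -> a <= u <= b -> Cmod (Phi del u) <= eta.
Proof.
  intros H.
  assert (G : forall u, exists r : posreal, a <= u <= b -> forall del u', 0 < del < r -> Rabs (u' - u) < r ->
     Cmod (Phi del u') <= eta).
  { intros u. destruct (Rle_dec a u) as [Ha|Ha]; [destruct (Rle_dec u b) as [Hb|Hb]|].
    - destruct (H u (conj Ha Hb)) as [r [Hr K]]. exists (mkposreal r Hr). intros _. exact K.
    - exists (mkposreal 1 Rlt_0_1). intros; lra.
    - exists (mkposreal 1 Rlt_0_1). intros; lra. }
  set (dl := fun u => proj1_sig (constructive_indefinite_description _ (G u))).
  assert (K : forall u, a <= u <= b -> forall del u', 0 < del < dl u -> Rabs (u' - u) < dl u ->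
     Cmod (Phi del u') <= eta).
  { intros u. unfold dl. destruct (constructive_indefinite_description _ (G u)); simpl; auto. }
  destruct (compactness_value_1d a b dl) as [d Hd].
  exists d. split; [apply cond_pos|]. intros del u Hdel Hu.
  (* The covering theorem gives only the double negation of a covering point, which is enough to
     refute a strict inequality. *)
  apply Rnot_lt_le. intros C. apply (Hd u Hu). intros [t [Ht [Htu Hdt]]].
  specialize (K t Ht del u ltac:(lra) Htu). lra.
Qed.

Lemma RIntC_le_const f a b K : (forall t, continuous f t) -> a <= b ->
  (forall t, a <= t <= b -> Cmod (f t) <= K) -> Cmod (RIntC f a b) <= (b - a) * K.
Proof.
  intros Hc Hab H. apply (RIntC_bound f (fun _ => K) a b); auto.
  - now apply RIntC_correct.
  - apply (is_RInt_const (V := R_NormedModule)).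
Qed.

(* Pointwise convergence is only required away from the possible singularity at 0. *)
Lemma IntR_dominated_convergence (Phi : R -> R -> C) (M r1 : R) : 0 < r1 ->
  (forall del, 0 < del < r1 -> dom M (Phi del)) ->
  (forall u eta, u <> 0 -> 0 < eta -> exists r, 0 < r /\ forall del u', 0 < del < r -> Rabs (u' - u) < r ->
     Cmod (Phi del u') <= eta) ->
  forall eps, 0 < eps -> exists r, 0 < r /\ forall del, 0 < del < r -> Cmod (CInt_line (Phi del)) <= eps.
Proof.
  intros Hr1 D H eps He.
  assert (HM : 0 <= M) by (apply (dom_pos M (Phi (r1 / 2))), D; lra).
  (* The interval [-k, k] contributes at most 2 k M, which is at most eps / 4; the outside of
     [-A, A] is a tail, and the two compact pieces in between are left to [small_on_compact]. *)
  set (k := Rmin (1 / 2) (eps / (8 * (M + 1)))).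
  assert (Hk : 0 < k) by (apply Rmin_pos; [lra | apply Rdiv_lt_0_compat; lra]).
  pose proof (Rmin_l (1 / 2) (eps / (8 * (M + 1)))). pose proof (Rmin_r (1 / 2) (eps / (8 * (M + 1)))).
  fold k in H0, H1.
  destruct (IntR_tail_small M HM (eps / 4)) as [A [PA QA]]; [lra|].
  specialize (QA A (Rle_refl _)).
  assert (He2 : 0 < eps / (8 * A)) by (apply Rdiv_lt_0_compat; lra).
  destruct (small_on_compact Phi k A (eps / (8 * A))) as [ra [Hra Ka]].
  { intros u Hu. apply H; lra. }
  destruct (small_on_compact Phi (- A) (- k) (eps / (8 * A))) as [rb [Hrb Kb]].
  { intros u Hu. apply H; lra. }
  exists (Rmin r1 (Rmin ra rb)). split; [repeat apply Rmin_pos; auto|].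
  intros del [Hd0 Hd].
  pose proof (Rmin_l r1 (Rmin ra rb)). pose proof (Rmin_r r1 (Rmin ra rb)).
  pose proof (Rmin_l ra rb). pose proof (Rmin_r ra rb).
  assert (Dd : dom M (Phi del)) by (apply D; lra).
  pose proof (IntR_approx M _ A (- A) A Dd ltac:(lra) ltac:(lra) ltac:(lra)) as E.
  assert (Cc := proj1 Dd).
  rewrite <- (RIntC_Chasles _ (- A) (- k) A), <- (RIntC_Chasles _ (- k) k A) in E by auto.
  pose proof (RIntC_le_const (Phi del) (- A) (- k) (eps / (8 * A)) Cc ltac:(lra) (fun t Ht => Kb del t ltac:(lra) Ht)) as E1.
  pose proof (RIntC_le_const (Phi del) k A (eps / (8 * A)) Cc ltac:(lra) (fun t Ht => Ka del t ltac:(lra) Ht)) as E2.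
  assert (E3 : Cmod (RIntC (Phi del) (- k) k) <= (k - - k) * M).
  { apply RIntC_le_const; auto; [lra|]. intros t _. eapply Rle_trans; [apply Dd|].
    rewrite <- (Rmult_1_r M) at 2. apply Rmult_le_compat_l; auto.
    rewrite <- Rinv_1. apply Rinv_le_contravar; nra. }
  set (I1 := RIntC (Phi del) (- A) (- k)) in *. set (I2 := RIntC (Phi del) (- k) k) in *.
  set (I3 := RIntC (Phi del) k A) in *. set (I := CInt_line (Phi del)) in *.
  replace I with (I1 + (I2 + I3) - (I1 + (I2 + I3) - I))%C by ring.
  eapply Rle_trans; [apply Cmod_minus_le|].
  pose proof (Cmod_triangle I1 (I2 + I3)). pose proof (Cmod_triangle I2 I3).
  assert (F : (A - k) * (eps / (8 * A)) <= eps / 8).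
  { replace (eps / 8) with (A * (eps / (8 * A))) by (field; lra). apply Rmult_le_compat_r; lra. }
  assert (F3 : (k - - k) * M <= eps / 4).
  { apply (Rmult_le_compat_r (8 * (M + 1))) in H1; [|lra].
    unfold Rdiv in H1. rewrite Rmult_assoc, Rinv_l, Rmult_1_r in H1 by lra. nra. }
  replace (- k - - A) with (A - k) in E1 by ring. lra.
Qed.

(** * Fubini *)

Lemma continuous_RInt_param (F : R -> R -> R) (a b : R) :
  (forall u t, continuity_2d_pt F u t) ->
  forall t, continuous (fun t => RInt (fun u => F u t) a b) t.
Proof.
  intros H.
  assert (EX : forall x y t, ex_RInt (fun u => F u t) x y).
  { intros x y t. apply (ex_RInt_continuous (V := R_CompleteNormedModule)). intros u _.
    specialize (H u t). apply continuity_2d_pt_filterlim in H.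
    apply (continuous_comp_2 (fun u : R => u) (fun _ : R => t) F); [apply continuous_id | apply continuous_const | exact H]. }
  assert (G : forall a b, a <= b -> forall t, continuous (fun t => RInt (fun u => F u t) a b) t).
  { clear a b. intros a b Hab t. apply filterlim_locally. intros eps.
    assert (Hp : 0 < eps / (2 * (b - a + 1))) by (apply Rdiv_lt_0_compat; [apply cond_pos | lra]).
    destruct (uniform_continuity_2d F a b (t - 1) (t + 1) (fun x y _ _ => H x y) (mkposreal _ Hp)) as [del K].
    simpl in K.
    assert (Hd : 0 < Rmin 1 del) by (apply Rmin_pos; [lra | apply cond_pos]).
    exists (mkposreal _ Hd). intros t' Ht'. simpl in Ht'.
    assert (Ht2 : Rabs (t' - t) < Rmin 1 del) by exact Ht'.
    pose proof (Rmin_l 1 del). pose proof (Rmin_r 1 del).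
    change (Rabs (RInt (fun u => F u t') a b - RInt (fun u => F u t) a b) < eps).
    pose proof (RInt_minus (V := R_CompleteNormedModule) (fun u => F u t') (fun u => F u t) a b (EX a b t') (EX a b t)) as E.
    change (RInt (fun x => F x t' - F x t) a b = RInt (fun u => F u t') a b - RInt (fun u => F u t) a b) in E.
    rewrite <- E.
    apply Rle_lt_trans with ((b - a) * (eps / (2 * (b - a + 1)))).
    - apply (abs_RInt_le_const (fun x => F x t' - F x t)); auto.
      + apply (ex_RInt_minus (V := R_NormedModule)); apply EX.
      + intros x Hx. left. apply K; auto; try (split; lra).
        * apply Rabs_def2 in Ht2. lra.
        * rewrite Rminus_diag, Rabs_R0. apply cond_pos.
        * lra.
    - pose proof (cond_pos eps).
      apply (Rmult_lt_reg_r (2 * (b - a + 1))); [lra|].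
      replace ((b - a) * (eps / (2 * (b - a + 1))) * (2 * (b - a + 1))) with ((b - a) * eps) by (field; lra). nra. }
  destruct (Rle_dec a b) as [L|L].
  - now apply G.
  - intros t. apply (continuous_ext (fun t => - RInt (fun u => F u t) b a)).
    + intros x. apply (opp_RInt_swap (V := R_CompleteNormedModule)). apply EX.
    + apply continuous_Ropp. apply G. lra.
Qed.

(** As functions of the upper limit [d], both iterated integrals have the same derivative and vanish
    at [d = c]. *)
Lemma RInt_Fubini_R (F : R -> R -> R) (a b c d : R) :
  (forall u t, continuity_2d_pt F u t) ->
  RInt (fun u => RInt (fun t => F u t) c d) a b = RInt (fun t => RInt (fun u => F u t) a b) c d.
Proof.
  intros H.
  assert (H' : forall t u, continuity_2d_pt (fun t u => F u t) t u).
  { intros t u. apply continuity_2d_pt_filterlim. specialize (H u t). apply continuity_2d_pt_filterlim in H.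
    apply (continuous_comp_2 (fun z : R * R => snd z) (fun z : R * R => fst z) F);
      [apply continuous_snd | apply continuous_fst | exact H]. }
  set (L := fun y => RInt (fun u => RInt (fun t => F u t) c y) a b).
  set (G := fun y => RInt (fun t => RInt (fun u => F u t) a b) c y).
  assert (Cu : forall u t, continuous (fun u => F u t) u).
  { intros u t. specialize (H u t). apply continuity_2d_pt_filterlim in H.
    apply (continuous_comp_2 (fun u : R => u) (fun _ : R => t) F); [apply continuous_id | apply continuous_const | exact H]. }
  assert (Ct : forall u t, continuous (fun t => F u t) t).
  { intros u t. specialize (H u t). apply continuity_2d_pt_filterlim in H.
    apply (continuous_comp_2 (fun _ : R => u) (fun t : R => t) F); [apply continuous_const | apply continuous_id | exact H]. }
  assert (EXu : forall x y t, ex_RInt (fun u => F u t) x y).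
  { intros. apply (ex_RInt_continuous (V := R_CompleteNormedModule)). auto. }
  assert (EXt : forall x y u, ex_RInt (fun t => F u t) x y).
  { intros. apply (ex_RInt_continuous (V := R_CompleteNormedModule)). auto. }
  assert (Din : forall u y, is_derive (fun y => RInt (fun t => F u t) c y) y (F u y)).
  { intros u y. apply (is_derive_RInt (V := R_NormedModule) (fun t => F u t) _ c); auto.
    apply filter_forall. intros z. apply (RInt_correct (V := R_CompleteNormedModule)). apply EXt. }
  assert (DL : forall y, is_derive L y (RInt (fun u => F u y) a b)).
  { intros y. unfold L.
    replace (RInt (fun u => F u y) a b) with
      (RInt (fun u => Derive (fun y => RInt (fun t => F u t) c y) y) a b).
    - apply (is_derive_RInt_param (fun y u => RInt (fun t => F u t) c y)).
      + apply filter_forall. intros z u _. eexists. apply Din.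
      + intros u _. apply (continuity_2d_pt_ext (fun y u => F u y)); auto.
        intros z v. symmetry. apply is_derive_unique, Din.
      + apply filter_forall. intros z. apply (ex_RInt_continuous (V := R_CompleteNormedModule)).
        intros u _. apply (continuous_RInt_param (fun t u => F u t)); auto.
    - apply RInt_ext. intros u _. apply is_derive_unique, Din. }
  assert (DG : forall y, is_derive G y (RInt (fun u => F u y) a b)).
  { intros y. unfold G.
    apply (is_derive_RInt (V := R_NormedModule) (fun t => RInt (fun u => F u t) a b) _ c).
    - apply filter_forall. intros z. apply (RInt_correct (V := R_CompleteNormedModule)).
      apply (ex_RInt_continuous (V := R_CompleteNormedModule)). intros t _. apply continuous_RInt_param; auto.
    - apply continuous_RInt_param; auto. }
  assert (D0 : forall y, is_derive (fun y => L y - G y) y 0).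
  { intros y. replace 0 with (RInt (fun u => F u y) a b - RInt (fun u => F u y) a b) by ring.
    apply (is_derive_minus (V := R_NormedModule) L G); auto. }
  assert (E : L d - G d = L c - G c).
  { destruct (MVT_gen (fun y => L y - G y) c d (fun _ => 0)) as [z [_ Hz]].
    - intros; apply D0.
    - intros x _. apply continuity_pt_filterlim.
      apply (ex_derive_continuous (V := R_NormedModule) (fun y => L y - G y)). eexists. apply D0.
    - lra. }
  assert (E1 : L c = 0).
  { unfold L. rewrite (RInt_ext _ (fun _ => 0)).
    - rewrite RInt_const. unfold scal; simpl; unfold mult; simpl; ring.
    - intros. apply (RInt_point (V := R_CompleteNormedModule)). }
  assert (E2 : G c = 0) by (unfold G; apply (RInt_point (V := R_CompleteNormedModule))).
  change (L d = G d). lra.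
Qed.

Lemma cont2_l F : cont2 F -> forall u t, continuous (fun t => F u t) t.
Proof.
  intros H u t.
  apply (continuous_comp_2 (fun _ : R => u) (fun t : R => t) F); [apply continuous_const | apply continuous_id | apply H].
Qed.

Lemma cont2_r F : cont2 F -> forall t u, continuous (fun u => F u t) u.
Proof.
  intros H t u.
  apply (continuous_comp_2 (fun u : R => u) (fun _ : R => t) F); [apply continuous_id | apply continuous_const | apply H].
Qed.

Lemma RIntC_eq_ReIm f a b : (forall t, continuous f t) ->
  RIntC f a b = (RInt (fun t => Re (f t)) a b, RInt (fun t => Im (f t)) a b).
Proof.
  intros H. pose proof (RIntC_correct f a b H) as I.
  rewrite (is_RInt_unique _ _ _ _ (is_RIntC_Re _ _ _ _ I)), (is_RInt_unique _ _ _ _ (is_RIntC_Im _ _ _ _ I)).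
  now destruct (RIntC f a b).
Qed.

Lemma continuous_RIntC_param F a b : cont2 F -> forall t, continuous (fun t => RIntC (fun u => F u t) a b) t.
Proof.
  intros H t.
  apply (continuous_ext (fun t => (RInt (fun u => Re (F u t)) a b, RInt (fun u => Im (F u t)) a b) : C)).
  { intros x. symmetry. apply RIntC_eq_ReIm. intros u. now apply cont2_r. }
  apply continuous_ReIm; simpl.
  - apply (continuous_RInt_param (fun u t => Re (F u t))). intros u x. now apply continuity_2d_pt_Re.
  - apply (continuous_RInt_param (fun u t => Im (F u t))). intros u x. now apply continuity_2d_pt_Im.
Qed.

Lemma cont2_swap F : cont2 F -> cont2 (fun u t => F t u).
Proof.
  intros H u t.
  apply (continuous_comp_2 (fun z : R * R => snd z) (fun z : R * R => fst z) F);
      [apply continuous_snd | apply continuous_fst | apply H].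
Qed.

Lemma RIntC_Fubini F a b c d : cont2 F ->
  RIntC (fun u => RIntC (fun t => F u t) c d) a b = RIntC (fun t => RIntC (fun u => F u t) a b) c d.
Proof.
  intros H.
  rewrite (RIntC_eq_ReIm (fun u => RIntC (fun t => F u t) c d))
    by (intros; now apply (continuous_RIntC_param (fun t u => F u t)), cont2_swap).
  rewrite (RIntC_eq_ReIm (fun t => RIntC (fun u => F u t) a b))
    by (intros; now apply continuous_RIntC_param).
  f_equal.
  - rewrite (RInt_ext _ (fun u => RInt (fun t => Re (F u t)) c d)).
    2:{ intros u _. rewrite RIntC_eq_ReIm by (intros; now apply cont2_l). reflexivity. }
    rewrite (RInt_ext (fun t => Re (RIntC (fun u => F u t) a b)) (fun t => RInt (fun u => Re (F u t)) a b)).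
    2:{ intros u _. rewrite RIntC_eq_ReIm by (intros; now apply cont2_r). reflexivity. }
    apply RInt_Fubini_R. intros. now apply continuity_2d_pt_Re.
  - rewrite (RInt_ext _ (fun u => RInt (fun t => Im (F u t)) c d)).
    2:{ intros u _. rewrite RIntC_eq_ReIm by (intros; now apply cont2_l). reflexivity. }
    rewrite (RInt_ext (fun t => Im (RIntC (fun u => F u t) a b)) (fun t => RInt (fun u => Im (F u t)) a b)).
    2:{ intros u _. rewrite RIntC_eq_ReIm by (intros; now apply cont2_r). reflexivity. }
    apply RInt_Fubini_R. intros. now apply continuity_2d_pt_Im.
Qed.

(** The truncated integrals are continuous in the parameter and converge uniformly, so the limit is
    continuous. *)
Lemma dom_IntR_param F M : cont2 F ->
  (forall u t, Cmod (F u t) <= M / ((1 + u * u) * (1 + t * t))) ->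
  dom (PI * M) (fun u => CInt_line (F u)).
Proof.
  intros H B.
  assert (HM : 0 <= M).
  { specialize (B 0 0). pose proof (Cmod_ge_0 (F 0 0)).
    replace (M / ((1 + 0 * 0) * (1 + 0 * 0))) with M in B by field. lra. }
  assert (D : forall u, dom (M / (1 + u * u)) (F u)).
  { intros u. split; [intros; now apply cont2_l|]. intros t. eapply Rle_trans; [apply B|].
    right. field. pose proof (one_plus_sqr_pos u). pose proof (one_plus_sqr_pos t). lra. }
  split.
  - intros u. apply continuous_Cmod_eps. intros eps He.
    destruct (IntR_tail_small M HM (eps / 4)) as [A [PA QA]]; [lra|].
    specialize (QA A (Rle_refl _)).
    assert (E : forall v, Cmod (RIntC (F v) (- A) A - CInt_line (F v))%C <= eps / 4).
    { intros v. eapply Rle_trans; [apply (IntR_approx (M / (1 + v * v)) _ A); auto; lra|].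
      eapply Rle_trans; [|exact QA]. unfold Rdiv. apply Rmult_le_compat_r; [left; apply Rinv_0_lt_compat; lra|].
      apply Rmult_le_compat_l; [lra|]. rewrite <- (Rmult_1_r M) at 2. apply Rmult_le_compat_l; auto.
      rewrite <- Rinv_1. apply Rinv_le_contravar; nra. }
    pose proof (continuous_RIntC_param _ (- A) A (cont2_swap _ H) u) as Hc. cbv beta in Hc.
    rewrite continuous_Cmod_eps in Hc. specialize (Hc (eps / 4) ltac:(lra)).
    revert Hc. apply filter_imp. intros v Hv.
    pose proof (E u) as E1. pose proof (E v) as E2.
    change (RIntC (fun t => F u t) (- A) A) with (RIntC (F u) (- A) A) in Hv.
    change (RIntC (fun t => F v t) (- A) A) with (RIntC (F v) (- A) A) in Hv.
    replace (CInt_line (F v) - CInt_line (F u))%C with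
     ((RIntC (F v) (- A) A - RIntC (F u) (- A) A) + ((RIntC (F u) (- A) A - CInt_line (F u)) - (RIntC (F v) (- A) A - CInt_line (F v))))%C by ring.
    eapply Rle_lt_trans; [apply Cmod_triangle|].
    pose proof (Cmod_minus_le (RIntC (F u) (- A) A - CInt_line (F u)) (RIntC (F v) (- A) A - CInt_line (F v))).
    lra.
  - intros u. eapply Rle_trans; [apply (IntR_bound (M / (1 + u * u))); auto|]. right. unfold Rdiv; ring.
Qed.

(** Since the majorant is a product, each inner tail is O(1 / A) times a function that is still
    integrable in the outer variable; the case of a square then suffices. *)
Lemma IntR_Fubini F M : cont2 F ->
  (forall u t, Cmod (F u t) <= M / ((1 + u * u) * (1 + t * t))) ->
  CInt_line (fun u => CInt_line (fun t => F u t)) = CInt_line (fun t => CInt_line (fun u => F u t)).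
Proof.
  intros H B.
  assert (D : forall u, dom (M / (1 + u * u)) (F u)).
  { intros u. split; [intros; now apply cont2_l|]. intros t. eapply Rle_trans; [apply B|].
    right. field. pose proof (one_plus_sqr_pos u). pose proof (one_plus_sqr_pos t). lra. }
  assert (D' : forall t, dom (M / (1 + t * t)) (fun u => F u t)).
  { intros t. split; [intros; now apply cont2_r|]. intros u. eapply Rle_trans; [apply B|].
    right. field. pose proof (one_plus_sqr_pos u). pose proof (one_plus_sqr_pos t). lra. }
  pose proof (dom_IntR_param F M H B) as P1.
  assert (P2 : dom (PI * M) (fun t => CInt_line (fun u => F u t))).
  { apply (dom_IntR_param (fun t u => F u t)); [now apply cont2_swap|].
    intros u t. rewrite Rmult_comm. apply B. }
  assert (HM : 0 <= M).
  { pose proof (dom_pos _ _ (D 0)) as K. replace (M / (1 + 0 * 0)) with M in K by field. lra. }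
  assert (HP : 0 <= 2 * PI * M) by (pose proof PI_RGT_0; nra).
  set (J := CInt_line (fun t => CInt_line (fun u => F u t))).
  apply (IntR_unique (PI * M)); [exact P1|]. intros eps He.
  destruct (IntR_tail_small (2 * PI * M) HP (eps / 3)) as [A0 [PA QA]]; [lra|].
  exists A0. intros A HA. specialize (QA A HA).
  set (S := RIntC (fun u => RIntC (fun t => F u t) (- A) A) (- A) A).
  (* the tail of the inner integral is at most 2M/A times 1/(1+u^2) *)
  assert (K : forall G : R -> R -> C, cont2 G -> (forall u, dom (M / (1 + u * u)) (G u)) ->
     dom (PI * M) (fun u => CInt_line (G u)) ->
     Cmod (RIntC (fun u => CInt_line (G u)) (- A) A - RIntC (fun u => RIntC (G u) (- A) A) (- A) A)%C <= PI * (2 * M / A)).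
  { intros G HG DG PG.
    assert (CG : forall u, continuous (fun u => RIntC (G u) (- A) A) u).
    { intros u. exact (continuous_RIntC_param _ (- A) A (cont2_swap _ HG) u). }
    replace (RIntC (fun u => CInt_line (G u)) (- A) A - RIntC (fun u => RIntC (G u) (- A) A) (- A) A)%C
      with (RIntC (fun u => CInt_line (G u) + (- (1)) * RIntC (G u) (- A) A)%C (- A) A).
    2:{ rewrite RIntC_plus; [|apply PG|].
        - rewrite (RIntC_scal (fun u => RIntC (G u) (- A) A)) by auto.
          cring.
        - intros t. apply continuous_Cmult; [apply continuous_const | auto]. }
    apply (RIntC_bound_dom (2 * M / A)); [|lra]. split.
    - intros t. apply continuous_Cplus; [apply PG|]. apply continuous_Cmult; [apply continuous_const | auto].
    - intros u. replace (CInt_line (G u) + - (1) * RIntC (G u) (- A) A)%C with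
        (- (RIntC (G u) (- A) A - CInt_line (G u)))%C by ring. rewrite Cmod_opp.
      eapply Rle_trans; [apply (IntR_approx _ _ A (- A) A (DG u)); lra|].
      right. field. pose proof (one_plus_sqr_pos u). split; lra. }
  pose proof (K F H D P1) as K1.
  pose proof (K (fun t u => F u t) (cont2_swap _ H) D' P2) as K2.
  cbv beta in K1, K2. change (UniformSpace.sort R_UniformSpace) with R in K1, K2.
  rewrite <- (RIntC_Fubini F (- A) A (- A) A H) in K2.
  pose proof (IntR_approx _ _ A (- A) A P2 ltac:(lra) ltac:(lra) ltac:(lra)) as K3. fold J in K3.
  change (RIntC (fun u => RIntC (F u) (- A) A) (- A) A) with S in K1. fold S in K2.
  set (X := RIntC (fun u => CInt_line (F u)) (- A) A) in *.
  set (Y := RIntC (fun t => CInt_line (fun u => F u t)) (- A) A) in *.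
  change (Cmod (X - J)%C <= eps).
  replace (X - J)%C with ((X - S) + ((Y - J) - (Y - S)))%C by ring.
  eapply Rle_trans; [apply Cmod_triangle|].
  pose proof (Cmod_minus_le (Y - J) (Y - S)).
  assert (2 * (PI * M) / A <= eps / 3 /\ PI * (2 * M / A) <= eps / 3).
  { assert (E : 2 * (2 * PI * M) / A = 2 * (PI * (2 * M / A))) by (field; lra).
    assert (E' : 2 * (PI * M) / A = PI * (2 * M / A)) by (field; lra).
    assert (0 <= PI * (2 * M / A)).
    { apply Rmult_le_pos; [pose proof PI_RGT_0; lra|]. apply Rmult_le_pos; [lra | left; apply Rinv_0_lt_compat; lra]. }
    lra. }
  lra.
Qed.

(** * Exponential substitution and dominating functions *)

Lemma exp_ge_quadratic (x : R) : 0 <= x -> 1 + x + x * x / 2 <= exp x.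
Proof.
  intros Hx.
  assert (D : forall t, is_derive (fun t => exp t - 1 - t - t * t / 2) t (exp t - 1 - t)).
  { intros t. auto_derive; auto. field. }
  destruct (MVT_gen (fun t => exp t - 1 - t - t * t / 2) 0 x (fun t => exp t - 1 - t)) as [c [Hc E]].
  - intros; apply D.
  - intros y _. apply continuity_pt_filterlim.
    apply (ex_derive_continuous (V := R_NormedModule) (fun t => exp t - 1 - t - t * t / 2)). eexists. apply D.
  - rewrite Rmin_left in Hc by lra. rewrite exp_0 in E.
    assert (1 + c <= exp c).
    { destruct (Req_dec c 0) as [->|N]; [rewrite exp_0; lra|]. left. apply exp_ineq1; auto. }
    assert (0 <= (exp c - 1 - c) * (x - 0)) by (apply Rmult_le_pos; lra). lra.
Qed.

Lemma exp_neg_abs_le (b t : R) : 0 < b -> exp (- (b * Rabs t)) <= 2 * (1 + / (b * b)) / (1 + t * t).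
Proof.
  intros Hb. pose proof (Rabs_pos t) as Ht. pose proof (one_plus_sqr_pos t).
  set (x := b * Rabs t). assert (Hx : 0 <= x) by (unfold x; nra).
  pose proof (exp_ge_quadratic x Hx). rewrite exp_Ropp.
  assert (E : t * t = / (b * b) * (x * x)).
  { unfold x. replace (/ (b * b) * (b * Rabs t * (b * Rabs t))) with (Rabs t * Rabs t) by (field; lra).
    rewrite <- Rabs_mult. rewrite Rabs_pos_eq; nra. }
  assert (Hb2 : 0 < / (b * b)) by (apply Rinv_0_lt_compat; nra).
  apply (Rmult_le_reg_r (exp x)); [apply exp_pos|]. rewrite Rinv_l by (pose proof (exp_pos x); lra).
  apply (Rmult_le_reg_r (1 + t * t)); auto.
  replace (2 * (1 + / (b * b)) / (1 + t * t) * exp x * (1 + t * t)) with (2 * (1 + / (b * b)) * exp x) by (field; lra).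
  rewrite Rmult_1_l, E.
  apply Rle_trans with (2 * (1 + / (b * b)) * (1 + x * x / 2)).
  - assert (0 <= x * x) by nra. nra.
  - apply Rmult_le_compat_l; lra.
Qed.

(** Completing the square absorbs any linear exponent; the extra 1 next to [b] keeps one unit of
    exponential decay in reserve. *)
Lemma exp_gauss_le (a b t : R) : 0 < a ->
  exp (- (a * (t * t)) + b * Rabs t) <= exp ((b + 1) * (b + 1) / (4 * a)) * exp (- (1 * Rabs t)).
Proof.
  intros Ha. rewrite <- exp_plus. apply exp_le.
  assert (E : t * t = Rabs t * Rabs t) by (rewrite <- Rabs_mult; rewrite Rabs_pos_eq; nra).
  rewrite E. set (x := Rabs t).
  assert (0 <= a * ((x - (b + 1) / (2 * a)) * (x - (b + 1) / (2 * a)))).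
  { apply Rmult_le_pos; [lra|]. apply Rle_0_sqr. }
  replace (a * ((x - (b + 1) / (2 * a)) * (x - (b + 1) / (2 * a)))) with
    (a * (x * x) - (b + 1) * x + (b + 1) * (b + 1) / (4 * a)) in H by (field; lra).
  lra.
Qed.

Lemma exp_gauss_dom (a b t : R) : 0 < a ->
  exp (- (a * (t * t)) + b * Rabs t) <= 4 * exp ((b + 1) * (b + 1) / (4 * a)) / (1 + t * t).
Proof.
  intros Ha. eapply Rle_trans; [now apply exp_gauss_le|].
  pose proof (exp_neg_abs_le 1 t Rlt_0_1) as H.
  replace (2 * (1 + / (1 * 1))) with 4 in H by field.
  apply (Rmult_le_compat_l (exp ((b + 1) * (b + 1) / (4 * a)))) in H; [|left; apply exp_pos].
  eapply Rle_trans; [exact H|]. right. unfold Rdiv; ring.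
Qed.

Lemma exp_cosh_le (t : R) : exp t / (1 + exp t * exp t) <= 4 / (1 + t * t).
Proof.
  pose proof (exp_neg_abs_le 1 t Rlt_0_1) as H.
  replace (2 * (1 + / (1 * 1))) with 4 in H by field.
  eapply Rle_trans; [|exact H]. rewrite Rmult_1_l.
  pose proof (exp_pos t).
  apply (Rmult_le_reg_r (1 + exp t * exp t)); [nra|].
  unfold Rdiv. rewrite Rmult_assoc, Rinv_l, Rmult_1_r by nra.
  unfold Rabs. destruct (Rcase_abs t).
  - rewrite Ropp_involutive. nra.
  - rewrite exp_Ropp. rewrite Rmult_plus_distr_l, <- Rmult_assoc, Rinv_l by lra.
    pose proof (Rinv_0_lt_compat _ H0). lra.
Qed.

(** [s] is 1 or -1. The Jacobian exp t makes the composed function small at both ends, since exp t /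
    (1 + exp (2 t)) decays exponentially in |t|. *)
Lemma dom_exp_comp M f (s : R) : s * s = 1 -> dom M f -> dom (4 * M) (fun t => exp t * f (s * exp t)%R)%C.
Proof.
  intros Hs D. pose proof (dom_pos _ _ D) as HM. destruct D as [Hc Hb]. split.
  - intros t. apply continuous_Cmult; [ccont|].
    apply (continuous_comp (fun t => s * exp t) f); auto. ccont.
  - intros t. rewrite Cmod_mult, Cmod_R, Rabs_pos_eq by (left; apply exp_pos).
    specialize (Hb (s * exp t)). replace (s * exp t * (s * exp t)) with (s * s * (exp t * exp t)) in Hb by ring.
    rewrite Hs, Rmult_1_l in Hb.
    eapply Rle_trans; [apply Rmult_le_compat_l; [left; apply exp_pos | exact Hb]|].
    pose proof (exp_cosh_le t) as K. apply (Rmult_le_compat_l M) in K; auto.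
    unfold Rdiv in *. lra.
Qed.

Lemma RIntC_exp_comp f (s a b : R) : (forall t, continuous f t) ->
  (RtoC s * RIntC (fun t => exp t * f (s * exp t)%R)%C a b)%C = RIntC f (s * exp a) (s * exp b).
Proof.
  intros H. symmetry. rewrite <- RIntC_scal.
  2:{ intros t. apply continuous_Cmult; [ccont|].
    apply (continuous_comp (fun t => s * exp t) f); auto. ccont. }
  symmetry. apply RIntC_unique.
  pose proof (is_RInt_comp (V := C_R_CompleteNormedModule) f (fun t => s * exp t) (fun t => s * exp t) a b) as I.
  eapply is_RInt_ext; [|apply I].
  - intros t _. apply injective_projections; simpl; unfold scal, mult; simpl; unfold mult; simpl; ring.
  - intros; apply H.
  - intros x _. split; [auto_derive; auto; ring | ccont].
Qed.

(** Integrals over half-lines are always written over R by means of [exp]. What the truncation to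
    [-A, A] leaves out around 0 is an interval of length 2 exp (-A). *)
Lemma IntR_split_exp M f : dom M f ->
  CInt_line f = (CInt_line (fun t => exp t * f (1 * exp t)%R) + CInt_line (fun t => exp t * f (-1 * exp t)%R))%C.
Proof.
  intros D. pose proof (dom_pos _ _ D) as HM.
  pose proof (dom_exp_comp M f 1 ltac:(ring) D) as D1.
  pose proof (dom_exp_comp M f (-1) ltac:(ring) D) as D2.
  rewrite <- (IntR_plus _ _ _ _ D1 D2). symmetry.
  apply (IntR_unique _ _ _ (dom_plus _ _ _ _ D1 D2)). intros eps He.
  destruct (IntR_tail_small M HM (eps / 2)) as [A0 [P Q]]; [lra|].
  exists (Rmax A0 (4 * M / eps)). intros A HA.
  pose proof (Rmax_l A0 (4 * M / eps)). pose proof (Rmax_r A0 (4 * M / eps)).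
  assert (HE : A + 1 <= exp A).
  { left. rewrite Rplus_comm. apply exp_ineq1. lra. }
  rewrite RIntC_plus by (apply D1 || apply D2).
  replace (RIntC (fun t => exp t * f (1 * exp t)%R)%C (- A) A) with (RIntC f (exp (- A)) (exp A)).
  2:{ pose proof (RIntC_exp_comp f 1 (- A) A (proj1 D)) as E. rewrite !Rmult_1_l in E. rewrite <- E. cring. }
  replace (RIntC (fun t => exp t * f (-1 * exp t)%R)%C (- A) A) with (RIntC f (- exp A) (- exp (- A))).
  2:{ pose proof (RIntC_exp_comp f (-1) (- A) A (proj1 D)) as E.
      rewrite <- (RIntC_swap f (- exp (- A)) (- exp A)) by apply D.
      replace (- exp (- A)) with (-1 * exp (- A)) by ring. replace (- exp A) with (-1 * exp A) by ring.
      rewrite <- E. cring. }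
  pose proof (IntR_approx M f (exp A) (- exp A) (exp A) D ltac:(apply exp_pos) ltac:(lra) ltac:(lra)) as K.
  rewrite <- (RIntC_Chasles f (- exp A) (- exp (- A)) (exp A)), <- (RIntC_Chasles f (- exp (- A)) (exp (- A)) (exp A)) in K by apply D.
  assert (HN : exp (- A) <= / A).
  { rewrite exp_Ropp. apply Rinv_le_contravar; lra. }
  pose proof (exp_pos (- A)) as HN0.
  assert (K2 : Cmod (RIntC f (- exp (- A)) (exp (- A))) <= 2 * M / A).
  { eapply Rle_trans.
    - apply (RIntC_le_const f _ _ M); [apply D | lra |]. intros t _. eapply Rle_trans; [apply D|].
      rewrite <- (Rmult_1_r M) at 2. apply Rmult_le_compat_l; auto.
      rewrite <- Rinv_1. apply Rinv_le_contravar; nra.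
    - replace (exp (- A) - - exp (- A)) with (2 * exp (- A)) by ring.
      apply (Rmult_le_compat_l M) in HN; auto. unfold Rdiv. lra. }
  assert (K3 : 2 * M / exp A <= 2 * M / A).
  { apply Rmult_le_compat_l; [lra|]. apply Rinv_le_contravar; lra. }
  specialize (Q A ltac:(lra)).
  set (X := RIntC f (- exp A) (- exp (- A))) in *. set (Y := RIntC f (- exp (- A)) (exp (- A))) in *.
  set (Z := RIntC f (exp (- A)) (exp A)) in *. set (I := CInt_line f) in *.
  replace (Z + X - I)%C with (X + (Y + Z) - I - Y)%C by ring.
  eapply Rle_trans; [apply Cmod_minus_le|]. lra.
Qed.

(** * The principal logarithm *)

Lemma Cmod_sqr (z : C) : Cmod z * Cmod z = Re z * Re z + Im z * Im z.
Proof. pose proof (Cmod2_alt z) as H. simpl in H. lra. Qed.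

Lemma carg_polar (r th : R) : 0 < r -> - PI < th <= PI -> carg (r * cos th, r * sin th) = th.
Proof.
  intros Hr Ht.
  assert (Hm : Cmod (r * cos th, r * sin th) = r).
  { unfold Cmod; simpl.
    replace (_ + _) with (r ^ 2 * ((sin th)² + (cos th)²)) by (unfold Rsqr; ring).
    rewrite sin2_cos2, Rmult_1_r. apply sqrt_pow2. lra. }
  unfold carg. rewrite Hm. destruct (Req_EM_T r 0); [lra|]. simpl.
  replace (r * cos th / r) with (cos th) by (field; lra).
  destruct (Rle_dec 0 (r * sin th)) as [H|H].
  - destruct (Rle_dec 0 th); [apply acos_cos; lra|].
    exfalso. assert (0 < sin (- th)) by (apply sin_gt_0; lra). rewrite sin_neg in H0. nra.
  - assert (th < 0).
    { apply Rnot_le_lt. intros C. apply H. apply Rmult_le_pos; [lra|]. apply sin_ge_0; lra. }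
    rewrite <- cos_neg, acos_cos; lra.
Qed.

Lemma polar_form (z : C) : z <> RtoC 0 -> exists th, - PI < th <= PI /\ z = (Cmod z * cos th, Cmod z * sin th).
Proof.
  intros Hz. apply Cmod_gt_0 in Hz as Hm. pose proof (Cmod_sqr z) as S.
  destruct z as [x y]; simpl in *. set (r := Cmod (x, y)) in *. clearbody r.
  assert (Hb : -1 <= x / r <= 1).
  { split; apply (Rmult_le_reg_r r); auto; unfold Rdiv; rewrite Rmult_assoc, Rinv_l, Rmult_1_r by lra; nra. }
  assert (Hs : r * sqrt (1 - (x / r)²) = Rabs y).
  { rewrite <- (sqrt_Rsqr r) at 1 by lra. rewrite <- sqrt_mult.
    - rewrite <- sqrt_Rsqr_abs. f_equal. unfold Rsqr.
      replace (r * r * (1 - x / r * (x / r))) with (r * r - x * x) by (field; lra). lra.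
    - apply Rle_0_sqr.
    - unfold Rsqr. nra. }
  pose proof (acos_bound (x / r)) as B.
  destruct (Rle_dec 0 y).
  - exists (acos (x / r)). split; [pose proof PI_RGT_0; lra|].
    rewrite cos_acos, sin_acos, Hs, Rabs_pos_eq by auto. f_equal. field; lra.
  - exists (- acos (x / r)).
    assert (acos (x / r) <> PI).
    { intros E. assert (C : cos (acos (x / r)) = -1) by (rewrite E; apply cos_PI).
      rewrite cos_acos in C by auto. assert (x = - r) by (apply (Rmult_eq_reg_r (/ r)); [unfold Rdiv in C; rewrite C; field; lra | apply Rinv_neq_0_compat; lra]).
      rewrite H in S. nra. }
    split; [lra|]. rewrite cos_neg, sin_neg, cos_acos, sin_acos by auto.
    f_equal; [field; lra|]. rewrite Ropp_mult_distr_r_reverse, Hs, Rabs_left; lra.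
Qed.

Lemma carg_bound (z : C) : z <> RtoC 0 -> - PI < carg z <= PI.
Proof.
  intros Hz. destruct (polar_form z Hz) as [th [Ht E]]. apply Cmod_gt_0 in Hz. rewrite E.
  rewrite carg_polar; auto.
Qed.

Lemma polar_carg (z : C) : z <> RtoC 0 -> z = (Cmod z * cos (carg z), Cmod z * sin (carg z)).
Proof.
  intros Hz. destruct (polar_form z Hz) as [th [Ht E]]. apply Cmod_gt_0 in Hz.
  assert (carg z = th) by (rewrite E; now apply carg_polar).
  rewrite H. exact E.
Qed.

Lemma cexp_clog (z : C) : z <> RtoC 0 -> cexp (clog z) = z.
Proof.
  intros Hz. rewrite (polar_carg z Hz) at 2. apply Cmod_gt_0 in Hz.
  unfold cexp, clog; simpl. now rewrite exp_ln.
Qed.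

Lemma clog_cexp (z : C) : - PI < Im z <= PI -> clog (cexp z) = z.
Proof.
  intros H. unfold clog. rewrite Cmod_cexp, ln_exp.
  unfold cexp. rewrite carg_polar; auto; [now destruct z | apply exp_pos].
Qed.

Lemma clog_RtoC (x : R) : 0 < x -> clog x = RtoC (ln x).
Proof.
  intros H. replace (RtoC x) with (cexp (RtoC (ln x))).
  - apply clog_cexp. simpl. pose proof PI_RGT_0; lra.
  - rewrite cexp_R, exp_ln; auto.
Qed.

Definition slit (z : C) : Prop := 0 < Re z \/ Im z <> 0.

Lemma slit_neq_0 z : slit z -> z <> RtoC 0.
Proof. intros [H|H] E; rewrite E in H; simpl in H; lra. Qed.

Lemma atan_polar (x y : R) : 0 < x ->
  x = sqrt (x * x + y * y) * cos (atan (y / x)) /\ y = sqrt (x * x + y * y) * sin (atan (y / x)).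
Proof.
  intros Hx. rewrite cos_atan, sin_atan.
  assert (E : sqrt (x * x + y * y) = x * sqrt (1 + (y / x)²)).
  { rewrite <- (sqrt_Rsqr x) at 3 by lra. rewrite <- sqrt_mult.
    - f_equal. unfold Rsqr. field; lra.
    - apply Rle_0_sqr.
    - pose proof (Rle_0_sqr (y / x)). lra. }
  assert (0 < sqrt (1 + (y / x)²)) by (apply sqrt_lt_R0; pose proof (Rle_0_sqr (y / x)); lra).
  rewrite E. split; field; repeat split; lra.
Qed.

Lemma carg_Re_pos (x y : R) : 0 < x -> carg (x, y) = atan (y / x).
Proof.
  intros Hx. destruct (atan_polar x y Hx) as [E1 E2].
  assert (0 < sqrt (x * x + y * y)) by (apply sqrt_lt_R0; nra).
  pose proof (atan_bound (y / x)). pose proof PI_RGT_0.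
  rewrite <- (carg_polar (sqrt (x * x + y * y)) (atan (y / x))) by (auto; lra).
  f_equal. now rewrite <- E1, <- E2.
Qed.

Lemma carg_Im_pos (x y : R) : 0 < y -> carg (x, y) = PI / 2 - atan (x / y).
Proof.
  intros Hy. destruct (atan_polar y x Hy) as [E1 E2].
  rewrite Rplus_comm in E1, E2.
  assert (0 < sqrt (x * x + y * y)) by (apply sqrt_lt_R0; nra).
  pose proof (atan_bound (x / y)). pose proof PI_RGT_0.
  rewrite <- (carg_polar (sqrt (x * x + y * y)) (PI / 2 - atan (x / y))) by (auto; lra).
  f_equal. rewrite cos_shift, sin_shift. now rewrite <- E1, <- E2.
Qed.

Lemma carg_Im_neg (x y : R) : y < 0 -> carg (x, y) = - (PI / 2) - atan (x / y).
Proof.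
  intros Hy. destruct (atan_polar (- y) (- x)) as [E1 E2]; [lra|].
  replace (- y * - y + - x * - x) with (x * x + y * y) in E1, E2 by ring.
  replace (- x / - y) with (x / y) in E1, E2 by (field; lra).
  assert (0 < sqrt (x * x + y * y)) by (apply sqrt_lt_R0; nra).
  pose proof (atan_bound (x / y)). pose proof PI_RGT_0.
  rewrite <- (carg_polar (sqrt (x * x + y * y)) (- (PI / 2) - atan (x / y))) by (auto; lra).
  f_equal. replace (- (PI / 2) - atan (x / y)) with (- (PI / 2 + atan (x / y))) by ring.
  rewrite cos_neg, sin_neg, <- cos_sin.
  replace (cos (PI / 2 + atan (x / y))) with (- sin (atan (x / y))) by (symmetry; rewrite sin_cos; ring).
  f_equal; lra.
Qed.

Lemma locally_C_cont (g : C -> R) (z : C) : continuous g z -> 0 < g z -> locally z (fun y => 0 < g y).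
Proof.
  intros H H0. apply filterlim_locally with (eps := mkposreal _ H0) in H.
  revert H. apply filter_imp. intros y Hy.
  assert (Hy' : Rabs (g y - g z) < g z) by exact Hy. apply Rabs_def2 in Hy'. lra.
Qed.

Lemma continuous_fst_C (z : C) : continuous (fun y : C => fst y) z.
Proof. apply (continuous_Re (fun y : C => y)), continuous_id. Qed.
Lemma continuous_snd_C (z : C) : continuous (fun y : C => snd y) z.
Proof. apply (continuous_Im (fun y : C => y)), continuous_id. Qed.

Lemma continuous_Cmod (z : C) : continuous Cmod z.
Proof.
  unfold Cmod. apply (continuous_Rcomp sqrt).
  - simpl. pose proof (continuous_fst_C z). pose proof (continuous_snd_C z). ccont.
  - apply continuity_pt_sqrt. nra.
Qed.

(** Three half-planes cover the slit plane, and on each the argument is an arctangent of a quotient;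
    this avoids both the end points of acos and the case distinction on the real axis. *)
Lemma continuous_carg z : slit z -> continuous carg z.
Proof.
  pose proof (continuous_fst_C z) as C1. pose proof (continuous_snd_C z) as C2.
  assert (Catan : forall x, continuity_pt atan x) by (intros; apply derivable_continuous_pt, derivable_pt_atan).
  intros H. assert (T : 0 < Re z \/ 0 < Im z \/ 0 < - Im z) by (destruct H; lra).
  destruct T as [T|[T|T]].
  - apply (continuous_ext_loc carg (fun y => atan (snd y / fst y))).
    + generalize (locally_C_cont _ z C1 T). apply filter_imp. intros [x y] Hx. simpl. symmetry; now apply carg_Re_pos.
    + apply (continuous_Rcomp atan); auto. apply continuous_Rmult; auto. apply continuous_Rinv_comp'; auto. unfold Re in T; lra.
  - apply (continuous_ext_loc carg (fun y => PI / 2 - atan (fst y / snd y))).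
    + generalize (locally_C_cont _ z C2 T). apply filter_imp. intros [x y] Hx. simpl. symmetry; now apply carg_Im_pos.
    + apply continuous_Rminus; [apply continuous_const|].
      apply (continuous_Rcomp atan); auto. apply continuous_Rmult; auto. apply continuous_Rinv_comp'; auto. unfold Im in T; lra.
  - apply (continuous_ext_loc carg (fun y => - (PI / 2) - atan (fst y / snd y))).
    + generalize (locally_C_cont _ z (continuous_Ropp _ _ C2) T). apply filter_imp. intros [x y] Hx. simpl in *. symmetry; apply carg_Im_neg. lra.
    + apply continuous_Rminus; [apply continuous_const|].
      apply (continuous_Rcomp atan); auto. apply continuous_Rmult; auto. apply continuous_Rinv_comp'; auto. unfold Im in T; lra.
Qed.

Lemma continuous_clog z : slit z -> continuous clog z.
Proof.
  intros H. unfold clog. apply continuous_ReIm; simpl.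
  - apply (continuous_Rcomp ln); [apply continuous_Cmod|].
    apply derivable_continuous_pt. exists (/ Cmod z). apply derivable_pt_lim_ln. now apply Cmod_gt_0, slit_neq_0.
  - now apply continuous_carg.
Qed.

Lemma locally_C_ex (z : C) P : locally z P -> exists r, 0 < r /\ forall y, Cmod (y - z) < r -> P y.
Proof.
  intros [e H]. exists e. split; [apply cond_pos|]. intros y Hy. apply H.
  now apply (C_NormedModule_mixin_compat1 z y e).
Qed.

(** The increment [k] of the logarithm satisfies exp k = 1 + h / z exactly; continuity makes [k]
    small, and the quadratic remainder of exp then compares [k] with h / z. *)
Lemma holo_clog z : slit z -> holo clog z (/ z).
Proof.
  intros Hs eps He. pose proof (slit_neq_0 z Hs) as Hz.
  apply Cmod_gt_0 in Hz as Hm. set (m := Cmod z) in *.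
  pose proof (continuous_clog z Hs) as Hc. rewrite continuous_Cmod_eps in Hc.
  set (k0 := Rmin (1 / 8) (eps * m / 16)).
  assert (Hk0 : 0 < k0) by (apply Rmin_pos; [lra|]; apply Rdiv_lt_0_compat; nra).
  pose proof (Rmin_l (1 / 8) (eps * m / 16)). pose proof (Rmin_r (1 / 8) (eps * m / 16)).
  fold k0 in H, H0.
  destruct (locally_C_ex _ _ (Hc k0 Hk0)) as [r [Hr K]].
  exists (Rmin r m). split; [now apply Rmin_pos|]. intros h Hh.
  pose proof (Rmin_l r m). pose proof (Rmin_r r m).
  set (k := (clog (z + h) - clog z)%C).
  assert (Hk : Cmod k < k0).
  { apply K. replace (z + h - z)%C with h by ring. lra. }
  assert (Hzh : (z + h)%C <> RtoC 0).
  { intros E. assert (h = (- z)%C) by (replace h with (z + h - z)%C by ring; rewrite E; ring).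
    rewrite H3, Cmod_opp in Hh. fold m in Hh. lra. }
  assert (Ek : cexp k = (1 + h / z)%C).
  { unfold k. rewrite cexp_minus, !cexp_clog by auto. field. auto. }
  pose proof (Cmod_cexp_minus_1_z k) as B. rewrite Ek in B.
  replace (1 + h / z - 1 - k)%C with (- (k - / z * h))%C in B by (field; auto).
  rewrite Cmod_opp in B. fold k.
  assert (Hq : Cmod (/ z * h) = Cmod h / m).
  { rewrite Cmod_mult, Cmod_inv by auto. fold m. field. lra. }
  pose proof (Cmod_ge_0 k) as Hk1.
  assert (He1 : exp (Cmod k) <= 4).
  { apply Rle_trans with (exp 1); [apply exp_le; lra | pose proof exp_le_3; lra]. }
  pose proof (exp_pos (Cmod k)).
  assert (Kb : Cmod k <= 2 * (Cmod h / m)).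
  { pose proof (Cmod_triangle (k - / z * h) (/ z * h)) as T.
    replace (k - / z * h + / z * h)%C with k in T by ring. rewrite Hq in T.
    assert (Cmod k * Cmod k * exp (Cmod k) <= Cmod k * (1/8) * 4).
    { apply Rmult_le_compat; try nra. } lra. }
  eapply Rle_trans; [exact B|].
  apply Rle_trans with (2 * (Cmod h / m) * (eps * m / 16) * 4).
  - apply Rmult_le_compat; try nra.
  - assert (0 <= Cmod h) by apply Cmod_ge_0.
    replace (2 * (Cmod h / m) * (eps * m / 16) * 4) with (eps * Cmod h / 2) by (field; lra). nra.
Qed.

Lemma holo_clog_comp f z l : holo f z l -> slit (f z) -> holo (fun x => clog (f x)) z (/ f z * l)%C.
Proof. intros H Hs. apply (holo_comp clog f); auto. now apply holo_clog. Qed.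

(** The restriction on [al] keeps the sector clear of the branch cut, so the principal argument
    needs no correction by 2 pi. *)
Lemma carg_sector (z : C) (al : R) : - (PI / 2) <= al <= PI / 2 ->
  0 < Re (z * cexp (- (al * ci))) -> z <> RtoC 0 /\ al - PI / 2 < carg z < al + PI / 2.
Proof.
  intros Ha H.
  assert (Hz : z <> RtoC 0).
  { intros E. rewrite E in H. rewrite Cmult_0_l in H. simpl in H. lra. }
  split; auto. pose proof (carg_bound z Hz) as B. pose proof PI_RGT_0.
  rewrite (polar_carg z Hz) in H. apply Cmod_gt_0 in Hz.
  set (th := carg z) in *. set (r := Cmod z) in *.
  assert (E : Re ((r * cos th, r * sin th) * cexp (- (al * ci))) = r * cos (th - al)).
  { unfold cexp, ci; simpl. rewrite cos_minus.
    replace (- (al * 0 - 0 * 1)) with 0 by ring. replace (- (al * 1 + 0 * 0)) with (- al) by ring.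
    rewrite exp_0, cos_neg, sin_neg. ring. }
  rewrite E in H.
  assert (Hc : 0 < cos (th - al)) by nra.
  split; apply Rnot_le_lt; intros N.
  - assert (cos (al - th) <= 0) by (apply cos_le_0; lra).
    replace (th - al) with (- (al - th)) in Hc by ring. rewrite cos_neg in Hc. lra.
  - assert (cos (th - al) <= 0) by (apply cos_le_0; lra). lra.
Qed.

Lemma slit_of_carg z : z <> RtoC 0 -> - PI < carg z < PI -> slit z.
Proof.
  intros Hz H. rewrite (polar_carg z Hz). apply Cmod_gt_0 in Hz. unfold slit; simpl.
  destruct (Req_dec (Cmod z * sin (carg z)) 0) as [E|N]; [|now right]. left.
  assert (S : sin (carg z) = 0) by nra.
  assert (carg z = 0).
  { destruct (Rtotal_order (carg z) 0) as [L|[L|L]]; auto.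
    - assert (0 < sin (- carg z)) by (apply sin_gt_0; lra). rewrite sin_neg in H0. lra.
    - assert (0 < sin (carg z)) by (apply sin_gt_0; lra). lra. }
  rewrite H0, cos_0. lra.
Qed.

Lemma clog_mult (x y : C) : x <> RtoC 0 -> y <> RtoC 0 -> - PI < carg x + carg y <= PI ->
  clog (x * y) = (clog x + clog y)%C.
Proof.
  intros Hx Hy H. rewrite <- (cexp_clog x Hx) at 1. rewrite <- (cexp_clog y Hy) at 1.
  rewrite <- cexp_plus. apply clog_cexp. simpl. exact H.
Qed.

Lemma clog_div (x y : C) : x <> RtoC 0 -> y <> RtoC 0 -> - PI < carg x - carg y <= PI ->
  clog (x / y) = (clog x - clog y)%C.
Proof.
  intros Hx Hy H. rewrite <- (cexp_clog x Hx) at 1. rewrite <- (cexp_clog y Hy) at 1.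
  rewrite <- cexp_minus. apply clog_cexp. simpl. lra.
Qed.

(** * The oblique lines *)

Definition rt : R := / sqrt 2.

Lemma rt_pos : 0 < rt.
Proof. apply Rinv_0_lt_compat, sqrt_lt_R0. lra. Qed.

Lemma rt_sqr : rt * rt = / 2.
Proof. unfold rt. rewrite <- Rinv_mult, sqrt_sqrt; lra. Qed.

Lemma cexp_ci (x : R) : cexp (x * ci) = (cos x, sin x).
Proof.
  unfold cexp, ci; simpl. replace (x * 0 - 0 * 1) with 0 by ring.
  replace (x * 1 + 0 * 0) with x by ring. rewrite exp_0. f_equal; ring.
Qed.

Lemma cos_PI4_rt : cos (PI / 4) = rt.
Proof. rewrite cos_PI4. unfold rt. field. apply Rgt_not_eq, sqrt_lt_R0; lra. Qed.
Lemma sin_PI4_rt : sin (PI / 4) = rt.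
Proof. rewrite sin_PI4. unfold rt. field. apply Rgt_not_eq, sqrt_lt_R0; lra. Qed.

Lemma dir_SE_eq : dir_SE = (rt, - rt).
Proof.
  unfold dir_SE. rewrite cexp_ci. replace (- PI / 4) with (- (PI / 4)) by field.
  rewrite cos_neg, sin_neg, cos_PI4_rt, sin_PI4_rt. reflexivity.
Qed.

Lemma dir_SW_eq : dir_SW = (- rt, - rt).
Proof.
  unfold dir_SW. rewrite cexp_ci. replace (-3 * PI / 4) with (PI / 4 - PI) by field.
  rewrite cos_minus, sin_minus, cos_PI, sin_PI, cos_PI4_rt, sin_PI4_rt. f_equal; ring.
Qed.

Lemma dir_SE_neq_0 : dir_SE <> RtoC 0.
Proof. rewrite dir_SE_eq. intros E. inversion E. pose proof rt_pos. lra. Qed.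

Lemma dir_SW_neq_0 : dir_SW <> RtoC 0.
Proof. rewrite dir_SW_eq. intros E. inversion E. pose proof rt_pos. lra. Qed.

Lemma dir_SE_sqr : (dir_SE * dir_SE = - ci)%C.
Proof.
  rewrite dir_SE_eq. unfold ci. pose proof rt_sqr. apply injective_projections; simpl; lra.
Qed.

(** For [c > 0] the line lies in the open half-plane to the upper right of the parallel line through
    0, and these are the arguments of that half-plane. *)
Lemma carg_SE_line (c u : R) : 0 < c ->
  (c + u * dir_SE)%C <> RtoC 0 /\ - (PI / 4) < carg (c + u * dir_SE) < 3 * PI / 4.
Proof.
  intros Hc. pose proof PI_RGT_0. pose proof rt_pos. pose proof rt_sqr.
  destruct (carg_sector (c + u * dir_SE)%C (PI / 4)) as [A B]; [lra | |split; [auto|lra]].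
  replace (- ((PI / 4)%R * ci))%C with ((- (PI / 4))%R * ci)%C by (rewrite RtoC_opp; ring).
  rewrite cexp_ci, cos_neg, sin_neg, cos_PI4_rt, sin_PI4_rt, dir_SE_eq. simpl. nra.
Qed.

Lemma carg_SW_line (c u : R) : 0 < c ->
  (c + u * dir_SW)%C <> RtoC 0 /\ - (3 * PI / 4) < carg (c + u * dir_SW) < PI / 4.
Proof.
  intros Hc. pose proof PI_RGT_0. pose proof rt_pos. pose proof rt_sqr.
  destruct (carg_sector (c + u * dir_SW)%C (- (PI / 4))) as [A B]; [lra | |split; [auto|lra]].
  replace (- ((- (PI / 4))%R * ci))%C with ((PI / 4)%R * ci)%C by (rewrite RtoC_opp; ring).
  rewrite cexp_ci, cos_PI4_rt, sin_PI4_rt, dir_SW_eq. simpl. nra.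
Qed.

Lemma slit_SE_line (c u : R) : 0 < c -> slit (c + u * dir_SE)%C.
Proof.
  intros Hc. destruct (carg_SE_line c u Hc). pose proof PI_RGT_0. apply slit_of_carg; auto; lra.
Qed.

Lemma slit_SW_line (c u : R) : 0 < c -> slit (c + u * dir_SW)%C.
Proof.
  intros Hc. destruct (carg_SW_line c u Hc). pose proof PI_RGT_0. apply slit_of_carg; auto; lra.
Qed.

(** * Complex sequences *)

Definition Cseq (u : nat -> C) (l : C) : Prop :=
  forall eps : R, 0 < eps -> exists N : nat, forall n, (N <= n)%nat -> Cmod (u n - l)%C <= eps.

Lemma Cseq_ext_from (N0 : nat) u v l : (forall n, (N0 <= n)%nat -> u n = v n) -> Cseq u l -> Cseq v l.
Proof.
  intros E H eps He. destruct (H eps He) as [N K]. exists (max N N0).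
  intros n Hn. rewrite <- E by lia. apply K. lia.
Qed.

Lemma Cseq_const l : Cseq (fun _ => l) l.
Proof. intros eps He. exists 0%nat. intros n _. replace (l - l)%C with (RtoC 0) by ring. rewrite Cmod_0. lra. Qed.

Lemma Cseq_plus u v a b : Cseq u a -> Cseq v b -> Cseq (fun n => u n + v n)%C (a + b)%C.
Proof.
  intros H1 H2 eps He. destruct (H1 (eps / 2)) as [N1 K1]; [lra|]. destruct (H2 (eps / 2)) as [N2 K2]; [lra|].
  exists (max N1 N2). intros n Hn. specialize (K1 n ltac:(lia)). specialize (K2 n ltac:(lia)).
  replace (u n + v n - (a + b))%C with ((u n - a) + (v n - b))%C by ring.
  eapply Rle_trans; [apply Cmod_triangle|]. lra.
Qed.

Lemma Cseq_continuous (f : C -> C) u l : continuous f l -> Cseq u l -> Cseq (fun n => f (u n)) (f l).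
Proof.
  intros Hf H eps He. rewrite continuous_Cmod_eps in Hf.
  destruct (locally_C_ex _ _ (Hf eps He)) as [r [Hr K]].
  destruct (H (r / 2)) as [N KN]; [lra|]. exists N. intros n Hn. left. apply K.
  specialize (KN n Hn). lra.
Qed.

Lemma Cseq_scal k u a : Cseq u a -> Cseq (fun n => k * u n)%C (k * a)%C.
Proof. intros H. apply (Cseq_continuous (fun x => k * x)%C); auto. ccont. Qed.

Lemma Cseq_mult u v a b : Cseq u a -> Cseq v b -> Cseq (fun n => u n * v n)%C (a * b)%C.
Proof.
  intros H1 H2. set (A := Cmod a + 1). set (B := Cmod b + 1).
  pose proof (Cmod_ge_0 a). pose proof (Cmod_ge_0 b).
  intros eps He.
  destruct (H1 (eps / 2 / B)) as [N1 K1]; [repeat apply Rdiv_lt_0_compat; unfold B; lra|].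
  destruct (H2 (Rmin 1 (eps / 2 / A))) as [N2 K2]; [apply Rmin_pos; [lra | repeat apply Rdiv_lt_0_compat; unfold A; lra]|].
  exists (max N1 N2). intros n Hn. specialize (K1 n ltac:(lia)). specialize (K2 n ltac:(lia)).
  pose proof (Rmin_l 1 (eps / 2 / A)). pose proof (Rmin_r 1 (eps / 2 / A)).
  replace (u n * v n - a * b)%C with ((u n - a) * v n + a * (v n - b))%C by ring.
  assert (V : Cmod (v n) <= B).
  { replace (v n) with ((v n - b) + b)%C by ring. eapply Rle_trans; [apply Cmod_triangle|]. unfold B; lra. }
  eapply Rle_trans; [apply Cmod_triangle|]. rewrite !Cmod_mult.
  assert (Cmod (u n - a) * Cmod (v n) <= eps / 2 / B * B).
  { apply Rmult_le_compat; auto; apply Cmod_ge_0. }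
  assert (Cmod a * Cmod (v n - b) <= A * (eps / 2 / A)).
  { assert (Cmod a <= A) by (unfold A; lra).
    apply Rmult_le_compat; try apply Cmod_ge_0; lra. }
  replace (eps / 2 / B * B) with (eps / 2) in * by (unfold B; field; lra).
  replace (A * (eps / 2 / A)) with (eps / 2) in * by (unfold A; field; lra). lra.
Qed.

Lemma Cseq_inv u a : a <> RtoC 0 -> Cseq u a -> Cseq (fun n => / u n)%C (/ a)%C.
Proof.
  intros Ha H. apply (Cseq_continuous Cinv); auto.
  apply (continuous_Cinv (fun x => x)); auto. apply continuous_id.
Qed.

Lemma Cseq_unique u a b : Cseq u a -> Cseq u b -> a = b.
Proof.
  intros H1 H2. apply Cmod_eq_of_small. intros eps He.
  destruct (H1 (eps / 2)) as [N1 K1]; [lra|]. destruct (H2 (eps / 2)) as [N2 K2]; [lra|].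
  specialize (K1 (max N1 N2) ltac:(lia)). specialize (K2 (max N1 N2) ltac:(lia)).
  set (x := u (max N1 N2)) in *. replace (a - b)%C with ((x - b) - (x - a))%C by ring.
  eapply Rle_trans; [apply Cmod_minus_le|]. lra.
Qed.

Lemma Cseq_RtoC (u : nat -> R) (l : R) :
  (forall eps, 0 < eps -> exists N, forall n, (N <= n)%nat -> Rabs (u n - l) <= eps) -> Cseq (fun n => RtoC (u n)) l.
Proof.
  intros H eps He. destruct (H eps He) as [N K]. exists N. intros n Hn.
  rewrite <- RtoC_minus, Cmod_R. auto.
Qed.

Lemma Cseq_subseq (phi : nat -> nat) u l : (forall n, (n <= phi n)%nat) -> Cseq u l -> Cseq (fun n => u (phi n)) l.
Proof.
  intros Hp H eps He. destruct (H eps He) as [N K]. exists N. intros n Hn. apply K. specialize (Hp n). lia.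
Qed.

(** [Clim] assigns a value to every sequence, convergent or not; this is the passage from actual
    convergence to that value. *)
Lemma Clim_unique u l : Cseq u l -> Clim u = l.
Proof.
  intros H. unfold Clim.
  assert (H1 : is_lim_seq (fun n => Re (u n)) (Re l)).
  { apply is_lim_seq_spec. intros eps. destruct (H (eps / 2)) as [N K]; [apply is_pos_div_2|].
    exists N. intros n Hn. pose proof (re_le_Cmod (u n - l)). specialize (K n Hn).
    change (Re (u n - l)) with (Re (u n) - Re l) in H0. pose proof (cond_pos eps). lra. }
  assert (H2 : is_lim_seq (fun n => Im (u n)) (Im l)).
  { apply is_lim_seq_spec. intros eps. destruct (H (eps / 2)) as [N K]; [apply is_pos_div_2|].
    exists N. intros n Hn. pose proof (im_le_Cmod (u n - l)). specialize (K n Hn).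
    change (Im (u n - l)) with (Im (u n) - Im l) in H0. pose proof (cond_pos eps). lra. }
  rewrite (is_lim_seq_unique _ _ H1), (is_lim_seq_unique _ _ H2). now destruct l.
Qed.

Lemma INR_large (x : R) : exists N : nat, (1 <= N)%nat /\ forall n, (N <= n)%nat -> x <= INR n.
Proof.
  destruct (INR_unbounded x) as [N HN]. exists (S N). split; [lia|]. intros n Hn.
  apply le_INR in Hn. rewrite S_INR in Hn. lra.
Qed.

(** * Euler's integral *)

Definition Gam (w : C) : C := CInt_line (fun t => cexp (w * t - cexp t)).

Definition mellin_const (sig kap : R) : R :=
  2 * (1 + / (sig * sig)) + 4 * exp ((sig + 1) * (sig + 1) / (4 * (kap / 2))).

(** The two summands of the constant serve the two ends: for [t < 0] the factor exp (sig t) decays,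
    and for [t >= 0] the inequality exp t >= t^2 / 2 turns the double exponential into a
    Gaussian. *)
Lemma mellin_bound sig kap t : 0 < sig -> 0 < kap ->
  exp (sig * t - kap * exp t) <= mellin_const sig kap / (1 + t * t).
Proof.
  intros Hs Hk. pose proof (exp_pos t). pose proof (one_plus_sqr_pos t).
  assert (H1 : exp (- (sig * Rabs t)) <= 2 * (1 + / (sig * sig)) / (1 + t * t)) by now apply exp_neg_abs_le.
  assert (H2 := exp_gauss_dom (kap / 2) sig t ltac:(lra)).
  unfold mellin_const, Rdiv in *. rewrite Rmult_plus_distr_r.
  pose proof (exp_pos (- (sig * Rabs t))). pose proof (exp_pos (- (kap * / 2 * (t * t)) + sig * Rabs t)).
  destruct (Rle_dec 0 t).
  - pose proof (exp_ge_quadratic t r).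
    assert (exp (sig * t - kap * exp t) <= exp (- (kap * / 2 * (t * t)) + sig * Rabs t)).
    { apply exp_le. rewrite Rabs_pos_eq by auto. nra. } lra.
  - assert (exp (sig * t - kap * exp t) <= exp (- (sig * Rabs t))).
    { apply exp_le. rewrite Rabs_left by lra. nra. } lra.
Qed.

Lemma Re_mult_R (z : C) (t : R) : Re (z * t) = Re z * t.
Proof. unfold Re, Cmult; simpl. ring. Qed.

Lemma Cmod_gint (w xi : C) (t : R) : Cmod (cexp (w * t - xi * cexp t)) = exp (Re w * t - Re xi * exp t).
Proof.
  rewrite Cmod_cexp, cexp_R. f_equal. unfold Cminus, Re, Cplus, Copp, Cmult; simpl. ring.
Qed.

Lemma dom_gint (w xi : C) : 0 < Re w -> 0 < Re xi ->
  dom (mellin_const (Re w) (Re xi)) (fun t => cexp (w * t - xi * cexp t)).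
Proof.
  intros Hw Hx. split; [intros; ccont|]. intros t. rewrite Cmod_gint. now apply mellin_bound.
Qed.

Lemma cos_pos_of_abs (x y : R) : Rabs x <= y -> y < PI / 2 -> cos y <= cos x.
Proof.
  intros H Hy. pose proof (Rabs_pos x).
  replace (cos x) with (cos (Rabs x)) by (unfold Rabs; destruct (Rcase_abs x); [apply cos_neg | auto]).
  apply cos_decr_1; lra.
Qed.

(* Rotating the half-line of integration is the shift of [t] by the complex number [log xi]. *)
Lemma gint_value (w xi : C) : 0 < Re w -> 0 < Re xi ->
  CInt_line (fun t => cexp (w * t - xi * cexp t)) = (Gam w * cexp (- w * clog xi))%C.
Proof.
  intros Hw Hx. set (L := clog xi).
  assert (Hxi : xi <> RtoC 0) by (intros E; rewrite E in Hx; simpl in Hx; lra).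
  assert (HL : Rabs (Im L) < PI / 2).
  { unfold L, clog; simpl. destruct xi as [x y]; simpl in *. rewrite carg_Re_pos by auto.
    pose proof (atan_bound (y / x)). apply Rabs_def1; lra. }
  assert (EL : cexp L = xi) by now apply cexp_clog.
  clearbody L.
  set (I := Rabs (Im L)) in *. assert (HI : 0 <= I) by apply Rabs_pos.
  (* [line_shift] needs an open strip, so the parameter runs slightly beyond [0, 1]; [nu] is small
     enough that Re exp (c L) stays positive there, with the lower bound [kap]. *)
  set (nu := (PI / 2 - I) / (2 * (I + 1))).
  assert (Hnu : 0 < nu) by (apply Rdiv_lt_0_compat; lra).
  assert (Hnu2 : (1 + nu) * I < PI / 2).
  { assert (nu * (2 * (I + 1)) = PI / 2 - I) by (unfold nu; field; lra). nra. }
  set (kap := exp (- ((1 + nu) * Rabs (Re L))) * cos ((1 + nu) * I)).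
  assert (Hc : 0 < cos ((1 + nu) * I)) by (apply cos_gt_0; nra).
  assert (Hk : 0 < kap) by (apply Rmult_lt_0_compat; [apply exp_pos | auto]).
  set (f := fun T => cexp (w * T - cexp T)).
  set (f' := fun T => (cexp (w * T - cexp T) * (w * 1 - cexp T * 1))%C).
  assert (Hshift := line_shift f f' 0 L 1 (- nu) (1 + nu) 0 1).
  assert (E : CInt_line (fun u => f (RtoC 0 + RtoC 0 * L + u * 1)%C) = CInt_line (fun u => f (RtoC 0 + RtoC 1 * L + u * 1)%C)).
  { apply Hshift; try lra.
    - intros E. inversion E; lra.
    - intros c u _. unfold f, f'. holo_tac.
    - intros c u _. unfold f'. ccont.
    - intros x y Hxa Hyb. exists (exp ((1 + nu) * Rabs (Re (w * L)%C)) * mellin_const (Re w) kap).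
      intros c u Hcc. unfold f. rewrite Cmod_cexp.
      assert (Hcabs : Rabs c <= 1 + nu) by (apply Rabs_le; lra).
      replace (Re (w * (0 + c * L + u * 1) - cexp (0 + c * L + u * 1))%C) with
        (c * Re (w * L)%C + (Re w * u - (exp (c * Re L) * cos (c * Im L)) * exp u)).
      2:{ replace (RtoC 0 + c * L + u * 1)%C with (c * L + u)%C by ring.
          rewrite cexp_plus, cexp_R. unfold cexp, Re, Im; simpl.
          replace (c * fst L - 0 * snd L) with (c * fst L) by ring.
          replace (c * snd L + 0 * fst L) with (c * snd L) by ring. ring. }
      rewrite exp_plus. unfold Rdiv. rewrite (Rmult_assoc (exp ((1 + nu) * Rabs (Re (w * L)%C)))).
      apply Rmult_le_compat; try (left; apply exp_pos).
      + apply exp_le. eapply Rle_trans; [apply Rle_abs|]. rewrite Rabs_mult.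
        apply Rmult_le_compat_r; auto. apply Rabs_pos.
      + eapply Rle_trans; [|apply (mellin_bound (Re w) kap u); auto].
        apply exp_le. apply Rplus_le_compat_l, Ropp_le_contravar, Rmult_le_compat_r; [left; apply exp_pos|].
        unfold kap. apply Rmult_le_compat; [left; apply exp_pos | lra | |].
        * apply exp_le. pose proof (Rabs_pos (Re L)).
          pose proof (Rle_abs (- (c * Re L))) as A. rewrite Rabs_Ropp, Rabs_mult in A. nra.
        * apply cos_pos_of_abs; auto. rewrite Rabs_mult. fold I. apply Rmult_le_compat_r; auto. }
  unfold f in E.
  rewrite (IntR_ext _ (fun t => cexp (w * t - cexp t))) in E.
  2:{ intros t. replace (RtoC 0 + 0 * L + t * 1)%C with (RtoC t) by ring. reflexivity. }
  change (CInt_line (fun t : R => cexp (w * t - cexp t))) with (Gam w) in E. rewrite E.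
  rewrite (IntR_ext (fun u => cexp (w * (RtoC 0 + RtoC 1 * L + u * 1)%C - cexp (RtoC 0 + RtoC 1 * L + u * 1)%C))
     (fun u => cexp (w * L) * cexp (w * u - xi * cexp u))%C).
  2:{ intros u. rewrite <- cexp_plus. f_equal.
      replace (RtoC 0 + 1 * L + u * 1)%C with (L + u)%C by ring. rewrite (cexp_plus L), EL. ring. }
  rewrite (IntR_scal (mellin_const (Re w) (Re xi))) by now apply dom_gint.
  replace (- w * L)%C with (- (w * L))%C by ring.
  rewrite cexp_opp. field. apply cexp_neq_0.
Qed.

Lemma Gam_as_gint w t : cexp (w * RtoC t - cexp t) = cexp (w * t - 1 * cexp t).
Proof. f_equal. ring. Qed.

Lemma dom_Gam (w : C) : 0 < Re w -> dom (mellin_const (Re w) 1) (fun t => cexp (w * t - cexp t)).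
Proof.
  intros Hw. apply (dom_ext _ _ _ (fun t => eq_sym (Gam_as_gint w t))).
  apply (dom_gint w 1); auto. simpl; lra.
Qed.

Lemma Gam_plus_1 (w : C) : 0 < Re w -> Gam (w + 1) = (w * Gam w)%C.
Proof.
  intros Hw.
  set (f := fun T => cexp (w * T - cexp T)).
  set (f' := fun T => (cexp (w * T - cexp T) * (w * 1 - cexp T * 1))%C).
  assert (Hw1 : 0 < Re (w + 1)) by (unfold Re, Cplus in *; simpl; lra).
  pose proof (dom_scal _ _ w (dom_Gam w Hw)) as D1. pose proof (dom_Gam _ Hw1) as D2.
  assert (E : forall t : R, f' (0 + t * 1)%C = (w * cexp (w * t - cexp t) - cexp ((w + 1) * t - cexp t))%C).
  { intros t. unfold f'. replace (RtoC 0 + t * 1)%C with (RtoC t) by ring.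
    replace ((w + 1) * t - cexp t)%C with ((w * t - cexp t) + t)%C by ring. rewrite (cexp_plus _ t). ring. }
  pose proof (dom_minus _ _ _ _ D1 D2) as D.
  assert (K := IntR_total_derivative f f' 0 1 (Cmod w * mellin_const (Re w) 1 + mellin_const (Re (w + 1)) 1) (mellin_const (Re w) 1)).
  rewrite (IntR_ext _ (fun t => w * cexp (w * t - cexp t) - cexp ((w + 1) * t - cexp t))%C) in K.
  2:{ intros t. rewrite E. ring. }
  rewrite (IntR_minus _ _ _ _ D1 D2), (IntR_scal _ _ _ (dom_Gam w Hw)) in K.
  fold (Gam w) in K. fold (Gam (w + 1)) in K.
  assert (Z : (w * Gam w - Gam (w + 1))%C = RtoC 0).
  { apply K.
    - intros t. unfold f, f'. holo_tac.
    - intros t. unfold f'. ccont.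
    - intros t. rewrite E. apply D.
    - intros t. unfold f. replace (RtoC 0 + t * 1)%C with (RtoC t) by ring. apply (dom_Gam w Hw). }
  replace (Gam (w + 1)) with (w * Gam w - (w * Gam w - Gam (w + 1)))%C by ring. rewrite Z. ring.
Qed.

Lemma Gam_1 : Gam 1 = 1%C.
Proof.
  apply (IntR_unique (mellin_const (Re 1) 1)); [apply dom_Gam; simpl; lra|].
  intros eps He.
  assert (HA : exists A0, 1 <= A0 /\ 4 / A0 <= eps).
  { exists (1 + 4 / eps). assert (0 < 4 / eps) by (apply Rdiv_lt_0_compat; lra). split; [lra|].
    apply (Rmult_le_reg_r (1 + 4 / eps)); [lra|].
    unfold Rdiv at 1. rewrite Rmult_assoc, Rinv_l, Rmult_1_r by lra.
    replace (eps * (1 + 4 / eps)) with (eps + 4) by (field; lra). lra. }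
  destruct HA as [A0 [P Q]]. exists A0. intros A HA.
  set (f := fun T => (- cexp (- cexp T))%C). set (f' := fun T => cexp (1 * T - cexp T)).
  pose proof (RIntC_FTC f f' 0 1 (- A) A) as I.
  assert (Hh : forall t : R, holo f (0 + t * 1)%C (f' (0 + t * 1)%C)).
  { intros t. unfold f, f'. eapply holo_eq; [holo_tac|]. cbv beta.
    replace (1 * (0 + t * 1) - cexp (0 + t * 1))%C with (- cexp (0 + t * 1) + (0 + t * 1))%C by ring.
    rewrite (cexp_plus (- _)). ring. }
  assert (Hc : forall t : R, continuous f' (0 + t * 1)%C) by (intros t; unfold f'; ccont).
  specialize (I (fun t _ => Hh t) (fun t _ => Hc t)).
  apply RIntC_unique in I. unfold f' in I.
  replace (RIntC (fun t => cexp (1 * t - cexp t)) (- A) A) with (f (0 + A * 1) - f (0 + (- A)%R * 1))%C.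
  2:{ symmetry. etransitivity; [|exact I]. apply (RInt_ext (V := C_R_CompleteNormedModule)). intros t _.
      replace (RtoC 0 + t * 1)%C with (RtoC t) by ring. cring. }
  unfold f. replace (RtoC 0 + A * 1)%C with (RtoC A) by ring. replace (RtoC 0 + (- A)%R * 1)%C with (RtoC (- A)) by ring.
  rewrite !cexp_R, <- !RtoC_opp, !cexp_R, <- !RtoC_opp, <- !RtoC_minus, Cmod_R.
  assert (E1 : 0 < exp (- exp A) <= / A).
  { split; [apply exp_pos|]. rewrite exp_Ropp. apply Rinv_le_contravar; [lra|].
    assert (1 + A < exp A) by (apply exp_ineq1; lra). assert (1 + exp A < exp (exp A)) by (apply exp_ineq1; pose proof (exp_pos A); lra). lra. }
  assert (E2 : 0 < exp (- A) <= / A).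
  { split; [apply exp_pos|]. rewrite exp_Ropp. apply Rinv_le_contravar; [lra|].
    assert (1 + A < exp A) by (apply exp_ineq1; lra). lra. }
  assert (E3 : 1 - exp (- A) <= exp (- exp (- A)) <= 1).
  { split. left; replace (1 - exp (- A)) with (1 + - exp (- A)) by ring; apply exp_ineq1; lra.
    rewrite <- exp_0. apply exp_le. lra. }
  assert (4 * / A <= eps).
  { eapply Rle_trans; [|exact Q]. unfold Rdiv. apply Rmult_le_compat_l; [lra|]. apply Rinv_le_contravar; lra. }
  apply Rabs_le. lra.
Qed.

Lemma Gam_fact (n : nat) : Gam (INR n + 1)%C = RtoC (INR (fact n)).
Proof.
  induction n as [|n IH].
  - simpl. replace (RtoC 0 + 1)%C with (RtoC 1) by ring. apply Gam_1.
  - replace (INR (S n)) with (INR n + 1) by (rewrite S_INR; ring). rewrite RtoC_plus.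
    rewrite Gam_plus_1 by (simpl; pose proof (pos_INR n); lra). rewrite IH.
    rewrite <- RtoC_plus, <- RtoC_mult. f_equal.
    change (fact (S n)) with (S n * fact n)%nat. rewrite mult_INR, S_INR. reflexivity.
Qed.

Lemma Gam_shift (w : C) (n : nat) : 0 < Re w -> Gam (w + INR n + 1)%C = (Cprod_shift w n * Gam w)%C.
Proof.
  intros Hw. induction n as [|n IH].
  - simpl. replace (w + 0 + 1)%C with (w + 1)%C by ring. now apply Gam_plus_1.
  - change (Cprod_shift w (S n)) with (Cprod_shift w n * (w + INR (S n)))%C.
    replace (w + INR (S n) + 1)%C with ((w + INR n + 1) + 1)%C by (rewrite S_INR, RtoC_plus; ring).
    rewrite Gam_plus_1. 2:{ unfold Re in *; simpl. pose proof (pos_INR n). lra. }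
    rewrite IH. rewrite S_INR, RtoC_plus. ring.
Qed.

Lemma C1_neq_0 : RtoC 1 <> RtoC 0.
Proof. intros E; inversion E; lra. Qed.

Lemma IntR_le_Re M N f g : dom M f -> dom N g -> (forall t, Cmod (f t) <= Re (g t)) ->
  Cmod (CInt_line f) <= Re (CInt_line g).
Proof.
  intros Df Dg H. apply le_epsilon. intros eps He.
  destruct (IntR_tail_small M (dom_pos _ _ Df) (eps / 2)) as [A1 [P1 Q1]]; [lra|].
  destruct (IntR_tail_small N (dom_pos _ _ Dg) (eps / 2)) as [A2 [P2 Q2]]; [lra|].
  set (A := Rmax A1 A2). pose proof (Rmax_l A1 A2). pose proof (Rmax_r A1 A2). fold A in H0, H1.
  specialize (Q1 A ltac:(lra)). specialize (Q2 A ltac:(lra)).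
  pose proof (IntR_approx M f A (- A) A Df ltac:(lra) ltac:(lra) ltac:(lra)) as E1.
  pose proof (IntR_approx N g A (- A) A Dg ltac:(lra) ltac:(lra) ltac:(lra)) as E2.
  assert (K : Cmod (RIntC f (- A) A) <= Re (RIntC g (- A) A)).
  { apply (RIntC_bound f (fun t => Re (g t)) (- A) A); [lra | auto | apply RIntC_correct, Df | ].
    apply is_RIntC_Re. apply RIntC_correct, Dg. }
  pose proof (Cmod_triangle_rev (CInt_line f) (RIntC f (- A) A)) as T.
  replace (CInt_line f - RIntC f (- A) A)%C with (- (RIntC f (- A) A - CInt_line f))%C in T by ring.
  rewrite Cmod_opp in T.
  pose proof (re_le_Cmod (RIntC g (- A) A - CInt_line g)) as T2.
  change (Re (RIntC g (- A) A - CInt_line g)) with (Re (RIntC g (- A) A) - Re (CInt_line g)) in T2.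
  pose proof (Rle_abs (Re (RIntC g (- A) A) - Re (CInt_line g))). lra.
Qed.

Lemma cpow_RtoC (x : R) (w : C) : 0 < x -> cpow x w = cexp (w * ln x).
Proof. intros H. unfold cpow. now rewrite clog_RtoC. Qed.

Lemma Cmod_cpow_RtoC (x : R) (w : C) : 0 < x -> Cmod (cpow x w) = exp (Re w * ln x).
Proof. intros H. rewrite cpow_RtoC, Cmod_cexp, Re_mult_R by auto. reflexivity. Qed.

(** With X = exp tau this is |X^w - 1| <= C |X - 1| for all X > 0; Re w <= 1 is what makes it true
    for large X, Re w > 0 for small X. *)
Lemma Cmod_pow_minus_1_le (w : C) (tau : R) : 0 < Re w <= 1 ->
  Cmod (cexp (w * tau) - 1) <= (4 + 2 * Cmod w) * Rabs (exp tau - 1).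
Proof.
  intros [Hw0 Hw1]. pose proof (Cmod_ge_0 w) as Hm. pose proof (Rabs_pos (exp tau - 1)) as Hp.
  assert (Hh : forall t : R, holo (fun s => cexp (w * s)) (0 + t * 1)%C (cexp (w * (0 + t * 1)) * (w * 1))%C)
    by (intros; holo_tac).
  assert (Hc : forall t : R, continuous (fun s => cexp (w * s) * (w * 1))%C (0 + t * 1)%C) by (intros; ccont).
  destruct (Rle_dec 0 tau) as [H|H].
  - pose proof (RIntC_FTC (fun s => cexp (w * s)) (fun s => cexp (w * s) * (w * 1))%C 0 1 0 tau
      (fun t _ => Hh t) (fun t _ => Hc t)) as I.
    assert (E : exp 0 <= exp tau) by (apply exp_le; lra). rewrite exp_0 in E.
    rewrite Rabs_pos_eq by lra.
    apply Rle_trans with (Cmod w * exp tau - Cmod w * exp 0); [|rewrite exp_0; nra].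
    cbv beta in I.
    replace (cexp (w * (0 + tau * 1)) - cexp (w * (0 + 0 * 1)))%C with (cexp (w * tau) - 1)%C in I.
    2:{ replace (RtoC 0 + tau * 1)%C with (RtoC tau) by ring. replace (w * (RtoC 0 + 0 * 1))%C with (RtoC 0) by ring.
        now rewrite cexp_0. }
    refine (RIntC_bound _ (fun s => Cmod w * exp s) 0 tau _ _ H _ I _).
    + intros s Hs. rewrite !Cmod_mult, Cmod_1, !Rmult_1_r. rewrite Cmod_cexp.
      replace (RtoC 0 + s * 1)%C with (RtoC s) by ring. rewrite Re_mult_R, Rmult_comm.
      apply Rmult_le_compat_l; auto. apply exp_le. nra.
    + apply (is_RInt_derive (V := R_CompleteNormedModule) (fun s => Cmod w * exp s)).
      * intros s _. auto_derive; auto. ring.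
      * intros s _. ccont.
  - assert (E : exp tau <= / (1 + - tau)).
    { replace tau with (- - tau) at 1 by ring. rewrite exp_Ropp. apply Rinv_le_contravar; [lra|].
      left. apply exp_ineq1. lra. }
    pose proof (exp_pos tau).
    assert (E1 : exp tau < 1) by (rewrite <- exp_0; apply exp_increasing; lra).
    rewrite Rabs_left by lra.
    destruct (Rle_dec tau (-1)) as [H1|H1].
    + assert (E2 : / (1 + - tau) <= / 2) by (apply Rinv_le_contravar; lra).
      eapply Rle_trans; [apply Cmod_minus_le|]. rewrite Cmod_1, Cmod_cexp, Re_mult_R.
      assert (exp (Re w * tau) <= exp 0) by (apply exp_le; nra). rewrite exp_0 in H2. nra.
    + assert (E2 : / (1 + - tau) <= 1 + tau / 2).
      { apply (Rmult_le_reg_l (1 + - tau)); [lra|]. rewrite Rinv_r by lra. nra. }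
      pose proof (holo_MVT (fun s => cexp (w * s)) (fun s => cexp (w * s) * (w * 1))%C 0 tau (Cmod w)) as M.
      cbv beta in M. rewrite Cmult_0_r, cexp_0 in M. replace (RtoC 0 + tau)%C with (RtoC tau) in M by ring.
      rewrite Cmod_R, Rabs_left in M by lra.
      apply Rle_trans with (Cmod w * - tau); [apply M|nra].
      * intros; holo_tac.
      * intros; ccont.
      * intros t Ht. rewrite !Cmod_mult, Cmod_1, Rmult_1_r, Cmod_cexp.
        replace (RtoC 0 + t * tau)%C with (RtoC (t * tau)) by (rewrite RtoC_mult; ring). rewrite Re_mult_R.
        rewrite <- (Rmult_1_l (Cmod w)) at 2. apply Rmult_le_compat_r; auto.
        rewrite <- exp_0. apply exp_le.
        assert (t * tau <= 0) by nra. nra.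
Qed.

Definition gauss_seq (w : C) (n : nat) : C :=
  (RtoC (INR (fact n)) * cpow (RtoC (INR n)) w / Cprod_shift w n)%C.

(** The density x^n exp (-x) / n! concentrates near x = n. With X = x / n, the ratio minus 1 is the
    mean of X^w - 1. This is at most a constant times the mean of |X - 1| <= eps / 2 + (X - 1)^2 /
    (2 eps), and (X - 1)^2 has mean (n + 2) / n^2. *)
Lemma Gam_ratio_bound (w : C) (n : nat) (eps : R) : 0 < Re w <= 1 -> (1 <= n)%nat -> 0 < eps ->
  Cmod (Gam (w + INR n + 1) / (RtoC (INR (fact n)) * cpow (INR n) w) - 1)%C <=
   (4 + 2 * Cmod w) * (eps / 2 + (INR n + 2) / (INR n * INR n) / (2 * eps)).
Proof.
  intros [Hw0 Hw1] Hn He.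
  set (N := INR n). assert (HN : 1 <= N) by (change 1 with (INR 1); now apply le_INR).
  set (C0 := 4 + 2 * Cmod w). assert (HC0 : 0 < C0) by (unfold C0; pose proof (Cmod_ge_0 w); lra).
  set (F := INR (fact n)). assert (HF : 0 < F) by (apply lt_0_INR, lt_O_fact).
  set (P := cpow N w). set (p := exp (Re w * ln N)). assert (Hp : 0 < p) by apply exp_pos.
  assert (HP : Cmod P = p) by (apply Cmod_cpow_RtoC; lra).
  assert (Pn : P <> RtoC 0) by (apply Cmod_gt_0; lra).
  assert (Fn : RtoC F <> RtoC 0) by (intros E; apply RtoC_inj in E; lra).
  set (G := fun (k : R) (t : R) => cexp (k * t - cexp t)).
  assert (DG : forall k, 0 < k -> dom (mellin_const k 1) (G k)) by (intros k Hk; apply (dom_Gam k Hk)).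
  assert (D1 := dom_Gam (w + N + 1)%C ltac:(unfold Re in *; simpl; lra)).
  assert (D2 := dom_scal _ _ P (DG (N + 1) ltac:(lra))).
  (* Coefficients of 1, x and x^2 in p C0 (eps / 2 + (x / N - 1)^2 / (2 eps)), the middle one taken
     with the opposite sign. *)
  set (a := p * C0 * (eps / 2 + / (2 * eps))). set (b := p * C0 * (/ (N * eps))). set (c := p * C0 / (2 * eps * (N * N))).
  assert (D3 := dom_plus _ _ _ _ (dom_minus _ _ _ _ (dom_scal _ _ a (DG (N + 1) ltac:(lra)))
      (dom_scal _ _ b (DG (N + 2) ltac:(lra)))) (dom_scal _ _ c (DG (N + 3) ltac:(lra)))).
  assert (D3' := dom_minus _ _ _ _ (dom_scal _ _ a (DG (N + 1) ltac:(lra)))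
      (dom_scal _ _ b (DG (N + 2) ltac:(lra)))).
  pose proof (IntR_le_Re _ _ _ _ (dom_minus _ _ _ _ D1 D2) D3) as K.
  cbv beta in K. rewrite (IntR_minus _ _ _ _ D1 D2) in K.
  rewrite (IntR_plus _ _ _ _ D3' (dom_scal _ _ c (DG (N + 3) ltac:(lra)))) in K.
  rewrite (IntR_minus _ _ _ _ (dom_scal _ _ a (DG (N + 1) ltac:(lra))) (dom_scal _ _ b (DG (N + 2) ltac:(lra)))) in K.
  rewrite (IntR_scal _ _ P (DG (N + 1) ltac:(lra))), (IntR_scal _ _ a (DG (N + 1) ltac:(lra))),
    (IntR_scal _ _ b (DG (N + 2) ltac:(lra))), (IntR_scal _ _ c (DG (N + 3) ltac:(lra))) in K.
  change (CInt_line (G (N + 1))) with (Gam (RtoC (N + 1))) in K.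
  change (CInt_line (G (N + 2))) with (Gam (RtoC (N + 2))) in K.
  change (CInt_line (G (N + 3))) with (Gam (RtoC (N + 3))) in K.
  fold (Gam (w + N + 1)) in K.
  assert (G1 : Gam (RtoC (N + 1)) = RtoC F) by (rewrite RtoC_plus; apply Gam_fact).
  assert (G2 : Gam (RtoC (N + 2)) = RtoC ((N + 1) * F)).
  { replace (N + 2) with (INR (S n) + 1) by (unfold N; rewrite S_INR; ring). rewrite RtoC_plus, Gam_fact.
    change (fact (S n)) with (S n * fact n)%nat. rewrite mult_INR, S_INR. reflexivity. }
  assert (G3 : Gam (RtoC (N + 3)) = RtoC ((N + 2) * ((N + 1) * F))).
  { replace (N + 3) with (INR (S (S n)) + 1) by (unfold N; rewrite !S_INR; ring). rewrite RtoC_plus, Gam_fact.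
    change (fact (S (S n))) with (S (S n) * (S n * fact n))%nat. rewrite !mult_INR, !S_INR. fold N F.
    f_equal. ring. }
  rewrite G1, G2, G3 in K.
  replace (Re (a * F - b * ((N + 1) * F)%R + c * ((N + 2) * ((N + 1) * F))%R)%C) with
    (p * F * (C0 * (eps / 2 + (N + 2) / (N * N) / (2 * eps)))) in K.
  2:{ unfold Re; simpl. unfold a, b, c. field. lra. }
  assert (K' : Cmod (Gam (w + N + 1) - P * F) <= p * F * (C0 * (eps / 2 + (N + 2) / (N * N) / (2 * eps)))).
  { apply K. intros t. unfold G.
    replace (cexp ((w + N + 1) * t - cexp t) - P * cexp ((N + 1)%R * t - cexp t))%C with
      (P * cexp ((N + 1)%R * t - cexp t) * (cexp (w * (t - ln N)%R) - 1))%C.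
    2:{ unfold P. rewrite cpow_RtoC by lra.
        replace ((w + N + 1) * t - cexp t)%C with (w * ln N + (((N + 1)%R * t - cexp t) + (w * (t - ln N)%R)))%C
          by (rewrite RtoC_plus, RtoC_minus; ring).
        rewrite (cexp_plus (w * ln N)), (cexp_plus _ (w * (t - ln N)%R)). ring. }
    rewrite !Cmod_mult, HP.
    set (g := exp ((N + 1) * t - 1 * exp t)).
    assert (Hg : forall k : R, cexp (k * t - cexp t) = RtoC (exp (k * t - exp t))).
    { intros k. rewrite cexp_R, <- RtoC_mult, <- RtoC_minus, cexp_R. reflexivity. }
    rewrite !Hg, Cmod_R, Rabs_pos_eq by (left; apply exp_pos).
    pose proof (Cmod_pow_minus_1_le w (t - ln N) (conj Hw0 Hw1)) as B. fold C0 in B.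
    set (X := exp (t - ln N)) in *.
    assert (EX : exp t = N * X) by (unfold X; rewrite <- (exp_ln N) at 1 by lra; rewrite <- exp_plus; f_equal; ring).
    replace (exp ((N + 2) * t - exp t)) with (exp ((N + 1) * t - exp t) * (N * X)).
    2:{ rewrite <- EX, <- exp_plus. f_equal. ring. }
    replace (exp ((N + 3) * t - exp t)) with (exp ((N + 1) * t - exp t) * (N * X) * (N * X)).
    2:{ rewrite <- EX, <- !exp_plus. f_equal. ring. }
    set (y := exp ((N + 1) * t - exp t)). assert (Hy : 0 < y) by apply exp_pos.
    replace (Re (a * y - b * (y * (N * X))%R + c * (y * (N * X) * (N * X))%R)%C) with
      (p * y * (C0 * (eps / 2 + (X - 1) * (X - 1) / (2 * eps)))).
    2:{ unfold Re; simpl. unfold a, b, c. field. lra. }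
    apply Rmult_le_compat_l; [nra|]. eapply Rle_trans; [exact B|].
    apply Rmult_le_compat_l; [lra|].
    replace ((X - 1) * (X - 1)) with (Rabs (X - 1) * Rabs (X - 1)) by (symmetry; apply Rsqr_abs).
    set (r := Rabs (X - 1)).
    assert (0 <= (r - eps) * (r - eps) / (2 * eps)).
    { apply Rmult_le_pos; [apply Rle_0_sqr | left; apply Rinv_0_lt_compat; lra]. }
    replace ((r - eps) * (r - eps) / (2 * eps)) with (eps / 2 + r * r / (2 * eps) - r) in H by (field; lra). lra. }
  replace (Gam (w + N + 1) / (F * P) - 1)%C with ((Gam (w + N + 1) - P * F) / (F * P))%C by (field; auto).
  rewrite Cmod_div by now apply Cmult_neq_0. rewrite Cmod_mult, HP, Cmod_R, Rabs_pos_eq by lra.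
  apply (Rmult_le_reg_r (F * p)); [nra|]. unfold Rdiv at 1. rewrite Rmult_assoc, Rinv_l, Rmult_1_r by nra.
  eapply Rle_trans; [exact K'|]. right; ring.
Qed.

Lemma Cprod_shift_neq_0 (w : C) n : 0 < Re w -> Cprod_shift w n <> RtoC 0.
Proof.
  intros Hw. induction n as [|n IH].
  - simpl. intros E; rewrite E in Hw; simpl in Hw; lra.
  - change (Cprod_shift w (S n)) with (Cprod_shift w n * (w + INR (S n)))%C.
    apply Cmult_neq_0; auto. intros E. apply (f_equal Re) in E.
    unfold Re in *; simpl in E. pose proof (pos_INR (S n)). simpl in H. lra.
Qed.

Lemma Gam_ratio_limit (w : C) : 0 < Re w <= 1 ->
  Cseq (fun n => Gam (w + INR n + 1) / (RtoC (INR (fact n)) * cpow (INR n) w))%C 1.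
Proof.
  intros Hw eta He. set (C0 := 4 + 2 * Cmod w). assert (HC0 : 0 < C0) by (unfold C0; pose proof (Cmod_ge_0 w); lra).
  set (eps := eta / C0). assert (He' : 0 < eps) by now apply Rdiv_lt_0_compat.
  destruct (INR_large (3 / (eps * eps))) as [N [HN1 HN]].
  exists N. intros n Hn. specialize (HN n Hn).
  eapply Rle_trans; [apply (Gam_ratio_bound w n eps); auto; lia|]. fold C0.
  assert (H1 : 1 <= INR n) by (change 1 with (INR 1); apply le_INR; lia).
  set (x := INR n) in *.
  assert (H2 : (x + 2) / (x * x) <= eps * eps).
  { apply (Rmult_le_reg_r (x * x)); [nra|]. unfold Rdiv. rewrite Rmult_assoc, Rinv_l, Rmult_1_r by nra.
    apply (Rmult_le_compat_l (eps * eps)) in HN; [|nra].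
    replace (eps * eps * (3 / (eps * eps))) with 3 in HN by (field; lra). nra. }
  assert (H3 : (x + 2) / (x * x) / (2 * eps) <= eps / 2).
  { apply (Rmult_le_reg_r (2 * eps)); [lra|]. unfold Rdiv at 1. rewrite Rmult_assoc, Rinv_l, Rmult_1_r by lra. nra. }
  apply Rle_trans with (C0 * eps); [apply Rmult_le_compat_l; lra|].
  right. unfold eps. field. lra.
Qed.

Lemma INR_fact_neq_0_C n : RtoC (INR (fact n)) <> RtoC 0.
Proof. intros E. apply RtoC_inj in E. now apply (INR_fact_neq_0 n). Qed.

Lemma cpow_neq_0 a b : cpow a b <> RtoC 0.
Proof. apply cexp_neq_0. Qed.

(** A zero of [Gam] would make every quotient in [Gam_ratio_limit] vanish, against the limit 1. *)
Lemma Gam_neq_0_strip (w : C) : 0 < Re w <= 1 -> Gam w <> RtoC 0.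
Proof.
  intros Hw E. destruct (Gam_ratio_limit w Hw (1/2) ltac:(lra)) as [N K]. specialize (K N (le_n _)).
  rewrite Gam_shift, E in K by lra.
  replace (Cprod_shift w N * 0 / (INR (fact N) * cpow (INR N) w) - 1)%C with (- (1))%C in K.
  - rewrite Cmod_m1 in K. lra.
  - field. split; [apply cpow_neq_0 | apply INR_fact_neq_0_C].
Qed.

Lemma Gam_neq_0 (w : C) : 0 < Re w -> Gam w <> RtoC 0.
Proof.
  intros Hw. destruct (INR_large (Re w)) as [n [_ Hn]]. specialize (Hn n (le_n n)). revert w Hw Hn.
  induction n as [|n IH]; intros w Hw Hn; [simpl in Hn; lra|].
  destruct (Rle_dec (Re w) 1) as [L|L]; [now apply Gam_neq_0_strip|].
  assert (Hw' : 0 < Re (w - 1)%C) by (unfold Re in *; simpl; lra). rewrite S_INR in Hn.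
  replace w with ((w - 1) + 1)%C by ring. rewrite Gam_plus_1 by exact Hw'. apply Cmult_neq_0.
  - intros E. rewrite E in Hw'. simpl in Hw'. lra.
  - apply IH; [exact Hw' | unfold Re in *; simpl; lra].
Qed.

Lemma gauss_limit_strip (w : C) : 0 < Re w <= 1 -> Cseq (gauss_seq w) (Gam w).
Proof.
  intros Hw. pose proof (Cseq_inv _ _ C1_neq_0 (Gam_ratio_limit w Hw)) as H.
  apply (Cseq_scal (Gam w)) in H. replace (Gam w * / 1)%C with (Gam w) in H by (field; apply C1_neq_0).
  pose proof (Gam_neq_0_strip w Hw) as G0.
  refine (Cseq_ext_from 0 _ _ _ _ H).
  intros n Hn. cbv beta. rewrite Gam_shift by lra. unfold gauss_seq. field.
  pose proof (Cprod_shift_neq_0 w n ltac:(lra)). pose proof (cpow_neq_0 (INR n) w). pose proof (INR_fact_neq_0_C n).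
  repeat split; auto.
Qed.

Lemma Cprod_shift_succ (w : C) n : (Cprod_shift w n * (w + INR n + 1) = w * Cprod_shift (w + 1) n)%C.
Proof.
  induction n as [|n IH].
  - simpl. ring.
  - change (Cprod_shift w (S n)) with (Cprod_shift w n * (w + INR (S n)))%C.
    change (Cprod_shift (w + 1) (S n)) with (Cprod_shift (w + 1) n * (w + 1 + INR (S n)))%C.
    rewrite S_INR, RtoC_plus.
    replace (w * (Cprod_shift (w + 1) n * (w + 1 + (INR n + 1))))%C with
      ((w * Cprod_shift (w + 1) n) * (w + 1 + (INR n + 1)))%C by ring.
    rewrite <- IH. ring.
Qed.

Lemma cpow_plus_1 (x : R) (w : C) : 0 < x -> cpow x (w + 1) = (cpow x w * x)%C.
Proof.
  intros H. rewrite !cpow_RtoC by auto. replace ((w + 1) * ln x)%C with (w * ln x + ln x)%C by ring.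
  rewrite cexp_plus, (cexp_R (ln x)), exp_ln; auto.
Qed.

Lemma Cseq_inv_INR : Cseq (fun n => / RtoC (INR n))%C 0.
Proof.
  apply (Cseq_ext_from 1 (fun n => RtoC (/ INR n))).
  { intros n Hn. apply RtoC_inv. apply not_0_INR. lia. }
  apply (Cseq_RtoC (fun n => / INR n) 0). intros eps He.
  destruct (INR_large (/ eps)) as [N [HN1 HN]]. exists N. intros n Hn. specialize (HN n Hn).
  pose proof (Rinv_0_lt_compat _ He). rewrite Rminus_0_r, Rabs_pos_eq by (left; apply Rinv_0_lt_compat; lra).
  rewrite <- (Rinv_inv eps). apply Rinv_le_contravar; auto.
Qed.

(** Gauss's formula is known on the strip 0 < Re w <= 1; the functional equation carries it to the
    right one unit at a time. *)
Lemma gauss_limit (w : C) : 0 < Re w -> Cseq (gauss_seq w) (Gam w).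
Proof.
  intros Hw. destruct (INR_unbounded (Re w)) as [k Hk].
  revert w Hw Hk. induction k as [|k IH]; intros w Hw Hk.
  - simpl in Hk. lra.
  - destruct (Rle_dec (Re w) 1) as [H|H]; [now apply gauss_limit_strip|].
    set (v := (w - 1)%C). assert (Ev : w = (v + 1)%C) by (unfold v; ring).
    assert (Hv : Re v = Re w - 1) by reflexivity.
    rewrite S_INR in Hk. specialize (IH v ltac:(lra) ltac:(lra)).
    rewrite Ev, Gam_plus_1 by lra.
    assert (L : Cseq (fun n => v * / (1 + (v + 1) * / RtoC (INR n)))%C (v * / (1 + (v + 1) * 0))%C).
    { apply Cseq_scal. apply Cseq_inv.
      - replace (1 + (v + 1) * 0)%C with (RtoC 1) by ring. apply C1_neq_0.
      - apply Cseq_plus; [apply Cseq_const|]. apply Cseq_scal, Cseq_inv_INR. }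
    replace (v * / (1 + (v + 1) * 0))%C with v in L.
    2:{ replace (1 + (v + 1) * 0)%C with (RtoC 1) by ring. field; try apply C1_neq_0. }
    refine (Cseq_ext_from 1 _ _ _ _ (Cseq_mult _ _ _ _ L IH)).
    intros n Hn. cbv beta. unfold gauss_seq.
    assert (HN : 0 < INR n) by (apply (lt_INR 0); exact Hn).
    assert (HNc : RtoC (INR n) <> RtoC 0) by (intros E; apply RtoC_inj in E; lra).
    rewrite cpow_plus_1 by auto.
    pose proof (Cprod_shift_neq_0 v n ltac:(lra)) as P1.
    assert (Hv1 : 0 < Re (v + 1)%C) by (rewrite <- Ev; auto).
    pose proof (Cprod_shift_neq_0 (v + 1)%C n Hv1) as P2.
    assert (V0 : v <> RtoC 0) by (intros E; rewrite E in Hv; simpl in Hv; lra).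
    assert (V1 : (v + INR n + 1)%C <> RtoC 0).
    { intros E. apply (f_equal Re) in E. unfold Re in *; simpl in E. lra. }
    pose proof (Cprod_shift_succ v n) as S.
    replace (Cprod_shift (v + 1) n) with (Cprod_shift v n * (v + INR n + 1) / v)%C
      by (rewrite S; field; auto).
    field. repeat split; auto.
Qed.

(** * The cosine product and Wallis' formula *)

Lemma csin_ccos_sqr (z : C) : (csin z * csin z = 1 - ccos z * ccos z)%C.
Proof.
  unfold csin, ccos. pose proof (cexp_neg_mult (ci * z)) as E.
  set (A := cexp (ci * z)) in *. set (B := cexp (- (ci * z))) in *.
  transitivity ((A - B) * (A - B) / (4 * (ci * ci)))%C.
  { field. repeat split; apply ci_neq_0. }
  rewrite ci_sqr.
  transitivity ((4 * (B * A) - (A + B) * (A + B)) / 4)%C; [field; repeat split; intros K; inversion K; lra|].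
  rewrite E. field.
Qed.

Lemma ccos_R (t : R) : ccos t = RtoC (cos t).
Proof.
  unfold ccos. replace (ci * t)%C with (t * ci)%C by ring.
  replace (- (t * ci))%C with ((- t)%R * ci)%C by (rewrite RtoC_opp; ring).
  rewrite !cexp_ci, cos_neg, sin_neg. apply injective_projections; simpl; field.
Qed.

Lemma csin_R (t : R) : csin t = RtoC (sin t).
Proof.
  unfold csin. replace (ci * t)%C with (t * ci)%C by ring.
  replace (- (t * ci))%C with ((- t)%R * ci)%C by (rewrite RtoC_opp; ring).
  rewrite !cexp_ci, cos_neg, sin_neg. unfold ci. apply injective_projections; simpl; field.
Qed.

Lemma csin_0 : csin 0 = RtoC 0.
Proof. rewrite csin_R, sin_0. reflexivity. Qed.
Lemma ccos_0 : ccos 0 = RtoC 1.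
Proof. rewrite ccos_R, cos_0. reflexivity. Qed.

Lemma holo_Cpow f z l n : holo f z l -> holo (fun x => (f x ^ S n)%C) z (INR (S n) * f z ^ n * l)%C.
Proof.
  intros H. induction n as [|n IH].
  - apply (holo_ext f); [intros; simpl; ring|]. eapply holo_eq; [exact H|]. simpl. ring.
  - change (fun x => (f x ^ S (S n))%C) with (fun x => (f x * f x ^ S n)%C).
    eapply holo_eq; [apply holo_mult; [exact H | exact IH]|].
    rewrite (S_INR (S n)), RtoC_plus. simpl Cpow. ring.
Qed.

Lemma continuous_Cpow {U : UniformSpace} (f : U -> C) x n : continuous f x -> continuous (fun y => (f y ^ n)%C) x.
Proof.
  intros H. induction n as [|n IH]; simpl.
  - apply continuous_const.
  - now apply continuous_Cmult.
Qed.

(** Euler's route to the cosine product: integration by parts in these moments produces the factors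
    of the product for cos (pi w / 2) one by one, and at w = 0 the same recursion is that of
    Wallis. *)
Definition cos_moment (w : C) (n : nat) : C := RIntC (fun t => ccos (w * t) * ccos t ^ n)%C 0 (PI / 2).

Lemma cont_cos_moment (w : C) n (z : C) : continuous (fun t : C => ccos (w * t) * ccos t ^ n)%C z.
Proof.
  apply continuous_Cmult; [ccont|]. apply continuous_Cpow. apply (continuous_ccos (fun x => x)), continuous_id.
Qed.

Lemma cont_cos_moment_R (w : C) n (t : R) : continuous (fun t : R => ccos (w * t) * ccos t ^ n)%C t.
Proof.
  apply (continuous_comp (fun t : R => RtoC t) (fun z : C => ccos (w * z) * ccos z ^ n)%C); [ccont|].
  apply cont_cos_moment.
Qed.

Lemma cos_moment_1 (w : C) : ((1 - w * w) * cos_moment w 1 = ccos (w * (PI / 2)%R))%C.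
Proof.
  unfold cos_moment. rewrite <- RIntC_scal by (intros; apply cont_cos_moment_R).
  set (F := fun T => (- w * (csin (w * T) * ccos T) + ccos (w * T) * csin T)%C).
  set (F' := fun T => ((1 - w * w) * (ccos (w * T) * ccos T ^ 1))%C).
  pose proof (RIntC_FTC F F' 0 1 0 (PI / 2)) as I.
  assert (H1 : forall t : R, holo F (0 + t * 1)%C (F' (0 + t * 1)%C)).
  { intros t. unfold F, F'. eapply holo_eq; [holo_tac|]. cbv beta. simpl Cpow. ring. }
  assert (H2 : forall t : R, continuous F' (0 + t * 1)%C).
  { intros t. unfold F'. apply continuous_Cmult; [apply continuous_const | apply cont_cos_moment]. }
  specialize (I (fun t _ => H1 t) (fun t _ => H2 t)). apply RIntC_unique in I.
  transitivity (F (0 + (PI / 2)%R * 1) - F (0 + 0 * 1))%C.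
  - rewrite <- I. apply (RInt_ext (V := C_R_CompleteNormedModule)). intros t _. unfold F'.
    replace (RtoC 0 + t * 1)%C with (RtoC t) by ring. cring.
  - unfold F. replace (RtoC 0 + (PI / 2)%R * 1)%C with (RtoC (PI / 2)) by ring.
    replace (RtoC 0 + 0 * 1)%C with (RtoC 0) by ring.
    rewrite Cmult_0_r, csin_0, !ccos_R, csin_R, cos_PI2, sin_PI2. ring.
Qed.

(** [F] collects the boundary terms of two integrations by parts. It vanishes at both ends, through
    sin at 0 and through a power of cos at pi / 2. *)
Lemma cos_moment_rec (w : C) (n : nat) :
  (((INR n + 2) * (INR n + 2) - w * w) * cos_moment w (S (S n)) = (INR n + 2) * (INR n + 1) * cos_moment w n)%C.
Proof.
  unfold cos_moment. 
  set (N := RtoC (INR n)).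
  set (F := fun T => (- w * (csin (w * T) * ccos T ^ S (S n)) + (N + 2) * (ccos (w * T) * (ccos T ^ S n * csin T)))%C).
  set (F' := fun T => (((N + 2) * (N + 2) - w * w) * (ccos (w * T) * ccos T ^ S (S n)) - (N + 2) * (N + 1) * (ccos (w * T) * ccos T ^ n))%C).
  pose proof (RIntC_FTC F F' 0 1 0 (PI / 2)) as I.
  assert (H1 : forall t : R, holo F (0 + t * 1)%C (F' (0 + t * 1)%C)).
  { intros t. unfold F, F'. set (T := (RtoC 0 + t * 1)%C).
    assert (P : forall k, holo (fun x => (ccos x ^ S k)%C) T (INR (S k) * ccos T ^ k * (- csin T * 1))%C).
    { intros k. apply (holo_Cpow ccos). apply (holo_ccos_comp (fun x => x)), holo_id. }
    eapply holo_eq.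
    - apply holo_plus.
      + apply holo_scal. apply holo_mult; [holo_tac | apply P].
      + apply holo_scal. apply holo_mult; [holo_tac|]. apply holo_mult; [apply P | holo_tac].
    - cbv beta. rewrite !S_INR, !RtoC_plus. fold N. simpl Cpow.
      generalize (ccos T ^ n)%C. intros Cn. pose proof (csin_ccos_sqr T) as S2.
      set (c2 := ccos (w * T)). set (s2 := csin (w * T)).
      set (c1 := ccos T) in *. set (s1 := csin T) in *. clearbody c1 s1 c2 s2.
      transitivity (- w * (c2 * (w * 1) * (c1 * (c1 * Cn)) + s2 * ((N + 1 + 1) * (c1 * Cn) * (- s1 * 1))) +
       (N + 2) * (- s2 * (w * 1) * (c1 * Cn * s1) + c2 * (- (N + 1) * Cn * (s1 * s1) + c1 * Cn * (c1 * 1))))%C; [ring|].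
      rewrite S2. ring. }
  assert (H2 : forall t : R, continuous F' (0 + t * 1)%C).
  { intros t. unfold F'. apply continuous_Cminus; apply continuous_Cmult; try apply continuous_const; apply cont_cos_moment. }
  specialize (I (fun t _ => H1 t) (fun t _ => H2 t)). apply RIntC_unique in I.
  assert (E : (F (0 + (PI / 2)%R * 1) - F (0 + 0 * 1))%C = RtoC 0).
  { unfold F. replace (RtoC 0 + (PI / 2)%R * 1)%C with (RtoC (PI / 2)) by ring.
    replace (RtoC 0 + 0 * 1)%C with (RtoC 0) by ring.
    rewrite Cmult_0_r, csin_0, !ccos_R, csin_R, cos_PI2, sin_PI2. simpl Cpow. ring. }
  rewrite E in I.
  rewrite <- (RIntC_scal (fun t : R => ccos (w * t) * ccos t ^ S (S n))%C) by (intros; apply cont_cos_moment_R).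
  rewrite <- (RIntC_scal (fun t : R => ccos (w * t) * ccos t ^ n)%C) by (intros; apply cont_cos_moment_R).
  set (u := fun t : R => (((N + 2) * (N + 2) - w * w) * (ccos (w * t) * ccos t ^ S (S n)))%C).
  set (v := fun t : R => ((N + 2) * (N + 1) * (ccos (w * t) * ccos t ^ n))%C).
  assert (Cu : forall t, continuous u t) by (intros; apply continuous_Cmult; [apply continuous_const | apply cont_cos_moment_R]).
  assert (Cv : forall t, continuous v t) by (intros; apply continuous_Cmult; [apply continuous_const | apply cont_cos_moment_R]).
  assert (S : RIntC (fun t => u t + (- (1)) * v t)%C 0 (PI / 2) = RtoC 0).
  { rewrite <- I. apply (RInt_ext (V := C_R_CompleteNormedModule)). intros t _. unfold F', u, v.
    replace (RtoC 0 + t * 1)%C with (RtoC t) by ring. cring. }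
  assert (Cv2 : forall t, continuous (fun t => - (1) * v t)%C t).
  { intros t. apply continuous_Cmult; [apply continuous_const | apply Cv]. }
  rewrite (RIntC_plus u _ _ _ Cu Cv2) in S.
  rewrite (RIntC_scal v) in S by auto.
  change (RIntC u 0 (PI / 2) = RIntC v 0 (PI / 2)).
  replace (RIntC u 0 (PI / 2)) with ((RIntC u 0 (PI / 2) + - (1) * RIntC v 0 (PI / 2)) + RIntC v 0 (PI / 2))%C by cring.
  rewrite S. cring.
Qed.

Definition cosI (n : nat) : R := RInt (fun t => cos t ^ n) 0 (PI / 2).

Lemma ex_cosI n a b : ex_RInt (fun t => cos t ^ n) a b.
Proof.
  apply (ex_RInt_continuous (V := R_CompleteNormedModule)). intros t _.
  apply (ex_derive_continuous (V := R_NormedModule) (fun t => cos t ^ n)). auto_derive. auto.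
Qed.

Lemma RtoC_pow' (a : R) n : (RtoC a ^ n)%C = RtoC (a ^ n).
Proof. symmetry. apply RtoC_pow. Qed.

Lemma cos_moment_0 n : cos_moment 0 n = RtoC (cosI n).
Proof.
  unfold cos_moment. apply RIntC_unique.
  apply (is_RInt_ext (V := C_R_NormedModule) (fun t => RtoC (cos t ^ n))).
  { intros t _. rewrite Cmult_0_l, ccos_0, ccos_R, RtoC_pow', Cmult_1_l. reflexivity. }
  apply is_RIntC_ReIm; simpl.
  - apply (RInt_correct (V := R_CompleteNormedModule)), ex_cosI.
  - pose proof (is_RInt_const (V := R_NormedModule) 0 (PI / 2) 0) as K.
    change (scal (PI / 2 - 0) 0) with ((PI / 2 - 0) * 0) in K. rewrite Rmult_0_r in K. exact K.
Qed.

Lemma cosI_0 : cosI 0 = PI / 2.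
Proof. unfold cosI. simpl. rewrite RInt_const. unfold scal; simpl; unfold mult; simpl. ring. Qed.

Lemma cosI_1 : cosI 1 = 1.
Proof.
  pose proof (cos_moment_1 0) as H. rewrite cos_moment_0, (Cmult_0_l (RtoC (PI / 2))), ccos_0 in H.
  apply RtoC_inj. rewrite <- H. ring.
Qed.

Lemma cosI_rec n : (INR n + 2) * cosI (S (S n)) = (INR n + 1) * cosI n.
Proof.
  pose proof (cos_moment_rec 0 n) as H. rewrite !cos_moment_0 in H.
  pose proof (pos_INR n).
  apply (Rmult_eq_reg_l (INR n + 2)); [|lra]. apply RtoC_inj.
  repeat rewrite ?RtoC_mult, ?RtoC_plus.
  transitivity (((INR n + 2) * (INR n + 2) - 0 * 0) * cosI (S (S n)))%C; [ring|]. rewrite H. ring.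
Qed.

(** Wallis' relation without closed forms: the recursion makes the left side independent of [n]. *)
Lemma cosI_prod n : (INR n + 1) * (cosI (S n) * cosI n) = PI / 2.
Proof.
  induction n as [|n IH].
  - simpl. rewrite cosI_1, cosI_0. ring.
  - rewrite <- IH, S_INR. pose proof (cosI_rec n).
    transitivity ((INR n + 2) * cosI (S (S n)) * cosI (S n)); [ring|]. rewrite H. ring.
Qed.

Lemma cos_0_1 t : 0 <= t <= PI / 2 -> 0 <= cos t <= 1.
Proof. intros H. split; [apply cos_ge_0; lra | apply COS_bound]. Qed.

Lemma cosI_decr n : cosI (S n) <= cosI n.
Proof.
  apply RInt_le; try apply ex_cosI; [pose proof PI_RGT_0; lra|].
  intros t Ht. pose proof (cos_0_1 t ltac:(lra)) as C. simpl.
  pose proof (pow_le (cos t) n (proj1 C)). nra.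
Qed.

Lemma cosI_pos n : 0 < cosI n.
Proof.
  assert (0 <= cosI n).
  { apply RInt_ge_0; [pose proof PI_RGT_0; lra | apply ex_cosI |].
    intros t Ht. apply pow_le. apply cos_0_1. lra. }
  destruct H as [H|H]; auto. exfalso. pose proof (cosI_prod n) as P. rewrite <- H in P. pose proof PI_RGT_0. lra.
Qed.

Lemma t_cos_le_sin t : 0 <= t <= PI / 2 -> 0 <= t * cos t <= sin t.
Proof.
  intros Ht. pose proof (cos_0_1 t Ht). split; [nra|].
  destruct (MVT_gen (fun t => sin t - t * cos t) 0 t (fun t => t * sin t)) as [c [Hc E]].
  - intros x _. auto_derive; auto. ring.
  - intros x _. apply continuity_pt_filterlim. apply (ex_derive_continuous (V := R_NormedModule) (fun t => sin t - t * cos t)). auto_derive; auto.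
  - rewrite Rmin_left, Rmax_right in Hc by lra. rewrite sin_0 in E.
    assert (0 <= sin c) by (apply sin_ge_0; pose proof PI_RGT_0; lra).
    assert (0 <= c * sin c * (t - 0)) by (apply Rmult_le_pos; nra). lra.
Qed.

Lemma Cmod_ccos_minus_1 (z : C) : Cmod (ccos z - 1) <= Cmod z * Cmod z * exp (Cmod z).
Proof.
  pose proof (Cmod_cexp_minus_1_z (ci * z)) as H1. pose proof (Cmod_cexp_minus_1_z (- (ci * z))) as H2.
  rewrite Cmod_opp in H2. replace (Cmod (ci * z)) with (Cmod z) in * by (rewrite Cmod_mult; change ci with Ci; rewrite Cmod_Ci; ring).
  replace (ccos z - 1)%C with (RtoC (/ 2) * ((cexp (ci * z) - 1 - ci * z) + (cexp (- (ci * z)) - 1 - - (ci * z))))%C.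
  2:{ unfold ccos. rewrite RtoC_inv by lra. field. }
  rewrite Cmod_mult, Cmod_R, Rabs_pos_eq by lra.
  pose proof (Cmod_triangle (cexp (ci * z) - 1 - ci * z) (cexp (- (ci * z)) - 1 - - (ci * z))). lra.
Qed.

(** One has |cos (w t) - 1| <= K t^2, and t^2 cos^2 t <= sin^2 t = 1 - cos^2 t trades the factor t^2
    for a difference of two moments, which is of relative size 1 / n. *)
Lemma cos_moment_close (w : C) (n : nat) :
  Cmod (cos_moment w (S (S n)) - cos_moment 0 (S (S n)))%C <=
    Cmod w * Cmod w * exp (Cmod w * (PI / 2)) * (cosI n - cosI (S (S n))).
Proof.
  set (K := Cmod w * Cmod w * exp (Cmod w * (PI / 2))).
  assert (HK : 0 <= K).
  { unfold K. apply Rmult_le_pos; [pose proof (Cmod_ge_0 w); nra | left; apply exp_pos]. }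
  pose proof PI_RGT_0.
  set (f := fun t : R => ((ccos (w * t) * ccos t ^ S (S n)) + (- (1)) * (ccos (0 * t) * ccos t ^ S (S n)))%C).
  assert (Cf : forall t, continuous f t).
  { intros t. apply continuous_Cplus; [apply cont_cos_moment_R|].
    apply continuous_Cmult; [apply continuous_const | apply cont_cos_moment_R]. }
  replace (cos_moment w (S (S n)) - cos_moment 0 (S (S n)))%C with (RIntC f 0 (PI / 2)).
  2:{ unfold f. rewrite RIntC_plus.
      - rewrite (RIntC_scal (fun t : R => ccos (0 * t) * ccos t ^ S (S n))%C) by (intros; apply cont_cos_moment_R).
        unfold cos_moment. cring.
      - intros; apply cont_cos_moment_R.
      - intros; apply continuous_Cmult; [apply continuous_const | apply cont_cos_moment_R]. }
  apply (RIntC_bound f (fun t => K * (cos t ^ n - cos t ^ S (S n))) 0 (PI / 2)); [lra | | now apply RIntC_correct | ].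
  - intros t Ht. unfold f. rewrite Cmult_0_l, ccos_0, ccos_R, RtoC_pow'.
    replace (ccos (w * t) * (cos t ^ S (S n))%R + - (1) * (1 * (cos t ^ S (S n))%R))%C with
      ((ccos (w * t) - 1) * (cos t ^ S (S n))%R)%C by ring.
    pose proof (cos_0_1 t Ht) as C. pose proof (pow_le (cos t) n (proj1 C)) as Pn.
    rewrite Cmod_mult, Cmod_R, Rabs_pos_eq by (apply pow_le; lra).
    pose proof (Cmod_ccos_minus_1 (w * t)) as B. rewrite Cmod_mult, Cmod_R, Rabs_pos_eq in B by lra.
    assert (B' : Cmod (ccos (w * t) - 1) <= K * (t * t)).
    { eapply Rle_trans; [exact B|]. unfold K.
      replace (Cmod w * t * (Cmod w * t) * exp (Cmod w * t)) with (Cmod w * Cmod w * (t * t) * exp (Cmod w * t)) by ring.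
      replace (Cmod w * Cmod w * exp (Cmod w * (PI / 2)) * (t * t)) with (Cmod w * Cmod w * (t * t) * exp (Cmod w * (PI / 2))) by ring.
      pose proof (Cmod_ge_0 w). apply Rmult_le_compat_l; [apply Rmult_le_pos; nra|]. apply exp_le. nra. }
    pose proof (t_cos_le_sin t Ht) as S1.
    assert (S2 : (t * cos t) * (t * cos t) <= 1 - cos t * cos t).
    { pose proof (sin2_cos2 t) as Q. unfold Rsqr in Q. nra. }
    apply Rle_trans with (K * (t * t) * cos t ^ S (S n)).
    + apply Rmult_le_compat_r; auto. apply pow_le; lra.
    + simpl. replace (K * (t * t) * (cos t * (cos t * cos t ^ n))) with (K * (((t * cos t) * (t * cos t)) * cos t ^ n)) by ring.
      replace (K * (cos t ^ n - cos t * (cos t * cos t ^ n))) with (K * ((1 - cos t * cos t) * cos t ^ n)) by ring.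
      apply Rmult_le_compat_l; auto. apply Rmult_le_compat_r; auto.
  - apply (is_RInt_scal (V := R_NormedModule) (fun t => cos t ^ n - cos t ^ S (S n)) 0 (PI / 2) K).
    apply (is_RInt_minus (V := R_NormedModule)); apply (RInt_correct (V := R_CompleteNormedModule)), ex_cosI.
Qed.

Fixpoint cosprod (w : C) (n : nat) : C :=
  match n with
  | O => (1 - w * w)%C
  | S k => (cosprod w k * (1 - w * w / ((2 * INR n + 1) * (2 * INR n + 1))))%C
  end.

Lemma INR_lin_neq_0 (a b : R) n : 0 < a -> 0 < b -> (a * INR n + b)%C <> RtoC 0.
Proof.
  intros Ha Hb E. rewrite <- RtoC_mult, <- RtoC_plus in E. apply RtoC_inj in E. pose proof (pos_INR n). nra.
Qed.

Lemma cosprod_moment (w : C) n :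
  (cosprod w n * cos_moment w (2 * n + 1) = ccos (w * (PI / 2)%R) * cosI (2 * n + 1))%C.
Proof.
  induction n as [|n IH].
  - simpl (2 * 0 + 1)%nat. rewrite cosI_1. change (cosprod w 0) with (1 - w * w)%C. rewrite cos_moment_1. ring.
  - replace (2 * S n + 1)%nat with (S (S (2 * n + 1))) by lia.
    set (m := (2 * n + 1)%nat) in *.
    assert (Em : INR m = 2 * INR n + 1) by (unfold m; rewrite plus_INR, mult_INR; simpl; ring).
    pose proof (cos_moment_rec w m) as R1. pose proof (cosI_rec m) as R2.
    change (cosprod w (S n)) with (cosprod w n * (1 - w * w / ((2 * INR (S n) + 1) * (2 * INR (S n) + 1))))%C.
    replace (2 * INR (S n) + 1)%C with (INR m + 2)%C by (rewrite S_INR, Em; repeat rewrite ?RtoC_plus, ?RtoC_mult; ring).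
    assert (M2 : (INR m + 2)%C <> RtoC 0).
    { pose proof (INR_lin_neq_0 1 2 m ltac:(lra) ltac:(lra)). now rewrite Cmult_1_l in H. }
    apply (f_equal RtoC) in R2. rewrite !RtoC_mult, !RtoC_plus in R2.
    set (N := RtoC (INR m)) in *.
    transitivity (cosprod w n * (((N + 2) * (N + 2) - w * w) * cos_moment w (S (S m))) / ((N + 2) * (N + 2)))%C; [field; auto|].
    rewrite R1.
    transitivity ((cosprod w n * cos_moment w m) * (N + 1) / (N + 2))%C; [field; auto|].
    rewrite IH.
    transitivity (ccos (w * (PI / 2)%R) * (((N + 1) * cosI m) / (N + 2)))%C; [field; auto|].
    rewrite <- R2. field. auto.
Qed.

(** The ratio of the moments at [w] and at 0 tends to 1, and [cosprod_moment] expresses the partial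
    product through this ratio. *)
Lemma cosprod_limit (w : C) : Cseq (cosprod w) (ccos (w * (PI / 2)%R)).
Proof.
  assert (L : Cseq (fun n => cos_moment w (2 * n + 1) / RtoC (cosI (2 * n + 1)))%C 1).
  { intros eps He. set (K := Cmod w * Cmod w * exp (Cmod w * (PI / 2))).
    assert (HK : 0 <= K).
    { unfold K. apply Rmult_le_pos; [pose proof (Cmod_ge_0 w); nra | left; apply exp_pos]. }
    destruct (INR_large (K / eps)) as [N [HN1 HN]]. exists N. intros n Hn.
    specialize (HN n Hn). destruct n as [|n]; [lia|].
    replace (2 * S n + 1)%nat with (S (S (2 * n + 1))) by lia.
    set (m := (2 * n + 1)%nat).
    pose proof (cos_moment_close w m) as B. fold K in B. pose proof (cosI_pos (S (S m))) as Pm.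
    pose proof (cosI_rec m) as R2.
    assert (Em : INR m + 1 = 2 * INR (S n)) by (unfold m; rewrite plus_INR, mult_INR, (S_INR n); simpl; ring).
    assert (Hn1 : 1 <= INR (S n)) by (rewrite S_INR; pose proof (pos_INR n); lra).
    rewrite cos_moment_0 in B.
    assert (Cn : RtoC (cosI (S (S m))) <> RtoC 0) by (intros E; apply RtoC_inj in E; lra).
    replace (cos_moment w (S (S m)) / cosI (S (S m)) - 1)%C with ((cos_moment w (S (S m)) - cosI (S (S m))) / cosI (S (S m)))%C by (field; auto).
    rewrite Cmod_div, Cmod_R, Rabs_pos_eq by (auto; lra).
    apply (Rmult_le_reg_r (cosI (S (S m)))); auto. unfold Rdiv. rewrite Rmult_assoc, Rinv_l, Rmult_1_r by lra.
    eapply Rle_trans; [exact B|].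
    assert (D : cosI m - cosI (S (S m)) = cosI (S (S m)) / (2 * INR (S n))).
    { assert (cosI m = (INR m + 2) * cosI (S (S m)) / (2 * INR (S n))).
      { rewrite R2, Em. field. lra. }
      rewrite H. replace (INR m) with (2 * INR (S n) - 1) by lra. field. lra. }
    rewrite D.
    assert (HK2 : K <= eps * INR (S n)).
    { apply (Rmult_le_compat_l eps) in HN; [|lra]. replace (eps * (K / eps)) with K in HN by (field; lra). lra. }
    replace (K * (cosI (S (S m)) / (2 * INR (S n)))) with ((K / (2 * INR (S n))) * cosI (S (S m))) by (field; lra).
    apply Rmult_le_compat_r; [lra|]. apply (Rmult_le_reg_r (2 * INR (S n))); [lra|].
    unfold Rdiv. rewrite Rmult_assoc, Rinv_l, Rmult_1_r by lra. nra. }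
  pose proof (Cseq_scal (ccos (w * (PI / 2)%R)) _ _ (Cseq_inv _ _ C1_neq_0 L)) as L2.
  replace (ccos (w * (PI / 2)%R) * / 1)%C with (ccos (w * (PI / 2)%R)) in L2 by (field; apply C1_neq_0).
  destruct (L (1 / 2) ltac:(lra)) as [N HN].
  refine (Cseq_ext_from N _ _ _ _ L2). intros n Hn. specialize (HN n Hn). cbv beta.
  pose proof (cosI_pos (2 * n + 1)) as P.
  assert (Cn : RtoC (cosI (2 * n + 1)) <> RtoC 0) by (intros E; apply RtoC_inj in E; lra).
  assert (Mn : cos_moment w (2 * n + 1) <> RtoC 0).
  { intros E. rewrite E in HN. replace (0 / cosI (2 * n + 1) - 1)%C with (- (1))%C in HN by (field; auto).
    rewrite Cmod_m1 in HN. lra. }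
  pose proof (cosprod_moment w n) as E.
  replace (cosprod w n) with (cosprod w n * cos_moment w (2 * n + 1) / cos_moment w (2 * n + 1))%C by (field; auto).
  rewrite E. field. auto.
Qed.

Notation Chalf := (RtoC (/ 2)).

Lemma Chalf_eq : Chalf = (/ 2)%C.
Proof. apply RtoC_inv. lra. Qed.

Lemma Cprod_half n : (Cprod_shift Chalf n * cosI (2 * n + 1) * 2 = INR (fact n))%C.
Proof.
  induction n as [|n IH].
  - simpl (2 * 0 + 1)%nat. rewrite cosI_1. simpl. rewrite Chalf_eq. field.
  - replace (2 * S n + 1)%nat with (S (S (2 * n + 1))) by lia.
    change (Cprod_shift Chalf (S n)) with (Cprod_shift Chalf n * (Chalf + INR (S n)))%C.
    change (fact (S n)) with (S n * fact n)%nat. rewrite mult_INR, RtoC_mult, <- IH.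
    pose proof (cosI_rec (2 * n + 1)) as Hr.
    replace (INR (2 * n + 1)) with (2 * INR n + 1) in Hr by (rewrite plus_INR, mult_INR; simpl; ring).
    assert (R' : ((Chalf + INR (S n)) * cosI (S (S (2 * n + 1))) = INR (S n) * cosI (2 * n + 1))%C).
    { rewrite <- RtoC_plus, <- !RtoC_mult. f_equal. rewrite S_INR. lra. }
    transitivity (Cprod_shift Chalf n * ((Chalf + INR (S n)) * cosI (S (S (2 * n + 1)))) * 2)%C; [ring|].
    rewrite R'. ring.
Qed.

Lemma gauss_half n : gauss_seq Chalf n = RtoC (2 * exp (/ 2 * ln (INR n)) * cosI (2 * n + 1)) \/ n = 0%nat.
Proof.
  destruct n as [|n]; [now right|]. left. set (m := S n).
  assert (Hm : 0 < INR m) by (apply lt_0_INR; unfold m; lia).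
  unfold gauss_seq. rewrite <- Cprod_half, cpow_RtoC by auto.
  rewrite <- RtoC_mult, cexp_R, !RtoC_mult. field.
  apply Cprod_shift_neq_0. simpl. lra.
Qed.

(** The term is 2 sqrt n times [cosI (2 * n + 1)], whose square lies between pi / (4 n + 4) and pi /
    (4 n + 2) by monotonicity and [cosI_prod]. *)
Lemma gauss_half_limit : Cseq (gauss_seq Chalf) (RtoC (sqrt PI)).
Proof.
  pose proof PI_RGT_0 as HP. assert (HS : 0 < sqrt PI) by now apply sqrt_lt_R0.
  intros eps He.
  destruct (INR_large (PI / (sqrt PI * eps))) as [N [HN1 HN]].
  exists N. intros n Hn. specialize (HN n Hn).
  destruct (gauss_half n) as [-> | ->]; [|lia].
  rewrite <- RtoC_minus, Cmod_R.
  assert (H1 : 0 < INR n) by (apply lt_0_INR; lia).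
  set (x := 2 * exp (/ 2 * ln (INR n)) * cosI (2 * n + 1)).
  pose proof (cosI_pos (2 * n + 1)) as HI. pose proof (exp_pos (/ 2 * ln (INR n))) as HE.
  assert (Hx : 0 < x) by (unfold x; nra).
  assert (Ex : x * x = 4 * INR n * (cosI (2 * n + 1) * cosI (2 * n + 1))).
  { unfold x. replace (2 * exp (/ 2 * ln (INR n)) * cosI (2 * n + 1) * (2 * exp (/ 2 * ln (INR n)) * cosI (2 * n + 1))) with
     (4 * (exp (/ 2 * ln (INR n)) * exp (/ 2 * ln (INR n))) * (cosI (2 * n + 1) * cosI (2 * n + 1))) by ring.
    rewrite <- exp_plus. replace (/ 2 * ln (INR n) + / 2 * ln (INR n)) with (ln (INR n)) by field.
    rewrite exp_ln; auto. }
  pose proof (cosI_prod (2 * n)) as W1. pose proof (cosI_prod (2 * n + 1)) as W2.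
  replace (S (2 * n)) with (2 * n + 1)%nat in W1 by lia.
  pose proof (cosI_decr (2 * n)) as M1. pose proof (cosI_decr (2 * n + 1)) as M2.
  replace (S (2 * n)) with (2 * n + 1)%nat in M1 by lia.
  replace (INR (2 * n + 1)) with (2 * INR n + 1) in W2 by (rewrite plus_INR, mult_INR; simpl; ring).
  replace (INR (2 * n)) with (2 * INR n) in W1 by (rewrite mult_INR; simpl; ring).
  set (N' := INR n) in *. set (I1 := cosI (2 * n + 1)) in *.
  assert (L : I1 * I1 * (2 * N' + 1) <= PI / 2) by (rewrite <- W1; nra).
  assert (U : PI / 2 <= I1 * I1 * (2 * N' + 2)).
  { rewrite <- W2. assert (cosI (S (2 * n + 1)) * I1 <= I1 * I1) by nra. nra. }
  assert (B1 : x * x <= PI) by (rewrite Ex; nra).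
  assert (B2 : PI - PI / (N' + 1) <= x * x).
  { rewrite Ex. apply (Rmult_le_reg_r (N' + 1)); [lra|].
    replace ((PI - PI / (N' + 1)) * (N' + 1)) with (PI * N') by (field; lra). nra. }
  assert (Sx : sqrt PI * sqrt PI = PI) by (apply sqrt_sqrt; lra).
  assert (Ls : x <= sqrt PI) by nra.
  rewrite Rabs_left1 by lra.
  apply (Rmult_le_reg_r (sqrt PI)); auto.
  apply Rle_trans with (PI - x * x); [nra|].
  apply Rle_trans with (PI / (N' + 1)); [lra|].
  apply (Rmult_le_reg_r (N' + 1)); [lra|].
  unfold Rdiv at 1. rewrite Rmult_assoc, Rinv_l, Rmult_1_r by lra.
  apply (Rmult_le_compat_l (sqrt PI * eps)) in HN; [|nra].
  replace (sqrt PI * eps * (PI / (sqrt PI * eps))) with PI in HN by (field; lra). nra.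
Qed.

Lemma Gam_half : Gam Chalf = RtoC (sqrt PI).
Proof. apply (Cseq_unique (gauss_seq Chalf)); [apply gauss_limit; simpl; lra | apply gauss_half_limit]. Qed.

(** * Gaussian integrals *)

Lemma dom_gauss_base : dom (4 * exp 1) (fun u => cexp (- (u * u))).
Proof.
  split; [intros; ccont|]. intros t. rewrite <- RtoC_mult, <- RtoC_opp, cexp_R, Cmod_R, Rabs_pos_eq by (left; apply exp_pos).
  pose proof (exp_gauss_dom 1 0 t Rlt_0_1) as H.
  replace (- (1 * (t * t)) + 0 * Rabs t) with (- (t * t)) in H by ring.
  eapply Rle_trans; [exact H|]. unfold Rdiv. apply Rmult_le_compat_r; [left; apply Rinv_0_lt_compat, one_plus_sqr_pos|].
  apply Rmult_le_compat_l; [lra|]. apply exp_le. lra.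
Qed.

(** Under u = exp t and u = - exp t, followed by the dilation of t by 2, each half-line contributes
    half of [Gam Chalf]. *)
Lemma gaussian_base : CInt_line (fun u => cexp (- (u * u))) = RtoC (sqrt PI).
Proof.
  rewrite (IntR_split_exp _ _ dom_gauss_base).
  assert (D := dom_Gam Chalf ltac:(simpl; lra)).
  pose proof (IntR_scale _ _ 2 ltac:(lra) D) as E.
  fold (Gam Chalf) in E.
  assert (F : forall s : R, s * s = 1 -> forall t : R, (exp t * cexp (- ((s * exp t)%R * (s * exp t)%R)))%C = cexp (Chalf * (2 * t)%R - cexp (2 * t)%R)).
  { intros s Hs t.
    transitivity (RtoC (exp t * exp (- (s * exp t * (s * exp t))))).
    { rewrite (RtoC_mult (exp t) (exp _)), <- (cexp_R (- _)), RtoC_opp, (RtoC_mult (s * exp t) (s * exp t)). reflexivity. }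
    transitivity (RtoC (exp (/ 2 * (2 * t) - exp (2 * t)))).
    2:{ rewrite <- (cexp_R (_ - _)), RtoC_minus, (RtoC_mult (/ 2) (2 * t)), (cexp_R (2 * t)). reflexivity. }
    rewrite <- exp_plus. do 2 f_equal. replace (2 * t) with (t + t) by ring. rewrite exp_plus.
    replace (s * exp t * (s * exp t)) with (s * s * (exp t * exp t)) by ring. rewrite Hs. field. }
  rewrite (IntR_ext (fun t => exp t * cexp (- ((1 * exp t)%R * (1 * exp t)%R)))%C _ (F 1 ltac:(ring))).
  rewrite (IntR_ext (fun t => exp t * cexp (- ((-1 * exp t)%R * (-1 * exp t)%R)))%C _ (F (-1) ltac:(ring))).
  rewrite E, Gam_half. field.
Qed.

(** Translation by a complex number is a shift of the line of integration, here along the direction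
    [q]. *)
Lemma gaussian_shifted (q : C) : CInt_line (fun u => cexp (- ((u + q) * (u + q)))) = RtoC (sqrt PI).
Proof.
  rewrite <- gaussian_base.
  set (f := fun z => cexp (- (z * z))). set (f' := fun z => (cexp (- (z * z)) * (- (1 * z + z * 1)))%C).
  assert (H := line_shift f f' 0 q 1 (-1) 2 1 0).
  rewrite (IntR_ext _ (fun u => f (RtoC 0 + RtoC 1 * q + u * 1)%C)) by (intros; unfold f; do 2 f_equal; ring).
  rewrite (IntR_ext (fun u => cexp (- (u * u))) (fun u => f (RtoC 0 + RtoC 0 * q + u * 1)%C)) by (intros; unfold f; do 2 f_equal; ring).
  apply H; try lra.
  - apply C1_neq_0.
  - intros c u _. unfold f, f'. holo_tac.
  - intros c u _. unfold f'. ccont.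
  - intros x y Hx Hy. exists (exp (4 * (Im q * Im q)) * (4 * exp ((4 * Rabs (Re q) + 1) * (4 * Rabs (Re q) + 1) / (4 * 1)))).
    intros c u Hc. unfold f. rewrite Cmod_cexp.
    replace (Re (- ((0 + c * q + u * 1) * (0 + c * q + u * 1)))%C) with
      (c * c * (Im q * Im q) + (- (1 * (u * u)) - 2 * (c * Re q * u) - c * c * (Re q * Re q))).
    2:{ unfold Re, Im; simpl. ring. }
    rewrite exp_plus. unfold Rdiv. rewrite (Rmult_assoc (exp (4 * (Im q * Im q)))).
    apply Rmult_le_compat; try (left; apply exp_pos).
    + apply exp_le. apply Rmult_le_compat_r; nra.
    + eapply Rle_trans; [|apply (exp_gauss_dom 1 (4 * Rabs (Re q)) u Rlt_0_1)].
      apply exp_le.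
      assert (Rabs (c * Re q * u) <= 2 * (Rabs (Re q) * Rabs u)).
      { rewrite !Rabs_mult, Rmult_assoc. apply Rmult_le_compat_r; [|apply Rabs_le; lra].
        apply Rmult_le_pos; apply Rabs_pos. }
      pose proof (Rle_abs (- (c * Re q * u))). rewrite Rabs_Ropp in H1.
      assert (0 <= c * c * (Re q * Re q)) by nra. lra.
Qed.

Lemma gaussian (k : R) (q : C) : 0 < k ->
  CInt_line (fun u => cexp (- ((k * u + q) * (k * u + q)))) = RtoC (sqrt PI / k).
Proof.
  intros Hk.
  assert (D : exists M, dom M (fun u => cexp (- ((u + q) * (u + q))))).
  { exists (exp (Im q * Im q) * (4 * exp ((2 * Rabs (Re q) + 1) * (2 * Rabs (Re q) + 1) / (4 * 1)))).
    split; [intros; ccont|]. intros u. rewrite Cmod_cexp.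
    replace (Re (- ((u + q) * (u + q)))%C) with
      (Im q * Im q + (- (1 * (u * u)) - 2 * (Re q * u) - (Re q * Re q))) by (unfold Re, Im; simpl; ring).
    rewrite exp_plus. unfold Rdiv. rewrite (Rmult_assoc (exp (Im q * Im q))).
    apply Rmult_le_compat_l; [left; apply exp_pos|].
    eapply Rle_trans; [|apply (exp_gauss_dom 1 (2 * Rabs (Re q)) u Rlt_0_1)].
    apply exp_le. pose proof (Rle_abs (- (Re q * u))). rewrite Rabs_Ropp, Rabs_mult in H. nra. }
  destruct D as [M D].
  pose proof (IntR_scale _ _ k Hk D) as E. rewrite gaussian_shifted in E.
  rewrite (IntR_ext _ (fun t => cexp (- (((k * t)%R + q) * ((k * t)%R + q))))) by (intros; now rewrite RtoC_mult).
  rewrite E, RtoC_div by lra. field. intros K; apply RtoC_inj in K; lra.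
Qed.

(** * The factor chi *)

Lemma fact_double n : (RtoC (INR (fact (2 * n + 1))) = 2 ^ (2 * n + 1) * INR (fact n) * Cprod_shift Chalf n)%C.
Proof.
  induction n as [|n IH].
  - simpl. rewrite Chalf_eq. field.
  - replace (2 * S n + 1)%nat with (S (S (2 * n + 1))) by lia.
    change (fact (S (S (2 * n + 1)))) with (S (S (2 * n + 1)) * (S (2 * n + 1) * fact (2 * n + 1)))%nat.
    change (fact (S n)) with (S n * fact n)%nat.
    change (Cprod_shift Chalf (S n)) with (Cprod_shift Chalf n * (Chalf + INR (S n)))%C.
    rewrite !mult_INR, !RtoC_mult, IH, !S_INR.
    replace (INR (2 * n + 1)) with (2 * INR n + 1) by (rewrite plus_INR, mult_INR; simpl; ring).
    rewrite Chalf_eq, !RtoC_plus, RtoC_mult. 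
    change (2 ^ S (S (2 * n + 1)))%C with (2 * (2 * 2 ^ (2 * n + 1)))%C.
    generalize (2 ^ (2 * n + 1))%C. intros P. field.
Qed.

Lemma Cprod_double (w : C) n :
  (Cprod_shift (w / 2) n * Cprod_shift ((w + 1) / 2) n * (2 * 2 ^ (2 * n + 1)) = Cprod_shift w (2 * n + 1))%C.
Proof.
  induction n as [|n IH].
  - simpl. field.
  - replace (2 * S n + 1)%nat with (S (S (2 * n + 1))) by lia.
    change (Cprod_shift w (S (S (2 * n + 1)))) with (Cprod_shift w (2 * n + 1) * (w + INR (S (2 * n + 1))) * (w + INR (S (S (2 * n + 1)))))%C.
    change (Cprod_shift (w / 2) (S n)) with (Cprod_shift (w / 2) n * (w / 2 + INR (S n)))%C.
    change (Cprod_shift ((w + 1) / 2) (S n)) with (Cprod_shift ((w + 1) / 2) n * ((w + 1) / 2 + INR (S n)))%C.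
    rewrite <- IH, !S_INR.
    replace (INR (2 * n + 1)) with (2 * INR n + 1) by (rewrite plus_INR, mult_INR; simpl; ring).
    change (2 ^ S (S (2 * n + 1)))%C with (2 * (2 * 2 ^ (2 * n + 1)))%C.
    repeat rewrite ?RtoC_plus, ?RtoC_mult.
    generalize (2 ^ (2 * n + 1))%C. intros P. field.
Qed.

Lemma Cpow_2_neq_0 n : (2 ^ n)%C <> RtoC 0.
Proof. rewrite RtoC_pow'. intros E. apply RtoC_inj in E. pose proof (pow_lt 2 n ltac:(lra)). lra. Qed.

Lemma Re_half (w : C) : Re (w / 2) = Re w / 2.
Proof. unfold Cdiv. rewrite <- RtoC_inv by lra. rewrite Re_mult_R. reflexivity. Qed.

(** Legendre's duplication already holds for the Gauss quotients; only (2 n + 1)^w = n^w (2 + 1 /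
    n)^w leaves a factor that becomes a power of 2 in the limit. *)
Lemma gauss_double (w : C) n : 0 < Re w -> (1 <= n)%nat ->
  (gauss_seq (w / 2) n * gauss_seq ((w + 1) / 2) n =
   gauss_seq w (2 * n + 1) * (2 * gauss_seq Chalf n * cexp (w * (- ln (2 + / INR n))%R)))%C.
Proof.
  intros Hw Hn.
  assert (Hm : 0 < INR n) by (apply lt_0_INR; lia).
  assert (Hm2 : INR (2 * n + 1) = 2 * INR n + 1) by (rewrite plus_INR, mult_INR; simpl; ring).
  assert (Hi : 0 < / INR n) by now apply Rinv_0_lt_compat.
  unfold gauss_seq. rewrite Hm2, !cpow_RtoC by lra.
  assert (L : ln (2 * INR n + 1) = ln (INR n) + ln (2 + / INR n)).
  { rewrite <- ln_mult by lra. f_equal. field. lra. }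
  rewrite L, fact_double. rewrite <- Cprod_double.
  replace (w * (ln (INR n) + ln (2 + / INR n))%R)%C with (w * ln (INR n) + w * ln (2 + / INR n))%C by (rewrite RtoC_plus; ring).
  replace (w * (- ln (2 + / INR n))%R)%C with (- (w * ln (2 + / INR n)))%C by (rewrite RtoC_opp; ring).
  rewrite cexp_plus, cexp_opp.
  replace ((w + 1) / 2 * ln (INR n))%C with (w / 2 * ln (INR n) + Chalf * ln (INR n))%C by (rewrite Chalf_eq; field).
  rewrite cexp_plus.
  replace (cexp (w * ln (INR n))) with (cexp (w / 2 * ln (INR n)) * cexp (w / 2 * ln (INR n)))%C
    by (rewrite <- cexp_plus; f_equal; field).
  pose proof (Cprod_shift_neq_0 (w / 2) n ltac:(rewrite Re_half; lra)).
  pose proof (Cprod_shift_neq_0 ((w + 1) / 2) n ltac:(rewrite Re_half; simpl; unfold Re in Hw; lra)).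
  pose proof (Cprod_shift_neq_0 Chalf n ltac:(simpl; lra)).
  pose proof (cexp_neq_0 (w * ln (2 + / INR n))). pose proof (Cpow_2_neq_0 (2 * n + 1)).
  generalize dependent (2 ^ (2 * n + 1))%C. intros P HP. field. repeat split; auto.
Qed.

Lemma Cseq_exp_ln2 (w : C) : Cseq (fun n => cexp (w * (- ln (2 + / INR n))%R)) (cexp (w * (- ln 2)%R)).
Proof.
  apply (Cseq_ext_from 1 (fun n => (fun x : C => cexp (w * (- ln (2 + Re x))%R)) (/ RtoC (INR n))%C)).
  { intros n Hn. cbv beta. rewrite <- RtoC_inv by (apply not_0_INR; lia). reflexivity. }
  replace (ln 2) with (ln (2 + Re 0)) by (simpl; f_equal; ring).
  apply (Cseq_continuous (fun x : C => cexp (w * (- ln (2 + Re x))%R)) _ (RtoC 0)); [|apply Cseq_inv_INR].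
  apply continuous_cexp. apply continuous_Cmult; [apply continuous_const|]. apply continuous_RtoC, continuous_Ropp.
  apply (continuous_Rcomp ln (fun x : C => 2 + Re x)).
  - apply continuous_Rplus; [apply continuous_const | apply (continuous_Re (fun x : C => x)), continuous_id].
  - apply derivable_continuous_pt. exists (/ (2 + Re 0)). apply derivable_pt_lim_ln. simpl; lra.
Qed.

Lemma Gam_duplication (w : C) : 0 < Re w ->
  (Gam (w / 2) * Gam ((w + 1) / 2) = 2 * sqrt PI * cexp (- w * ln 2) * Gam w)%C.
Proof.
  intros Hw.
  assert (H1 := gauss_limit (w / 2) ltac:(rewrite Re_half; lra)).
  assert (H2 := gauss_limit ((w + 1) / 2) ltac:(rewrite Re_half; simpl; unfold Re in Hw; lra)).
  apply (Cseq_unique _ _ _ (Cseq_mult _ _ _ _ H1 H2)).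
  assert (Hphi : forall n, (n <= 2 * n + 1)%nat) by (intros; lia).
  assert (H3 := Cseq_subseq (fun n => (2 * n + 1)%nat) _ _ Hphi (gauss_limit w Hw)).
  pose proof (Cseq_mult _ _ _ _ H3 (Cseq_mult _ _ _ _ (Cseq_scal 2 _ _ gauss_half_limit) (Cseq_exp_ln2 w))) as H4.
  replace (2 * sqrt PI * cexp (- w * ln 2) * Gam w)%C with (Gam w * (2 * sqrt PI * cexp (w * (- ln 2)%R)))%C.
  2:{ replace (w * (- ln 2)%R)%C with (- w * ln 2)%C by (rewrite RtoC_opp; ring). ring. }
  refine (Cseq_ext_from 1 _ _ _ _ H4). intros n Hn. cbv beta. rewrite gauss_double by auto. ring.
Qed.

Lemma Cprod_reflection (w : C) n :
  (Cprod_shift ((1 - w) / 2) n * Cprod_shift ((w + 1) / 2) n = Cprod_shift Chalf n * Cprod_shift Chalf n * cosprod w n)%C.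
Proof.
  induction n as [|n IH].
  - simpl. rewrite Chalf_eq. field.
  - change (Cprod_shift ((1 - w) / 2) (S n)) with (Cprod_shift ((1 - w) / 2) n * ((1 - w) / 2 + INR (S n)))%C.
    change (Cprod_shift ((w + 1) / 2) (S n)) with (Cprod_shift ((w + 1) / 2) n * ((w + 1) / 2 + INR (S n)))%C.
    change (Cprod_shift Chalf (S n)) with (Cprod_shift Chalf n * (Chalf + INR (S n)))%C.
    change (cosprod w (S n)) with (cosprod w n * (1 - w * w / ((2 * INR (S n) + 1) * (2 * INR (S n) + 1))))%C.
    transitivity ((Cprod_shift ((1 - w) / 2) n * Cprod_shift ((w + 1) / 2) n) * (((1 - w) / 2 + INR (S n)) * ((w + 1) / 2 + INR (S n))))%C; [ring|].
    rewrite IH, Chalf_eq. field. apply INR_lin_neq_0; lra.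
Qed.

(** The reflection formula at (1 - w) / 2, where Euler's integral may diverge because the real part
    can be negative. The finite products at (1 - w) / 2 and (1 + w) / 2 multiply to [cosprod], up to
    the square of the product at 1 / 2, so 1 / Gamma is reached directly. *)
Lemma CinvGamma_reflection (w : C) : 0 < Re w ->
  CinvGamma ((1 - w) / 2) = (Gam ((w + 1) / 2) * ccos (w * (PI / 2)%R) / PI)%C.
Proof.
  intros Hw. unfold CinvGamma. apply Clim_unique.
  assert (H2 := gauss_limit ((w + 1) / 2) ltac:(rewrite Re_half; simpl; unfold Re in Hw; lra)).
  pose proof PI_RGT_0 as HP.
  assert (HPc : RtoC PI <> RtoC 0) by (intros E; apply RtoC_inj in E; lra).
  assert (S2 : (sqrt PI * sqrt PI)%C = RtoC PI) by (rewrite <- RtoC_mult, sqrt_sqrt; auto; lra).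
  assert (HPs : (sqrt PI * sqrt PI)%C <> RtoC 0) by (rewrite S2; exact HPc).
  pose proof (Cseq_mult _ _ _ _ (Cseq_mult _ _ _ _ H2 (cosprod_limit w))
    (Cseq_inv _ _ HPs (Cseq_mult _ _ _ _ gauss_half_limit gauss_half_limit))) as H.
  cbv beta in H. rewrite S2 in H.
  refine (Cseq_ext_from 1 _ _ _ _ H). intros n Hn. cbv beta.
  assert (Hm : 0 < INR n) by (apply lt_0_INR; lia).
  unfold gauss_seq. rewrite !cpow_RtoC by auto.
  pose proof (Cprod_reflection w n) as E.
  pose proof (Cprod_shift_neq_0 ((w + 1) / 2) n ltac:(rewrite Re_half; simpl; unfold Re in Hw; lra)) as N1.
  pose proof (Cprod_shift_neq_0 Chalf n ltac:(simpl; lra)) as N2.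
  replace (cexp ((w + 1) / 2 * ln (INR n))) with (cexp (Chalf * ln (INR n)) * cexp (Chalf * ln (INR n)) / cexp ((1 - w) / 2 * ln (INR n)))%C.
  2:{ rewrite <- cexp_plus, <- cexp_minus. f_equal. rewrite Chalf_eq. field. }
  replace (Cprod_shift ((1 - w) / 2) n) with (Cprod_shift Chalf n * Cprod_shift Chalf n * cosprod w n / Cprod_shift ((w + 1) / 2) n)%C.
  2:{ rewrite <- E. field. auto. }
  field. repeat split; auto; try apply cexp_neq_0; apply INR_fact_neq_0_C.
Qed.

(** Reflection and duplication turn the quotient of Gamma factors into the factor of the unsymmetric
    functional equation. *)
Lemma chi_value (w : C) : 0 < Re w ->
  chi (1 - w) = (2 * cexp (- w * ln (2 * PI)) * ccos (w * (PI / 2)%R) * Gam w)%C.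
Proof.
  intros Hw. unfold chi. pose proof PI_RGT_0 as HP.
  assert (HPc : RtoC PI <> RtoC 0) by (intros E; apply RtoC_inj in E; lra).
  replace ((1 - (1 - w)) / 2)%C with (w / 2)%C by (f_equal; ring).
  rewrite CinvGamma_reflection by auto.
  replace (CGamma (w / 2)) with (Gam (w / 2)).
  2:{ symmetry. apply Clim_unique. apply gauss_limit. rewrite Re_half; lra. }
  pose proof (Gam_duplication w Hw) as D.
  transitivity (cpow PI (1 - w - Chalf) * (Gam (w / 2) * Gam ((w + 1) / 2)) * ccos (w * (PI / 2)%R) / PI)%C; [field; auto|].
  rewrite D, cpow_RtoC by auto.
  replace (RtoC (sqrt PI)) with (cexp (Chalf * ln PI)).
  2:{ rewrite <- RtoC_mult, cexp_R. f_equal. now apply Rpower_sqrt. }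
  replace (- w * ln (2 * PI))%C with (- w * ln 2 + - w * ln PI)%C by (rewrite ln_mult, RtoC_plus by lra; ring).
  rewrite (cexp_plus (- w * ln 2)).
  replace ((1 - w - Chalf) * ln PI)%C with (- w * ln PI + ln PI - Chalf * ln PI)%C by ring.
  rewrite cexp_minus, cexp_plus, (cexp_R (ln PI)), exp_ln by auto.
  field. repeat split; auto; apply cexp_neq_0.
Qed.

(** * The kernel [exp(pi i x) - exp(-pi i x)] *)

Definition den (x : C) : C := (cexp (RtoC PI * ci * x) - cexp (- (RtoC PI * ci * x)))%C.

Lemma den_eq (a b : R) :
  den (a, b) = (cos (PI * a) * (exp (- (PI * b)) - exp (PI * b)), sin (PI * a) * (exp (- (PI * b)) + exp (PI * b))).
Proof.
  unfold den. replace (RtoC PI * ci * (a, b))%C with ((- (PI * b), PI * a) : C)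
    by (apply injective_projections; unfold ci; simpl; ring).
  unfold cexp, Re, Im; simpl. rewrite Ropp_involutive, cos_neg, sin_neg.
  apply injective_projections; simpl; ring.
Qed.

Lemma Cmod_den_sqr (a b : R) :
  Cmod (den (a, b)) * Cmod (den (a, b)) =
    (exp (PI * b) - exp (- (PI * b))) * (exp (PI * b) - exp (- (PI * b))) + 4 * (sin (PI * a) * sin (PI * a)).
Proof.
  rewrite Cmod_sqr, den_eq. simpl.
  pose proof (sin2_cos2 (PI * a)) as S. unfold Rsqr in S.
  assert (E : exp (- (PI * b)) * exp (PI * b) = 1) by (rewrite <- exp_plus, Rplus_opp_l; apply exp_0).
  set (s := sin (PI * a)) in *. set (c := cos (PI * a)) in *.
  set (p := exp (PI * b)) in *. set (q := exp (- (PI * b))) in *.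
  replace (c * (q - p) * (c * (q - p)) + s * (q + p) * (s * (q + p))) with
    ((s * s + c * c) * ((p - q) * (p - q)) + 4 * (q * p) * (s * s)) by ring.
  rewrite S, E. ring.
Qed.

Lemma exp_minus_ge (y : R) : 0 <= y -> 2 * y <= exp y - exp (- y).
Proof.
  intros Hy.
  destruct (MVT_gen (fun t => exp t - exp (- t) - 2 * t) 0 y (fun t => exp t + exp (- t) - 2)) as [c [Hc E]].
  - intros x _. auto_derive; auto. ring.
  - intros x _. apply continuity_pt_filterlim.
    apply (ex_derive_continuous (V := R_NormedModule) (fun t => exp t - exp (- t) - 2 * t)). auto_derive; auto.
  - rewrite Ropp_0, exp_0 in E. pose proof (exp_pos c). pose proof (exp_pos (- c)).
    assert (exp c * exp (- c) = 1) by (rewrite <- exp_plus, Rplus_opp_r; apply exp_0).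
    rewrite Rmin_left, Rmax_right in Hc by lra.
    assert (Q : 0 <= exp (- c) * ((exp c - 1) * (exp c - 1))) by (apply Rmult_le_pos; [lra | apply Rle_0_sqr]).
    replace (exp (- c) * ((exp c - 1) * (exp c - 1))) with (exp c * exp (- c) * exp c - 2 * (exp c * exp (- c)) + exp (- c)) in Q by ring.
    rewrite H1 in Q.
    assert (0 <= (exp c + exp (- c) - 2) * (y - 0)) by (apply Rmult_le_pos; lra). lra.
Qed.

Lemma Cmod_den_ge_im (a b : R) : 2 * PI * Rabs b <= Cmod (den (a, b)).
Proof.
  pose proof (Cmod_den_sqr a b) as S. pose proof (Cmod_ge_0 (den (a, b))) as P.
  pose proof PI_RGT_0. pose proof (Rle_0_sqr (sin (PI * a))) as Q. unfold Rsqr in Q.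
  pose proof (Rabs_pos b).
  assert (E : (2 * PI * Rabs b) * (2 * PI * Rabs b) <= (exp (PI * b) - exp (- (PI * b))) * (exp (PI * b) - exp (- (PI * b)))).
  { destruct (Rle_dec 0 b) as [L|L].
    - rewrite Rabs_pos_eq by auto. pose proof (exp_minus_ge (PI * b) ltac:(nra)).
      assert (0 <= PI * b) by nra. nra.
    - rewrite Rabs_left by lra. pose proof (exp_minus_ge (- (PI * b)) ltac:(nra)). rewrite Ropp_involutive in H1.
      assert (0 <= - (PI * b)) by nra. nra. }
  apply Rnot_lt_le. intros L. nra.
Qed.

Lemma Cmod_den_ge_sin (a b : R) : 2 * Rabs (sin (PI * a)) <= Cmod (den (a, b)).
Proof.
  pose proof (Cmod_den_sqr a b) as S. pose proof (Cmod_ge_0 (den (a, b))) as P.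
  assert (Q : sin (PI * a) * sin (PI * a) = Rabs (sin (PI * a)) * Rabs (sin (PI * a))) by apply Rsqr_abs.
  pose proof (Rabs_pos (sin (PI * a))). rewrite Q in S.
  pose proof (Rle_0_sqr (exp (PI * b) - exp (- (PI * b)))) as Q2. unfold Rsqr in Q2.
  apply Rnot_lt_le. intros L. nra.
Qed.

(** The condition on (a, b) is met by all SE and SW lines through [al, be]. Where |b| >= d the
    hyperbolic part is large; where |b| < d the abscissa keeps the distance [d] from 0 and from
    1. *)
Lemma den_lower (al be : R) : 0 < al -> be < 1 -> exists kap, 0 < kap /\
  forall a b, al - Rabs b <= a <= be + Rabs b -> kap <= Cmod (den (a, b)).
Proof.
  intros Ha Hb.
  set (d := Rmin (1 / 2) (Rmin (al / 2) ((1 - be) / 2))).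
  assert (Hd : 0 < d) by (repeat apply Rmin_pos; lra).
  assert (D1 : d <= 1 / 2) by apply Rmin_l.
  assert (D2 : d <= al / 2) by (eapply Rle_trans; [apply Rmin_r | apply Rmin_l]).
  assert (D3 : d <= (1 - be) / 2) by (eapply Rle_trans; [apply Rmin_r | apply Rmin_r]).
  pose proof PI_RGT_0.
  assert (Hs : 0 < sin (PI * d)) by (apply sin_gt_0; nra).
  exists (Rmin (2 * PI * d) (2 * sin (PI * d))). split; [apply Rmin_pos; nra|].
  intros a b Hab. destruct (Rle_dec d (Rabs b)).
  - eapply Rle_trans; [apply Rmin_l|]. eapply Rle_trans; [|apply Cmod_den_ge_im]. nra.
  - eapply Rle_trans; [apply Rmin_r|]. eapply Rle_trans; [|apply Cmod_den_ge_sin].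
    apply Rmult_le_compat_l; [lra|].
    assert (L : sin (PI * d) <= sin (PI * a)).
    { destruct (Rle_dec a (1 / 2)).
      - apply sin_incr_1; nra.
      - rewrite <- (sin_PI_x (PI * a)). apply sin_incr_1; nra. }
    rewrite Rabs_pos_eq; lra.
Qed.

Lemma SE_point (c u : R) : (c + u * dir_SE)%C = (c + rt * u, - (rt * u)).
Proof. rewrite dir_SE_eq. apply injective_projections; simpl; ring. Qed.

Lemma SW_point (c u : R) : (c + u * dir_SW)%C = (c - rt * u, - (rt * u)).
Proof. rewrite dir_SW_eq. apply injective_projections; simpl; ring. Qed.

Lemma den_lower_lines (al be : R) : 0 < al -> be < 1 -> exists kap, 0 < kap /\
  forall c u : R, al <= c <= be -> kap <= Cmod (den (c + u * dir_SE)%C) /\ kap <= Cmod (den (c + u * dir_SW)%C).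
Proof.
  intros Ha Hb. destruct (den_lower al be Ha Hb) as [k [Hk K]]. exists k. split; auto.
  intros c u Hc. rewrite SE_point, SW_point.
  pose proof (Rle_abs (rt * u)). pose proof (Rle_abs (- (rt * u))).
  split; apply K; rewrite Rabs_Ropp in *; lra.
Qed.

Lemma cexp_pi_ci_Z (n : Z) : cexp (RtoC PI * ci * IZR n) = RtoC (powerRZ (-1) n).
Proof.
  assert (N : forall n : nat, cexp (RtoC PI * ci * INR n) = RtoC ((-1) ^ n)).
  { induction n0 as [|k IH].
    - simpl. rewrite Cmult_0_r, cexp_0. reflexivity.
    - rewrite S_INR, RtoC_plus. replace (RtoC PI * ci * (INR k + 1))%C with (RtoC PI * ci * INR k + PI * ci)%C by ring.
      rewrite cexp_plus, IH, cexp_ci, cos_PI, sin_PI. apply injective_projections; simpl; ring. }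
  destruct n as [|p|p].
  - simpl. rewrite Cmult_0_r, cexp_0. reflexivity.
  - simpl. rewrite <- N. f_equal. rewrite INR_IPR. reflexivity.
  - simpl. change (IZR (Z.neg p)) with (- IZR (Z.pos p)). 
    replace (RtoC PI * ci * (- IZR (Z.pos p))%R)%C with (- (RtoC PI * ci * IZR (Z.pos p)))%C by (rewrite RtoC_opp; ring).
    rewrite cexp_opp.
    replace (cexp (PI * ci * IZR (Z.pos p))) with (RtoC ((-1) ^ Pos.to_nat p)).
    + symmetry. apply RtoC_inv. apply pow_nonzero. lra.
    + rewrite <- N. f_equal. rewrite INR_IPR. reflexivity.
Qed.

Lemma powerRZ_m1_sqr (n : Z) : (RtoC (powerRZ (-1) n) * RtoC (powerRZ (-1) n))%C = RtoC 1.
Proof.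
  rewrite <- RtoC_mult.
  f_equal. rewrite <- powerRZ_mult. replace (-1 * -1) with 1 by ring. apply powerRZ_R1.
Qed.

Lemma Cmod_powerRZ_m1 (n : Z) : Cmod (powerRZ (-1) n) = 1.
Proof.
  pose proof (f_equal Cmod (powerRZ_m1_sqr n)) as H. rewrite Cmod_mult, Cmod_1 in H.
  pose proof (Cmod_ge_0 (powerRZ (-1) n)). nra.
Qed.

Lemma den_shift (n : Z) (x : C) : den (IZR n + x) = (powerRZ (-1) n * den x)%C.
Proof.
  unfold den.
  replace (RtoC PI * ci * (IZR n + x))%C with (RtoC PI * ci * IZR n + RtoC PI * ci * x)%C by ring.
  replace (- (RtoC PI * ci * IZR n + RtoC PI * ci * x))%C with (- (RtoC PI * ci * IZR n) + - (RtoC PI * ci * x))%C by ring.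
  rewrite !cexp_plus, (cexp_opp (RtoC PI * ci * IZR n)), cexp_pi_ci_Z.
  pose proof (powerRZ_m1_sqr n) as S. set (s := RtoC (powerRZ (-1) n)) in *.
  assert (s <> RtoC 0) by (intros E; rewrite E, Cmult_0_l in S; apply C1_neq_0; auto).
  replace (/ s)%C with s by (rewrite <- (Cmult_1_l (/ s)), <- S; field; auto). ring.
Qed.

Lemma den_opp x : den (- x) = (- den x)%C.
Proof. unfold den. replace (RtoC PI * ci * - x)%C with (- (RtoC PI * ci * x))%C by ring. replace (- - (RtoC PI * ci * x))%C with (RtoC PI * ci * x)%C by ring. ring. Qed.

Definition den' (x : C) : C := (RtoC PI * ci * (cexp (RtoC PI * ci * x) + cexp (- (RtoC PI * ci * x))))%C.

Lemma holo_den x : holo den x (den' x).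
Proof. unfold den, den'. eapply holo_eq; [holo_tac|]. cbv beta. ring. Qed.

Lemma continuous_den (x : C) : continuous den x.
Proof. unfold den. ccont. Qed.

Lemma continuous_den' (x : C) : continuous den' x.
Proof. unfold den'. ccont. Qed.

(** * Gaussian integrals along lines of direction SE *)

(** The square of [dir_SE] is - i, so in this direction the modulus behaves like exp (- A u^2): the
    SE lines are those of steepest descent. *)
Definition gau (A : R) (a x : C) : C := cexp (- (A * ci * ((x - a) * (x - a)))).

Lemma holo_gau A a x : holo (gau A a) x (gau A a x * - (A * ci * (2 * (x - a)))).
Proof. unfold gau. eapply holo_eq; [holo_tac|]. cbv beta. ring. Qed.

Lemma continuous_gau (A : R) (a x : C) : continuous (gau A a) x.
Proof. unfold gau. ccont. Qed.

Definition gau_const (A E : R) : R := exp (A * (E * E)) * (4 * exp ((2 * A * E + 1) * (2 * A * E + 1) / (4 * A))).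

Lemma gau_const_pos A E : 0 < gau_const A E.
Proof. unfold gau_const. apply Rmult_lt_0_compat; [apply exp_pos|]. pose proof (exp_pos ((2 * A * E + 1) * (2 * A * E + 1) / (4 * A))). lra. Qed.

Lemma Cmod_dir_SE : Cmod dir_SE = 1.
Proof.
  pose proof (Cmod_sqr dir_SE) as H. rewrite dir_SE_eq in *. simpl in H.
  pose proof rt_sqr. pose proof (Cmod_ge_0 (rt, - rt)). nra.
Qed.

Lemma gau_bound_exp (A E c u : R) (a : C) : 0 < A -> Cmod (c - a) <= E ->
  Cmod (gau A a (c + u * dir_SE)) <= exp (A * (E * E)) * exp (- (A * (u * u)) + 2 * A * E * Rabs u).
Proof.
  intros HA HE. unfold gau. set (e := (c - a)%C) in *.
  replace ((c + u * dir_SE - a) * (c + u * dir_SE - a))%C with (dir_SE * dir_SE * (u * u) + (2 * u * (dir_SE * e) + e * e))%C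
    by (unfold e; ring).
  rewrite dir_SE_sqr.
  replace (- (A * ci * (- ci * (u * u) + (2 * u * (dir_SE * e) + e * e))))%C with
   (ci * ci * (A * (u * u)) + - (A * ci * (2 * u * (dir_SE * e) + e * e)))%C by ring.
  rewrite ci_sqr, cexp_plus, Cmod_mult.
  replace (- (1) * (A * (u * u)))%C with (RtoC (- (A * (u * u)))) by (repeat rewrite ?RtoC_opp, ?RtoC_mult; ring).
  rewrite cexp_R, Cmod_R, Rabs_pos_eq by (left; apply exp_pos).
  rewrite exp_plus. rewrite (Rmult_comm (exp (A * (E * E)))), Rmult_assoc.
  apply Rmult_le_compat_l; [left; apply exp_pos|].
  eapply Rle_trans; [apply Cmod_cexp_le|]. rewrite <- exp_plus. apply exp_le.
  rewrite Cmod_opp, !Cmod_mult. change ci with Ci. rewrite Cmod_Ci, Cmod_R, (Rabs_pos_eq A) by lra.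
  pose proof (Cmod_ge_0 e). pose proof (Rabs_pos u).
  assert (Cmod (2 * u * (dir_SE * e) + e * e) <= 2 * E * Rabs u + E * E).
  { eapply Rle_trans; [apply Cmod_triangle|]. rewrite !Cmod_mult, Cmod_dir_SE, !Cmod_R, (Rabs_pos_eq 2) by lra. nra. }
  nra.
Qed.

Lemma gau_bound (A E c u : R) (a : C) : 0 < A -> Cmod (c - a) <= E ->
  Cmod (gau A a (c + u * dir_SE)) <= gau_const A E / (1 + u * u).
Proof.
  intros HA HE. eapply Rle_trans; [now apply (gau_bound_exp A E)|].
  unfold gau_const, Rdiv. rewrite (Rmult_assoc (exp (A * (E * E)))) . apply Rmult_le_compat_l; [left; apply exp_pos|].
  exact (exp_gauss_dom A (2 * A * E) u HA).
Qed.

Lemma gauss_line (A c : R) (a : C) : 0 < A ->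
  CInt_line (fun u => gau A a (c + u * dir_SE)) = RtoC (sqrt PI / sqrt A).
Proof.
  intros HA. assert (HS : 0 < sqrt A) by now apply sqrt_lt_R0.
  rewrite <- (gaussian (sqrt A) (sqrt A * (c - a) / dir_SE) HS).
  apply IntR_ext. intros u. unfold gau. f_equal. f_equal.
  assert (S2 : (sqrt A * sqrt A)%C = RtoC A) by (rewrite <- RtoC_mult, sqrt_sqrt; auto; lra).
  pose proof dir_SE_neq_0 as D0. pose proof dir_SE_sqr as D2.
  transitivity ((sqrt A * sqrt A) * ((c + u * dir_SE - a) * (c + u * dir_SE - a)) / (dir_SE * dir_SE))%C; [|field; auto].
  rewrite S2, D2.
  transitivity (- (ci * ci) * A * ((c + u * dir_SE - a) * (c + u * dir_SE - a)) / - ci)%C; [|rewrite ci_sqr; field; apply ci_neq_0].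
  field. apply ci_neq_0.
Qed.

(** * Powers as Mellin integrals along the line *)

Lemma clog_dir_SE : clog dir_SE = ((- (PI / 4))%R * ci)%C.
Proof.
  unfold dir_SE. rewrite clog_cexp; [f_equal; f_equal; field|].
  pose proof PI_RGT_0. unfold ci; simpl. lra.
Qed.

(** The principal value of [dir_SE] to the power - w. *)
Definition mu (w : C) : C := cexp (w * ((PI / 4)%R * ci)).

Lemma Re_SE_dir (c u : R) : Re ((c + u * dir_SE) * dir_SE) = c * rt.
Proof. rewrite dir_SE_eq. simpl. pose proof rt_sqr. nra. Qed.

(** A point of the line times [dir_SE] has its argument in (- pi / 2, pi / 2), so its logarithm is
    the sum of the two logarithms. *)
Lemma mellin_power (w : C) (c u : R) : 0 < Re w -> 0 < c ->
  CInt_line (fun t => cexp (w * t - ((c + u * dir_SE) * dir_SE) * cexp t)) = (Gam w * mu w * cexp (- w * clog (c + u * dir_SE)))%C.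
Proof.
  intros Hw Hc. pose proof rt_pos.
  rewrite gint_value by (auto; rewrite Re_SE_dir; nra).
  rewrite <- Cmult_assoc. f_equal. unfold mu. rewrite <- cexp_plus. f_equal.
  destruct (carg_SE_line c u Hc) as [N B].
  rewrite clog_mult, clog_dir_SE; auto.
  - rewrite RtoC_opp. ring.
  - apply dir_SE_neq_0.
  - pose proof PI_RGT_0. assert (carg dir_SE = - (PI / 4)).
    { pose proof (f_equal Im clog_dir_SE) as E. simpl in E. rewrite E. unfold ci; simpl. ring. }
    lra.
Qed.

Lemma Cmod_SE_line_ge (c u : R) : 0 < c -> c * rt <= Cmod (c + u * dir_SE).
Proof.
  intros Hc. pose proof (Re_SE_dir c u) as E. pose proof (re_le_Cmod ((c + u * dir_SE) * dir_SE)) as B.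
  rewrite E, Cmod_mult, Cmod_dir_SE, Rmult_1_r in B. pose proof (Rle_abs (c * rt)). lra.
Qed.

Lemma SE_power_bound (w : C) (c0 c u : R) : 0 < Re w -> 0 < c0 <= c ->
  Cmod (cexp (- w * clog (c + u * dir_SE))) <= exp (- (Re w * ln (c0 * rt)) + PI * Rabs (Im w)).
Proof.
  intros Hw Hc. pose proof rt_pos. rewrite Cmod_cexp. apply exp_le.
  destruct (carg_SE_line c u ltac:(lra)) as [N B].
  pose proof (Cmod_SE_line_ge c u ltac:(lra)) as L.
  set (x := (c + u * dir_SE)%C) in *.
  replace (Re (- w * clog x)%C) with (- (Re w * ln (Cmod x)) + Im w * carg x) by (unfold clog, Re, Im; simpl; ring).
  apply Rplus_le_compat.
  - apply Ropp_le_contravar, Rmult_le_compat_l; [lra|]. apply ln_le; nra.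
  - eapply Rle_trans; [apply Rle_abs|]. rewrite Rabs_mult, Rmult_comm. apply Rmult_le_compat_r; [apply Rabs_pos|].
    pose proof PI_RGT_0. apply Rabs_le. lra.
Qed.

Lemma continuous_SE_power (w : C) (c u : R) : 0 < c -> continuous (fun u : R => cexp (- w * clog (c + u * dir_SE))) u.
Proof.
  intros Hc. apply continuous_cexp, continuous_Cmult; [apply continuous_const|].
  apply (continuous_comp (fun u : R => (c + u * dir_SE)%C) clog); [ccont|].
  now apply continuous_clog, slit_SE_line.
Qed.

(** Fubini: the power is itself a Mellin integral, and after the exchange the inner integral over
    the line contains only an exponential linear in x. *)
Lemma mellin_line (kap : R -> C) (M c : R) (w : C) : 0 < Re w -> 0 < c -> dom M kap ->
  (exists N, dom N (fun t => CInt_line (fun u => kap u * cexp (w * t - ((c + u * dir_SE) * dir_SE) * cexp t))%C)) /\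
  (Gam w * mu w * CInt_line (fun u => kap u * cexp (- w * clog (c + u * dir_SE)))%C)%C =
  CInt_line (fun t => CInt_line (fun u => kap u * cexp (w * t - ((c + u * dir_SE) * dir_SE) * cexp t))%C).
Proof.
  intros Hw Hc D. pose proof (dom_pos _ _ D) as HM. pose proof rt_pos.
  set (F := fun u t : R => (kap u * cexp (w * t - ((c + u * dir_SE) * dir_SE) * cexp t))%C).
  assert (CF : cont2 F).
  { intros u t. apply continuous_Cmult.
    - apply (continuous_comp fst kap); [apply continuous_fst | apply D].
    - apply continuous_cexp.
      assert (C1 : continuous (fun z : R * R => RtoC (fst z)) (u, t)) by (apply continuous_RtoC, continuous_fst).
      assert (C2 : continuous (fun z : R * R => RtoC (snd z)) (u, t)) by (apply continuous_RtoC, continuous_snd).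
      apply continuous_Cminus; [apply continuous_Cmult; [apply continuous_const | exact C2]|].
      apply continuous_Cmult; [|now apply continuous_cexp].
      apply continuous_Cmult; [|apply continuous_const].
      apply continuous_Cplus; [apply continuous_const|].
      apply continuous_Cmult; [exact C1 | apply continuous_const]. }
  set (K := mellin_const (Re w) (c * rt)).
  assert (BF : forall u t, Cmod (F u t) <= (M * K) / ((1 + u * u) * (1 + t * t))).
  { intros u t. unfold F. rewrite Cmod_mult, Cmod_gint, Re_SE_dir.
    replace (M * K / ((1 + u * u) * (1 + t * t))) with ((M / (1 + u * u)) * (K / (1 + t * t))).
    2:{ field. pose proof (one_plus_sqr_pos u). pose proof (one_plus_sqr_pos t). lra. }
    apply Rmult_le_compat; [apply Cmod_ge_0 | left; apply exp_pos | apply D | apply mellin_bound; nra]. }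
  split.
  { exists (PI * (M * K)). apply (dom_IntR_param (fun t u => F u t)); [now apply cont2_swap|].
    intros t u. rewrite (Rmult_comm (1 + t * t)). apply BF. }
  pose proof (IntR_Fubini F _ CF BF) as E. unfold F in E. rewrite <- E.
  rewrite <- (IntR_scal (M * exp (- (Re w * ln (c * rt)) + PI * Rabs (Im w)))).
  - apply IntR_ext. intros u.
    rewrite (IntR_scal (mellin_const (Re w) (c * rt))).
    + rewrite mellin_power by auto. ring.
    + pose proof (dom_gint w ((c + u * dir_SE) * dir_SE) Hw) as G. rewrite Re_SE_dir in G. apply G. nra.
  - split.
    + intros u. apply continuous_Cmult; [apply D | now apply continuous_SE_power].
    + intros u. rewrite Cmod_mult. unfold Rdiv.
      replace (M * exp (- (Re w * ln (c * rt)) + PI * Rabs (Im w)) * / (1 + u * u)) with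
        (M / (1 + u * u) * exp (- (Re w * ln (c * rt)) + PI * Rabs (Im w))) by (unfold Rdiv; ring).
      apply Rmult_le_compat; try apply Cmod_ge_0; [apply D | apply SE_power_bound; auto; lra].
Qed.

(** * Crossing a pole *)

Lemma gau_linear (x Y : C) :
  (gau PI 0 x * cexp (- (x * Y)))%C = (cexp (- (ci * (Y * Y) / (4 * PI))) * gau PI (ci * Y / (2 * PI)) x)%C.
Proof.
  assert (HP : RtoC PI <> RtoC 0) by (intros E; apply RtoC_inj in E; pose proof PI_RGT_0; lra).
  unfold gau. rewrite <- !cexp_plus. f_equal.
  transitivity (- (PI * ci * (x * x)) + ci * ci * (x * Y) - (ci * (1 + ci * ci)) * (Y * Y) / (4 * PI))%C.
  - rewrite ci_sqr. field. auto.
  - field. auto.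
Qed.

Lemma IntR_gau_linear (c : R) (Y : C) :
  CInt_line (fun u => gau PI 0 (c + u * dir_SE) * cexp (- ((c + u * dir_SE) * Y)))%C = cexp (- (ci * (Y * Y) / (4 * PI))).
Proof.
  rewrite (IntR_ext _ _ (fun u => gau_linear (c + u * dir_SE) Y)).
  assert (HP := PI_RGT_0).
  rewrite (IntR_scal (gau_const PI (Cmod (c - ci * Y / (2 * PI))))).
  - rewrite gauss_line by auto. replace (sqrt PI / sqrt PI) with 1 by (field; apply Rgt_not_eq, sqrt_lt_R0; auto). ring.
  - split.
    + intros u. apply (continuous_comp (fun u : R => (c + u * dir_SE)%C)); [ccont | apply continuous_gau].
    + intros u. apply gau_bound; auto. lra.
Qed.

Lemma half_gaussian : CInt_line (fun t => cexp t * cexp (- (RtoC (exp (2 * t) / (4 * PI)))))%C = RtoC PI.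
Proof.
  pose proof PI_RGT_0 as HP. assert (HS : 0 < sqrt PI) by now apply sqrt_lt_R0.
  assert (SS : sqrt PI * sqrt PI = PI) by (apply sqrt_sqrt; lra).
  set (k := / (2 * sqrt PI)). assert (Hk : 0 < k) by (apply Rinv_0_lt_compat; lra).
  assert (D : dom (4 * exp ((0 + 1) * (0 + 1) / (4 * (k * k)))) (fun u => cexp (- ((k * u + 0) * (k * u + 0))))).
  { split; [intros; ccont|]. intros t.
    replace (- ((k * t + 0) * (k * t + 0)))%C with (RtoC (- (k * k * (t * t)) + 0 * Rabs t)).
    - rewrite cexp_R, Cmod_R, Rabs_pos_eq by (left; apply exp_pos). apply exp_gauss_dom. nra.
    - repeat rewrite ?RtoC_plus, ?RtoC_opp, ?RtoC_mult. ring. }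
  pose proof (gaussian k 0 Hk) as G. rewrite (IntR_split_exp _ _ D) in G.
  assert (F : forall s : R, s * s = 1 -> forall t : R,
    (exp t * cexp (- ((k * (s * exp t)%R + 0) * (k * (s * exp t)%R + 0))))%C = (cexp t * cexp (- (RtoC (exp (2 * t) / (4 * PI)))))%C).
  { intros s Hs t. rewrite (cexp_R t). f_equal. f_equal.
    transitivity (- RtoC ((k * (s * exp t)) * (k * (s * exp t))))%C.
    - repeat rewrite ?RtoC_mult. ring.
    - f_equal. f_equal. replace (2 * t) with (t + t) by ring. rewrite exp_plus.
      replace (k * (s * exp t) * (k * (s * exp t))) with (k * k * (s * s) * (exp t * exp t)) by ring.
      rewrite Hs. unfold k. rewrite <- SS at 3. field. lra. }
  rewrite (IntR_ext _ _ (F 1 ltac:(ring))), (IntR_ext _ _ (F (-1) ltac:(ring))) in G.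
  set (I := CInt_line _) in *.
  replace (sqrt PI / k) with (2 * PI) in G by (unfold k; rewrite <- SS at 1; field; lra).
  replace I with (RtoC (/ 2) * (I + I))%C by (rewrite RtoC_inv by lra; field).
  rewrite G, <- RtoC_mult. f_equal. field.
Qed.

Lemma cexp_opp_1_clog (x : C) : x <> RtoC 0 -> cexp (- (1) * clog x) = (/ x)%C.
Proof.
  intros H. replace (- (1) * clog x)%C with (- clog x)%C by ring. now rewrite cexp_opp, cexp_clog.
Qed.

Lemma mu_1 : (mu 1 * dir_SE)%C = RtoC 1.
Proof.
  unfold mu, dir_SE. rewrite <- cexp_plus.
  replace (1 * ((PI / 4)%R * ci) + (- PI / 4)%R * ci)%C with (((PI / 4)%R + (- PI / 4)%R) * ci)%C by ring.
  rewrite <- RtoC_plus. replace (PI / 4 + - PI / 4) with 0 by field.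
  rewrite Cmult_0_l. apply cexp_0.
Qed.

(** Writing 1 / x as a Mellin integral with w = 1 reduces this to Gaussians. The value is half of a
    residue; a line on the other side of 0 gives the opposite sign, and the difference of the two
    takes the place of the residue theorem. *)
Lemma IntR_gau_over_x (c : R) : 0 < c ->
  (CInt_line (fun u => gau PI 0 (c + u * dir_SE) / (c + u * dir_SE)) * dir_SE)%C = (- (PI * ci))%C.
Proof.
  intros Hc. assert (HP := PI_RGT_0).
  assert (D : dom (gau_const PI c) (fun u : R => gau PI 0 (c + u * dir_SE))).
  { split.
    - intros u. apply (continuous_comp (fun u : R => (c + u * dir_SE)%C)); [ccont | apply continuous_gau].
    - intros u. apply gau_bound; auto. replace (c - 0)%C with (RtoC c) by ring. rewrite Cmod_R, Rabs_pos_eq; lra. }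
  pose proof (proj2 (mellin_line _ _ c 1 ltac:(simpl; lra) Hc D)) as E.
  rewrite Gam_1 in E.
  rewrite (IntR_ext _ (fun u => gau PI 0 (c + u * dir_SE) / (c + u * dir_SE))%C) in E.
  2:{ intros u. rewrite cexp_opp_1_clog; [reflexivity | now apply carg_SE_line]. }
  rewrite (IntR_ext (fun t => CInt_line _) (fun t => cexp t * cexp (- (RtoC (exp (2 * t) / (4 * PI)))))%C) in E.
  2:{ intros t. set (Y := (dir_SE * cexp t)%C).
      rewrite (IntR_ext _ (fun u => cexp t * (gau PI 0 (c + u * dir_SE) * cexp (- ((c + u * dir_SE) * Y))))%C).
      2:{ intros u. replace (1 * t - (c + u * dir_SE) * dir_SE * cexp t)%C with (t + - ((c + u * dir_SE) * Y))%C by (unfold Y; ring).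
          rewrite cexp_plus. ring. }
      rewrite (IntR_scal (Cmod (cexp (- (ci * (Y * Y) / (4 * PI)))) * gau_const PI (Cmod (c - ci * Y / (2 * PI))))).
      - rewrite IntR_gau_linear. f_equal. f_equal. f_equal. unfold Y.
        assert (HPc : RtoC PI <> RtoC 0) by (intros K; apply RtoC_inj in K; lra).
        transitivity (ci * (dir_SE * dir_SE) * (cexp t * cexp t) / (4 * PI))%C; [field; auto|].
        rewrite dir_SE_sqr, <- cexp_plus, <- RtoC_plus, cexp_R.
        replace (t + t) with (2 * t) by ring.
        rewrite RtoC_div, RtoC_mult by lra.
        transitivity (- (ci * ci) * exp (2 * t) / (4 * PI))%C; [field; auto|]. rewrite ci_sqr. field. auto.
      - apply (dom_ext _ (fun u => cexp (- (ci * (Y * Y) / (4 * PI))) * gau PI (ci * Y / (2 * PI)) (c + u * dir_SE))%C).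
        + intros u. now rewrite gau_linear.
        + apply dom_scal. split.
          * intros u. apply (continuous_comp (fun u : R => (c + u * dir_SE)%C)); [ccont | apply continuous_gau].
          * intros u. apply gau_bound; auto. lra. }
  rewrite half_gaussian in E.
  set (I := CInt_line _) in *. pose proof mu_1 as M. pose proof dir_SE_sqr as S.
  replace (I * dir_SE)%C with ((mu 1 * dir_SE) * (I * dir_SE))%C by (rewrite M; ring).
  transitivity ((1 * mu 1 * I) * (dir_SE * dir_SE))%C; [ring|]. rewrite E, S. ring.
Qed.

Lemma line_shift_SE (f f' : C -> C) (a b c0 c1 : R) :
  a < c0 < b -> a < c1 < b ->
  (forall c u : R, a < c < b -> holo f (c + u * dir_SE)%C (f' (c + u * dir_SE)%C)) ->
  (forall c u : R, a < c < b -> continuous f' (c + u * dir_SE)%C) ->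
  (forall x y, a < x -> y < b -> exists M, forall c u : R, x <= c <= y ->
     Cmod (f (c + u * dir_SE))%C <= M / (1 + u * u)) ->
  CInt_line (fun u => f (c0 + u * dir_SE)%C) = CInt_line (fun u => f (c1 + u * dir_SE)%C).
Proof.
  intros H0 H1 Hh Hc Hd.
  assert (E : forall c u : R, (RtoC 0 + c * 1 + u * dir_SE = c + u * dir_SE)%C) by (intros; ring).
  pose proof (line_shift f f' 0 1 dir_SE a b c0 c1 dir_SE_neq_0 H0 H1) as L.
  rewrite (IntR_ext _ (fun u => f (c0 + u * dir_SE)%C)) in L by (intros; now rewrite E).
  rewrite (IntR_ext (fun u => f (0 + c1 * 1 + u * dir_SE)%C) (fun u => f (c1 + u * dir_SE)%C)) in L by (intros; now rewrite E).
  apply L.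
  - intros. rewrite E. auto.
  - intros. rewrite E. auto.
  - intros x y Hx Hy. destruct (Hd x y Hx Hy) as [M K]. exists M. intros. rewrite E. auto.
Qed.

Lemma den_lower_SE_neg (al be : R) : -1 < al -> be < 0 -> exists kap, 0 < kap /\
  forall c u : R, al <= c <= be -> kap <= Cmod (den (c + u * dir_SE)%C).
Proof.
  intros Ha Hb. destruct (den_lower_lines (1 + al) (1 + be) ltac:(lra) ltac:(lra)) as [k [Hk K]].
  exists k. split; auto. intros c u Hc. specialize (K (1 + c) u ltac:(lra)). destruct K as [K _].
  replace ((1 + c)%R + u * dir_SE)%C with (IZR 1 + (c + u * dir_SE))%C in K by (rewrite RtoC_plus; ring).
  rewrite (den_shift 1), Cmod_mult, Cmod_powerRZ_m1, Rmult_1_l in K. exact K.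
Qed.

Lemma den_neq_0_of_lower (x : C) (k : R) : 0 < k -> k <= Cmod (den x) -> den x <> RtoC 0.
Proof. intros Hk K. apply Cmod_gt_0. lra. Qed.

Lemma Rinv_bound_div (x k m : R) : 0 < k -> k <= m -> 0 <= x -> x / m <= x / k.
Proof. intros. apply Rmult_le_compat_l; auto. apply Rinv_le_contravar; auto. Qed.

(** The two strips adjacent to the zero of [den] at 0; strips between other integers are reduced to
    them by translation. *)
Lemma over_den_const (g g' : C -> C) (n : Z) (lo hi c0 c1 : R) :
  (lo = 0 /\ hi = 1) \/ (lo = -1 /\ hi = 0) ->
  lo < c0 < hi -> lo < c1 < hi ->
  (forall c u : R, lo < c < hi -> holo g (c + u * dir_SE)%C (g' (c + u * dir_SE)%C)) ->
  (forall c u : R, lo < c < hi -> continuous g' (c + u * dir_SE)%C) ->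
  (forall x y, lo < x -> y < hi -> exists M, forall c u : R, x <= c <= y ->
     Cmod (g (c + u * dir_SE))%C <= M / (1 + u * u)) ->
  CInt_line (fun u => g (c0 + u * dir_SE) / den (c0 + u * dir_SE))%C =
  CInt_line (fun u => g (c1 + u * dir_SE) / den (c1 + u * dir_SE))%C.
Proof.
  intros Hlh H0 H1 Hh Hc Hd.
  assert (LB : forall x y, lo < x -> y < hi -> exists kap, 0 < kap /\
    forall c u : R, x <= c <= y -> kap <= Cmod (den (c + u * dir_SE)%C)).
  { intros x y Hx Hy. destruct Hlh as [[-> ->] | [-> ->]].
    - destruct (den_lower_lines x y Hx Hy) as [k [Hk K]]. exists k. split; [exact Hk|]. intros c u Hcc. exact (proj1 (K c u Hcc)).
    - exact (den_lower_SE_neg x y Hx Hy). }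
  assert (N0 : forall c u : R, lo < c < hi -> den (c + u * dir_SE)%C <> RtoC 0).
  { intros c u Hcc. destruct (LB c c ltac:(lra) ltac:(lra)) as [k [Hk K]]. apply (den_neq_0_of_lower _ k); auto. apply K; lra. }
  apply (line_shift_SE (fun x => g x / den x)%C (fun x => (g' x * den x - g x * den' x) / (den x * den x))%C lo hi c0 c1 H0 H1).
  - intros c u Hcc. exact (holo_div g den _ _ _ (Hh c u Hcc) (holo_den _) (N0 c u Hcc)).
  - intros c u Hcc. set (x := (c + u * dir_SE)%C).
    assert (Cg : continuous g x) by exact (holo_continuous _ _ _ (Hh c u Hcc)).
    assert (Cg' : continuous g' x) by exact (Hc c u Hcc).
    pose proof (continuous_den x) as Cd. pose proof (continuous_den' x) as Cd'.
    apply (continuous_Cdiv (fun x => g' x * den x - g x * den' x)%C (fun x => den x * den x)%C).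
    + apply (continuous_Cminus (fun x => g' x * den x)%C (fun x => g x * den' x)%C).
      * exact (continuous_Cmult g' den x Cg' Cd).
      * exact (continuous_Cmult g den' x Cg Cd').
    + exact (continuous_Cmult den den x Cd Cd).
    + exact (Cmult_neq_0 _ _ (N0 c u Hcc) (N0 c u Hcc)).
  - intros x y Hx Hy. destruct (Hd x y Hx Hy) as [M HM]. destruct (LB x y Hx Hy) as [k [Hk K]].
    exists (M / k). intros c u Hcc. specialize (K c u Hcc). specialize (HM c u Hcc).
    rewrite Cmod_div by (apply (den_neq_0_of_lower _ k); auto).
    eapply Rle_trans; [apply (Rinv_bound_div _ k); auto; apply Cmod_ge_0|].
    unfold Rdiv in *. apply (Rmult_le_compat_r (/ k)) in HM; [|left; now apply Rinv_0_lt_compat]. lra.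
Qed.

Lemma den_small (h : C) : Cmod h <= / 16 ->
  Cmod (den h - 2 * (PI * ci * h)) <= 8 / 3 * (PI * Cmod h * (PI * Cmod h)) /\ PI * Cmod h <= Cmod (den h).
Proof.
  intros Hh. pose proof PI_RGT_0. pose proof PI_4. pose proof (Cmod_ge_0 h).
  set (z := (RtoC PI * ci * h)%C).
  assert (Hz : Cmod z = PI * Cmod h).
  { unfold z. rewrite !Cmod_mult, Cmod_R, Rabs_pos_eq by lra. change ci with Ci. rewrite Cmod_Ci. ring. }
  assert (Hz4 : Cmod z <= / 4) by (rewrite Hz; nra).
  pose proof (Cmod_ge_0 z) as Hz0.
  pose proof (Cmod_cexp_minus_1_z z) as A. pose proof (Cmod_cexp_minus_1_z (- z)) as B. rewrite Cmod_opp in B.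
  assert (E : exp (Cmod z) <= 4 / 3).
  { replace (Cmod z) with (- - Cmod z) by ring. rewrite exp_Ropp.
    replace (4 / 3) with (/ (3 / 4)) by field. apply Rinv_le_contravar; [lra|].
    assert (1 + - Cmod z <= exp (- Cmod z)).
    { destruct (Req_dec (Cmod z) 0) as [->|N]; [rewrite Ropp_0, exp_0; lra | left; apply exp_ineq1; lra]. } lra. }
  assert (S : Cmod z * Cmod z * exp (Cmod z) <= Cmod z * Cmod z * (4 / 3)) by (apply Rmult_le_compat_l; nra).
  assert (K : Cmod (den h - 2 * z) <= 8 / 3 * (Cmod z * Cmod z)).
  { replace (den h - 2 * z)%C with ((cexp z - 1 - z) - (cexp (- z) - 1 - - z))%C by (unfold den; fold z; ring).
    eapply Rle_trans; [apply Cmod_minus_le|]. lra. }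
  fold z. rewrite <- Hz. split; auto.
  pose proof (Cmod_triangle_rev (2 * z) (2 * z - den h)) as T.
  replace (2 * z - (2 * z - den h))%C with (den h) in T by ring.
  replace (2 * z - den h)%C with (- (den h - 2 * z))%C in T by ring.
  rewrite Cmod_opp, Cmod_mult, Cmod_R, Rabs_pos_eq in T by lra. nra.
Qed.

(** [gau PI 0 h / h] is the model pole: it decays along the line, and its integrals on both sides of
    0 are known. Its coefficient is the residue, so the terms of order 1 / h cancel and only bounded
    ones are left. *)
Lemma pole_part_bounded (g : C -> C) (l : C) : holo g 0 l -> exists r K, 0 < r <= / 16 /\ 0 <= K /\
  forall h, h <> RtoC 0 -> Cmod h < r -> Cmod (g h / den h - g (RtoC 0) / (2 * (PI * ci)) * (gau PI 0 h / h)) <= K.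
Proof.
  intros H. destruct (holo_bound _ _ _ H) as [d [Hd B]]. set (K1 := Cmod l + 1) in *.
  pose proof PI_RGT_0. pose proof PI_4. pose proof (Cmod_ge_0 l).
  set (g0 := g (RtoC 0)) in *. pose proof (Cmod_ge_0 g0) as G0.
  exists (Rmin d (/ 16)), (K1 + 3 * Cmod g0). split; [|split; [unfold K1; lra|]].
  { split; [apply Rmin_pos; lra | apply Rmin_r]. }
  intros h Hh0 Hh. pose proof (Rmin_l d (/ 16)). pose proof (Rmin_r d (/ 16)).
  destruct (den_small h ltac:(lra)) as [D1 D2].
  apply Cmod_gt_0 in Hh0 as Hm. set (m := Cmod h) in *.
  assert (HPc : RtoC PI <> RtoC 0) by (intros E; apply RtoC_inj in E; lra).
  pose proof ci_neq_0 as Hci. pose proof C2_neq_0 as HC2.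
  assert (Hden : den h <> RtoC 0) by (apply Cmod_gt_0; nra).
  specialize (B h ltac:(fold m; lra)). replace (RtoC 0 + h)%C with h in B by ring. fold m in B. fold g0 in B.
  replace (g h / den h - g0 / (2 * (PI * ci)) * (gau PI 0 h / h))%C with
   ((g h - g0) / den h + (g0 * (- (den h - 2 * (PI * ci * h))) / (2 * (PI * ci * h) * den h) + g0 * (- (gau PI 0 h - 1)) / (2 * (PI * ci * h))))%C
   by (field; repeat split; auto).
  assert (Hz : Cmod (PI * ci * h) = PI * m).
  { rewrite !Cmod_mult, Cmod_R, Rabs_pos_eq by lra. change ci with Ci. rewrite Cmod_Ci. fold m. ring. }
  assert (Hzn : (PI * ci * h)%C <> RtoC 0) by (repeat apply Cmult_neq_0; auto).
  assert (PM : 0 < PI * m) by nra.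
  eapply Rle_trans; [apply Cmod_triangle|].
  apply Rle_trans with (K1 + (4 / 3 * Cmod g0 + 3 / 2 * Cmod g0)); [|lra].
  apply Rplus_le_compat.
  { rewrite Cmod_div by auto. eapply Rle_trans; [apply (Rinv_bound_div _ (PI * m)); auto; apply Cmod_ge_0|].
    apply (Rmult_le_reg_r (PI * m)); auto. unfold Rdiv. rewrite Rmult_assoc, Rinv_l, Rmult_1_r by lra.
    pose proof PI2_3_2. assert (K1 * m * 1 <= K1 * m * PI) by (apply Rmult_le_compat_l; [unfold K1; nra | lra]). lra. }
  eapply Rle_trans; [apply Cmod_triangle|]. apply Rplus_le_compat.
  - rewrite Cmod_div, !Cmod_mult, Cmod_opp by (repeat apply Cmult_neq_0; auto).
    replace (Cmod PI * Cmod ci * Cmod h) with (PI * m) by (rewrite <- Hz, !Cmod_mult; reflexivity).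
    rewrite Cmod_R, Rabs_pos_eq by lra.
    assert (Q : 0 < 2 * (PI * m) * Cmod (den h)) by nra.
    apply (Rmult_le_reg_r (2 * (PI * m) * Cmod (den h))); auto. unfold Rdiv. rewrite Rmult_assoc, Rinv_l, Rmult_1_r by lra.
    replace (4 * / 3 * Cmod g0 * (2 * (PI * m) * Cmod (den h))) with (Cmod g0 * (8 / 3 * (PI * m) * Cmod (den h))) by field.
    apply Rmult_le_compat_l; auto. eapply Rle_trans; [exact D1|]. nra.
  - rewrite Cmod_div, !Cmod_mult, Cmod_opp by (repeat apply Cmult_neq_0; auto).
    replace (Cmod PI * Cmod ci * Cmod h) with (PI * m) by (rewrite <- Hz, !Cmod_mult; reflexivity).
    rewrite Cmod_R, Rabs_pos_eq by lra.
    apply (Rmult_le_reg_r (2 * (PI * m))); [lra|]. unfold Rdiv. rewrite Rmult_assoc, Rinv_l, Rmult_1_r by lra.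
    replace (3 * / 2 * Cmod g0 * (2 * (PI * m))) with (Cmod g0 * (3 * (PI * m))) by field.
    apply Rmult_le_compat_l; auto. unfold gau.
    pose proof (Cmod_cexp_minus_1 (- (PI * ci * ((h - 0) * (h - 0))))) as E.
    replace (Cmod (- (PI * ci * ((h - 0) * (h - 0))))) with (PI * m * m) in E.
    2:{ rewrite Cmod_opp, !Cmod_mult, Cmod_R, Rabs_pos_eq by lra. change ci with Ci. rewrite Cmod_Ci.
        replace (h - 0)%C with h by ring. fold m. ring. }
    eapply Rle_trans; [exact E|].
    assert (PI * m * m <= 1) by nra.
    assert (exp (PI * m * m) <= 3).
    { apply Rle_trans with (exp 1); [now apply exp_le | apply exp_le_3]. }
    pose proof (exp_pos (PI * m * m)).
    assert (PI * m * m * exp (PI * m * m) <= PI * m * m * 3) by (apply Rmult_le_compat_l; nra). nra.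
Qed.

Lemma SE_im (c u : R) : Rabs (Im (c + u * dir_SE)%C) = rt * Rabs u.
Proof. rewrite SE_point. simpl. rewrite Rabs_Ropp, Rabs_mult, (Rabs_pos_eq rt); auto. left; apply rt_pos. Qed.

Lemma SE_neq_0 (c u : R) : u <> 0 -> (c + u * dir_SE)%C <> RtoC 0.
Proof.
  intros Hu E. pose proof (SE_im c u) as H. rewrite E in H. simpl in H. rewrite Rabs_R0 in H.
  pose proof rt_pos. pose proof (Rabs_pos_lt u Hu). nra.
Qed.

Lemma Cmod_den_SE (c u : R) : 2 * PI * (rt * Rabs u) <= Cmod (den (c + u * dir_SE)%C).
Proof.
  rewrite SE_point. pose proof (Cmod_den_ge_im (c + rt * u) (- (rt * u))) as H.
  rewrite Rabs_Ropp, Rabs_mult, (Rabs_pos_eq rt) in H; auto. left; apply rt_pos.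
Qed.

Lemma den_SE_neq_0 (c u : R) : u <> 0 -> den (c + u * dir_SE)%C <> RtoC 0.
Proof.
  intros Hu. apply Cmod_gt_0. pose proof (Cmod_den_SE c u). pose proof rt_pos. pose proof (Rabs_pos_lt u Hu).
  pose proof PI_RGT_0. assert (0 < 2 * PI * (rt * Rabs u)) by (apply Rmult_lt_0_compat; [lra | now apply Rmult_lt_0_compat]). lra.
Qed.

Lemma continuous_SE (f : C -> C) (c u : R) :
  continuous f (c + u * dir_SE)%C -> continuous (fun u : R => f (c + u * dir_SE)%C) u.
Proof. apply (continuous_path f). Qed.

Lemma IntR_gau_over_x_neg (c : R) : 0 < c ->
  (CInt_line (fun u => gau PI 0 (- c + u * dir_SE) / (- c + u * dir_SE)) * dir_SE)%C = (PI * ci)%C.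
Proof.
  intros Hc. pose proof PI_RGT_0 as HP. pose proof rt_pos as Hr.
  assert (N : forall u : R, (c + u * dir_SE)%C <> RtoC 0) by (intros u; now apply carg_SE_line).
  assert (D : dom (gau_const PI c / (c * rt)) (fun u => gau PI 0 (c + u * dir_SE) / (c + u * dir_SE))%C).
  { split.
    - intros u. apply continuous_Cdiv; [apply continuous_SE, continuous_gau | ccont | apply N].
    - intros u. rewrite Cmod_div by apply N.
      pose proof (Cmod_SE_line_ge c u Hc).
      eapply Rle_trans; [apply (Rinv_bound_div _ (c * rt)); [nra | auto | apply Cmod_ge_0]|].
      replace (gau_const PI c / (c * rt) / (1 + u * u)) with (gau_const PI c / (1 + u * u) / (c * rt)).
      2:{ field. pose proof (one_plus_sqr_pos u). repeat split; lra. }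
      apply Rmult_le_compat_r; [left; apply Rinv_0_lt_compat; nra|].
      apply gau_bound; auto. replace (c - 0)%C with (RtoC c) by ring. rewrite Cmod_R, Rabs_pos_eq; lra. }
  pose proof (IntR_reflect _ _ D) as R1. pose proof (IntR_opp _ _ (dom_reflect _ _ D)) as R2. cbv beta in R2.
  pose proof (IntR_gau_over_x c Hc) as E.
  rewrite (IntR_ext _ (fun u => - (gau PI 0 (c + (- u)%R * dir_SE) / (c + (- u)%R * dir_SE)))%C).
  - rewrite R2, R1. replace (PI * ci)%C with (- - (PI * ci))%C by ring. rewrite <- E. ring.
  - intros u. replace (- c + u * dir_SE)%C with (- (c + (- u)%R * dir_SE))%C by (rewrite RtoC_opp; ring).
    replace (gau PI 0 (- (c + (- u)%R * dir_SE))) with (gau PI 0 (c + (- u)%R * dir_SE)) by (unfold gau; f_equal; ring).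
    field. apply N.
Qed.

(** After removal of the model pole, the lines through -del and del are compared as del tends to 0.
    Away from [u = 0] the integrands on both sides have the same limit, and near it they are
    bounded, so dominated convergence applies and no removable singularity has to be filled. *)
Lemma pole_jump_0 (g g' : C -> C) (c1 c2 : R) : -1 < c1 < 0 -> 0 < c2 < 1 ->
  (forall c u : R, -1 < c < 1 -> holo g (c + u * dir_SE)%C (g' (c + u * dir_SE)%C)) ->
  (forall c u : R, -1 < c < 1 -> continuous g' (c + u * dir_SE)%C) ->
  (forall x y, -1 < x -> y < 1 -> exists M, forall c u : R, x <= c <= y ->
     Cmod (g (c + u * dir_SE))%C <= M / (1 + u * u)) ->
  ((CInt_line (fun u => g (c1 + u * dir_SE) / den (c1 + u * dir_SE)) -
    CInt_line (fun u => g (c2 + u * dir_SE) / den (c2 + u * dir_SE))) * dir_SE)%C = g (RtoC 0).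
Proof.
  intros H1 H2 Hh Hc Hd. pose proof PI_RGT_0 as HP. pose proof rt_pos as Hr.
  assert (H0 : holo g (RtoC 0) (g' (RtoC 0))).
  { pose proof (Hh 0 0 ltac:(lra)) as K. replace (0 + 0 * dir_SE)%C with (RtoC 0) in K by ring. exact K. }
  destruct (pole_part_bounded g _ H0) as [r [K [[Hr0 Hr16] [HK B0]]]].
  set (rho := (g (RtoC 0) / (2 * (PI * ci)))%C) in *.
  set (P := fun x => (gau PI 0 x / x)%C). set (G := fun x => (g x / den x)%C).
  set (B := fun x => (G x - rho * P x)%C).
  set (u0 := r / 2). set (r1 := r / 2). assert (Hu0 : 0 < u0) by (unfold u0; lra).
  destruct (Hd (- r1) r1) as [M HM]; [unfold r1; lra | unfold r1; lra |].
  assert (M0 : 0 <= M).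
  { pose proof (HM 0 0 ltac:(unfold r1; lra)) as E. replace (M / (1 + 0 * 0)) with M in E by field.
    pose proof (Cmod_ge_0 (g (0 + 0 * dir_SE)%C)). lra. }
  set (gc := gau_const PI 1). assert (Hgc : 0 < gc) by apply gau_const_pos.
  set (s := rt * u0). assert (Hs : 0 < s) by (unfold s; nra).
  set (MB := 2 * K + M / (2 * PI * s) + Cmod rho * (gc / s)).
  assert (X1 : 0 <= M / (2 * PI * s)) by (apply Rmult_le_pos; [auto | left; apply Rinv_0_lt_compat; nra]).
  assert (X2 : 0 <= Cmod rho * (gc / s)) by (apply Rmult_le_pos; [apply Cmod_ge_0|]; apply Rmult_le_pos; [lra | left; now apply Rinv_0_lt_compat]).
  assert (Nz : forall c u : R, c <> 0 -> (c + u * dir_SE)%C <> RtoC 0).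
  { intros c u Hcc E. destruct (Req_dec u 0) as [->|N]; [|now apply (SE_neq_0 c u)].
    replace (c + 0 * dir_SE)%C with (RtoC c) in E by ring. apply RtoC_inj in E. auto. }
  assert (ND : forall c u : R, 0 < Rabs c < 1 -> den (c + u * dir_SE)%C <> RtoC 0).
  { intros c u Hcc. destruct (Req_dec u 0) as [->|N]; [|now apply den_SE_neq_0].
    destruct (Rle_dec 0 c).
    - rewrite Rabs_pos_eq in Hcc by auto. destruct (den_lower_lines c c ltac:(lra) ltac:(lra)) as [k [Hk L]].
      apply (den_neq_0_of_lower _ k Hk). apply (L c 0). lra.
    - rewrite Rabs_left in Hcc by lra. destruct (den_lower_SE_neg c c ltac:(lra) ltac:(lra)) as [k [Hk L]].
      apply (den_neq_0_of_lower _ k Hk). apply (L c 0). lra. }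
  assert (CG : forall c u : R, -1 < c < 1 -> den (c + u * dir_SE)%C <> RtoC 0 -> continuous G (c + u * dir_SE)%C).
  { intros c u Hcc N. apply (continuous_Cdiv g den); auto; [|apply continuous_den].
    exact (holo_continuous _ _ _ (Hh c u Hcc)). }
  assert (CP : forall x, x <> RtoC 0 -> continuous P x).
  { intros x N. apply (continuous_Cdiv (gau PI 0) (fun x => x)); auto; [apply continuous_gau | apply continuous_id]. }
  assert (CB : forall c u : R, -1 < c < 1 -> (c + u * dir_SE)%C <> RtoC 0 -> den (c + u * dir_SE)%C <> RtoC 0 -> continuous B (c + u * dir_SE)%C).
  { intros c u Hcc N1 N2. apply (continuous_Cminus G (fun x => rho * P x)%C); [now apply CG|].
    apply (continuous_Cmult (fun _ => rho) P); [apply continuous_const | now apply CP]. }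
  assert (DB : forall c, 0 < Rabs c < r1 -> dom MB (fun u : R => B (c + u * dir_SE)%C)).
  { intros c Hcc. assert (Hc1 : -1 < c < 1) by (destruct (Rabs_def2 c r1 (proj2 Hcc)); unfold r1 in *; lra).
    assert (Hcn : c <> 0) by (intros ->; rewrite Rabs_R0 in Hcc; lra).
    assert (Hc2 : 0 < Rabs c < 1) by (unfold r1 in *; lra).
    split.
    - intros u. apply continuous_SE. apply CB; auto.
    - intros u. pose proof (one_plus_sqr_pos u) as Q. destruct (Rlt_dec (Rabs u) u0) as [Hu|Hu].
      + assert (Hx : Cmod (c + u * dir_SE) < r).
        { eapply Rle_lt_trans; [apply Cmod_triangle|]. rewrite Cmod_mult, Cmod_dir_SE, !Cmod_R.
          unfold u0, r1 in *. lra. }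
        assert (Cmod (B (c + u * dir_SE)%C) <= K) by (apply B0; auto).
        apply (Rmult_le_reg_r (1 + u * u)); auto. unfold Rdiv. rewrite Rmult_assoc, Rinv_l, Rmult_1_r by lra.
        assert (u * u <= 1).
        { apply Rabs_def2 in Hu. assert (-1 < u < 1) by (unfold u0 in *; lra). nra. }
        pose proof (Cmod_ge_0 (B (c + u * dir_SE)%C)). unfold MB. nra.
      + apply Rnot_lt_le in Hu.
        assert (L1 : 2 * PI * s <= Cmod (den (c + u * dir_SE)%C)).
        { eapply Rle_trans; [|apply Cmod_den_SE]. apply Rmult_le_compat_l; [lra|]. unfold s. apply Rmult_le_compat_l; lra. }
        assert (L2 : s <= Cmod (c + u * dir_SE)%C).
        { eapply Rle_trans; [|apply im_le_Cmod]. rewrite SE_im. unfold s. apply Rmult_le_compat_l; lra. }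
        unfold B. eapply Rle_trans; [apply Cmod_minus_le|].
        assert (E1 : Cmod (G (c + u * dir_SE)%C) <= M / (2 * PI * s) / (1 + u * u)).
        { unfold G. rewrite Cmod_div by auto. eapply Rle_trans; [apply (Rinv_bound_div _ (2 * PI * s)); auto; [nra | apply Cmod_ge_0]|].
          replace (M / (2 * PI * s) / (1 + u * u)) with (M / (1 + u * u) / (2 * PI * s)) by (unfold Rdiv; ring).
          apply Rmult_le_compat_r; [left; apply Rinv_0_lt_compat; nra|]. apply HM.
          destruct (Rabs_def2 c r1 (proj2 Hcc)). lra. }
        assert (E2 : Cmod (rho * P (c + u * dir_SE))%C <= Cmod rho * (gc / s) / (1 + u * u)).
        { rewrite Cmod_mult. unfold Rdiv. rewrite !Rmult_assoc. apply Rmult_le_compat_l; [apply Cmod_ge_0|].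
          unfold P. rewrite Cmod_div by auto. eapply Rle_trans; [apply (Rinv_bound_div _ s); auto; apply Cmod_ge_0|].
          replace (gc * (/ s * / (1 + u * u))) with (gc / (1 + u * u) / s) by (unfold Rdiv; ring).
          apply Rmult_le_compat_r; [left; now apply Rinv_0_lt_compat|]. apply gau_bound; auto.
          replace (c - 0)%C with (RtoC c) by ring. rewrite Cmod_R. lra. }
        unfold MB, Rdiv in *. assert (0 <= 2 * K * / (1 + u * u)) by (apply Rmult_le_pos; [lra | left; now apply Rinv_0_lt_compat]). lra. }
  set (Phi := fun (del u : R) => (B ((- del)%R + u * dir_SE) - B (del + u * dir_SE))%C).
  assert (DPhi : forall del, 0 < del < r1 -> dom (MB + MB) (Phi del)).
  { intros del Hdel. apply dom_minus; apply DB.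
    - rewrite Rabs_Ropp, Rabs_pos_eq; lra.
    - rewrite Rabs_pos_eq; lra. }
  assert (LPhi : forall u eta, u <> 0 -> 0 < eta -> exists q, 0 < q /\ forall del u', 0 < del < q -> Rabs (u' - u) < q ->
     Cmod (Phi del u') <= eta).
  { intros u eta Hu He.
    assert (CB0 : continuous B (RtoC 0 + u * dir_SE)%C).
    { apply (CB 0 u); [lra | now apply SE_neq_0 | now apply den_SE_neq_0]. }
    rewrite continuous_Cmod_eps in CB0.
    destruct (locally_C_ex _ _ (CB0 (eta / 2) ltac:(lra))) as [q [Hq Q]].
    exists (q / 2). split; [lra|]. intros del u' Hdel Hu'.
    assert (Near : forall e, Rabs e = del -> Cmod (e + u' * dir_SE - (0 + u * dir_SE))%C < q).
    { intros e He'. replace (e + u' * dir_SE - (0 + u * dir_SE))%C with (e + (u' - u)%R * dir_SE)%C by (rewrite RtoC_minus; ring).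
      eapply Rle_lt_trans; [apply Cmod_triangle|]. rewrite Cmod_mult, Cmod_dir_SE, !Cmod_R. lra. }
    pose proof (Q _ (Near (- del) ltac:(rewrite Rabs_Ropp, Rabs_pos_eq; lra))) as Q1.
    pose proof (Q _ (Near del ltac:(rewrite Rabs_pos_eq; lra))) as Q2.
    unfold Phi. set (b0 := B (0 + u * dir_SE)%C) in *.
    replace (B ((- del)%R + u' * dir_SE) - B (del + u' * dir_SE))%C with
      ((B ((- del)%R + u' * dir_SE) - b0) - (B (del + u' * dir_SE) - b0))%C by ring.
    eapply Rle_trans; [apply Cmod_minus_le|]. lra. }
  assert (Hr1 : 0 < r1) by (unfold r1; lra).
  pose proof (IntR_dominated_convergence Phi _ r1 Hr1 DPhi LPhi) as DCT.
  set (I1 := CInt_line (fun u => g (c1 + u * dir_SE) / den (c1 + u * dir_SE))%C) in *.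
  set (I2 := CInt_line (fun u => g (c2 + u * dir_SE) / den (c2 + u * dir_SE))%C) in *.
  (* The lines through -del and del are moved to [c1] and [c2], so the quantity that tends to 0 does
     not depend on [del]. *)
  assert (Val : forall del, 0 < del < r1 -> (CInt_line (Phi del) * dir_SE)%C = ((I1 - I2) * dir_SE - g (RtoC 0))%C).
  { intros del Hdel. unfold Phi.
    rewrite (IntR_minus MB MB) by (apply DB; rewrite ?Rabs_Ropp, Rabs_pos_eq; lra).
    (* B = G - rho P; both G and P are individually integrable on each line *)
    assert (DP : forall c, 0 < Rabs c < r1 -> exists m, dom m (fun u : R => P (c + u * dir_SE)%C)).
    { intros c Hcc. assert (Hcn : c <> 0) by (intros ->; rewrite Rabs_R0 in Hcc; lra).
      assert (Lc : forall u : R, Rabs c * rt <= Cmod (c + u * dir_SE)).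
      { intros u. pose proof (re_le_Cmod ((c + u * dir_SE) * dir_SE)) as Z.
        rewrite Re_SE_dir, Cmod_mult, Cmod_dir_SE, Rmult_1_r, Rabs_mult, (Rabs_pos_eq rt) in Z by lra. exact Z. }
      exists (gc / (Rabs c * rt)). split.
      - intros u. apply continuous_SE, CP. auto.
      - intros u. unfold P. rewrite Cmod_div by auto.
        eapply Rle_trans; [apply (Rinv_bound_div _ (Rabs c * rt)); [nra | auto | apply Cmod_ge_0]|].
        replace (gc / (Rabs c * rt) / (1 + u * u)) with (gc / (1 + u * u) / (Rabs c * rt)) by (unfold Rdiv; ring).
        apply Rmult_le_compat_r; [left; apply Rinv_0_lt_compat; nra|]. apply gau_bound; auto.
        replace (c - 0)%C with (RtoC c) by ring. rewrite Cmod_R. unfold r1 in *; lra. }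
    assert (IB : forall c, 0 < Rabs c < r1 -> CInt_line (fun u : R => G (c + u * dir_SE)%C) =
       (CInt_line (fun u : R => B (c + u * dir_SE)%C) + rho * CInt_line (fun u : R => P (c + u * dir_SE)%C))%C).
    { intros c Hcc. destruct (DP c Hcc) as [m Dm]. rewrite <- (IntR_scal m) by auto.
      rewrite <- (IntR_plus MB (Cmod rho * m)); [|now apply DB | now apply dom_scal].
      apply IntR_ext. intros u. unfold B. ring. }
    pose proof (IB (- del) ltac:(rewrite Rabs_Ropp, Rabs_pos_eq; lra)) as J1.
    pose proof (IB del ltac:(rewrite Rabs_pos_eq; lra)) as J2.
    assert (J3 : CInt_line (fun u : R => G ((- del)%R + u * dir_SE)%C) = I1).
    { refine (over_den_const g g' 0 (-1) 0 (- del) c1 (or_intror (conj eq_refl eq_refl)) _ H1 _ _ _); [unfold r1 in *; lra | | | ].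
      - intros; apply Hh; lra.
      - intros; apply Hc; lra.
      - intros x y Hx Hy. apply Hd; lra. }
    assert (J4 : CInt_line (fun u : R => G (del + u * dir_SE)%C) = I2).
    { refine (over_den_const g g' 0 0 1 del c2 (or_introl (conj eq_refl eq_refl)) _ H2 _ _ _); [unfold r1 in *; lra | | | ].
      - intros; apply Hh; lra.
      - intros; apply Hc; lra.
      - intros x y Hx Hy. apply Hd; lra. }
    pose proof (IntR_gau_over_x del (proj1 Hdel)) as J5.
    pose proof (IntR_gau_over_x_neg del (proj1 Hdel)) as J6.
    rewrite (IntR_ext (fun u => gau PI 0 (- del + u * dir_SE) / (- del + u * dir_SE))%C (fun u : R => P ((- del)%R + u * dir_SE)%C)) in J6
      by (intros; unfold P; rewrite RtoC_opp; reflexivity).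
    change (fun u : R => (gau PI 0 (del + u * dir_SE) / (del + u * dir_SE))%C) with (fun u : R => P (del + u * dir_SE)%C) in J5.
    rewrite J3 in J1. rewrite J4 in J2.
    set (b1 := CInt_line (fun u : R => B ((- del)%R + u * dir_SE)%C)) in *.
    set (b2 := CInt_line (fun u : R => B (del + u * dir_SE)%C)) in *.
    set (p1 := CInt_line (fun u : R => P ((- del)%R + u * dir_SE)%C)) in *.
    set (p2 := CInt_line (fun u : R => P (del + u * dir_SE)%C)) in *.
    rewrite J1, J2.
    transitivity ((b1 + rho * p1 - (b2 + rho * p2)) * dir_SE - rho * (p1 * dir_SE - p2 * dir_SE))%C; [ring|].
    rewrite J5, J6. unfold rho. field. split; [apply ci_neq_0 | intros E; apply RtoC_inj in E; lra]. }
  apply Cmod_eq_of_small. intros eps He.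
  destruct (DCT eps He) as [q [Hq Q]].
  set (del := Rmin q r1 / 2). pose proof (Rmin_l q r1). pose proof (Rmin_r q r1). pose proof (Rmin_pos q r1 Hq Hr1).
  rewrite <- (Val del) by (unfold del; lra). rewrite Cmod_mult, Cmod_dir_SE, Rmult_1_r.
  apply Q. unfold del; lra.
Qed.

(** * Integrals over SE lines with the kernel in the denominator *)

Lemma line_integral_SE (c : R) (f : C -> C) : line_integral c dir_SE f = CInt_line (fun u => f (c + u * dir_SE) * dir_SE)%C.
Proof. reflexivity. Qed.

(** The hypotheses of [line_shift_SE]. The majorant may depend on the closed substrip, because a
    negative power of x is unbounded near the origin. *)
Definition nice (g g' : C -> C) (lo hi : R) : Prop :=
  (forall c u : R, lo < c < hi -> holo g (c + u * dir_SE)%C (g' (c + u * dir_SE)%C)) /\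
  (forall c u : R, lo < c < hi -> continuous g' (c + u * dir_SE)%C) /\
  (forall x y, lo < x -> y < hi -> exists M, forall c u : R, x <= c <= y ->
     Cmod (g (c + u * dir_SE))%C <= M / (1 + u * u)).

Lemma nice_sub g g' lo hi lo' hi' : lo <= lo' -> hi' <= hi -> nice g g' lo hi -> nice g g' lo' hi'.
Proof.
  intros H1 H2 [A [B D]]. split; [|split].
  - intros; apply A; lra.
  - intros; apply B; lra.
  - intros x y Hx Hy. apply D; lra.
Qed.

Lemma nice_translate g g' lo hi (n : R) : nice g g' lo hi ->
  nice (fun x => g (n + x)%C) (fun x => g' (n + x)%C) (lo - n) (hi - n).
Proof.
  intros [A [B D]].
  assert (E : forall c u : R, (n + (c + u * dir_SE) = (n + c)%R + u * dir_SE)%C) by (intros; rewrite RtoC_plus; ring).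
  split; [|split].
  - intros c u Hc. eapply holo_eq.
    + apply (holo_comp g (fun x => n + x)%C); [holo_tac|]. rewrite E. apply A. lra.
    + rewrite E. ring.
  - intros c u Hc. apply (continuous_comp (fun x => n + x)%C g'); [ccont|]. rewrite E. apply B. lra.
  - intros x y Hx Hy. destruct (D (n + x) (n + y)) as [M K]; [lra | lra |].
    exists M. intros c u Hc. rewrite E. apply K. lra.
Qed.

Lemma shift_over_den g (n : Z) (c : R) :
  CInt_line (fun u => g (c + u * dir_SE) / den (c + u * dir_SE))%C =
  CInt_line (fun u => (powerRZ (-1) n * g (IZR n + ((c - IZR n)%R + u * dir_SE))) / den ((c - IZR n)%R + u * dir_SE))%C.
Proof.
  apply IntR_ext. intros u.
  replace (c + u * dir_SE)%C with (IZR n + ((c - IZR n)%R + u * dir_SE))%C by (rewrite RtoC_minus; ring).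
  rewrite den_shift. pose proof (powerRZ_m1_sqr n) as S. set (s := RtoC (powerRZ (-1) n)) in *.
  unfold Cdiv. rewrite (Cmult_comm s (g _)), <- Cmult_assoc. f_equal.
  assert (Hs : s <> RtoC 0) by (intros E; rewrite E, Cmult_0_l in S; apply C1_neq_0; auto).
  rewrite <- (Cmult_1_l (/ den _)), <- S.
  (* There is no condition on [c]; at a zero of [den] both sides are 0 because [Cinv] sends 0 to
     0. *)
  destruct (Ceq_dec (den ((c - IZR n)%R + u * dir_SE)) 0) as [Z|Z].
  - rewrite Z, Cmult_0_r. unfold Cinv; simpl. apply injective_projections; simpl; unfold Rdiv; ring_simplify; rewrite ?Rmult_0_l; ring.
  - rewrite S. transitivity ((s * s) * / (s * den ((c - IZR n)%R + u * dir_SE)))%C; [rewrite S; ring | field; auto].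
Qed.

Lemma nice_scal g g' lo hi k : nice g g' lo hi -> nice (fun x => k * g x)%C (fun x => k * g' x)%C lo hi.
Proof.
  intros [A [B D]]. split; [|split].
  - intros. now apply holo_scal, A.
  - intros c u Hc. apply (continuous_Cmult (fun _ => k) g'); [apply continuous_const | now apply B].
  - intros x y Hx Hy. destruct (D x y Hx Hy) as [M K]. exists (Cmod k * M). intros c u Hc.
    rewrite Cmod_mult. unfold Rdiv. rewrite Rmult_assoc. apply Rmult_le_compat_l; [apply Cmod_ge_0 | now apply K].
Qed.

Lemma nice_shifted g g' (n : Z) lo hi : nice g g' (IZR n + lo) (IZR n + hi) ->
  nice (fun x => powerRZ (-1) n * g (IZR n + x))%C (fun x => powerRZ (-1) n * g' (IZR n + x))%C lo hi.
Proof.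
  intros H. apply (nice_scal (fun x => g (IZR n + x)%C) (fun x => g' (IZR n + x)%C)).
  pose proof (nice_translate _ _ _ _ (IZR n) H) as K.
  replace (IZR n + lo - IZR n) with lo in K by ring. replace (IZR n + hi - IZR n) with hi in K by ring. exact K.
Qed.

(* the integral of [g x / (exp(pi i x) - exp(-pi i x))] along the line of direction SE through [c] *)
Definition LI (g : C -> C) (c : R) : C := (CInt_line (fun u => g (c + u * dir_SE) / den (c + u * dir_SE)) * dir_SE)%C.

Lemma LI_const g g' (n : Z) (c0 c1 : R) : nice g g' (IZR n) (IZR n + 1) ->
  IZR n < c0 < IZR n + 1 -> IZR n < c1 < IZR n + 1 -> LI g c0 = LI g c1.
Proof.
  intros H H0 H1. unfold LI. rewrite (shift_over_den g n c0), (shift_over_den g n c1).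
  replace (IZR n) with (IZR n + 0) in H at 1 by ring. apply nice_shifted in H. destruct H as [A [B D]].
  f_equal. apply (over_den_const _ _ 0 0 1 (c0 - IZR n) (c1 - IZR n) (or_introl (conj eq_refl eq_refl)) ltac:(lra) ltac:(lra) A B D).
Qed.

Lemma LI_jump g g' (n : Z) (c0 c1 : R) : nice g g' (IZR n - 1) (IZR n + 1) ->
  IZR n - 1 < c0 < IZR n -> IZR n < c1 < IZR n + 1 -> (LI g c0 - LI g c1)%C = (powerRZ (-1) n * g (RtoC (IZR n)))%C.
Proof.
  intros H H0 H1. unfold LI. rewrite (shift_over_den g n c0), (shift_over_den g n c1).
  apply (nice_shifted g g' n (-1) 1) in H. destruct H as [A [B D]].
  pose proof (pole_jump_0 _ _ (c0 - IZR n) (c1 - IZR n) ltac:(lra) ltac:(lra) A B D) as P. cbv beta in P.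
  replace (IZR n + 0)%C with (RtoC (IZR n)) in P by ring. rewrite <- P. ring.
Qed.

Lemma den_neq_0_frac (n : Z) (c u : R) : IZR n < c < IZR n + 1 -> den (c + u * dir_SE)%C <> RtoC 0.
Proof.
  intros Hc. destruct (den_lower_lines (c - IZR n) (c - IZR n) ltac:(lra) ltac:(lra)) as [k [Hk K]].
  replace (c + u * dir_SE)%C with (IZR n + ((c - IZR n)%R + u * dir_SE))%C by (rewrite RtoC_minus; ring).
  rewrite den_shift. apply Cmult_neq_0.
  - apply Cmod_gt_0. rewrite Cmod_powerRZ_m1. lra.
  - apply (den_neq_0_of_lower _ k Hk). apply (K (c - IZR n) u). lra.
Qed.

Lemma over_den_dom g g' (n : Z) (c : R) lo hi : nice g g' lo hi -> lo < c < hi -> IZR n < c < IZR n + 1 ->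
  exists M, dom M (fun u => g (c + u * dir_SE) / den (c + u * dir_SE))%C.
Proof.
  intros [A [B D]] Hl Hc. destruct (D c c ltac:(lra) ltac:(lra)) as [M HM].
  destruct (den_lower_lines (c - IZR n) (c - IZR n) ltac:(lra) ltac:(lra)) as [k [Hk K]].
  assert (L : forall u : R, k <= Cmod (den (c + u * dir_SE)%C)).
  { intros u. replace (c + u * dir_SE)%C with (IZR n + ((c - IZR n)%R + u * dir_SE))%C by (rewrite RtoC_minus; ring).
    rewrite den_shift, Cmod_mult, Cmod_powerRZ_m1, Rmult_1_l. apply (K (c - IZR n) u). lra. }
  exists (M / k). split.
  - intros u. apply (continuous_SE (fun x => g x / den x)%C).
    apply (continuous_Cdiv g den); [exact (holo_continuous _ _ _ (A c u Hl)) | apply continuous_den | apply (den_neq_0_of_lower _ k Hk), L].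
  - intros u. rewrite Cmod_div by (apply (den_neq_0_of_lower _ k Hk), L).
    eapply Rle_trans; [apply (Rinv_bound_div _ k); [auto | apply L | apply Cmod_ge_0]|].
    specialize (HM c u ltac:(lra)). unfold Rdiv in *. apply (Rmult_le_compat_r (/ k)) in HM; [|left; now apply Rinv_0_lt_compat]. lra.
Qed.

Lemma nice_dom g g' lo hi (c : R) : nice g g' lo hi -> lo < c < hi -> exists M, dom M (fun u : R => g (c + u * dir_SE)%C).
Proof.
  intros [A [B D]] Hl. destruct (D c c ltac:(lra) ltac:(lra)) as [M HM]. exists M. split.
  - intros u. apply continuous_SE. exact (holo_continuous _ _ _ (A c u Hl)).
  - intros u. apply HM. lra.
Qed.

Lemma nice_gau (A : R) (a : C) lo hi : 0 < A -> nice (gau A a) (fun x => gau A a x * - (A * ci * (2 * (x - a))))%C lo hi.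
Proof.
  intros HA. split; [|split].
  - intros; apply holo_gau.
  - intros c u _. apply (continuous_Cmult (gau A a) (fun x => - (A * ci * (2 * (x - a))))%C); [apply continuous_gau | ccont].
  - intros x y _ _. exists (gau_const A (Rabs x + Rabs y + Cmod a)). intros c u Hc. apply gau_bound; auto.
    eapply Rle_trans; [apply Cmod_minus_le|]. apply Rplus_le_compat_r. rewrite Cmod_R.
    unfold Rabs. destruct (Rcase_abs c), (Rcase_abs x), (Rcase_abs y); lra.
Qed.

Lemma nice_ext g g' h h' lo hi : (forall x, g x = h x) -> (forall x, g' x = h' x) -> nice g g' lo hi -> nice h h' lo hi.
Proof. intros E1 E2. replace h with g by now apply functional_extensionality. now replace h' with g' by now apply functional_extensionality. Qed.

Lemma cexp_2pi_Z (n : Z) : cexp (2 * (PI * ci * IZR n)) = RtoC 1.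
Proof.
  replace (2 * (PI * ci * IZR n))%C with (PI * ci * IZR n + PI * ci * IZR n)%C by ring.
  rewrite cexp_plus, cexp_pi_ci_Z. apply powerRZ_m1_sqr.
Qed.

Lemma cexp_pi : cexp (PI * ci) = (- (1))%C.
Proof. rewrite cexp_ci, cos_PI, sin_PI. apply injective_projections; simpl; ring. Qed.

Lemma cexp_inv_l (z : C) : (cexp z * cexp (- z) = 1)%C.
Proof. rewrite Cmult_comm. apply cexp_neg_mult. Qed.

(** * Two Mordell integrals *)

Definition gY (Y x : C) : C := (gau PI 0 x * cexp (- (x * Y)))%C.

Lemma nice_gY Y lo hi : exists g', nice (gY Y) g' lo hi.
Proof.
  eexists. eapply (nice_ext _ _ (gY Y)); [intros x; symmetry; apply gau_linear | intros x; reflexivity |].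
  apply nice_scal, nice_gau, PI_RGT_0.
Qed.

(** Mordell's device: translation by 1 produces exp (-2 pi i y) = 1 - den y exp (- pi i y); the
    second term cancels the denominator and leaves a pure Gaussian. *)
Lemma gY_shift Y y : den y <> RtoC 0 ->
  (gY Y (1 + y) / den (1 + y) = cexp (- Y) * (gY Y y / den y + (- (1)) * gY (Y + PI * ci) y))%C.
Proof.
  intros Hd. pose proof (den_shift 1 y) as S. change (powerRZ (-1) 1) with (-1 * 1) in S.
  rewrite Rmult_1_r in S. rewrite S.
  assert (E : gY Y (1 + y) = (- (cexp (- Y) * (1 - den y * cexp (- (PI * ci * y))) * gY Y y))%C).
  { unfold gY, gau.
    replace (- (PI * ci * ((1 + y - 0) * (1 + y - 0))))%C with (- (PI * ci) + (- (2 * (PI * ci * y)) + - (PI * ci * ((y - 0) * (y - 0)))))%C by ring.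
    replace (- ((1 + y) * Y))%C with (- Y + - (y * Y))%C by ring.
    rewrite !cexp_plus, (cexp_opp (PI * ci)), cexp_pi.
    replace (cexp (- (2 * (PI * ci * y)))) with (1 - den y * cexp (- (PI * ci * y)))%C.
    - field.
    - unfold den. set (z := (PI * ci * y)%C). replace (- (2 * z))%C with (- z + - z)%C by ring. rewrite cexp_plus.
      transitivity (1 - cexp z * cexp (- z) + cexp (- z) * cexp (- z))%C; [ring|]. rewrite cexp_inv_l. ring. }
  rewrite E.
  replace (gY (Y + PI * ci) y) with (cexp (- (PI * ci * y)) * gY Y y)%C.
  2:{ unfold gY. replace (- (y * (Y + PI * ci)))%C with (- (PI * ci * y) + - (y * Y))%C by ring. rewrite cexp_plus. ring. }
  replace (RtoC (-1)) with (- (1))%C by (rewrite <- RtoC_opp; f_equal; ring).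
  field. auto.
Qed.

(** The integral on the line through c + 1 is expressed twice: by translation from the line through
    c, with a Gaussian as correction, and by crossing the pole at 1. Together this is a linear
    equation for the integral. *)
Lemma mordell_J (Y : C) (c : R) : 0 < c < 1 ->
  (LI (gY Y) c * (cexp Y - 1) = 1 - cexp (Y / 2) * cexp (- (ci * (Y * Y) / (4 * PI))))%C.
Proof.
  intros Hc. destruct (nice_gY Y 0 2) as [g' Hn].
  pose proof (LI_jump (gY Y) g' 1 c (c + 1)) as J. simpl IZR in J.
  replace (1 - 1) with 0 in J by ring. replace (1 + 1) with 2 in J by ring.
  specialize (J Hn ltac:(lra) ltac:(lra)).
  destruct (over_den_dom (gY Y) g' 0 c 0 2 Hn ltac:(lra) ltac:(simpl; lra)) as [M D].
  destruct (nice_gY (Y + PI * ci) 0 2) as [h' Hn2].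
  destruct (nice_dom _ _ 0 2 c Hn2 ltac:(lra)) as [N D2].
  assert (E : LI (gY Y) (c + 1) = (cexp (- Y) * (LI (gY Y) c + - (1) * (cexp (- (ci * ((Y + PI * ci) * (Y + PI * ci)) / (4 * PI))) * dir_SE)))%C).
  { unfold LI.
    rewrite (IntR_ext _ (fun u => cexp (- Y) * (gY Y (c + u * dir_SE) / den (c + u * dir_SE) + (- (1)) * gY (Y + PI * ci) (c + u * dir_SE)))%C).
    - rewrite (IntR_scal (M + Cmod (- (1)) * N)); [|apply dom_plus; [exact D | now apply dom_scal]].
      rewrite (IntR_plus M (Cmod (- (1)) * N)); [|exact D | now apply dom_scal].
      rewrite (IntR_scal N) by exact D2. unfold gY at 2. rewrite IntR_gau_linear. ring.
    - intros u. rewrite <- gY_shift by (apply (den_neq_0_frac 0); simpl; lra).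
      replace ((c + 1)%R + u * dir_SE)%C with (1 + (c + u * dir_SE))%C by (rewrite RtoC_plus; ring). reflexivity. }
  rewrite E in J.
  assert (G1 : gY Y (RtoC 1) = (- cexp (- Y))%C).
  { unfold gY, gau. replace (- (PI * ci * ((1 - 0) * (1 - 0))))%C with (- (PI * ci))%C by ring.
    replace (- (1 * Y))%C with (- Y)%C by ring. rewrite cexp_opp, cexp_pi. field. }
  rewrite G1 in J. change (powerRZ (-1) 1) with (-1 * 1) in J. rewrite Rmult_1_r in J.
  assert (HP : RtoC PI <> RtoC 0) by (intros K; apply RtoC_inj in K; pose proof PI_RGT_0; lra).
  replace (cexp (- (ci * ((Y + PI * ci) * (Y + PI * ci)) / (4 * PI))) * dir_SE)%C with (cexp (Y / 2) * cexp (- (ci * (Y * Y) / (4 * PI))))%C in J.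
  2:{ replace (- (ci * ((Y + PI * ci) * (Y + PI * ci)) / (4 * PI)))%C with
       (Y / 2 + - (ci * (Y * Y) / (4 * PI)) + (PI / 4)%R * ci)%C.
      - rewrite !cexp_plus. pose proof mu_1 as Hm. unfold mu in Hm.
        replace (1 * ((PI / 4)%R * ci))%C with ((PI / 4)%R * ci)%C in Hm by ring.
        transitivity (cexp (Y / 2) * cexp (- (ci * (Y * Y) / (4 * PI))) * (cexp ((PI / 4)%R * ci) * dir_SE))%C; [|ring].
        rewrite Hm. ring.
      - transitivity (- (ci * (Y * Y) / (4 * PI)) - (ci * ci) * Y / 2 - (ci * ci) * (ci * PI) / 4)%C.
        + rewrite ci_sqr, RtoC_div by lra. field. auto.
        + field. auto. }
  set (W := (cexp (Y / 2) * cexp (- (ci * (Y * Y) / (4 * PI))))%C) in *. set (L := LI (gY Y) c) in *.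
  replace (RtoC (-1)) with (- (1))%C in J by (rewrite <- RtoC_opp; f_equal; ring).
  transitivity (cexp Y * (L - cexp (- Y) * (L + - (1) * W)) - W + L * (cexp Y * cexp (- Y) - 1) + W * (1 - cexp Y * cexp (- Y)))%C; [ring|].
  rewrite J, cexp_inv_l. transitivity (cexp Y * cexp (- Y) - W)%C; [ring|]. rewrite cexp_inv_l. ring.
Qed.

Lemma gau2_times_exp (a x : C) (j : R) :
  (gau (2 * PI) a x * cexp (- (j * (PI * ci * x))) = cexp (PI * ci * (j * j) / 8 - j * (PI * ci * a)) * gau (2 * PI) (a - j / 4) x)%C.
Proof.
  unfold gau. rewrite <- !cexp_plus. f_equal. rewrite RtoC_mult. field.
Qed.

(** With 2 pi in the exponent the factor is exp (-4 pi i y) = 1 - den y (exp (- pi i y) + exp (-3 pi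
    i y)), so two Gaussians are left over. *)
Lemma gau2_shift (a y : C) : den y <> RtoC 0 ->
  (gau (2 * PI) a (1 + y) / den (1 + y) = - cexp (4 * (PI * ci * a)) *
    (gau (2 * PI) a y / den y + - (1) * (gau (2 * PI) a y * cexp (- (1 * (PI * ci * y))) + gau (2 * PI) a y * cexp (- (3 * (PI * ci * y))))))%C.
Proof.
  intros Hd. pose proof (den_shift 1 y) as S. change (powerRZ (-1) 1) with (-1 * 1) in S.
  rewrite Rmult_1_r in S. rewrite S.
  assert (E : gau (2 * PI) a (1 + y) = (cexp (4 * (PI * ci * a)) * cexp (- (4 * (PI * ci * y))) * gau (2 * PI) a y)%C).
  { unfold gau. rewrite <- !cexp_plus.
    replace (- ((2 * PI)%R * ci * ((1 + y - a) * (1 + y - a))))%C with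
     (4 * (PI * ci * a) + - (4 * (PI * ci * y)) + - ((2 * PI)%R * ci * ((y - a) * (y - a))) + - (2 * (PI * ci * 1)))%C by (rewrite RtoC_mult; ring).
    rewrite (cexp_plus _ (- (2 * (PI * ci * 1)))), (cexp_opp (2 * (PI * ci * 1))), (cexp_2pi_Z 1). field. }
  rewrite E.
  set (z := (PI * ci * y)%C).
  assert (Q : cexp (- (4 * z)) = (1 - den y * (cexp (- (1 * z)) + cexp (- (3 * z))))%C).
  { unfold den. fold z. pose proof (cexp_inv_l z) as I. set (p := cexp z) in *. set (q := cexp (- z)) in *.
    replace (- (1 * z))%C with (- z)%C by ring.
    replace (- (3 * z))%C with (- z + - z + - z)%C by ring. replace (- (4 * z))%C with (- z + - z + - z + - z)%C by ring.
    rewrite !cexp_plus. fold q.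
    transitivity (1 - p * q - (p * q) * (q * q) + q * q + q * q * q * q)%C; [rewrite I; ring | ring]. }
  rewrite Q. replace (RtoC (-1)) with (- (1))%C by (rewrite <- RtoC_opp; f_equal; ring).
  field. auto.
Qed.

Lemma mordell_F (a : C) (k : Z) (c : R) : IZR k < c < IZR k + 1 -> ccos (2 * PI * a) <> RtoC 0 ->
  LI (gau (2 * PI) a) c =
   ((RtoC (sqrt 2) * cexp (RtoC (3 * PI / 8) * ci) * csin (PI * a) - powerRZ (-1) k *
     cexp (2 * PI * ci * a - 2 * PI * ci * (a - IZR k) * (a - IZR k))) / (2 * ccos (2 * PI * a)))%C.
Proof.
  intros Hc Hcos. pose proof PI_RGT_0 as HP.
  set (f := gau (2 * PI) a).
  pose proof (nice_gau (2 * PI) a (IZR k) (IZR (k + 1) + 1) ltac:(lra)) as Hn. fold f in Hn.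
  set (f' := fun x : C => _) in Hn.
  assert (Ek : IZR (k + 1) - 1 = IZR k) by (rewrite plus_IZR; ring).
  pose proof (LI_jump f f' (k + 1) c (c + 1)) as J.
  rewrite Ek in J. rewrite plus_IZR in *. specialize (J Hn ltac:(lra) ltac:(lra)).
  destruct (over_den_dom _ _ k c _ _ Hn ltac:(lra) Hc) as [M D].
  assert (Gj : forall j : R, exists m, dom m (fun u => gau (2 * PI) a (c + u * dir_SE) * cexp (- (j * (PI * ci * (c + u * dir_SE)))))%C /\
     CInt_line (fun u => gau (2 * PI) a (c + u * dir_SE) * cexp (- (j * (PI * ci * (c + u * dir_SE)))))%C =
      (cexp (PI * ci * (j * j) / 8 - j * (PI * ci * a)) * rt)%C).
  { intros j. 
    destruct (nice_dom _ _ _ _ c (nice_gau (2 * PI) (a - j / 4) (IZR k) (IZR k + 1) ltac:(lra)) Hc) as [m Dm].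
    exists (Cmod (cexp (PI * ci * (j * j) / 8 - j * (PI * ci * a))) * m). split.
    - apply (dom_ext _ (fun u => cexp (PI * ci * (j * j) / 8 - j * (PI * ci * a)) * gau (2 * PI) (a - j / 4) (c + u * dir_SE))%C).
      + intros u. now rewrite gau2_times_exp.
      + now apply dom_scal.
    - rewrite (IntR_ext _ _ (fun u => gau2_times_exp a (c + u * dir_SE) j)).
      rewrite (IntR_scal m) by auto. rewrite gauss_line by lra. f_equal. f_equal.
      unfold rt. rewrite sqrt_mult by lra. field. split; apply Rgt_not_eq, sqrt_lt_R0; lra. }
  destruct (Gj 1) as [m1 [D1 I1]]. destruct (Gj 3) as [m3 [D3 I3]].
  assert (E : LI f (c + 1) = (- cexp (4 * (PI * ci * a)) * (LI f c + - (1) *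
     ((cexp (PI * ci * (1 * 1) / 8 - 1 * (PI * ci * a)) * rt + cexp (PI * ci * (3 * 3) / 8 - 3 * (PI * ci * a)) * rt) * dir_SE)))%C).
  { unfold LI. rewrite <- I1, <- I3.
    rewrite (IntR_ext (fun u => f ((c + 1)%R + u * dir_SE) / den ((c + 1)%R + u * dir_SE))%C (fun u => - cexp (4 * (PI * ci * a)) * (gau (2 * PI) a (c + u * dir_SE) / den (c + u * dir_SE) + - (1) *
      (gau (2 * PI) a (c + u * dir_SE) * cexp (- (1 * (PI * ci * (c + u * dir_SE)))) + gau (2 * PI) a (c + u * dir_SE) * cexp (- (3 * (PI * ci * (c + u * dir_SE)))))))%C).
    - pose proof (dom_plus _ _ _ _ D1 D3) as D13. pose proof (dom_scal _ _ (- (1))%C D13) as D13'.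
      rewrite (IntR_scal _ _ _ (dom_plus _ _ _ _ D D13')), (IntR_plus _ _ _ _ D D13'), (IntR_scal _ _ _ D13), (IntR_plus _ _ _ _ D1 D3).
      unfold f. ring.
    - intros u. rewrite <- gau2_shift by (apply (den_neq_0_frac k); lra).
      replace ((c + 1)%R + u * dir_SE)%C with (1 + (c + u * dir_SE))%C by (rewrite RtoC_plus; ring). reflexivity. }
  rewrite E in J. clear E Gj.
  rewrite powerRZ_add in J by lra. change (powerRZ (-1) 1) with (-1 * 1) in J. rewrite Rmult_1_r, RtoC_mult, RtoC_plus in J.
  replace (RtoC (-1)) with (- (1))%C in J by (rewrite <- RtoC_opp; f_equal; ring).
  set (S := RtoC (powerRZ (-1) k)) in *. set (L := LI f c) in *.
  set (z := (PI * ci * a)%C) in *.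
  assert (F1 : f (IZR k + 1)%C = (cexp (2 * PI * ci * a - 2 * PI * ci * (a - IZR k) * (a - IZR k)) * cexp (2 * z))%C).
  { unfold f, gau. rewrite <- cexp_plus.
    replace (- ((2 * PI)%R * ci * ((IZR k + 1 - a) * (IZR k + 1 - a))))%C with
     (2 * PI * ci * a - 2 * PI * ci * (a - IZR k) * (a - IZR k) + 2 * z + - (2 * (PI * ci * IZR (2 * k + 1))))%C.
    - rewrite cexp_plus, (cexp_opp (2 * (PI * ci * _))), cexp_2pi_Z. field.
    - rewrite plus_IZR, mult_IZR. unfold z. repeat rewrite ?RtoC_plus, ?RtoC_mult. ring. }
  rewrite F1 in J. set (X := cexp (2 * PI * ci * a - 2 * PI * ci * (a - IZR k) * (a - IZR k))) in *.
  (* All constant phases are powers of exp (pi i / 8), whose eighth power is -1; what remains is a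
     rational identity in [e8] and exp (pi i a). *)
  set (e8 := cexp ((PI / 8)%R * ci)).
  assert (P8 : forall n : nat, cexp (INR n * (PI / 8)%R * ci) = (e8 ^ n)%C).
  { induction n as [|n IH]; [simpl; rewrite !Cmult_0_l; apply cexp_0|].
    rewrite S_INR, RtoC_plus. replace ((INR n + 1) * (PI / 8)%R * ci)%C with (INR n * (PI / 8)%R * ci + (PI / 8)%R * ci)%C by ring.
    rewrite cexp_plus, IH. fold e8. simpl. ring. }
  assert (P88 : (e8 ^ 8)%C = (- (1))%C).
  { rewrite <- P8, <- cexp_pi. f_equal. rewrite RtoC_div by lra. simpl INR. repeat rewrite ?RtoC_plus. field. }
  assert (P84 : (e8 ^ 4)%C = ci).
  { rewrite <- P8. simpl INR. replace ((1 + 1 + 1 + 1)%R * (PI / 8)%R * ci)%C with ((PI / 2)%R * ci)%C.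
    - rewrite cexp_ci, cos_PI2, sin_PI2. reflexivity.
    - rewrite <- RtoC_mult. f_equal. f_equal. field. }
  assert (P83 : cexp ((3 * PI / 8)%R * ci) = (e8 ^ 3)%C).
  { rewrite <- P8. f_equal. simpl INR. repeat rewrite ?RtoC_plus, ?RtoC_mult, ?(RtoC_div (3 * PI)), ?RtoC_div by lra. field. }
  assert (Pd : dir_SE = (- (e8 ^ 6))%C).
  { rewrite <- P8, dir_SE_eq. simpl INR. replace ((1 + 1 + 1 + 1 + 1 + 1)%R * (PI / 8)%R * ci)%C with ((PI - PI / 4)%R * ci)%C.
    - rewrite cexp_ci, cos_minus, sin_minus, cos_PI, sin_PI, cos_PI4_rt, sin_PI4_rt. apply injective_projections; simpl; ring.
    - rewrite <- RtoC_mult. f_equal. f_equal. field. }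
  assert (Q1 : cexp (PI * ci * (1 * 1) / 8 - 1 * z) = (e8 * cexp (- z))%C).
  { unfold e8. rewrite <- cexp_plus. f_equal. rewrite RtoC_div by lra. field. }
  assert (Q3 : cexp (PI * ci * (3 * 3) / 8 - 3 * z) = (- e8 * cexp (- z) * cexp (- z) * cexp (- z))%C).
  { replace (PI * ci * (3 * 3) / 8 - 3 * z)%C with (PI * ci + (PI / 8)%R * ci + - z + - z + - z)%C by (rewrite RtoC_div by lra; field).
    rewrite !cexp_plus, cexp_pi. fold e8. ring. }
  assert (S2 : (RtoC (sqrt 2) * rt)%C = RtoC 1).
  { rewrite <- RtoC_mult. f_equal. unfold rt. field. apply Rgt_not_eq, sqrt_lt_R0; lra. }
  assert (S3 : (RtoC (sqrt 2) = 2 * rt)%C).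
  { rewrite <- RtoC_mult. f_equal. unfold rt. assert (Hq : 0 < sqrt 2) by (apply sqrt_lt_R0; lra).
    apply (Rmult_eq_reg_r (sqrt 2)); [|lra]. rewrite sqrt_sqrt by lra. field. lra. }
  rewrite Q1, Q3, Pd in J. rewrite P83, S3.
  unfold csin, ccos in *.
  replace (ci * (PI * a))%C with z by (unfold z; ring).
  replace (ci * (2 * PI * a))%C with (2 * z)%C in * by (unfold z; ring).
  pose proof (cexp_inv_l z) as I. pose proof (cexp_inv_l (2 * z)) as I2.
  replace (cexp (4 * z)) with (cexp (2 * z) * cexp (2 * z))%C in J by (rewrite <- cexp_plus; f_equal; ring).
  assert (P2z : cexp (2 * z) = (cexp z * cexp z)%C) by (rewrite <- cexp_plus; f_equal; ring).
  assert (N2z : cexp (- (2 * z)) = (cexp (- z) * cexp (- z))%C) by (rewrite <- cexp_plus; f_equal; ring).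
  rewrite P2z, N2z in *. set (p := cexp z) in *. set (q := cexp (- z)) in *.
  assert (Hs : (p * p + q * q)%C <> RtoC 0).
  { intros K. apply Hcos. rewrite K. unfold Cdiv. apply Cmult_0_l. }
  clear P8 F1 Q1 Q3 I1 I3 I2 P2z N2z. clearbody p q e8 X L S.
  assert (Np : p <> RtoC 0) by (intros K; rewrite K, Cmult_0_l in I; apply C1_neq_0; auto).
  assert (Eq : q = (/ p)%C) by (rewrite <- (Cmult_1_r (/ p)), <- I; field; auto). subst q.
  assert (Ne : e8 <> RtoC 0).
  { intros K. rewrite K in P88. apply (f_equal Re) in P88. simpl in P88. lra. }
  assert (N7 : (e8 ^ 7 = - / e8)%C).
  { transitivity (e8 ^ 8 / e8)%C; [field; auto|]. rewrite P88. field. auto. }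
  assert (T : (L * (p * p + / p * / p) = 2 * rt * e8 ^ 3 * ((p - / p) / (2 * ci)) - S * X)%C).
  { transitivity ((S * - (1) * (X * (p * p))) * (/ p * / p) - rt * e8 ^ 7 * (p - / p))%C.
    - rewrite <- J. field. auto.
    - rewrite N7, <- P84. field. auto. }
  apply (f_equal (fun y => y / (p * p + / p * / p))%C) in T.
  transitivity (L * (p * p + / p * / p) / (p * p + / p * / p))%C; [unfold Cdiv; rewrite <- Cmult_assoc, Cinv_r by auto; ring|]. rewrite T.
  f_equal. field. auto.
Qed.

(** * The function x exp(pi i x^2) / (exp(pi i x) - exp(-pi i x)) *)

Definition e1 (x : C) : C := cexp (RtoC PI * ci * x * x).
Definition hf (x : C) : C := (x * e1 x / den x)%C.
(* the derivative of [hf] *)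
Definition hp (x : C) : C := (e1 x * ((den x - x * den' x) + 2 * (PI * ci * x) * x * den x) / (den x * den x))%C.

Lemma holo_hf x : den x <> RtoC 0 -> holo hf x (hp x).
Proof.
  intros Hd. unfold hf. eapply holo_eq.
  - apply holo_div; [|apply holo_den|exact Hd].
    apply (holo_mult (fun x => x) e1); [apply holo_id|]. unfold e1. holo_tac.
  - cbv beta. unfold hp. fold (e1 x). field. exact Hd.
Qed.

Lemma continuous_hp x : den x <> RtoC 0 -> continuous hp x.
Proof.
  intros Hd. pose proof (continuous_den x) as C1. pose proof (continuous_den' x) as C2.
  assert (C3 : continuous e1 x) by (unfold e1; ccont).
  unfold hp. apply continuous_Cdiv; [| now apply continuous_Cmult | now apply Cmult_neq_0].
  apply continuous_Cmult; [exact C3|]. apply continuous_Cplus.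
  - apply continuous_Cminus; [exact C1|]. apply continuous_Cmult; [apply continuous_id | exact C2].
  - apply continuous_Cmult; [ccont | exact C1].
Qed.

Definition dir_NE : C := (- dir_SW)%C.

Lemma dir_NE_eq : dir_NE = (rt, rt).
Proof. unfold dir_NE. rewrite dir_SW_eq. apply injective_projections; simpl; ring. Qed.

Lemma Cmod_dir_NE : Cmod dir_NE = 1.
Proof.
  pose proof (Cmod_sqr dir_NE) as H. rewrite dir_NE_eq in *. simpl in H.
  pose proof rt_sqr. pose proof (Cmod_ge_0 (rt, rt)). nra.
Qed.

Lemma NE_point (c s : R) : (c + s * dir_NE)%C = (c + rt * s, rt * s).
Proof. rewrite dir_NE_eq. apply injective_projections; simpl; ring. Qed.

Lemma e1_NE_bound (c s : R) : 0 <= c <= 1 -> Cmod (e1 (c + s * dir_NE)) <= exp (- (PI * (s * s)) + 2 * PI * Rabs s).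
Proof.
  intros Hc. unfold e1. rewrite Cmod_cexp. apply exp_le. rewrite NE_point. pose proof rt_sqr as R2. pose proof rt_pos.
  pose proof PI_RGT_0 as HP.
  set (x := ((c + rt * s)%R, (rt * s)%R) : C).
  replace (Re (PI * ci * x * x)%C) with (- (2 * PI * (rt * c * s)) - 2 * PI * (rt * rt) * (s * s)) by (unfold x, ci; simpl; ring).
  rewrite R2. pose proof (Rle_abs (- s)) as A. rewrite Rabs_Ropp in A. pose proof (Rabs_pos s).
  assert (rt <= 1) by nra.
  assert (- (rt * c * s) <= Rabs s).
  { assert (0 <= rt * c <= 1) by nra. nra. }
  nra.
Qed.

Lemma Cmod_den'_le (a b : R) : Cmod (den' (a, b)) <= 2 * PI * exp (PI * Rabs b).
Proof.
  pose proof PI_RGT_0 as HP. unfold den'. rewrite !Cmod_mult, Cmod_R, Rabs_pos_eq by lra. change ci with Ci. rewrite Cmod_Ci. change Ci with ci.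
  assert (E : forall s, Rabs s <= PI * Rabs b -> exp s <= exp (PI * Rabs b)) by (intros s Hs; apply exp_le; pose proof (Rle_abs s); lra).
  pose proof (Cmod_triangle (cexp (PI * ci * (a, b))) (cexp (- (PI * ci * (a, b))))) as T. rewrite !Cmod_cexp in T.
  replace (Re (PI * ci * (a, b))%C) with (- (PI * b)) in T by (unfold ci; simpl; ring).
  replace (Re (- (PI * ci * (a, b)))%C) with (PI * b) in T by (unfold ci; simpl; ring).
  pose proof (E (- (PI * b)) ltac:(rewrite Rabs_Ropp, Rabs_mult, (Rabs_pos_eq PI); lra)).
  pose proof (E (PI * b) ltac:(rewrite Rabs_mult, (Rabs_pos_eq PI); lra)). nra.
Qed.

(** [den x] and [x * den' x] both begin with 2 pi i x, so the numerator of [hp] is quadratically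
    small, like the square of [den x]. *)
Lemma hp_small (x : C) : x <> RtoC 0 -> Cmod x <= / 16 -> Cmod (hp x) <= 19.
Proof.
  intros Hx0 Hx. pose proof PI_RGT_0 as HP. pose proof PI_4. destruct (den_small x Hx) as [D1 D2].
  apply Cmod_gt_0 in Hx0 as Hm. set (m := Cmod x) in *. set (z := (RtoC PI * ci * x)%C) in *.
  assert (Hz : Cmod z = PI * m).
  { unfold z. rewrite !Cmod_mult, Cmod_R, Rabs_pos_eq by lra. change ci with Ci. rewrite Cmod_Ci. fold m. ring. }
  assert (Hz4 : PI * m <= / 4) by nra.
  assert (E : exp (PI * m) <= 4 / 3).
  { replace (PI * m) with (- - (PI * m)) by ring. rewrite exp_Ropp.
    replace (4 / 3) with (/ (3 / 4)) by field. apply Rinv_le_contravar; [lra|].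
    assert (1 + - (PI * m) < exp (- (PI * m))) by (apply exp_ineq1; nra). lra. }
  assert (Pm : 0 < PI * m) by nra.
  assert (D3 : Cmod (x * den' x - 2 * z) <= 8 / 3 * (PI * m * (PI * m))).
  { replace (x * den' x - 2 * z)%C with (z * ((cexp z - 1) + (cexp (- z) - 1)))%C by (unfold den'; fold z; unfold z; ring).
    rewrite Cmod_mult, Hz.
    pose proof (Cmod_cexp_minus_1 z) as A. pose proof (Cmod_cexp_minus_1 (- z)) as B. rewrite Cmod_opp in B. rewrite Hz in A, B.
    pose proof (Cmod_triangle (cexp z - 1) (cexp (- z) - 1)).
    assert (Cmod ((cexp z - 1) + (cexp (- z) - 1)) <= 2 * (PI * m * (4 / 3))) by nra.
    apply (Rmult_le_compat_l (PI * m)) in H1; [|lra]. lra. }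
  assert (Hd : den x <> RtoC 0) by (apply Cmod_gt_0; lra).
  assert (He : Cmod (e1 x) <= 3).
  { unfold e1. eapply Rle_trans; [apply Cmod_cexp_le|]. apply Rle_trans with (exp 1); [apply exp_le | apply exp_le_3].
    rewrite Cmod_mult. fold z. rewrite Hz. fold m. nra. }
  unfold hp. rewrite Cmod_div by now apply Cmult_neq_0. rewrite !Cmod_mult.
  set (D := Cmod (den x)) in *.
  apply (Rmult_le_reg_r (D * D)); [nra|]. unfold Rdiv. rewrite Rmult_assoc, Rinv_l, Rmult_1_r by nra.
  assert (N : Cmod (den x - x * den' x + 2 * z * x * den x) <= 16 / 3 * (PI * m * (PI * m)) + 2 * (PI * m) * m * D).
  { eapply Rle_trans; [apply Cmod_triangle|]. apply Rplus_le_compat.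
    - replace (den x - x * den' x)%C with ((den x - 2 * z) - (x * den' x - 2 * z))%C by ring.
      eapply Rle_trans; [apply Cmod_minus_le|]. lra.
    - rewrite !Cmod_mult, Hz, Cmod_R, Rabs_pos_eq by lra. fold m D. lra. }
  assert (N2 : 16 / 3 * (PI * m * (PI * m)) + 2 * (PI * m) * m * D <= 19 / 3 * (D * D)).
  { assert (PI * m * (PI * m) <= D * D) by nra. assert (2 * (PI * m) * m <= D) by (assert (PI * m * m <= / 4 * m) by (apply Rmult_le_compat_r; lra); pose proof PI2_1; unfold PI in *; nra).
    assert (2 * (PI * m) * m * D <= D * D) by (apply Rmult_le_compat_r; [apply Cmod_ge_0 | assumption]). lra. }
  replace (19 * (D * D)) with (3 * (19 / 3 * (D * D))) by lra.
  apply Rmult_le_compat; [apply Cmod_ge_0 | apply Cmod_ge_0 | exact He | exact (Rle_trans _ _ _ N N2)].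
Qed.

Lemma den_lower_NE (c0 : R) : 0 < c0 < 1 -> exists kap, 0 < kap /\
  forall c s : R, 0 <= c <= c0 -> / 16 <= Cmod (c + s * dir_NE)%C -> kap <= Cmod (den (c + s * dir_NE)%C).
Proof.
  intros Hc0. pose proof rt_pos as Hr. pose proof PI_RGT_0 as HP.
  destruct (den_lower (/ 32) c0 ltac:(lra) ltac:(lra)) as [k [Hk K]].
  assert (0 < 2 * PI * (rt * / 32)) by (apply Rmult_lt_0_compat; nra).
  exists (Rmin k (2 * PI * (rt * / 32))). split; [now apply Rmin_pos|].
  intros c s Hc Hx. rewrite NE_point. destruct (Rle_dec (/ 32) c).
  - eapply Rle_trans; [apply Rmin_l|]. apply K. pose proof (Rle_abs (rt * s)). pose proof (Rle_abs (- (rt * s))).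
    rewrite Rabs_Ropp in *. lra.
  - eapply Rle_trans; [apply Rmin_r|]. eapply Rle_trans; [|apply Cmod_den_ge_im].
    apply Rmult_le_compat_l; [lra|]. rewrite Rabs_mult, (Rabs_pos_eq rt) by lra. apply Rmult_le_compat_l; [lra|].
    pose proof (Cmod_triangle c (s * dir_NE)) as T. rewrite Cmod_mult, Cmod_dir_NE, !Cmod_R, (Rabs_pos_eq c) in T by lra. lra.
Qed.

(** Near 0 the bound is [hp_small], elsewhere [den] is bounded below. The range of [c] includes 0,
    which the limit of lines tending to the origin will need. The exponent 20 leaves room for 2 pi
    and for five factors exp |s|. *)
Lemma hp_bound (c0 : R) : 0 < c0 < 1 -> exists K, 0 <= K /\
  forall c s : R, 0 <= c <= c0 -> (c + s * dir_NE)%C <> RtoC 0 ->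
    Cmod (hp (c + s * dir_NE)) <= K * exp (- (PI * (s * s)) + 20 * Rabs s).
Proof.
  intros Hc0. destruct (den_lower_NE c0 Hc0) as [k [Hk Kd]]. pose proof PI_RGT_0 as HP. pose proof PI_4 as HP4. pose proof rt_pos. pose proof rt_sqr.
  assert (Hik : 0 < / k) by now apply Rinv_0_lt_compat.
  exists (19 * exp PI + 100 * (/ k + / k * / k)). split.
  { pose proof (exp_pos PI). nra. }
  intros c s Hc Hx0. pose proof (Rabs_pos s) as Hs. set (X := exp (- (PI * (s * s)) + 20 * Rabs s)).
  assert (HX : 0 < X) by apply exp_pos.
  assert (S2 : s * s = Rabs s * Rabs s) by apply Rsqr_abs.
  destruct (Rle_dec (Cmod (c + s * dir_NE)) (/ 16)) as [L|L].
  - eapply Rle_trans; [now apply hp_small|].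
    assert (Rabs s <= 1).
    { pose proof (im_le_Cmod (c + s * dir_NE)) as I. rewrite NE_point in I at 1. simpl in I.
      rewrite Rabs_mult, (Rabs_pos_eq rt) in I by lra. nra. }
    assert (1 <= exp PI * X).
    { unfold X. rewrite <- exp_plus, <- exp_0. apply exp_le. rewrite S2. nra. }
    assert (0 <= 100 * (/ k + / k * / k) * X) by (apply Rmult_le_pos; nra). nra.
  - specialize (Kd c s Hc ltac:(lra)).
    assert (Hd : den (c + s * dir_NE)%C <> RtoC 0) by (apply (den_neq_0_of_lower _ k); auto).
    set (x := (c + s * dir_NE)%C) in *.
    assert (Mx : Cmod x <= exp (Rabs s)).
    { apply Rle_trans with (1 + Rabs s).
      - unfold x. eapply Rle_trans; [apply Cmod_triangle|]. rewrite Cmod_mult, Cmod_dir_NE, !Cmod_R, (Rabs_pos_eq c) by lra. lra.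
      - pose proof (exp_ge_quadratic (Rabs s) Hs). nra. }
    assert (D' : Cmod (den' x) <= 2 * PI * exp (4 * Rabs s)).
    { unfold x. rewrite NE_point. eapply Rle_trans; [apply Cmod_den'_le|]. apply Rmult_le_compat_l; [lra|]. apply exp_le.
      rewrite Rabs_mult, (Rabs_pos_eq rt) by lra. assert (rt <= 1) by nra. assert (rt * Rabs s <= Rabs s) by nra. nra. }
    pose proof (e1_NE_bound c s ltac:(lra)) as E1. fold x in E1.
    pose proof (Cmod_ge_0 x) as Mx0.
    replace (hp x) with (e1 x * ((1 + 2 * (PI * ci * x) * x) / den x - x * den' x / (den x * den x)))%C by (unfold hp; field; auto).
    rewrite Cmod_mult.
    set (q := exp (Rabs s)) in *. assert (Hq : 1 <= q) by (unfold q; rewrite <- exp_0; apply exp_le; lra).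
    assert (Q4 : exp (4 * Rabs s) = q * q * q * q) by (unfold q; rewrite <- !exp_plus; f_equal; ring).
    assert (B1 : Cmod ((1 + 2 * (PI * ci * x) * x) / den x - x * den' x / (den x * den x)) <= 40 * (/ k + / k * / k) * (q * q * q * q * q)).
    { eapply Rle_trans; [apply Cmod_minus_le|]. rewrite !Cmod_div, !Cmod_mult by (try apply Cmult_neq_0; auto).
      set (D := Cmod (den x)) in *. assert (/ D <= / k) by (apply Rinv_le_contravar; auto).
      assert (0 < / D) by (apply Rinv_0_lt_compat; lra).
      assert (A1 : Cmod (1 + 2 * (PI * ci * x) * x) <= 9 * (q * q)).
      { eapply Rle_trans; [apply Cmod_triangle|]. rewrite !Cmod_mult, Cmod_1, !Cmod_R, !Rabs_pos_eq by lra. change ci with Ci. rewrite Cmod_Ci.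
        assert (Cmod x * Cmod x <= q * q) by nra. nra. }
      unfold Rdiv. rewrite Rinv_mult.
      assert (Q3 : 1 <= q * q * q) by nra. assert (Q2 : 1 <= q * q) by nra.
      assert (Cmod (1 + 2 * (PI * ci * x) * x) * / D <= 9 * (q * q) * / k) by (apply Rmult_le_compat; try apply Cmod_ge_0; lra).
      assert (Cmod x * Cmod (den' x) <= q * (8 * (q * q * q * q))).
      { apply Rmult_le_compat; try apply Cmod_ge_0; auto. rewrite Q4 in D'. eapply Rle_trans; [exact D'|].
        apply Rmult_le_compat_r; [|lra]. nra. }
      assert (/ D * / D <= / k * / k) by nra.
      assert (Cmod x * Cmod (den' x) * (/ D * / D) <= q * (8 * (q * q * q * q)) * (/ k * / k)).
      { apply Rmult_le_compat; auto; [apply Rmult_le_pos; apply Cmod_ge_0 | nra]. }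
      set (Q5 := q * q * q * q * q). replace (q * (8 * (q * q * q * q))) with (8 * Q5) in H6 by (unfold Q5; ring).
      assert (q * q <= Q5) by (unfold Q5; nra). assert (0 < Q5) by (unfold Q5; nra).
      assert (0 < / k * / k) by nra. assert (q * q * / k <= Q5 * / k) by (apply Rmult_le_compat_r; lra). nra. }
    assert (Xq : exp (- (PI * (s * s)) + 2 * PI * Rabs s) * (q * q * q * q * q) <= X).
    { unfold q, X. rewrite <- !exp_plus. apply exp_le. nra. }
    apply Rle_trans with (40 * (/ k + / k * / k) * X).
    + apply Rle_trans with (exp (- (PI * (s * s)) + 2 * PI * Rabs s) * (40 * (/ k + / k * / k) * (q * q * q * q * q))).
      * apply Rmult_le_compat; auto; apply Cmod_ge_0.
      * assert (0 <= 40 * (/ k + / k * / k)) by nra. nra.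
    + pose proof (exp_pos PI). assert (0 <= / k + / k * / k) by nra. nra.
Qed.

Lemma hp_odd x : hp (- x) = (- hp x)%C.
Proof.
  unfold hp. rewrite den_opp. replace (e1 (- x)) with (e1 x) by (unfold e1; f_equal; ring).
  replace (den' (- x)) with (den' x).
  - destruct (Ceq_dec (den x) 0) as [Z|Z].
    + rewrite Z. replace (- (0) * - (0))%C with (0 * 0)%C by ring. unfold Cdiv. ring.
    + field. auto.
  - unfold den'. replace (PI * ci * - x)%C with (- (PI * ci * x))%C by ring.
    replace (- - (PI * ci * x))%C with (PI * ci * x)%C by ring. ring.
Qed.

(** * The Mellin transform of the zeta side *)

Lemma fold_right_Cplus_app (l l' : list C) :
  List.fold_right Cplus (RtoC 0) (l ++ l') = (List.fold_right Cplus (RtoC 0) l + List.fold_right Cplus (RtoC 0) l')%C.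
Proof. induction l as [|a l IH]; simpl; [ring | rewrite IH; ring]. Qed.

Lemma CsumZ_succ f (a b : Z) : (a <= b + 1)%Z -> CsumZ f a (b + 1) = (CsumZ f a b + f (b + 1)%Z)%C.
Proof.
  intros H. unfold CsumZ. replace (Z.to_nat (b + 1 - a + 1)) with (S (Z.to_nat (b - a + 1))) by lia.
  rewrite List.seq_S, List.map_app, fold_right_Cplus_app. simpl. rewrite Cplus_0_r. do 2 f_equal. lia.
Qed.

Lemma CsumZ_empty f (a b : Z) : (b < a)%Z -> CsumZ f a b = RtoC 0.
Proof. intros H. unfold CsumZ. replace (Z.to_nat (b - a + 1)) with 0%nat by lia. reflexivity. Qed.

Lemma IntR_derivative (f f' : C -> C) M N :
  (forall t : R, holo f t (f' t)) -> (forall t : R, continuous f' (RtoC t)) ->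
  dom M (fun t : R => f' t) -> dom N (fun t : R => f t) -> CInt_line (fun t : R => f' t) = RtoC 0.
Proof.
  intros A B [_ D1] [_ D2]. assert (E : forall t : R, (RtoC 0 + t * 1)%C = RtoC t) by (intros; ring).
  rewrite <- (IntR_total_derivative f f' 0 1 M N); try (intros t; rewrite E; auto).
  apply IntR_ext. intros t. rewrite E. ring.
Qed.

Definition Yt (t : R) : C := (dir_SE * cexp t)%C.

Lemma Yt_eq t : Yt t = (rt * exp t, - (rt * exp t)).
Proof. unfold Yt. rewrite cexp_R, dir_SE_eq. apply injective_projections; simpl; ring. Qed.

Lemma Re_Yt t : Re (Yt t) = rt * exp t.
Proof. now rewrite Yt_eq. Qed.

Lemma Cmod_Yt t : Cmod (Yt t) = exp t.
Proof. unfold Yt. rewrite Cmod_mult, Cmod_dir_SE, Cmod_cexp. simpl. ring. Qed.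

Lemma Yt_neq_0 t : Yt t <> RtoC 0.
Proof. apply Cmod_gt_0. rewrite Cmod_Yt. apply exp_pos. Qed.

Lemma Cmod_exp_Yt_ge t : rt * exp t <= Cmod (cexp (Yt t) - 1).
Proof.
  pose proof (Cmod_triangle_rev (cexp (Yt t)) 1) as T. rewrite Cmod_cexp, Re_Yt, Cmod_1 in T.
  pose proof rt_pos. pose proof (exp_pos t). pose proof (exp_ineq1 (rt * exp t)) as I.
  assert (0 < rt * exp t) by (apply Rmult_lt_0_compat; auto). lra.
Qed.

Lemma exp_Yt_neq t : (cexp (Yt t) - 1)%C <> RtoC 0.
Proof.
  apply Cmod_gt_0. eapply Rlt_le_trans; [|apply Cmod_exp_Yt_ge]. apply Rmult_lt_0_compat; [apply rt_pos | apply exp_pos].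
Qed.

(** The poles of the two terms at Y = 0 cancel. For |Y| > 1 / 4 the terms are bounded separately by
    4 and 8. *)
Lemma inv_diff_bound t : Cmod (/ Yt t - / (cexp (Yt t) - 1)) <= 12.
Proof.
  pose proof (Yt_neq_0 t) as Y0. pose proof (exp_Yt_neq t) as E0. pose proof (Cmod_Yt t) as MY.
  pose proof (Cmod_exp_Yt_ge t) as ME. pose proof (exp_pos t) as Hr. set (r := exp t) in *.
  pose proof rt_pos. pose proof rt_sqr. set (Y := Yt t) in *.
  assert (Rt : / 2 <= rt) by nra.
  destruct (Rle_dec r (/ 4)) as [L|L].
  - pose proof (Cmod_cexp_minus_1_z Y) as Q. rewrite MY in Q.
    assert (E : exp r <= 4 / 3).
    { replace r with (- - r) by ring. rewrite exp_Ropp. replace (4 / 3) with (/ (3 / 4)) by field. apply Rinv_le_contravar; [lra|].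
      assert (1 + - r < exp (- r)) by (apply exp_ineq1; lra). lra. }
    assert (Q2 : Cmod (cexp Y - 1 - Y) <= 4 / 3 * (r * r)) by (assert (0 < r * r) by nra; nra).
    assert (Q3 : 2 / 3 * r <= Cmod (cexp Y - 1)).
    { replace (cexp Y - 1)%C with (Y - - (cexp Y - 1 - Y))%C by ring.
      eapply Rle_trans; [|apply Cmod_triangle_rev]. rewrite Cmod_opp, MY. nra. }
    replace (/ Y - / (cexp Y - 1))%C with ((cexp Y - 1 - Y) / (Y * (cexp Y - 1)))%C by (field; auto).
    rewrite Cmod_div by now apply Cmult_neq_0. rewrite Cmod_mult, MY.
    set (m := Cmod (cexp Y - 1)) in *. apply (Rmult_le_reg_r (r * m)); [nra|]. unfold Rdiv.
    rewrite Rmult_assoc, Rinv_l, Rmult_1_r by nra. nra.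
  - eapply Rle_trans; [apply Cmod_minus_le|]. rewrite !Cmod_inv, MY by auto.
    assert (/ r <= 4) by (replace 4 with (/ / 4) by field; apply Rinv_le_contravar; lra).
    assert (/ Cmod (cexp Y - 1) <= 8).
    { replace 8 with (/ / 8) by field. apply Rinv_le_contravar; [lra|]. nra. }
    lra.
Qed.

Section zeta_side.

Variable w : C.
Hypothesis Hw : 0 < Re w.

Lemma mellin_exp_Yt (x : R) : 0 < x ->
  (exists M, dom M (fun t => cexp (w * t) * cexp (- (x * Yt t)))%C) /\
  CInt_line (fun t => cexp (w * t) * cexp (- (x * Yt t)))%C = (Gam w * mu w * cexp (- w * ln x))%C.
Proof.
  intros Hx. pose proof rt_pos.
  assert (E : forall t : R, (cexp (w * t - ((x + 0 * dir_SE) * dir_SE) * cexp t) = cexp (w * t) * cexp (- (x * Yt t)))%C).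
  { intros t. rewrite <- cexp_plus. f_equal. unfold Yt. ring. }
  split.
  - exists (mellin_const (Re w) (Re ((x + 0 * dir_SE) * dir_SE))). refine (dom_ext _ _ _ E _).
    apply dom_gint; auto. rewrite Re_SE_dir. now apply Rmult_lt_0_compat.
  - rewrite <- (IntR_ext _ _ E), mellin_power by auto. rewrite Cmult_0_l, Cplus_0_r, clog_RtoC by auto. reflexivity.
Qed.

Definition Fz (c t : R) : C := (cexp (w * t) * LI (gY (Yt t)) c)%C.

(* [x^{-w} exp(-pi i x^2)] *)
Definition gP (x : C) : C := (cexp (- w * clog x) * gau PI 0 x)%C.

Lemma Fz_integral (c : R) : 0 < c < 1 ->
  (exists M, dom M (Fz c)) /\ CInt_line (Fz c) = (Gam w * mu w * LI gP c)%C.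
Proof.
  intros Hc. pose proof PI_RGT_0 as HP.
  destruct (over_den_dom _ _ 0 c (-1) 2 (nice_gau PI 0 (-1) 2 HP) ltac:(lra) ltac:(lra)) as [M D].
  destruct (mellin_line _ M c w Hw (proj1 Hc) D) as [[N DN] E].
  set (I := fun t : R => CInt_line _) in DN, E.
  assert (EF : forall t, (dir_SE * I t)%C = Fz c t).
  { intros t. unfold Fz, LI, I. destruct (nice_gY (Yt t) (-1) 2) as [g' Hg].
    destruct (over_den_dom _ _ 0 c (-1) 2 Hg ltac:(lra) ltac:(lra)) as [M' D'].
    rewrite (IntR_ext _ (fun u => cexp (w * t) * (gY (Yt t) (c + u * dir_SE) / den (c + u * dir_SE)))%C).
    - rewrite (IntR_scal M') by exact D'. ring.
    - intros u. cbv beta. unfold gY, Cdiv. rewrite cexp_minus. unfold Cdiv. rewrite <- cexp_opp.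
      replace (- ((c + u * dir_SE) * Yt t))%C with (- ((c + u * dir_SE) * dir_SE * cexp t))%C by (unfold Yt; ring). ring. }
  split.
  - exists (Cmod dir_SE * N). refine (dom_ext _ _ _ EF _). now apply dom_scal.
  - rewrite <- (IntR_ext _ _ EF), (IntR_scal N), <- E by exact DN. unfold LI.
    rewrite (IntR_ext (fun u => gP (c + u * dir_SE) / den (c + u * dir_SE))%C
      (fun u => gau PI 0 (c + u * dir_SE) / den (c + u * dir_SE) * cexp (- w * clog (c + u * dir_SE)))%C); [ring|].
    intros u. unfold gP, Cdiv. ring.
Qed.

(* The remainder of the geometric series after [x] terms against [1/Y]; its integral vanishes as [x] grows. *)
Definition Ez (x t : R) : C := (cexp (w * t) * cexp (- (x * Yt t)) * (/ Yt t - / (cexp (Yt t) - 1)))%C.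

Lemma continuous_Yt t : continuous Yt t.
Proof. unfold Yt. ccont. Qed.

Lemma Ez_bound (x t : R) : Cmod (Ez x t) <= 12 * exp (Re w * t - (x * rt) * exp t).
Proof.
  unfold Ez. rewrite <- cexp_plus, Cmod_mult, Cmod_cexp, Rmult_comm.
  replace (Re (w * t + - (x * Yt t))%C) with (Re w * t - x * rt * exp t) by (rewrite Yt_eq; unfold Re; simpl; ring).
  apply Rmult_le_compat_r; [left; apply exp_pos | apply inv_diff_bound].
Qed.

Lemma continuous_Ez (x t : R) : continuous (Ez x) t.
Proof.
  pose proof (continuous_Yt t). pose proof (exp_Yt_neq t). pose proof (Yt_neq_0 t). unfold Ez. ccont; assumption.
Qed.

Lemma dom_Ez (x : R) : 0 < x -> exists M, dom M (Ez x).
Proof.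
  intros Hx. pose proof rt_pos. exists (12 * mellin_const (Re w) (x * rt)). split; [apply continuous_Ez|].
  intros t. eapply Rle_trans; [apply Ez_bound|]. unfold Rdiv. rewrite (Rmult_assoc 12). apply Rmult_le_compat_l; [lra|].
  apply mellin_bound; auto. now apply Rmult_lt_0_compat.
Qed.

(** Comparison with a real Mellin integral, which is evaluated exactly and decays like x^(- Re
    w). *)
Lemma Ez_integral_le (x : R) : 0 < x -> Cmod (CInt_line (Ez x)) <= 12 * (Cmod (Gam (Re w)) * exp (- (Re w * ln (x * rt)))).
Proof.
  intros Hx. pose proof rt_pos. destruct (dom_Ez x Hx) as [M D].
  assert (Hk : 0 < x * rt) by now apply Rmult_lt_0_compat.
  pose proof (dom_gint (Re w) (x * rt)%R Hw Hk) as G.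
  eapply Rle_trans; [apply (IntR_le_Re _ _ _ (fun t => 12 * cexp (Re w * t - (x * rt)%R * cexp t))%C D (dom_scal _ _ 12 G))|].
  - intros t. eapply Rle_trans; [apply Ez_bound|]. right.
    replace (Re w * t - (x * rt)%R * cexp t)%C with (RtoC (Re w * t - x * rt * exp t)).
    + rewrite cexp_R, <- RtoC_mult. reflexivity.
    + rewrite cexp_R, <- !RtoC_mult, <- RtoC_minus. reflexivity.
  - rewrite (IntR_scal _ _ _ G), gint_value by auto. eapply Rle_trans; [apply Rle_abs|]. eapply Rle_trans; [apply re_le_Cmod|].
    rewrite !Cmod_mult, Cmod_R, Rabs_pos_eq, Cmod_cexp, clog_RtoC by (auto; lra). right. do 3 f_equal. simpl. ring.
Qed.

Lemma Ez_integral_limit : Cseq (fun N => CInt_line (Ez (INR N))) 0.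
Proof.
  pose proof rt_pos as Hr. intros eps He. set (B := 12 * Cmod (Gam (Re w)) + 1).
  assert (HB : 0 < B) by (pose proof (Cmod_ge_0 (Gam (Re w))); unfold B; lra).
  destruct (INR_large (exp (- (ln (eps / B) / Re w)) / rt)) as [N [HN1 HN]]. exists N. intros n Hn. specialize (HN n Hn).
  assert (Hn0 : 0 < INR n) by (apply lt_0_INR; lia).
  replace (CInt_line (Ez (INR n)) - 0)%C with (CInt_line (Ez (INR n))) by ring.
  eapply Rle_trans; [now apply Ez_integral_le|].
  assert (exp (- (Re w * ln (INR n * rt))) <= eps / B).
  { rewrite <- (exp_ln (eps / B)) by now apply Rdiv_lt_0_compat. apply exp_le.
    assert (L : - (ln (eps / B) / Re w) <= ln (INR n * rt)).
    { rewrite <- (ln_exp (- (ln (eps / B) / Re w))). apply ln_le; [apply exp_pos|].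
      apply (Rmult_le_compat_r rt) in HN; [|lra]. unfold Rdiv in HN. rewrite Rmult_assoc, Rinv_l, Rmult_1_r in HN by lra. exact HN. }
    apply (Rmult_le_compat_l (Re w)) in L; [|lra].
    replace (Re w * - (ln (eps / B) / Re w)) with (- ln (eps / B)) in L by (field; lra). lra. }
  apply Rle_trans with (B * (eps / B)); [|right; field; lra].
  pose proof (exp_pos (- (Re w * ln (INR n * rt)))). pose proof (Cmod_ge_0 (Gam (Re w))). unfold B in *. nra.
Qed.

(* Its integral produces the term [N^{1-w}/(1-w)] of the definition of [zeta]. *)
Definition Hz (x t : R) : C := (cexp (w * t) * (cexp (- Yt t) - cexp (- (x * Yt t))) / Yt t)%C.

Lemma Hz_bound (x t : R) : 1 <= x -> Cmod (Hz x t) <= (x - 1) * exp (Re w * t - rt * exp t).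
Proof.
  intros Hx. unfold Hz. pose proof rt_pos. pose proof (exp_pos t).
  rewrite Cmod_div, Cmod_mult, Cmod_cexp, Cmod_Yt by apply Yt_neq_0.
  assert (B : Cmod (cexp (- Yt t) - cexp (- (x * Yt t))) <= exp (- (rt * exp t)) * ((x - 1) * exp t)).
  { replace (cexp (- Yt t) - cexp (- (x * Yt t)))%C with (- (cexp (- Yt t + (1 - x)%R * Yt t) - cexp (- Yt t)))%C.
    2:{ replace (- Yt t + (1 - x)%R * Yt t)%C with (- (x * Yt t))%C by (rewrite RtoC_minus; ring). ring. }
    rewrite Cmod_opp. eapply Rle_trans; [apply (holo_MVT cexp cexp _ _ (exp (- (rt * exp t))))|].
    - intros s _. apply holo_cexp.
    - intros s _. ccont.
    - intros s Hs. rewrite Cmod_cexp. apply exp_le. rewrite Yt_eq. unfold Re. simpl.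
      assert (0 <= s * (x - 1) * (rt * exp t)) by (repeat apply Rmult_le_pos; lra). lra.
    - rewrite Cmod_mult, Cmod_Yt, Cmod_R, Rabs_left1 by lra. right. ring. }
  replace (Re (w * t)%C) with (Re w * t) by (unfold Re; simpl; ring).
  unfold Rminus at 2. rewrite exp_plus. unfold Rdiv. apply (Rmult_le_reg_r (exp t)); [auto|].
  rewrite (Rmult_assoc _ (/ exp t)), Rinv_l, Rmult_1_r by lra.
  replace ((x - 1) * (exp (Re w * t) * exp (- (rt * exp t))) * exp t) with (exp (Re w * t) * (exp (- (rt * exp t)) * ((x - 1) * exp t))) by ring.
  apply Rmult_le_compat_l; [left; apply exp_pos | exact B].
Qed.

Lemma dom_Hz (x : R) : 1 <= x -> exists M, dom M (Hz x).
Proof.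
  intros Hx. pose proof rt_pos. exists ((x - 1) * mellin_const (Re w) rt). split.
  - intros t. pose proof (continuous_Yt t). pose proof (Yt_neq_0 t). unfold Hz. ccont; assumption.
  - intros t. eapply Rle_trans; [now apply Hz_bound|]. unfold Rdiv. rewrite (Rmult_assoc (x - 1)). apply Rmult_le_compat_l; [lra|].
    now apply mellin_bound.
Qed.

Lemma cexp_w_minus_1 (t : R) : (cexp ((w - 1) * t) * Yt t = dir_SE * cexp (w * t))%C.
Proof.
  unfold Yt. replace ((w - 1) * t)%C with (w * t - t)%C by ring. rewrite cexp_minus. field. apply cexp_neq_0.
Qed.

(** Formally a difference of two multiples of Gamma(w - 1), whose integrals diverge separately for
    Re w <= 1. The combined integral converges for Re w > 0, and integration by parts brings in the
    factor w - 1. *)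
Lemma Hz_integral (x : R) : 1 <= x ->
  ((w - 1) * CInt_line (Hz x) = Gam w * mu w * (1 - cexp ((1 - w) * ln x)))%C.
Proof.
  intros Hx. destruct (dom_Hz x Hx) as [M D].
  destruct (mellin_exp_Yt 1 ltac:(lra)) as [[M1 D1] E1]. destruct (mellin_exp_Yt x ltac:(lra)) as [[M2 D2] E2].
  set (G1 := fun t : R => (cexp (w * t) * cexp (- (1%R * Yt t)))%C) in *. set (G2 := fun t : R => (cexp (w * t) * cexp (- (x * Yt t)))%C) in *.
  set (f := fun T : C => (cexp ((w - 1) * T) * (cexp (- (dir_SE * cexp T)) - cexp (- (x * (dir_SE * cexp T)))))%C).
  set (f' := fun T : C => ((w - 1) * f T + cexp ((w - 1) * T) * (dir_SE * cexp T) * (x * cexp (- (x * (dir_SE * cexp T))) - cexp (- (dir_SE * cexp T))))%C).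
  assert (Ef : forall t : R, (dir_SE * Hz x t)%C = f t).
  { intros t. unfold f, Hz. change (dir_SE * cexp t)%C with (Yt t).
    replace (cexp ((w - 1) * t)) with (dir_SE * cexp (w * t) / Yt t)%C by (rewrite <- cexp_w_minus_1; field; apply Yt_neq_0).
    field. apply Yt_neq_0. }
  assert (Ef' : forall t : R, (dir_SE * ((w - 1) * Hz x t + (x * G2 t - G1 t)))%C = f' t).
  { intros t. unfold f'. rewrite <- Ef. change (dir_SE * cexp t)%C with (Yt t). rewrite cexp_w_minus_1. unfold G1, G2.
    replace (1%R * Yt t)%C with (Yt t) by ring. ring. }
  pose proof (dom_scal _ _ (w - 1) D) as DA. pose proof (dom_scal _ _ x D2) as DB.
  pose proof (dom_plus _ _ _ _ DA (dom_minus _ _ _ _ DB D1)) as DC. cbv beta in DC.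
  pose proof (dom_scal _ _ dir_SE DC) as DD. cbv beta in DD.
  assert (Z : CInt_line (fun t : R => f' t) = RtoC 0).
  { eapply (IntR_derivative f f').
    - intros t. unfold f. eapply holo_eq; [holo_tac|]. unfold f', f. ring.
    - intros t. unfold f', f. ccont.
    - exact (dom_ext _ _ _ Ef' DD).
    - exact (dom_ext _ _ _ Ef (dom_scal _ _ dir_SE D)). }
  rewrite <- (IntR_ext _ _ Ef'), (IntR_scal _ _ _ DC), (IntR_plus _ _ _ _ DA (dom_minus _ _ _ _ DB D1)),
    (IntR_minus _ _ _ _ DB D1), (IntR_scal _ _ _ D), (IntR_scal _ _ _ D2), E1, E2 in Z.
  rewrite ln_1 in Z. replace (- w * 0)%C with (RtoC 0) in Z by ring. rewrite cexp_0 in Z.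
  replace ((1 - w) * ln x)%C with (- w * ln x + ln x)%C by ring. rewrite cexp_plus, (cexp_R (ln x)), exp_ln by lra.
  apply (f_equal (fun z => (z / dir_SE)%C)) in Z.
  match type of Z with ((dir_SE * ?a) / _ = _)%C => replace ((dir_SE * a) / dir_SE)%C with a in Z by (field; apply dir_SE_neq_0) end.
  replace (0 / dir_SE)%C with (RtoC 0) in Z by (unfold Cdiv; ring).
  match type of Z with (?a + ?b)%C = _ => replace a with ((a + b) - b)%C by ring; rewrite Z end. ring.
Qed.

(** What is left of the partial sums once everything depending on N is split off: the first term of
    the series, the Mordell integral and the remainder at 1. *)
Definition Mz (c t : R) : C := (cexp (w * t) * cexp (- (1 * Yt t)) - Fz c t - Ez 1 t)%C.

(** The summand with exp (-(x + 1) Y) is the increment of [Hz + Ez] from x to x + 1, so the sum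
    telescopes. Summing the geometric series outright is impossible for Re w <= 1, since 1 / (exp Y
    - 1) behaves like 1 / Y at the origin; hence the comparison with 1 / Y. *)
Lemma zeta_partial (c : R) (N : nat) : 0 < c < 1 -> (1 <= N)%nat ->
  (Gam w * mu w * (CsumZ (fun n => cpow (RtoC (IZR n)) (- w)) 1 (Z.of_nat N) - LI gP c) =
   CInt_line (Mz c) + CInt_line (Hz (INR N)) + CInt_line (Ez (INR N)))%C.
Proof.
  intros Hc HN. destruct N as [|N]; [lia|]. clear HN.
  destruct (Fz_integral c Hc) as [[MF DF] EF]. induction N as [|N IH].
  - destruct (mellin_exp_Yt 1 ltac:(lra)) as [[M1 D1] E1]. destruct (dom_Ez 1 ltac:(lra)) as [ME DE].
    assert (HZ : CInt_line (Hz 1) = RtoC 0).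
    { assert (D0 : dom 0 (fun _ : R => RtoC 0)).
      { split; [intros t; apply continuous_const|]. intros t. rewrite Cmod_0. unfold Rdiv. rewrite Rmult_0_l. lra. }
      rewrite (IntR_ext (Hz 1) (fun _ => 0 * 0)%C).
      - rewrite (IntR_scal 0 (fun _ => RtoC 0) 0 D0). ring.
      - intros t. unfold Hz. replace (1%R * Yt t)%C with (Yt t) by ring. unfold Cdiv. ring. }
    unfold Mz. rewrite (IntR_minus _ _ _ _ (dom_minus _ _ _ _ D1 DF) DE), (IntR_minus _ _ _ _ D1 DF), E1, EF.
    change (INR 1) with 1. rewrite HZ, ln_1.
    change (Z.of_nat 1) with (0 + 1)%Z. rewrite CsumZ_succ, CsumZ_empty by lia. change (IZR (0 + 1)) with 1.
    rewrite cpow_RtoC, ln_1 by lra. replace (- w * 0)%C with (RtoC 0) by ring. rewrite cexp_0. ring.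
  - set (x := INR (S N)) in *. assert (Hx : 1 <= x) by (unfold x; apply (le_INR 1); lia).
    replace (INR (S (S N))) with (x + 1) by (unfold x; rewrite (S_INR (S N)); ring).
    replace (Z.of_nat (S (S N))) with (Z.of_nat (S N) + 1)%Z by lia. rewrite CsumZ_succ by lia.
    replace (IZR (Z.of_nat (S N) + 1)) with (x + 1) by (rewrite plus_IZR, <- INR_IZR_INZ; reflexivity).
    destruct (mellin_exp_Yt (x + 1) ltac:(lra)) as [[M1 D1] E1].
    destruct (dom_Ez x ltac:(lra)) as [ME DE]. destruct (dom_Ez (x + 1) ltac:(lra)) as [ME1 DE1].
    destruct (dom_Hz x Hx) as [MH DH]. destruct (dom_Hz (x + 1) ltac:(lra)) as [MH1 DH1].
    rewrite (IntR_ext _ (fun t => (Hz (x + 1) t - Hz x t) + (Ez (x + 1) t - Ez x t))%C) in E1.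
    2:{ intros t. unfold Hz, Ez. rewrite RtoC_plus. replace (- ((x + 1) * Yt t))%C with (- (x * Yt t) - Yt t)%C by ring.
        rewrite cexp_minus. field. pose proof (Yt_neq_0 t). pose proof (exp_Yt_neq t). pose proof (cexp_neq_0 (Yt t)). repeat split; auto. }
    rewrite (IntR_plus _ _ _ _ (dom_minus _ _ _ _ DH1 DH) (dom_minus _ _ _ _ DE1 DE)), (IntR_minus _ _ _ _ DH1 DH), (IntR_minus _ _ _ _ DE1 DE) in E1.
    rewrite cpow_RtoC by lra.
    match goal with |- (_ * (?S + ?T - ?L) = _)%C => replace (Gam w * mu w * (S + T - L))%C with (Gam w * mu w * (S - L) + Gam w * mu w * T)%C by ring end.
    rewrite IH, <- E1. ring.
Qed.

Lemma mu_neq_0 : mu w <> RtoC 0.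
Proof. apply cexp_neq_0. Qed.

(** The [Hz] term supplies the N^(1-w) / (1-w) that the definition of [zeta] subtracts, together
    with the constant 1 / (1 - w); the [Ez] term tends to 0. *)
Lemma zeta_main (c : R) : 0 < c < 1 -> w <> RtoC 1 ->
  (Gam w * mu w * (zeta w + 1 / (1 - w) - LI gP c) = CInt_line (Mz c))%C.
Proof.
  intros Hc H1. pose proof (Gam_neq_0 w Hw) as G0. pose proof mu_neq_0 as M0.
  assert (H1' : (1 - w)%C <> RtoC 0) by (intros E; apply H1; replace w with (1 - (1 - w))%C by ring; rewrite E; ring).
  assert (L : zeta w = (LI gP c + CInt_line (Mz c) / (Gam w * mu w) - 1 / (1 - w) + 0 * / (Gam w * mu w))%C).
  { unfold zeta. apply Clim_unique.
    apply (Cseq_ext_from 1 (fun N => (LI gP c + CInt_line (Mz c) / (Gam w * mu w) - 1 / (1 - w)) + CInt_line (Ez (INR N)) * / (Gam w * mu w))%C).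
    - intros N HN. pose proof (zeta_partial c N Hc HN) as P. assert (Hx : 1 <= INR N) by (apply (le_INR 1); lia).
      pose proof (Hz_integral (INR N) Hx) as Q. rewrite cpow_RtoC by lra.
      set (S := CsumZ _ _ _) in *. set (P1 := cexp ((1 - w) * ln (INR N))) in *.
      replace S with (LI gP c + (Gam w * mu w * (S - LI gP c)) / (Gam w * mu w))%C by (field; auto). rewrite P.
      replace (CInt_line (Hz (INR N))) with (Gam w * mu w * (1 - P1) / (w - 1))%C.
      + field. repeat split; auto. intros E. apply H1'. replace (1 - w)%C with (- (w - 1))%C by ring. rewrite E. ring.
      + rewrite <- Q. field. intros E. apply H1'. replace (1 - w)%C with (- (w - 1))%C by ring. rewrite E. ring.
    - apply Cseq_plus; [apply Cseq_const|]. apply Cseq_mult; [apply Ez_integral_limit | apply Cseq_const]. }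
  rewrite L. field. auto.
Qed.

End zeta_side.

Lemma ci_dir_NE : (ci * dir_NE = - dir_SE)%C.
Proof. rewrite dir_NE_eq, dir_SE_eq. unfold ci. apply injective_projections; simpl; ring. Qed.

Lemma den_NE_neq_0 (r : R) : 0 < r -> den (r * dir_NE) <> RtoC 0.
Proof.
  intros Hr. apply Cmod_gt_0. replace (r * dir_NE)%C with (((rt * r)%R, (rt * r)%R) : C).
  - eapply Rlt_le_trans; [|apply Cmod_den_ge_im]. pose proof PI_RGT_0. pose proof rt_pos.
    assert (0 < rt * r) by now apply Rmult_lt_0_compat. rewrite Rabs_pos_eq by lra. nra.
  - rewrite dir_NE_eq. apply injective_projections; simpl; ring.
Qed.

(* With [x = cexp t * dir_NE] this is [x^w hp(x) dx/x] on the diagonal half-line, up to a constant; both R(s) and the zeta side reduce to its integral. *)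
Definition hp_mellin (w : C) (t : R) : C := (cexp (w * t) * hp (cexp t * dir_NE))%C.

Lemma dom_hp_mellin (w : C) : 0 < Re w -> exists M, dom M (hp_mellin w).
Proof.
  intros Hw. pose proof PI_RGT_0 as HP. destruct (hp_bound (/ 2) ltac:(lra)) as [K [HK B]].
  set (G := exp ((20 + 1) * (20 + 1) / (4 * PI))).
  exists (K * G * mellin_const (Re w) 1). split.
  - intros t. pose proof (den_NE_neq_0 (exp t) (exp_pos t)) as D0. rewrite <- cexp_R in D0. unfold hp_mellin.
    apply continuous_Cmult; [ccont|]. apply (continuous_comp (fun t : R => (cexp t * dir_NE)%C) hp); [ccont | now apply continuous_hp].
  - intros t. unfold hp_mellin. rewrite Cmod_mult, Cmod_cexp, cexp_R. pose proof (exp_pos t) as Ht. set (s := exp t) in *.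
    assert (N0 : (0 + s * dir_NE)%C <> RtoC 0).
    { apply Cmod_gt_0. rewrite Cplus_0_l, Cmod_mult, Cmod_dir_NE, Cmod_R, Rabs_pos_eq; lra. }
    specialize (B 0 s ltac:(lra) N0). rewrite Cplus_0_l in B.
    pose proof (exp_gauss_le PI 20 s HP) as Q. fold G in Q. rewrite (Rabs_pos_eq s) in B, Q by lra.
    replace (Re (w * t)%C) with (Re w * t) by (unfold Re; simpl; ring).
    pose proof (mellin_bound (Re w) 1 t Hw ltac:(lra)) as MB. unfold Rminus in MB. rewrite exp_plus in MB. fold s in MB.
    assert (HG : 0 < G) by apply exp_pos. pose proof (exp_pos (Re w * t)).
    apply Rle_trans with (exp (Re w * t) * (K * (G * exp (- (1 * s))))).
    + apply Rmult_le_compat_l; [lra|]. eapply Rle_trans; [exact B|]. now apply Rmult_le_compat_l.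
    + unfold Rdiv in *. assert (0 <= K * G) by (apply Rmult_le_pos; lra). apply (Rmult_le_compat_l (K * G)) in MB; auto. lra.
Qed.

Lemma hp_mellin_shift (w : C) (t : R) :
  (cexp (w * t) * hp (cexp t * dir_NE / (2 * PI)) = cexp (w * ln (2 * PI)) * hp_mellin w (t + - ln (2 * PI)))%C.
Proof.
  pose proof PI_RGT_0. unfold hp_mellin. rewrite RtoC_plus, RtoC_opp. replace (w * (t + - ln (2 * PI)))%C with (w * t - w * ln (2 * PI))%C by ring.
  rewrite (cexp_minus (w * t)). replace (t + - ln (2 * PI))%C with (t - ln (2 * PI))%C by ring. rewrite (cexp_minus t), (cexp_R (ln _)), exp_ln by lra.
  rewrite RtoC_mult. replace (cexp t * dir_NE / (2 * PI))%C with (cexp t / (2 * PI) * dir_NE)%C; [field; apply cexp_neq_0|].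
  field. intros E. inversion E. lra.
Qed.

(** Here 2 pi i x = - Y: the Gaussian term in the closed form of [mordell_J], multiplied by Y, is
    [hf] on the diagonal half-line. *)
Lemma hf_Yt (t : R) : den (cexp t * dir_NE / (2 * PI)) <> RtoC 0 /\
  (2 * (PI * ci) * hf (cexp t * dir_NE / (2 * PI)) =
   Yt t * (cexp (Yt t / 2) * cexp (- (ci * (Yt t * Yt t) / (4 * PI)))) / (cexp (Yt t) - 1))%C.
Proof.
  pose proof PI_RGT_0 as HP. assert (P0 : RtoC PI <> RtoC 0) by (intros E; inversion E; lra).
  set (x := (cexp t * dir_NE / (2 * PI))%C). set (Y := Yt t).
  assert (X : (PI * ci * x = - (Y / 2))%C).
  { unfold x, Y, Yt. replace (PI * ci * (cexp t * dir_NE / (2 * PI)))%C with (cexp t * (ci * dir_NE) / 2)%C by (field; auto).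
    rewrite ci_dir_NE. field. }
  assert (D : den x = (cexp (- (Y / 2)) - cexp (Y / 2))%C).
  { unfold den. rewrite X. do 2 f_equal. ring. }
  assert (D2 : (den x * cexp (Y / 2) = - (cexp Y - 1))%C).
  { rewrite D. replace (cexp Y) with (cexp (Y / 2) * cexp (Y / 2))%C by (rewrite <- cexp_plus; f_equal; field).
    pose proof (cexp_neg_mult (Y / 2)) as N. rewrite <- (Cmult_1_r 1), Cmult_1_r.
    replace (RtoC 1) with (cexp (- (Y / 2)) * cexp (Y / 2))%C by exact N. ring. }
  pose proof (exp_Yt_neq t) as E0. fold Y in E0.
  assert (D0 : den x <> RtoC 0).
  { intros E. rewrite E in D2. apply E0. replace (cexp Y - 1)%C with (- - (cexp Y - 1))%C by ring. rewrite <- D2. ring. }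
  split; [exact D0|]. unfold hf.
  assert (E1 : e1 x = cexp (- (ci * (Y * Y) / (4 * PI)))).
  { unfold e1. f_equal. rewrite X. replace (- (Y / 2) * x)%C with (- (Y / 2) * (PI * ci * x) * (- ci) / PI)%C.
    - rewrite X. field. auto.
    - replace (- (Y / 2) * (PI * ci * x) * - ci / PI)%C with (- (Y / 2) * x * (- (ci * ci)))%C by (field; auto). rewrite ci_sqr. ring. }
  rewrite E1. replace (2 * (PI * ci) * (x * cexp (- (ci * (Y * Y) / (4 * PI))) / den x))%C with
    (2 * (PI * ci * x) * cexp (- (ci * (Y * Y) / (4 * PI))) / den x)%C by (field; auto).
  rewrite X. replace (cexp Y - 1)%C with (- (den x * cexp (Y / 2)))%C by (rewrite D2; ring).
  field. pose proof (cexp_neq_0 (Y / 2)). repeat split; auto.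
Qed.

Lemma Mz_eq (w : C) (c t : R) : 0 < c < 1 ->
  (dir_SE * Mz w c t = cexp ((w - 1) * t) * (2 * (PI * ci) * hf (cexp t * dir_NE / (2 * PI)) - cexp (- Yt t)))%C.
Proof.
  intros Hc. rewrite (proj2 (hf_Yt t)). pose proof (mordell_J (Yt t) c Hc) as J. pose proof (exp_Yt_neq t) as E0. pose proof (Yt_neq_0 t) as Y0.
  unfold Mz, Fz, Ez. replace (1%R * Yt t)%C with (Yt t) by ring. set (Y := Yt t) in *.
  set (EE := (cexp (Y / 2) * cexp (- (ci * (Y * Y) / (4 * PI))))%C) in *.
  replace (LI (gY Y) c) with ((1 - EE) / (cexp Y - 1))%C by (rewrite <- J; field; auto).
  replace (cexp ((w - 1) * t)) with (dir_SE * cexp (w * t) / Y)%C by (rewrite <- cexp_w_minus_1; fold Y; field; auto).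
  rewrite cexp_opp. field. repeat split; auto. apply cexp_neq_0.
Qed.

(** Integration by parts in t. Both 2 pi i hf(x) and exp (-Y) tend to 1 at the origin, so their
    difference compensates exp ((w - 1) t), and no boundary term appears even for Re w <= 1. *)
Lemma zeta_hp_mellin (w : C) (c : R) : 0 < Re w -> w <> RtoC 1 -> 0 < c < 1 ->
  (Gam w * mu w * ((w - 1) * (zeta w - LI (gP w) c)) = cexp (w * ln (2 * PI)) * CInt_line (hp_mellin w))%C.
Proof.
  intros Hw H1 Hc. pose proof PI_RGT_0 as HP. assert (P0 : RtoC PI <> RtoC 0) by (intros E; inversion E; lra).
  destruct (mellin_exp_Yt w Hw 1 ltac:(lra)) as [[M1 D1] E1]. rewrite ln_1 in E1.
  replace (- w * 0)%C with (RtoC 0) in E1 by ring. rewrite cexp_0 in E1.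
  destruct (Fz_integral w Hw c Hc) as [[MF DF] _]. destruct (dom_Ez w Hw 1 ltac:(lra)) as [ME DE].
  pose proof (dom_minus _ _ _ _ (dom_minus _ _ _ _ D1 DF) DE) as DM. change (fun t => _) with (Mz w c) in DM.
  destruct (dom_hp_mellin w Hw) as [MA DA].
  set (G1 := fun t : R => (cexp (w * t) * cexp (- (1%R * Yt t)))%C) in *.
  set (P := fun t : R => (cexp (w * t) * hp (cexp t * dir_NE / (2 * PI)))%C).
  pose proof (dom_scal _ _ (cexp (w * ln (2 * PI))) (dom_shift _ _ (- ln (2 * PI)) DA)) as DP. cbv beta in DP.
  pose proof (dom_ext _ _ P (fun t => eq_sym (hp_mellin_shift w t)) DP) as DP'.
  assert (EP : CInt_line P = (cexp (w * ln (2 * PI)) * CInt_line (hp_mellin w))%C).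
  { unfold P. rewrite (IntR_ext _ _ (hp_mellin_shift w)). rewrite (IntR_scal _ _ _ (dom_shift _ _ (- ln (2 * PI)) DA)).
    now rewrite (IntR_shift MA (hp_mellin w)). }
  rewrite <- EP. clear DP EP.
  set (x := fun T : C => (cexp T * dir_NE / (2 * PI))%C).
  set (f := fun T : C => (cexp ((w - 1) * T) * (2 * (PI * ci) * hf (x T) - cexp (- (dir_SE * cexp T))))%C).
  set (f' := fun T : C => ((w - 1) * f T + cexp ((w - 1) * T) * (2 * (PI * ci) * (hp (x T) * x T) + dir_SE * cexp T * cexp (- (dir_SE * cexp T))))%C).
  assert (Hx : forall T, holo x T (x T)).
  { intros T. unfold x. eapply holo_eq; [holo_tac|]; [|field]; try (intros E; inversion E; lra); auto. }
  assert (Ef : forall t : R, (dir_SE * Mz w c t)%C = f t) by (intros t; now apply Mz_eq).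
  assert (Ef' : forall t : R, (dir_SE * ((w - 1) * Mz w c t + (G1 t - P t)))%C = f' t).
  { intros t. unfold f'. rewrite <- Ef. change (dir_SE * cexp t)%C with (Yt t).
    replace (2 * (PI * ci) * (hp (x t) * x t))%C with (- (Yt t * hp (x t)))%C.
    - replace (cexp ((w - 1) * t) * (- (Yt t * hp (x t)) + Yt t * cexp (- Yt t)))%C with
        ((cexp ((w - 1) * t) * Yt t) * (cexp (- Yt t) - hp (x t)))%C by ring.
      rewrite cexp_w_minus_1. unfold G1, P. fold (x t). replace (1%R * Yt t)%C with (Yt t) by ring. ring.
    - unfold x at 3. unfold Yt. replace (- (dir_SE * cexp t * hp (x t)))%C with (- dir_SE * cexp t * hp (x t))%C by ring.
      rewrite <- ci_dir_NE. field. auto. }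
  pose proof (dom_scal _ _ (w - 1) DM) as DA1.
  pose proof (dom_plus _ _ _ _ DA1 (dom_minus _ _ _ _ D1 DP')) as DC. cbv beta in DC.
  pose proof (dom_scal _ _ dir_SE DC) as DD. cbv beta in DD.
  assert (Z : CInt_line (fun t : R => f' t) = RtoC 0).
  { eapply (IntR_derivative f f').
    - intros t. pose proof (proj1 (hf_Yt t)) as D0. fold (x t) in D0.
      pose proof (holo_comp hf x t _ _ (Hx t) (holo_hf _ D0)) as HH. cbv beta in HH.
      unfold f. eapply holo_eq; [holo_tac|]. unfold f', f. ring.
    - intros t. pose proof (proj1 (hf_Yt t)) as D0. fold (x t) in D0.
      pose proof (holo_continuous _ _ _ (Hx t)) as C0.
      pose proof (continuous_comp x hp (RtoC t) C0 (continuous_hp _ D0)) as C1.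
      pose proof (continuous_comp x hf (RtoC t) C0 (holo_continuous _ _ _ (holo_hf _ D0))) as C2.
      unfold f', f. ccont.
    - exact (dom_ext _ _ _ Ef' DD).
    - exact (dom_ext _ _ _ Ef (dom_scal _ _ dir_SE DM)). }
  rewrite <- (IntR_ext _ _ Ef'), (IntR_scal _ _ _ DC), (IntR_plus _ _ _ _ DA1 (dom_minus _ _ _ _ D1 DP')),
    (IntR_minus _ _ _ _ D1 DP'), (IntR_scal _ _ _ DM), E1 in Z.
  rewrite <- (zeta_main w Hw c Hc H1) in Z.
  assert (H1' : (1 - w)%C <> RtoC 0) by (intros E; apply H1; replace w with (1 - (1 - w))%C by ring; rewrite E; ring).
  apply (f_equal (fun z => (z / dir_SE)%C)) in Z.
  match type of Z with ((dir_SE * ?a) / _ = _)%C => replace ((dir_SE * a) / dir_SE)%C with a in Z by (field; split; [exact H1' | apply dir_SE_neq_0]) end.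
  replace (0 / dir_SE)%C with (RtoC 0) in Z by (unfold Cdiv; ring).
  replace (CInt_line P) with (0 + CInt_line P)%C by ring. rewrite <- Z. field. exact H1'.
Qed.

(** * The integral R(s) on lines through the origin *)

Lemma SW_NE (c u : R) : (c + u * dir_SW)%C = (c + (- u)%R * dir_NE)%C.
Proof. unfold dir_NE. rewrite RtoC_opp. ring. Qed.

Lemma Cmod_SW_ge (c u : R) : rt * Rabs u <= Cmod (c + u * dir_SW).
Proof.
  pose proof (im_le_Cmod (c + u * dir_SW)) as I. rewrite SW_point in *. simpl in I. rewrite Rabs_Ropp, Rabs_mult, (Rabs_pos_eq rt) in I; auto.
  left; apply rt_pos.
Qed.

Lemma Cmod_SW_ge_c (c u : R) : 0 < c -> c * rt <= Cmod (c + u * dir_SW).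
Proof.
  intros Hc. pose proof rt_pos. pose proof rt_sqr. pose proof (Cmod_sqr (c + u * dir_SW)) as S. rewrite SW_point in *. simpl in S.
  set (m := Cmod _) in *. assert (0 <= m) by apply Cmod_ge_0.
  assert (c * rt * (c * rt) <= m * m).
  { rewrite S. replace (c * rt * (c * rt)) with (c * c * (rt * rt)) by ring.
    replace ((c - rt * u) * (c - rt * u) + - (rt * u) * - (rt * u)) with (c * c - 2 * (c * (rt * u)) + 2 * (rt * u * (rt * u))) by ring.
    rewrite H0. pose proof (pow2_ge_0 (c - 2 * (rt * u))). nra. }
  assert (0 < c * rt) by nra. nra.
Qed.

Lemma Cmod_SW_le (c u : R) : 0 <= c -> Cmod (c + u * dir_SW) <= c + Rabs u.
Proof.
  intros Hc. eapply Rle_trans; [apply Cmod_triangle|]. rewrite Cmod_mult, !Cmod_R, (Rabs_pos_eq c) by auto.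
  replace (Cmod dir_SW) with 1; [lra|]. rewrite <- Cmod_dir_NE. unfold dir_NE. now rewrite Cmod_opp.
Qed.

Lemma Cmod_power_le (a x : C) : x <> RtoC 0 -> Cmod (cexp (a * clog x)) <= exp (Re a * ln (Cmod x)) * exp (PI * Rabs (Im a)).
Proof.
  intros Hx. rewrite Cmod_cexp, <- exp_plus. apply exp_le.
  replace (Re (a * clog x)%C) with (Re a * ln (Cmod x) - Im a * carg x) by reflexivity.
  pose proof (carg_bound x Hx). pose proof PI_RGT_0. pose proof (Rle_abs (- (Im a * carg x))) as A. rewrite Rabs_Ropp, Rabs_mult in A.
  assert (Rabs (carg x) <= PI) by (apply Rabs_le; lra). pose proof (Rabs_pos (Im a)). pose proof (Rabs_pos (carg x)). nra.
Qed.

Lemma ln_le_minus_1 (x : R) : 0 < x -> ln x <= x - 1.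
Proof. intros H. pose proof (exp_ineq1_le (ln x)). rewrite exp_ln in H0 by auto. lra. Qed.

Definition pw (a : C) (h : C -> C) (x : C) : C := (cexp (a * clog x) * h x)%C.

Lemma holo_pw a h l x : slit x -> holo h x l -> holo (pw a h) x (cexp (a * clog x) * (a * h x / x + l))%C.
Proof.
  intros Hs Hh. pose proof (holo_clog x Hs) as L. pose proof (slit_neq_0 _ Hs). unfold pw. eapply holo_eq.
  - apply (holo_mult (fun x => cexp (a * clog x)) h); [|exact Hh]. apply (holo_cexp_comp (fun x => (a * clog x)%C)). apply (holo_scal clog), L.
  - cbv beta. field. auto.
Qed.

Lemma continuous_pw a h x : slit x -> continuous h x -> continuous (pw a h) x.
Proof.
  intros Hs Hh. unfold pw. apply continuous_Cmult; [|exact Hh]. apply continuous_cexp.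
  apply continuous_Cmult; [apply continuous_const | now apply continuous_clog].
Qed.

Lemma SW_den_neq_0 (c u : R) : 0 < c < 1 -> den (c + u * dir_SW) <> RtoC 0.
Proof.
  intros Hc. destruct (den_lower_lines c c ltac:(lra) ltac:(lra)) as [k [Hk K]].
  apply (den_neq_0_of_lower _ k Hk). apply K. lra.
Qed.

Lemma pw_bound (a : C) (h : C -> C) (x y K b : R) : 0 < x -> y < 1 -> 0 <= K ->
  (forall c u : R, x <= c <= y -> Cmod (h (c + u * dir_SW)%C) <= K * exp (- (PI * (u * u)) + b * Rabs u)) ->
  exists M, forall c u : R, x <= c <= y -> Cmod (pw a h (c + u * dir_SW)%C) <= M / (1 + u * u).
Proof.
  intros Hx Hy HK B. pose proof PI_RGT_0 as HP. pose proof rt_pos.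
  set (L := Rabs (ln (x * rt)) + 1). set (A := Rabs (Re a)). assert (HA : 0 <= A) by apply Rabs_pos.
  exists (K * exp (A * L) * exp (PI * Rabs (Im a)) * (4 * exp ((b + A + 1) * (b + A + 1) / (4 * PI)))). intros c u Hc.
  assert (N0 : (c + u * dir_SW)%C <> RtoC 0) by (apply carg_SW_line; lra).
  unfold pw. rewrite Cmod_mult. pose proof (Cmod_power_le a _ N0) as P. specialize (B c u Hc).
  pose proof (Cmod_SW_ge_c c u ltac:(lra)) as G1. pose proof (Cmod_SW_le c u ltac:(lra)) as G2. set (m := Cmod (c + u * dir_SW)) in *.
  assert (H1 : 0 < x * rt) by now apply Rmult_lt_0_compat.
  assert (H2 : x * rt <= m) by (eapply Rle_trans; [|exact G1]; apply Rmult_le_compat_r; lra).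
  assert (H3 : Rabs (ln m) <= L + Rabs u).
  { unfold L. apply Rabs_le. split.
    - apply Rle_trans with (ln (x * rt)); [|apply ln_le; lra].
      pose proof (Rle_abs (- ln (x * rt))) as Q. rewrite Rabs_Ropp in Q. pose proof (Rabs_pos u). lra.
    - pose proof (ln_le_minus_1 m ltac:(lra)). pose proof (Rabs_pos (ln (x * rt))). lra. }
  assert (H4 : exp (Re a * ln m) <= exp (A * L) * exp (A * Rabs u)).
  { rewrite <- exp_plus. apply exp_le. eapply Rle_trans; [apply Rle_abs|]. rewrite Rabs_mult. fold A. nra. }
  pose proof (exp_gauss_dom PI (b + A) u HP) as G. replace ((b + A) * Rabs u) with (b * Rabs u + A * Rabs u) in G by ring.
  rewrite <- Rplus_assoc, exp_plus in G.
  apply Rle_trans with ((exp (A * L) * exp (A * Rabs u) * exp (PI * Rabs (Im a))) * (K * exp (- (PI * (u * u)) + b * Rabs u))).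
  - apply Rmult_le_compat; try apply Cmod_ge_0; auto. eapply Rle_trans; [exact P|]. apply Rmult_le_compat_r; [left; apply exp_pos | exact H4].
  - set (X := exp (A * Rabs u)) in *. set (Z := exp (- (PI * (u * u)) + b * Rabs u)) in *.
    set (k := K * exp (A * L) * exp (PI * Rabs (Im a))). assert (0 <= k) by (unfold k; repeat apply Rmult_le_pos; auto; left; apply exp_pos).
    apply (Rmult_le_compat_l k) in G; auto. unfold Rdiv in *. unfold k in *. lra.
Qed.

Lemma hf_SW_bound (x y : R) : 0 < x -> y < 1 -> exists K, 0 <= K /\
  forall c u : R, x <= c <= y -> Cmod (hf (c + u * dir_SW)%C) <= K * exp (- (PI * (u * u)) + 20 * Rabs u).
Proof.
  intros Hx Hy. destruct (den_lower_lines x y Hx Hy) as [k [Hk Kd]]. pose proof PI_4. assert (0 < / k) by now apply Rinv_0_lt_compat.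
  exists (/ k * exp 1). split; [left; apply Rmult_lt_0_compat; auto; apply exp_pos|].
  intros c u Hc. destruct (Kd c u Hc) as [_ D]. assert (D0 := den_neq_0_of_lower _ _ Hk D).
  pose proof (e1_NE_bound c (- u) ltac:(lra)) as E1. rewrite <- SW_NE in E1. rewrite Rabs_Ropp in E1. replace (- u * - u) with (u * u) in E1 by ring.
  pose proof (Cmod_SW_le c u ltac:(lra)) as G2. pose proof (Rabs_pos u).
  assert (G3 : Cmod (c + u * dir_SW) <= exp 1 * exp (Rabs u)).
  { rewrite <- exp_plus. pose proof (exp_ineq1_le (1 + Rabs u)). lra. }
  unfold hf. rewrite Cmod_div, Cmod_mult by auto.
  eapply Rle_trans; [apply (Rinv_bound_div _ k); auto; apply Rmult_le_pos; apply Cmod_ge_0|].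
  apply Rle_trans with (/ k * ((exp 1 * exp (Rabs u)) * exp (- (PI * (u * u)) + 2 * PI * Rabs u))).
  - unfold Rdiv. rewrite (Rmult_comm (/ k)). apply Rmult_le_compat_r; [lra|]. apply Rmult_le_compat; auto; apply Cmod_ge_0.
  - rewrite (Rmult_assoc (/ k)). apply Rmult_le_compat_l; [lra|]. rewrite (Rmult_assoc (exp 1)). apply Rmult_le_compat_l; [left; apply exp_pos|].
    rewrite <- exp_plus. apply exp_le. nra.
Qed.

Lemma hp_SW_bound (x y : R) : 0 < x -> y < 1 -> exists K, 0 <= K /\
  forall c u : R, x <= c <= y -> Cmod (hp (c + u * dir_SW)%C) <= K * exp (- (PI * (u * u)) + 20 * Rabs u).
Proof.
  intros Hx Hy. destruct (Rle_dec x y) as [L|L].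
  2:{ exists 0. split; [lra|]. intros c u Hc. lra. }
  destruct (hp_bound y ltac:(lra)) as [K [HK B]]. exists K. split; auto. intros c u Hc.
  assert (N0 : (c + u * dir_SW)%C <> RtoC 0) by (apply carg_SW_line; lra).
  rewrite SW_NE in *. specialize (B c (- u) ltac:(lra) N0). rewrite Rabs_Ropp in B. replace (- u * - u) with (u * u) in B by ring. exact B.
Qed.

Lemma pw_hf_bound (a : C) (x y : R) : 0 < x -> y < 1 ->
  exists M, forall c u : R, x <= c <= y -> Cmod (pw a hf (c + u * dir_SW)%C) <= M / (1 + u * u).
Proof. intros Hx Hy. destruct (hf_SW_bound x y Hx Hy) as [K [HK B]]. exact (pw_bound a hf x y K 20 Hx Hy HK B). Qed.

Lemma pw_hp_bound (a : C) (x y : R) : 0 < x -> y < 1 ->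
  exists M, forall c u : R, x <= c <= y -> Cmod (pw a hp (c + u * dir_SW)%C) <= M / (1 + u * u).
Proof. intros Hx Hy. destruct (hp_SW_bound x y Hx Hy) as [K [HK B]]. exact (pw_bound a hp x y K 20 Hx Hy HK B). Qed.

Lemma continuous_SW (f : C -> C) (c u : R) :
  continuous f (c + u * dir_SW)%C -> continuous (fun u : R => f (c + u * dir_SW)%C) u.
Proof. exact (continuous_path f c dir_SW u). Qed.

Lemma dom_pw_hf (a : C) (c : R) : 0 < c < 1 -> exists M, dom M (fun u => pw a hf (c + u * dir_SW)%C).
Proof.
  intros Hc. destruct (pw_hf_bound a c c ltac:(lra) ltac:(lra)) as [M B]. exists M. split; [|intros u; apply B; lra].
  intros u. apply continuous_SW, continuous_pw; [apply slit_SW_line; lra|]. exact (holo_continuous _ _ _ (holo_hf _ (SW_den_neq_0 c u Hc))).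
Qed.

Lemma dom_pw_hp (a : C) (c : R) : 0 < c < 1 -> exists M, dom M (fun u => pw a hp (c + u * dir_SW)%C).
Proof.
  intros Hc. destruct (pw_hp_bound a c c ltac:(lra) ltac:(lra)) as [M B]. exists M. split; [|intros u; apply B; lra].
  intros u. apply continuous_SW, continuous_pw; [apply slit_SW_line; lra|]. exact (continuous_hp _ (SW_den_neq_0 c u Hc)).
Qed.

Lemma Rcal_pw (c : R) (w : C) : 0 < c < 1 ->
  Rcal c (1 - w) = (CInt_line (fun u => pw (w - 2) hf (c + u * dir_SW)%C) * dir_SW)%C.
Proof.
  intros Hc. unfold Rcal, line_integral. destruct (dom_pw_hf (w - 2) c Hc) as [M D].
  rewrite (IntR_ext _ (fun u => dir_SW * pw (w - 2) hf (c + u * dir_SW)%C)%C).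
  - rewrite (IntR_scal _ _ _ D). ring.
  - intros u. assert (N0 : (c + u * dir_SW)%C <> RtoC 0) by (apply carg_SW_line; lra). set (x := (c + u * dir_SW)%C) in *.
    unfold pw, hf, cpow. fold (e1 x). fold (den x).
    replace (- (1 - w) * clog x)%C with ((w - 2) * clog x + clog x)%C by ring. rewrite cexp_plus, (cexp_clog x) by auto. unfold Cdiv. ring.
Qed.

Lemma Rcal_shift (c0 c1 : R) (w : C) : 0 < c0 < 1 -> 0 < c1 < 1 -> Rcal c0 (1 - w) = Rcal c1 (1 - w).
Proof.
  intros H0 H1. rewrite !Rcal_pw by auto. f_equal. set (a := (w - 2)%C).
  set (f' := fun x => (cexp (a * clog x) * (a * hf x / x + hp x))%C).
  assert (E : forall c u : R, (RtoC 0 + c * 1 + u * dir_SW)%C = (c + u * dir_SW)%C) by (intros; ring).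
  pose proof (line_shift (pw a hf) f' 0 1 dir_SW 0 1 c0 c1 dir_SW_neq_0 H0 H1) as S.
  rewrite (IntR_ext (fun u => pw a hf (RtoC 0 + c0 * 1 + u * dir_SW)%C) (fun u => pw a hf (c0 + u * dir_SW)%C)) in S by (intros; now rewrite E).
  rewrite (IntR_ext (fun u => pw a hf (RtoC 0 + c1 * 1 + u * dir_SW)%C) (fun u => pw a hf (c1 + u * dir_SW)%C)) in S by (intros; now rewrite E).
  apply S.
  - intros c u Hc. rewrite E. apply holo_pw; [apply slit_SW_line; lra | now apply holo_hf, SW_den_neq_0].
  - intros c u Hc. rewrite E. pose proof (slit_SW_line c u ltac:(lra)) as Sl. pose proof (SW_den_neq_0 c u Hc) as D0.
    apply (continuous_pw a (fun x => a * hf x / x + hp x)%C); [exact Sl|].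
    apply continuous_Cplus; [|now apply continuous_hp]. apply continuous_Cdiv; [|apply continuous_id | now apply slit_neq_0].
    apply continuous_Cmult; [apply continuous_const | exact (holo_continuous _ _ _ (holo_hf _ D0))].
  - intros x y Hx Hy. destruct (pw_hf_bound a x y Hx Hy) as [M B]. exists M. intros c u Hc. rewrite E. now apply B.
Qed.

(** The counterpart on the side of R(s): after it the integrand is x^(w-1) [hp], which is integrable
    up to the origin, so the line may be moved there. *)
Lemma Rcal_by_parts (c : R) (w : C) : 0 < c < 1 ->
  ((w - 1) * Rcal c (1 - w) = CInt_line (fun u => pw (w - 1) hp (c + u * dir_SW)%C) * dir_NE)%C.
Proof.
  intros Hc. rewrite Rcal_pw by auto. destruct (dom_pw_hf (w - 2) c Hc) as [M1 D1]. destruct (dom_pw_hp (w - 1) c Hc) as [M2 D2].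
  destruct (dom_pw_hf (w - 1) c Hc) as [M3 D3].
  set (f' := fun x => (cexp ((w - 1) * clog x) * ((w - 1) * hf x / x + hp x))%C).
  assert (E : forall u : R, ((w - 1) * pw (w - 2) hf (c + u * dir_SW)%C + pw (w - 1) hp (c + u * dir_SW)%C)%C = f' (c + u * dir_SW)%C).
  { intros u. assert (N0 : (c + u * dir_SW)%C <> RtoC 0) by (apply carg_SW_line; lra). set (x := (c + u * dir_SW)%C) in *.
    unfold f', pw. replace ((w - 1) * clog x)%C with ((w - 2) * clog x + clog x)%C by ring. rewrite cexp_plus, (cexp_clog x) by auto. field. auto. }
  pose proof (dom_plus _ _ _ _ (dom_scal _ _ (w - 1) D1) D2) as D4. cbv beta in D4. pose proof (dom_ext _ _ _ E D4) as D5.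
  pose proof (IntR_total_derivative (pw (w - 1) hf) f' c dir_SW (Cmod (w - 1) * M1 + M2) M3
    (fun u => holo_pw _ _ _ _ (slit_SW_line c u (proj1 Hc)) (holo_hf _ (SW_den_neq_0 c u Hc)))) as T.
  assert (Z : CInt_line (fun t : R => f' (c + t * dir_SW) * dir_SW)%C = RtoC 0).
  { apply T.
    - intros u. pose proof (slit_SW_line c u ltac:(lra)) as Sl. pose proof (SW_den_neq_0 c u Hc) as D0.
      apply (continuous_pw (w - 1) (fun x => (w - 1) * hf x / x + hp x)%C); [exact Sl|].
      apply continuous_Cplus; [|now apply continuous_hp]. apply continuous_Cdiv; [|apply continuous_id | now apply slit_neq_0].
      apply continuous_Cmult; [apply continuous_const | exact (holo_continuous _ _ _ (holo_hf _ D0))].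
    - apply D5.
    - apply D3. }
  rewrite (IntR_ext _ (fun u => dir_SW * ((w - 1) * pw (w - 2) hf (c + u * dir_SW)%C + pw (w - 1) hp (c + u * dir_SW)%C))%C) in Z
    by (intros u; rewrite E; ring).
  rewrite (IntR_scal _ _ _ D4), (IntR_plus _ _ _ _ (dom_scal _ _ (w - 1) D1) D2), (IntR_scal _ _ _ D1) in Z.
  unfold dir_NE. rewrite <- (Cplus_0_l (CInt_line _ * - dir_SW)%C), <- Z. ring.
Qed.

Lemma SW_off_axis (c u : R) : u <> 0 -> slit (c + u * dir_SW)%C /\ den (c + u * dir_SW)%C <> RtoC 0.
Proof.
  intros Hu. pose proof rt_pos. pose proof PI_RGT_0. assert (rt * u <> 0) by (apply Rmult_integral_contrapositive; lra). rewrite SW_point. split.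
  - right. simpl. lra.
  - apply Cmod_gt_0. eapply Rlt_le_trans; [|apply Cmod_den_ge_im]. apply Rmult_lt_0_compat; [lra|]. apply Rabs_pos_lt. lra.
Qed.

Lemma sign_exp (s t : R) : s * s = 1 -> s * exp t <> 0 /\ Rabs (s * exp t) = exp t.
Proof.
  intros Hs. pose proof (exp_pos t). split.
  - apply Rmult_integral_contrapositive. split; [intros E; rewrite E in Hs|]; lra.
  - rewrite Rabs_mult, (Rabs_pos_eq (exp t)) by lra.
    assert (Rabs s * Rabs s = 1) by (rewrite <- Rabs_mult, Hs; apply Rabs_R1). pose proof (Rabs_pos s).
    replace (Rabs s) with 1 by nra. ring.
Qed.

(** The majorant is uniform down to [c = 0], as the passage to the limit demands. For Re w >= 1 the
    power is at most exponential in |x|; for Re w < 1 it is controlled by |x| >= rt exp t, and the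
    Jacobian exp t completes it to exp (Re w t). *)
Lemma half_line_bound (w : C) (s : R) : 0 < Re w -> s * s = 1 -> exists M, forall c t : R, 0 <= c <= / 2 ->
  Cmod (cexp t * pw (w - 1) hp (c + (s * exp t)%R * dir_SW)%C) <= M / (1 + t * t).
Proof.
  intros Hw Hs. pose proof PI_RGT_0 as HP. pose proof rt_pos as Hr.
  destruct (hp_bound (/ 2) ltac:(lra)) as [K [HK B]].
  set (a := Re w - 1). set (A := Rabs a). assert (HA : 0 <= A) by apply Rabs_pos.
  set (G := exp ((20 + A + 1) * (20 + A + 1) / (4 * PI))). assert (HG : 0 < G) by apply exp_pos.
  set (P := exp (PI * Rabs (Im w))). assert (HPp : 0 < P) by apply exp_pos.
  set (R0 := exp (a * ln rt)). assert (HR : 0 < R0) by apply exp_pos.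
  exists (K * G * P * R0 * mellin_const (Re w) 1 + K * G * P * mellin_const 1 1). intros c t Hc.
  destruct (sign_exp s t Hs) as [U0 U1]. set (u := s * exp t) in *. pose proof (exp_pos t) as Ht.
  destruct (SW_off_axis c u U0) as [Sl _]. pose proof (slit_neq_0 _ Sl) as N0.
  pose proof (Cmod_SW_ge c u) as G1. pose proof (Cmod_SW_le c u ltac:(lra)) as G2. rewrite U1 in G1, G2.
  assert (Bh : Cmod (hp (c + u * dir_SW)%C) <= K * exp (- (PI * (exp t * exp t)) + 20 * exp t)).
  { rewrite SW_NE in *. specialize (B c (- u) ltac:(lra) N0). rewrite Rabs_Ropp, U1 in B.
    replace (- u * - u) with (exp t * exp t) in B; [exact B|]. rewrite <- U1. rewrite <- Rabs_mult, Rabs_pos_eq; [ring|].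
    replace (u * u) with (Rsqr u) by reflexivity. apply Rle_0_sqr. }
  clear B. unfold pw. rewrite !Cmod_mult, cexp_R, Cmod_R, (Rabs_pos_eq (exp t)) by lra.
  pose proof (Cmod_power_le (w - 1) _ N0) as Q. replace (Re (w - 1)%C) with a in Q by (unfold a, Re; simpl; ring).
  replace (Im (w - 1)%C) with (Im w) in Q by (unfold Im; simpl; ring). fold P in Q.
  set (m := Cmod (c + u * dir_SW)%C) in *. assert (Hm : 0 < m) by now apply Cmod_gt_0.
  set (r := exp t) in *.
  assert (Hpow : exp (a * ln m) <= (R0 * exp (a * t) + 1) * exp (A * r)).
  { assert (E1 : 1 <= exp (A * r)) by (rewrite <- exp_0; apply exp_le, Rmult_le_pos; lra). pose proof (exp_pos (a * t)).
    destruct (Rle_dec 0 a) as [L|L].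
    - apply Rle_trans with (exp (A * r)); [|assert (0 < R0 * exp (a * t)) by (now apply Rmult_lt_0_compat); nra].
      apply exp_le. unfold A. rewrite Rabs_pos_eq by auto. apply Rmult_le_compat_l; auto. pose proof (ln_le_minus_1 m Hm). lra.
    - apply Rle_trans with (R0 * exp (a * t)); [|assert (0 < R0 * exp (a * t)) by (now apply Rmult_lt_0_compat); nra].
      unfold R0. rewrite <- exp_plus. apply exp_le. assert (HL : ln (rt * r) <= ln m) by (apply ln_le; auto; now apply Rmult_lt_0_compat).
      rewrite ln_mult in HL by auto. unfold r in HL. rewrite ln_exp in HL.
      apply (Rmult_le_compat_neg_l a) in HL; lra. }
  pose proof (exp_gauss_le PI (20 + A) r HP) as Gs. fold G in Gs. rewrite (Rabs_pos_eq r) in Gs by lra.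
  replace ((20 + A) * r) with (20 * r + A * r) in Gs by ring. rewrite <- Rplus_assoc, exp_plus in Gs.
  set (X := exp (- (PI * (r * r)) + 20 * r)) in *. assert (0 < X) by apply exp_pos.
  pose proof (mellin_bound (Re w) 1 t Hw ltac:(lra)) as M1. pose proof (mellin_bound 1 1 t ltac:(lra) ltac:(lra)) as M2. fold r in M1, M2.
  unfold Rminus in M1, M2. rewrite exp_plus in M1, M2. replace (exp (1 * t)) with r in M2 by (unfold r; f_equal; ring).
  replace (exp (Re w * t)) with (r * exp (a * t)) in M1 by (unfold r; rewrite <- exp_plus; unfold a; f_equal; ring).
  set (Y := exp (- (1 * r))) in *. set (Z := exp (A * r)) in *. set (V := exp (a * t)) in *. assert (0 < V) by apply exp_pos.
  apply Rle_trans with (r * ((R0 * V + 1) * Z * P * (K * X))).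
  - apply Rmult_le_compat_l; [lra|]. apply Rmult_le_compat; try apply Cmod_ge_0; auto. eapply Rle_trans; [exact Q|]. apply Rmult_le_compat_r; [lra | exact Hpow].
  - replace (r * ((R0 * V + 1) * Z * P * (K * X))) with ((K * P * (r * (R0 * V + 1))) * (X * Z)) by ring.
    assert (W : 0 <= K * P * (r * (R0 * V + 1))) by (repeat apply Rmult_le_pos; try lra; assert (0 < R0 * V) by (now apply Rmult_lt_0_compat); lra).
    apply (Rmult_le_compat_l _ _ _ W) in Gs. eapply Rle_trans; [exact Gs|].
    assert (W1 : 0 <= K * P * R0 * G) by (repeat apply Rmult_le_pos; lra). assert (W2 : 0 <= K * P * G) by (repeat apply Rmult_le_pos; lra).
    apply (Rmult_le_compat_l _ _ _ W1) in M1. apply (Rmult_le_compat_l _ _ _ W2) in M2. unfold Rdiv in *. lra.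
Qed.

Lemma half_line_dom (w : C) (s : R) : 0 < Re w -> s * s = 1 -> exists M, forall c : R, 0 <= c <= / 2 ->
  dom M (fun t => cexp t * pw (w - 1) hp (c + (s * exp t)%R * dir_SW)%C)%C.
Proof.
  intros Hw Hs. destruct (half_line_bound w s Hw Hs) as [M B]. exists M. intros c Hc. split; [|intros t; now apply B].
  intros t. destruct (SW_off_axis c (s * exp t) (proj1 (sign_exp s t Hs))) as [Sl D0].
  apply continuous_Cmult; [ccont|].
  apply (continuous_comp (fun t : R => (c + (s * exp t)%R * dir_SW)%C) (pw (w - 1) hp)); [ccont|].
  apply continuous_pw; auto. now apply continuous_hp.
Qed.

Lemma half_line_limit (w : C) (s : R) : 0 < Re w -> s * s = 1 -> forall eps, 0 < eps ->
  exists r, 0 < r /\ forall c, 0 < c < r -> c < / 2 /\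
    Cmod (CInt_line (fun t => cexp t * pw (w - 1) hp (c + (s * exp t)%R * dir_SW)%C)%C -
          CInt_line (fun t => cexp t * pw (w - 1) hp (0 + (s * exp t)%R * dir_SW)%C)%C) <= eps.
Proof.
  intros Hw Hs eps He. destruct (half_line_dom w s Hw Hs) as [M D]. set (B := pw (w - 1) hp) in *.
  set (Phi := fun c t : R => (cexp t * B (c + (s * exp t)%R * dir_SW)%C - cexp t * B (0 + (s * exp t)%R * dir_SW)%C)%C).
  destruct (IntR_dominated_convergence Phi (M + M) (/ 2) ltac:(lra)) with (eps := eps) as [r [Hr HL]]; auto.
  - intros c Hc. apply dom_minus; apply D; lra.
  - intros u et _ Het. set (z0 := (0 + (s * exp u)%R * dir_SW)%C).
    assert (CB : continuous B z0).
    { destruct (SW_off_axis 0 (s * exp u) (proj1 (sign_exp s u Hs))) as [Sl D0]. apply continuous_pw; auto. now apply continuous_hp. }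
    set (ee := et / (2 * exp (u + 1))). assert (Hee : 0 < ee) by (apply Rdiv_lt_0_compat; auto; pose proof (exp_pos (u + 1)); lra).
    destruct (locally_C_ex _ _ (proj1 (continuous_Cmod_eps _ _) CB ee Hee)) as [d [Hd Hb]].
    assert (CE : continuity_pt exp u) by apply derivable_continuous_pt, derivable_pt_exp.
    destruct (CE (d / 2) ltac:(lra)) as [al [Hal Hc]].
    exists (Rmin (Rmin al 1) (d / 2)). split; [repeat apply Rmin_pos; lra|]. intros c u' Hcc Hu'.
    pose proof (Rmin_l (Rmin al 1) (d / 2)). pose proof (Rmin_r (Rmin al 1) (d / 2)). pose proof (Rmin_l al 1). pose proof (Rmin_r al 1).
    assert (Hexp : Rabs (exp u' - exp u) < d / 2).
    { destruct (Req_dec u' u) as [->|Ne]; [rewrite Rminus_diag, Rabs_R0; lra|].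
      apply Hc. split; [split; [exact I | auto]|]. simpl. unfold R_dist. lra. }
    assert (Near : forall c', 0 <= c' < d / 2 -> Cmod (B (c' + (s * exp u')%R * dir_SW)%C - B z0) < ee).
    { intros c' Hc'. apply Hb. unfold z0.
      replace (c' + (s * exp u')%R * dir_SW - (0 + (s * exp u)%R * dir_SW))%C with (c' + (s * (exp u' - exp u))%R * dir_SW)%C.
      2:{ rewrite !RtoC_mult, RtoC_minus. ring. }
      eapply Rle_lt_trans; [apply Cmod_SW_le; lra|]. rewrite Rabs_mult.
      replace (Rabs s) with 1; [lra|]. pose proof (sign_exp s 0 Hs) as [_ Q]. rewrite exp_0, Rmult_1_r in Q. lra. }
    pose proof (Near c ltac:(lra)) as N1. pose proof (Near 0 ltac:(lra)) as N2.
    unfold Phi. replace (cexp u' * B (c + (s * exp u')%R * dir_SW)%C - cexp u' * B (0 + (s * exp u')%R * dir_SW)%C)%C with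
      (cexp u' * ((B (c + (s * exp u')%R * dir_SW)%C - B z0) - (B (0 + (s * exp u')%R * dir_SW)%C - B z0)))%C by ring.
    rewrite Cmod_mult, Cmod_cexp. simpl Re.
    assert (E : exp u' <= exp (u + 1)) by (apply exp_le; apply Rabs_def2 in Hu'; lra).
    apply Rle_trans with (exp (u + 1) * (2 * ee)).
    + apply Rmult_le_compat; [left; apply exp_pos | apply Cmod_ge_0 | exact E |]. eapply Rle_trans; [apply Cmod_minus_le|]. lra.
    + right. unfold ee. field. pose proof (exp_pos (u + 1)). lra.
  - exists (Rmin r (/ 2)). split; [apply Rmin_pos; lra|]. intros c Hc. pose proof (Rmin_l r (/ 2)). pose proof (Rmin_r r (/ 2)). split; [lra|].
    rewrite <- (IntR_minus M M) by (apply D; lra). apply HL. lra.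
Qed.

Lemma NE_half_line (w : C) (t : R) :
  (cexp t * pw (w - 1) hp (0 + (-1 * exp t)%R * dir_SW)%C * dir_NE = cexp (w * ((PI / 4)%R * ci)) * hp_mellin w t)%C.
Proof.
  pose proof PI_RGT_0. assert (EN : dir_NE = cexp ((PI / 4)%R * ci)).
  { rewrite cexp_ci, cos_PI4_rt, sin_PI4_rt. apply dir_NE_eq. }
  replace (0 + (-1 * exp t)%R * dir_SW)%C with (cexp t * dir_NE)%C by (rewrite cexp_R, RtoC_mult; unfold dir_NE; change (-1) with (-(1)); rewrite RtoC_opp; ring).
  unfold pw, hp_mellin. set (h := hp (cexp t * dir_NE)).
  assert (L : clog (cexp t * dir_NE) = (t + (PI / 4)%R * ci)%C).
  { rewrite EN, <- cexp_plus. apply clog_cexp. unfold ci; simpl. lra. }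
  rewrite L. rewrite EN at 1.
  replace (cexp t * (cexp ((w - 1) * (t + (PI / 4)%R * ci)) * h) * cexp ((PI / 4)%R * ci))%C with
    (cexp t * cexp ((w - 1) * (t + (PI / 4)%R * ci)) * cexp ((PI / 4)%R * ci) * h)%C by ring.
  rewrite <- !cexp_plus, Cmult_assoc, <- cexp_plus. do 2 f_equal. ring.
Qed.

(** The argument is - 3 pi / 4 here. Oddness of [hp] transfers its values to the opposite half-line,
    and the sign is absorbed as exp (- pi i). *)
Lemma SW_half_line (w : C) (t : R) :
  (cexp t * pw (w - 1) hp (0 + (1 * exp t)%R * dir_SW)%C * dir_NE = cexp (- w * ((3 * PI / 4)%R * ci)) * hp_mellin w t)%C.
Proof.
  pose proof PI_RGT_0. assert (EN : dir_NE = cexp ((PI / 4)%R * ci)).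
  { rewrite cexp_ci, cos_PI4_rt, sin_PI4_rt. apply dir_NE_eq. }
  replace (0 + (1 * exp t)%R * dir_SW)%C with (- (cexp t * dir_NE))%C by (rewrite cexp_R, RtoC_mult; unfold dir_NE; ring).
  unfold pw, hp_mellin. rewrite hp_odd. set (h := hp (cexp t * dir_NE)).
  assert (L : clog (- (cexp t * dir_NE)) = (t + (- (3 * PI / 4))%R * ci)%C).
  { replace (- (cexp t * dir_NE))%C with (cexp (t + (- (3 * PI / 4))%R * ci)); [apply clog_cexp; unfold ci; simpl; lra|].
    rewrite EN. replace (- (cexp t * cexp ((PI / 4)%R * ci)))%C with (cexp t * cexp ((PI / 4)%R * ci) * / cexp (PI * ci))%C.
    - rewrite <- cexp_opp, <- !cexp_plus. f_equal. rewrite RtoC_opp. replace (3 * PI / 4) with (PI - PI / 4) by field. rewrite RtoC_minus. ring.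
    - rewrite cexp_pi. field. }
  rewrite L. rewrite EN.
  replace (cexp t * (cexp ((w - 1) * (t + (- (3 * PI / 4))%R * ci)) * - h) * cexp ((PI / 4)%R * ci))%C with
    (cexp t * cexp ((w - 1) * (t + (- (3 * PI / 4))%R * ci)) * cexp ((PI / 4)%R * ci) * (- (1)) * h)%C by ring.
  replace (- (1))%C with (cexp (- (PI * ci))) by (rewrite cexp_opp, cexp_pi; field).
  rewrite <- !cexp_plus, Cmult_assoc, <- cexp_plus. do 2 f_equal.
  rewrite RtoC_opp. replace (PI / 4) with (PI - 3 * PI / 4) by field. rewrite (RtoC_minus PI). ring.
Qed.

(** Both halves of the line through the origin are multiples of the same integral. That line is
    reached only as the limit of lines through c > 0, because the power has its branch point
    there. *)
Lemma Rcal_hp_mellin (w : C) (c0 : R) : 0 < Re w -> 0 < c0 < 1 ->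
  ((w - 1) * Rcal c0 (1 - w) = (cexp (w * ((PI / 4)%R * ci)) + cexp (- w * ((3 * PI / 4)%R * ci))) * CInt_line (hp_mellin w))%C.
Proof.
  intros Hw Hc0. destruct (dom_hp_mellin w Hw) as [MA DA].
  set (J := fun s c : R => CInt_line (fun t => cexp t * pw (w - 1) hp (c + (s * exp t)%R * dir_SW)%C)%C).
  assert (J1 : (J 1 0 * dir_NE = cexp (- w * ((3 * PI / 4)%R * ci)) * CInt_line (hp_mellin w))%C).
  { destruct (half_line_dom w 1 Hw ltac:(ring)) as [M D]. specialize (D 0 ltac:(lra)). rewrite Cmult_comm. unfold J.
    rewrite <- (IntR_scal _ _ _ D), <- (IntR_scal _ _ _ DA). apply IntR_ext. intros t. rewrite <- SW_half_line. ring. }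
  assert (J2 : (J (-1) 0 * dir_NE = cexp (w * ((PI / 4)%R * ci)) * CInt_line (hp_mellin w))%C).
  { destruct (half_line_dom w (-1) Hw ltac:(ring)) as [M D]. specialize (D 0 ltac:(lra)). rewrite Cmult_comm. unfold J.
    rewrite <- (IntR_scal _ _ _ D), <- (IntR_scal _ _ _ DA). apply IntR_ext. intros t. rewrite <- NE_half_line. ring. }
  rewrite Cmult_plus_distr_r, <- J1, <- J2. apply Cmod_eq_of_small. intros eps He.
  destruct (half_line_limit w 1 Hw ltac:(ring) (eps / 2) ltac:(lra)) as [r1 [Hr1 L1]].
  destruct (half_line_limit w (-1) Hw ltac:(ring) (eps / 2) ltac:(lra)) as [r2 [Hr2 L2]].
  set (c := Rmin r1 r2 / 2). pose proof (Rmin_l r1 r2). pose proof (Rmin_r r1 r2). pose proof (Rmin_pos r1 r2 Hr1 Hr2).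
  destruct (L1 c ltac:(unfold c; lra)) as [Hc B1]. destruct (L2 c ltac:(unfold c; lra)) as [_ B2].
  assert (Hc' : 0 < c < 1) by (unfold c in *; lra).
  rewrite (Rcal_shift c0 c) by auto. rewrite Rcal_by_parts by auto.
  destruct (dom_pw_hp (w - 1) c Hc') as [M D]. rewrite (IntR_split_exp M _ D).
  replace (CInt_line _ + CInt_line _)%C with (J 1 c + J (-1) c)%C by (unfold J; f_equal; apply IntR_ext; intros t; now rewrite cexp_R).
  fold (J 1 0) in B1. fold (J (-1) 0) in B2.
  replace ((J 1 c + J (-1) c) * dir_NE - (J (-1) 0 * dir_NE + J 1 0 * dir_NE))%C with (((J 1 c - J 1 0) + (J (-1) c - J (-1) 0)) * dir_NE)%C by ring.
  rewrite Cmod_mult, Cmod_dir_NE, Rmult_1_r. eapply Rle_trans; [apply Cmod_triangle|].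
  change (Cmod (J 1 c - J 1 0) <= eps / 2) in B1. change (Cmod (J (-1) c - J (-1) 0) <= eps / 2) in B2. lra.
Qed.

(** * The functional equation and the saddle point *)

(** The integral of [hp_mellin] is eliminated between the two sides. The exponentials of
    [Rcal_hp_mellin] add up to 2 cos (pi w / 2) / mu w, which completes the remaining factors to
    [chi_value]; the common factor w - 1 is cancelled. *)
Lemma Rcal_zeta (w : C) (c0 c : R) : 0 < Re w -> w <> RtoC 1 -> 0 < c0 < 1 -> 0 < c < 1 ->
  Rcal c0 (1 - w) = (chi (1 - w) * (zeta w - LI (gP w) c))%C.
Proof.
  intros Hw H1 Hc0 Hc. pose proof (zeta_hp_mellin w c Hw H1 Hc) as Z. pose proof (Rcal_hp_mellin w c0 Hw Hc0) as A. rewrite chi_value by auto.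
  assert (H1' : (w - 1)%C <> RtoC 0) by (intros E; apply H1; replace w with ((w - 1) + 1)%C by ring; rewrite E; ring).
  set (B := cexp (w * ln (2 * PI))) in *. assert (B0 : B <> RtoC 0) by apply cexp_neq_0.
  replace (cexp (- w * ln (2 * PI))) with (/ B)%C by (unfold B; rewrite <- cexp_opp; f_equal; ring).
  set (D := (zeta w - LI (gP w) c)%C) in *.
  assert (E : (cexp (w * ((PI / 4)%R * ci)) + cexp (- w * ((3 * PI / 4)%R * ci)) = 2 * ccos (w * (PI / 2)%R) / mu w)%C).
  { unfold ccos, mu. replace (2 * ((cexp (ci * (w * (PI / 2)%R)) + cexp (- (ci * (w * (PI / 2)%R)))) / 2))%C with
      (cexp (ci * (w * (PI / 2)%R)) + cexp (- (ci * (w * (PI / 2)%R))))%C by field.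
    unfold Cdiv. rewrite <- cexp_opp, Cmult_plus_distr_r, <- !cexp_plus. replace (3 * PI / 4) with (PI / 2 + PI / 4) by field.
    replace (RtoC (PI / 2)%R) with (RtoC (PI / 4) + RtoC (PI / 4))%C by (rewrite <- RtoC_plus; f_equal; field).
    rewrite RtoC_plus. replace (RtoC (PI / 2)%R) with (RtoC (PI / 4) + RtoC (PI / 4))%C by (rewrite <- RtoC_plus; f_equal; field).
    f_equal; f_equal; ring. }
  rewrite E in A. replace (CInt_line (hp_mellin w)) with (Gam w * mu w * ((w - 1) * D) / B)%C in A by (rewrite Z; field; auto).
  replace (Rcal c0 (1 - w)) with ((w - 1) * Rcal c0 (1 - w) / (w - 1))%C by (field; auto). rewrite A. field.
  repeat split; auto. apply mu_neq_0.
Qed.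

Lemma nice_gP (w : C) (hi : R) : 0 < Re w -> exists g', nice (gP w) g' 0 hi.
Proof.
  intros Hw. pose proof PI_RGT_0 as HP. destruct (nice_gau PI 0 0 hi HP) as [A [B D]].
  set (g := gau PI 0) in *. set (g' := fun x => (g x * - (PI * ci * (2 * (x - 0))))%C) in *.
  exists (fun x => (cexp (- w * clog x) * (- w * g x / x + g' x))%C). split; [|split].
  - intros c u Hc. apply (holo_pw (- w) g); [apply slit_SE_line; lra | now apply A].
  - intros c u Hc. pose proof (slit_SE_line c u ltac:(lra)) as Sl. apply (continuous_pw (- w) (fun x => - w * g x / x + g' x)%C); [exact Sl|].
    apply continuous_Cplus; [|now apply B]. apply continuous_Cdiv; [|apply continuous_id | now apply slit_neq_0].
    apply continuous_Cmult; [apply continuous_const | exact (holo_continuous _ _ _ (A c u Hc))].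
  - intros x y Hx Hy. destruct (D x y Hx Hy) as [M HM]. exists (exp (- (Re w * ln (x * rt)) + PI * Rabs (Im w)) * M).
    intros c u Hc. unfold gP. fold g. rewrite Cmod_mult. unfold Rdiv. rewrite Rmult_assoc.
    apply Rmult_le_compat; try apply Cmod_ge_0; [apply SE_power_bound; auto; lra | now apply HM].
Qed.

Lemma powerRZ_m1_succ (n : Z) : RtoC (powerRZ (-1) (n + 1)) = (- powerRZ (-1) n)%C.
Proof. rewrite powerRZ_add by lra. replace (powerRZ (-1) 1) with (- (1)) by (simpl; ring). rewrite RtoC_mult, RtoC_opp. ring. Qed.

(** n^2 and n have the same parity, so exp (- pi i n^2) cancels the sign of the residue and the
    crossed poles give the plain summands of zeta. *)
Lemma gau_at_Z (n : Z) : (powerRZ (-1) n * gau PI 0 (IZR n) = 1)%C.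
Proof.
  unfold gau. replace (RtoC (IZR n) - 0)%C with (RtoC (IZR n)) by ring.
  destruct (Z.Even_or_Odd n) as [[j ->]|[j ->]].
  - rewrite <- cexp_pi_ci_Z, <- cexp_plus. rewrite <- (cexp_2pi_Z (j - 2 * j * j)). f_equal.
    rewrite minus_IZR, !mult_IZR, RtoC_minus, !RtoC_mult. ring.
  - rewrite <- cexp_pi_ci_Z, <- cexp_plus. rewrite <- (cexp_2pi_Z (- j - 2 * j * j)). f_equal.
    rewrite minus_IZR, opp_IZR, !plus_IZR, !mult_IZR, RtoC_minus, !RtoC_plus, !RtoC_mult, RtoC_opp. ring.
Qed.

Lemma gP_at_Z (s : C) (n : Z) : (1 <= n)%Z -> (powerRZ (-1) n * gP (1 - s) (IZR n) = cpow (IZR n) (s - 1))%C.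
Proof.
  intros Hn. unfold gP. replace (- (1 - s))%C with (s - 1)%C by ring. unfold cpow.
  replace (powerRZ (-1) n * (cexp ((s - 1) * clog (IZR n)) * gau PI 0 (IZR n)))%C with
    (cexp ((s - 1) * clog (IZR n)) * (powerRZ (-1) n * gau PI 0 (IZR n)))%C by ring.
  rewrite gau_at_Z. ring.
Qed.

Lemma LI_gP_sum (s : C) (n : nat) : Re s < 1 -> forall c c0 : R, INR n < c < INR n + 1 -> 0 < c0 < 1 ->
  LI (gP (1 - s)) c0 = (CsumZ (fun j => cpow (RtoC (IZR j)) (s - 1)) 1 (Z.of_nat n) + LI (gP (1 - s)) c)%C.
Proof.
  intros Hs. assert (Hw : 0 < Re (1 - s)%C) by (unfold Re in *; simpl; lra).
  induction n as [|n IH]; intros c c0 Hc Hc0.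
  - destruct (nice_gP (1 - s) 2 Hw) as [g' G]. rewrite CsumZ_empty by lia. simpl in Hc.
    rewrite (LI_const _ g' 0 c0 c); [ring | exact (nice_sub _ _ 0 2 0 (0 + 1) ltac:(lra) ltac:(lra) G) | lra | lra].
  - rewrite S_INR in Hc. pose proof (pos_INR n). rewrite (IH (INR n + / 2) c0 ltac:(lra) Hc0).
    replace (Z.of_nat (S n)) with (Z.of_nat n + 1)%Z by lia. rewrite CsumZ_succ by lia.
    destruct (nice_gP (1 - s) (INR n + 2) Hw) as [g' G]. rewrite <- gP_at_Z by lia.
    assert (E : IZR (Z.of_nat n + 1) = INR n + 1) by (rewrite plus_IZR, <- INR_IZR_INZ; reflexivity).
    rewrite <- (LI_jump _ g' (Z.of_nat n + 1) (INR n + / 2) c).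
    + ring.
    + rewrite E. apply (nice_sub _ _ 0 (INR n + 2)); auto; lra.
    + rewrite E. lra.
    + rewrite E. lra.
Qed.

(** For Re s < 1 the number (s - 1) / (2 pi i) lies in the upper half-plane, so its principal root
    lies in the open first quadrant, inside the range prescribed for arg eta. *)
Lemma eta_facts (s : C) : Re s < 1 ->
  ((eta s * eta s) * (2 * (PI * ci)) = s - 1)%C /\ 0 < Re (eta s) /\ 0 < Im (eta s) /\ 0 < carg (eta s) < PI / 2.
Proof.
  intros Hs. pose proof PI_RGT_0 as HP. assert (P0 : RtoC PI <> RtoC 0) by (intros E; inversion E; lra). pose proof ci_neq_0 as I0.
  set (q := ((s - 1) / (2 * RtoC PI * ci))%C).
  assert (Eq : (q * (2 * (PI * ci)) = s - 1)%C) by (unfold q; field; auto).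
  assert (Iq : 0 < Im q).
  { apply (f_equal Re) in Eq. replace (Re (q * (2 * (PI * ci)))%C) with (- (2 * PI * Im q)) in Eq by (destruct q as [a b]; unfold ci, Re, Im; simpl; ring).
    replace (Re (s - 1)%C) with (Re s - 1) in Eq by (destruct s as [a b]; unfold Re; simpl; ring). nra. }
  assert (Q0 : q <> RtoC 0) by (intros E; rewrite E in Iq; simpl in Iq; lra).
  assert (Aq : 0 < carg q < PI).
  { destruct q as [x y]. simpl in Iq. rewrite carg_Im_pos by auto. pose proof (atan_bound (x / y)). lra. }
  set (th := carg q) in *. set (l := ln (Cmod q)).
  assert (Ee : eta s = cexp ((l / 2)%R, (th / 2)%R)).
  { unfold eta, csqrt, cpow. fold q. f_equal. unfold clog. fold th l. apply injective_projections; simpl; field. }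
  assert (Ce : clog (eta s) = ((l / 2)%R, (th / 2)%R)) by (rewrite Ee; apply clog_cexp; simpl; lra).
  split; [|split; [|split]].
  - rewrite <- Eq. f_equal. rewrite Ee, <- cexp_plus. rewrite <- (cexp_clog q) by auto. f_equal.
    unfold clog. fold th l. apply injective_projections; simpl; field.
  - rewrite Ee. simpl. apply Rmult_lt_0_compat; [apply exp_pos | apply cos_gt_0; lra].
  - rewrite Ee. simpl. apply Rmult_lt_0_compat; [apply exp_pos | apply sin_gt_0; lra].
  - apply (f_equal snd) in Ce. simpl in Ce. rewrite Ce. lra.
Qed.

Lemma eta_neq_0 (s : C) : Re s < 1 -> eta s <> RtoC 0.
Proof. intros Hs E. destruct (eta_facts s Hs) as [_ [H _]]. rewrite E in H. simpl in H. lra. Qed.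

Lemma Cmod_eta (s : C) : Re s < 1 -> 4 * PI <= Cmod (s - 1) -> 2 <= Cmod (eta s) * Cmod (eta s).
Proof.
  intros Hs H4. pose proof PI_RGT_0 as HP. destruct (eta_facts s Hs) as [E _]. rewrite <- E, !Cmod_mult, !Cmod_R, !Rabs_pos_eq in H4 by lra.
  change ci with Ci in H4. rewrite Cmod_Ci in H4. nra.
Qed.

Lemma eta_sum_ge (s : C) : Re s < 1 -> Cmod (eta s) <= Re (eta s) + Im (eta s).
Proof.
  intros Hs. destruct (eta_facts s Hs) as [_ [H1 [H2 _]]]. pose proof (Cmod_le_Re_Im (eta s)) as B.
  rewrite !Rabs_pos_eq in B by lra. exact B.
Qed.

Lemma mZ_bounds (s : C) : IZR (mZ s) <= Re (eta s) + Im (eta s) < IZR (mZ s) + 1.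
Proof. unfold mZ. destruct (base_Int_part (Re (eta s) + Im (eta s))) as [A B]. lra. Qed.

(** |eta| >= sqrt 2 > 1 and eta_1 + eta_2 >= |eta|. Consequently the line of the remainder crosses
    the positive real axis. *)
Lemma mZ_ge_1 (s : C) : Re s < 1 -> 4 * PI <= Cmod (s - 1) -> (1 <= mZ s)%Z.
Proof.
  intros Hs H4. pose proof (Cmod_eta s Hs H4). pose proof (eta_sum_ge s Hs). pose proof (mZ_bounds s). pose proof (Cmod_ge_0 (eta s)).
  assert (1 < Cmod (eta s)) by nra. assert (0 < IZR (mZ s)) by lra.
  assert (0 < mZ s)%Z by (apply lt_IZR; lra). lia.
Qed.

Definition saddle (s : C) : C := (cpow (eta s) (s - 1) * cexp (- (RtoC PI * ci * eta s * eta s)))%C.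

Definition gW (s x : C) : C := (gau (2 * PI) (eta s) x * wfun s (x - eta s))%C.

(** Since 2 pi i eta^2 = s - 1, the derivative of the exponent vanishes at eta. The logarithm and -
    pi i x^2 contribute equally to the second-order term, hence 2 pi instead of pi in the Gaussian;
    [wfun] collects the rest without approximation. The ranges of the arguments allow log (x / eta)
    to be split. *)
Lemma gP_saddle (s : C) (x : C) : Re s < 1 -> x <> RtoC 0 -> - (PI / 4) < carg x < 3 * PI / 4 ->
  gP (1 - s) x = (saddle s * (gau (2 * PI) (eta s) x + gW s x))%C.
Proof.
  intros Hs X0 Ax. destruct (eta_facts s Hs) as [E [_ [_ Ae]]]. pose proof (eta_neq_0 s Hs) as E0. pose proof PI_RGT_0.
  unfold gW, wfun, saddle, gP, gau, cpow. cbv zeta. set (e := eta s) in *.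
  replace (1 + (x - e) / e)%C with (x / e)%C by (field; auto). rewrite clog_div by (auto; lra).
  set (lx := clog x). set (le := clog e).
  set (A := cexp (- ((2 * PI)%R * ci * ((x - e) * (x - e))))).
  match goal with |- _ = (?L * (A + A * (cexp ?X - _)))%C => transitivity (L * (A * cexp X))%C; [unfold A | ring] end.
  rewrite <- !cexp_plus. f_equal. replace (s - 1)%C with (e * e * (2 * (PI * ci)))%C by exact E.
  replace (- (1 - s))%C with (e * e * (2 * (PI * ci)))%C by (rewrite E; ring). rewrite RtoC_mult. field. exact E0.
Qed.

Lemma saddle_neq_0 (s : C) : saddle s <> RtoC 0.
Proof. unfold saddle. apply Cmult_neq_0; [apply cpow_neq_0 | apply cexp_neq_0]. Qed.

(** Convergence requires no estimate of [wfun]: up to a constant, [gW] is a combination of two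
    functions that are already dominated. *)
Lemma gW_over_den_dom (s : C) (n : Z) (c : R) : Re s < 1 -> 0 < c -> IZR n < c < IZR n + 1 ->
  (exists M, dom M (fun u => gW s (c + u * dir_SE)%C / den (c + u * dir_SE))%C) /\
  LI (gP (1 - s)) c = (saddle s * (LI (gau (2 * PI) (eta s)) c + LI (gW s) c))%C.
Proof.
  intros Hs Hc Hn. assert (Hw : 0 < Re (1 - s)%C) by (unfold Re in *; simpl; lra). pose proof PI_RGT_0. pose proof (saddle_neq_0 s) as S0.
  destruct (nice_gP (1 - s) (c + 1) Hw) as [g' G]. destruct (over_den_dom _ _ n c 0 (c + 1) G ltac:(lra) Hn) as [M1 D1].
  destruct (over_den_dom _ _ n c 0 (c + 1) (nice_gau (2 * PI) (eta s) 0 (c + 1) ltac:(lra)) ltac:(lra) Hn) as [M2 D2].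
  assert (E : forall u : R, (/ saddle s * (gP (1 - s) (c + u * dir_SE)%C / den (c + u * dir_SE)) -
     gau (2 * PI) (eta s) (c + u * dir_SE)%C / den (c + u * dir_SE) = gW s (c + u * dir_SE)%C / den (c + u * dir_SE))%C).
  { intros u. destruct (carg_SE_line c u Hc) as [X0 Ax]. rewrite gP_saddle by auto. field. split; auto. now apply (den_neq_0_frac n). }
  pose proof (dom_minus _ _ _ _ (dom_scal _ _ (/ saddle s) D1) D2) as D3. cbv beta in D3.
  split; [exists (Cmod (/ saddle s) * M1 + M2); exact (dom_ext _ _ _ E D3)|].
  unfold LI at 3. rewrite <- (IntR_ext _ _ E), (IntR_minus _ _ _ _ (dom_scal _ _ (/ saddle s) D1) D2), (IntR_scal _ _ _ D1).
  unfold LI. field. exact S0.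
Qed.

Lemma Rrem_LI (s : C) (n : Z) (c : R) : Re s < 1 -> 0 < c -> IZR n < c < IZR n + 1 -> Rrem c s = LI (gW s) c.
Proof.
  intros Hs Hc Hn. destruct (gW_over_den_dom s n c Hs Hc Hn) as [[M D] _]. unfold Rrem. rewrite line_integral_SE. unfold LI.
  rewrite (Cmult_comm _ dir_SE), <- (IntR_scal _ _ _ D). apply IntR_ext. intros u. unfold gW, gau, den. rewrite RtoC_mult.
  set (x := (c + u * dir_SE)%C). replace (2 * PI * ci * ((x - eta s) * (x - eta s)))%C with (2 * PI * ci * (x - eta s) * (x - eta s))%C by ring.
  unfold Cdiv. ring.
Qed.

(** Because Im eta > 0, the two exponentials in the cosine have different moduli and cannot
    cancel. *)
Lemma ccos_eta_neq_0 (s : C) : Re s < 1 -> ccos (2 * PI * eta s) <> RtoC 0.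
Proof.
  intros Hs E. destruct (eta_facts s Hs) as [_ [_ [He _]]]. pose proof PI_RGT_0. unfold ccos in E.
  assert (Z : cexp (ci * (2 * PI * eta s)) = (- cexp (- (ci * (2 * PI * eta s))))%C).
  { set (a := cexp _) in *. set (b := cexp (- _)) in *. replace a with (2 * ((a + b) / 2) - b)%C by field. rewrite E. ring. }
  apply (f_equal Cmod) in Z. rewrite Cmod_opp, !Cmod_cexp in Z. apply exp_inv in Z.
  replace (Re (- (ci * (2 * PI * eta s)))%C) with (2 * PI * Im (eta s)) in Z by (destruct (eta s); unfold ci, Re, Im; simpl; ring).
  replace (Re (ci * (2 * PI * eta s))%C) with (- (2 * PI * Im (eta s))) in Z by (destruct (eta s); unfold ci, Re, Im; simpl; ring).
  assert (0 < 2 * PI * Im (eta s)) by (apply Rmult_lt_0_compat; [lra | exact He]). lra.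
Qed.

(** Induction on k - m. Only the Gaussian part is moved across k + 1, while the line of [gW] stays.
    The new summand of zeta, rewritten by [gP_saddle], splits into the jump of the Gaussian part and
    the new term with [wfun]. *)
Lemma identity_step (s : C) (c1 c0 : R) (d : nat) : Re s < 1 -> (1 <= mZ s)%Z -> IZR (mZ s) < c1 < IZR (mZ s) + 1 -> 0 < c0 < 1 ->
  let k := (mZ s + Z.of_nat d)%Z in
  LI (gP (1 - s)) c0 = (CsumZ (fun n => cpow (RtoC (IZR n)) (s - 1)) 1 k + saddle s * (LI (gau (2 * PI) (eta s)) (IZR k + / 2) +
    CsumZ (fun j => RtoC (powerRZ (-1) (j - 1)) * cexp (- (2 * RtoC PI * ci * (RtoC (IZR j) - eta s) * (RtoC (IZR j) - eta s))) * wfun s (RtoC (IZR j) - eta s)) (mZ s + 1) k + LI (gW s) c1))%C.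
Proof.
  intros Hs Hm Hc1 Hc0. pose proof PI_RGT_0. induction d as [|d IH]; intros k.
  - unfold k. rewrite Z.add_0_r. rewrite (CsumZ_empty _ (mZ s + 1)) by lia. assert (1 <= IZR (mZ s)) by now apply IZR_le.
    assert (Em : INR (Z.to_nat (mZ s)) = IZR (mZ s)) by (rewrite INR_IZR_INZ, Z2Nat.id by lia; reflexivity).
    rewrite (LI_gP_sum s (Z.to_nat (mZ s)) Hs c1 c0) by (try rewrite Em; lra). rewrite Z2Nat.id by lia.
    rewrite (proj2 (gW_over_den_dom s (mZ s) c1 Hs ltac:(lra) Hc1)).
    rewrite (LI_const _ _ (mZ s) c1 (IZR (mZ s) + / 2) (nice_gau (2 * PI) (eta s) _ _ ltac:(lra))) by lra. ring.
  - rewrite IH. set (k0 := (mZ s + Z.of_nat d)%Z) in *. assert (Ek : k = (k0 + 1)%Z) by (unfold k, k0; lia). rewrite Ek.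
    rewrite !CsumZ_succ by (unfold k0; lia). assert (Hk : 1 <= IZR k0) by (apply IZR_le; unfold k0; lia).
    set (S1 := CsumZ _ 1 k0). set (S2 := CsumZ _ _ k0).
    assert (J := LI_jump _ _ (k0 + 1) (IZR k0 + / 2) (IZR (k0 + 1) + / 2) (nice_gau (2 * PI) (eta s) _ _ ltac:(lra))).
    rewrite !plus_IZR in J. specialize (J ltac:(lra) ltac:(lra)). rewrite <- plus_IZR in J.
    rewrite <- (gP_at_Z s (k0 + 1)) by (unfold k0; lia).
    assert (X0 : RtoC (IZR (k0 + 1)) <> RtoC 0) by (rewrite plus_IZR; intros E; inversion E; lra).
    rewrite gP_saddle; auto.
    2:{ assert (C0 : carg (RtoC (IZR (k0 + 1))) = 0).
        { pose proof (clog_RtoC (IZR (k0 + 1)) ltac:(rewrite plus_IZR; lra)) as Q. now apply (f_equal snd) in Q. }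
        rewrite C0. lra. }
    replace (LI (gau (2 * PI) (eta s)) (IZR k0 + / 2)) with
      (LI (gau (2 * PI) (eta s)) (IZR (k0 + 1) + / 2) + powerRZ (-1) (k0 + 1) * gau (2 * PI) (eta s) (RtoC (IZR (k0 + 1))))%C by (rewrite <- J; ring).
    unfold gW. set (x := RtoC (IZR (k0 + 1))). replace (k0 + 1 - 1)%Z with k0 by ring. rewrite powerRZ_m1_succ.
    replace (cexp (- (2 * PI * ci * (x - eta s) * (x - eta s)))) with (gau (2 * PI) (eta s) x) by (unfold gau; rewrite RtoC_mult; f_equal; ring).
    ring.
Qed.

Lemma main_identity (s : C) (k : Z) (c0 c1 : R) : Re s < 1 -> 4 * PI <= Cmod (s - 1) -> s <> RtoC 0 -> (mZ s <= k)%Z ->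
  0 < c0 < 1 -> IZR (mZ s) < c1 < IZR (mZ s) + 1 ->
  Rcal c0 s = (chi s * (zeta (1 - s) - CsumZ (fun n => cpow (RtoC (IZR n)) (s - 1)%C) 1 k - saddle s *
    ((RtoC (sqrt 2) * cexp (RtoC (3 * PI / 8) * ci) * csin (RtoC PI * eta s)
            - RtoC (powerRZ (-1) k) * cexp (2 * RtoC PI * ci * eta s - 2 * RtoC PI * ci * (eta s - RtoC (IZR k)) * (eta s - RtoC (IZR k))))
           / (2 * ccos (2 * RtoC PI * eta s))
     + CsumZ (fun j => RtoC (powerRZ (-1) (j - 1)) * cexp (- (2 * RtoC PI * ci * (RtoC (IZR j) - eta s) * (RtoC (IZR j) - eta s)))
                             * wfun s (RtoC (IZR j) - eta s))%C (mZ s + 1) k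
     + Rrem c1 s)))%C.
Proof.
  intros Hs H4 S0 Hk Hc0 Hc1. pose proof (mZ_ge_1 s Hs H4) as Hm. assert (1 <= IZR (mZ s)) by now apply IZR_le.
  assert (Hw : 0 < Re (1 - s)%C) by (unfold Re in *; simpl; lra).
  assert (W1 : (1 - s)%C <> RtoC 1) by (intros E; apply S0; replace s with (1 - (1 - s))%C by ring; rewrite E; ring).
  pose proof (Rcal_zeta (1 - s) c0 c0 Hw W1 Hc0 Hc0) as R. replace (1 - (1 - s))%C with s in R by ring. rewrite R.
  pose proof (identity_step s c1 c0 (Z.to_nat (k - mZ s)) Hs Hm Hc1 Hc0) as I. cbv zeta in I.
  replace (mZ s + Z.of_nat (Z.to_nat (k - mZ s)))%Z with k in I by lia. rewrite I.
  rewrite (mordell_F (eta s) k) by (try lra; now apply ccos_eta_neq_0).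
  rewrite (Rrem_LI s (mZ s) c1 Hs ltac:(lra) Hc1). ring.
Qed.

(** * Estimates on a line near the saddle point *)

Lemma exp_convex (t a : R) : 0 <= t <= 1 -> exp (t * a) <= 1 - t + t * exp a.
Proof.
  intros Ht. pose proof (exp_pos (t * a)) as P.
  pose proof (exp_ineq1_le (- (t * a))) as A. pose proof (exp_ineq1_le ((1 - t) * a)) as B.
  assert (E1 : exp (t * a) * exp (- (t * a)) = 1) by (rewrite <- exp_plus, Rplus_opp_r; apply exp_0).
  assert (E2 : exp (t * a) * exp ((1 - t) * a) = exp a) by (rewrite <- exp_plus; f_equal; ring).
  apply (Rmult_le_compat_l (exp (t * a))) in A; [|lra]. apply (Rmult_le_compat_l (exp (t * a))) in B; [|lra]. rewrite E1 in A. rewrite E2 in B.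
  apply (Rmult_le_compat_l (1 - t)) in A; [|lra]. apply (Rmult_le_compat_l t) in B; [|lra]. lra.
Qed.

Lemma is_RInt_poly (F f : R -> R) : (forall x, is_derive F x (f x)) -> (forall x, continuous f x) -> is_RInt f 0 1 (F 1 - F 0).
Proof. intros HF Hf. apply (is_RInt_derive F f); auto. Qed.

(** Convexity of exp on [0, |z|], used before integrating, gains almost a factor 2 over |z| exp |z|
    for large |z|; the numerical constants of the theorem depend on this gain. *)
Lemma Cmod_cexp_minus_1_convex (z : C) : Cmod (cexp z - 1) <= Cmod z * ((1 + exp (Cmod z)) / 2).
Proof.
  set (a := Cmod z). assert (Ha : 0 <= a) by apply Cmod_ge_0.
  assert (F : is_RIntC (fun t => cexp (0 + t * z) * z)%C 0 1 (cexp (0 + 1 * z) - cexp (0 + 0 * z))%C).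
  { apply RIntC_FTC; intros t _; [apply holo_cexp | ccont]. }
  replace (cexp z - 1)%C with (cexp (0 + 1 * z) - cexp (0 + 0 * z))%C.
  2:{ replace (0 + 1 * z)%C with z by ring. replace (0 + 0 * z)%C with (RtoC 0) by ring. now rewrite cexp_0. }
  replace (a * ((1 + exp a) / 2)) with ((fun t => a * (t - t * t / 2 + t * t / 2 * exp a)) 1 - (fun t => a * (t - t * t / 2 + t * t / 2 * exp a)) 0) by (cbv beta; field).
  refine (RIntC_bound _ (fun t => a * (1 - t + t * exp a)) 0 1 _ _ ltac:(lra) _ F _).
  - intros t Ht. rewrite Cmod_mult, Cmod_cexp. fold a. rewrite Rmult_comm. apply Rmult_le_compat_l; auto.
    eapply Rle_trans; [|now apply exp_convex]. apply exp_le. eapply Rle_trans; [apply Rle_abs|]. eapply Rle_trans; [apply re_le_Cmod|].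
    rewrite Cplus_0_l, Cmod_mult, Cmod_R, Rabs_pos_eq by lra. fold a. lra.
  - apply (is_RInt_poly (fun t => a * (t - t * t / 2 + t * t / 2 * exp a)) (fun t => a * (1 - t + t * exp a)));
      [intros x; auto_derive; [exact I | field] | intros x; ccont].
Qed.

(* The line [d + u * dir_SE], parametrized symmetrically so that [|z|^2 = v^2 + d^2/2]. *)
Definition zz (d v : R) : C := ((d / 2 + rt * v)%R, (d / 2 - rt * v)%R).

Lemma Cmod_zz (d v : R) : Cmod (zz d v) * Cmod (zz d v) = v * v + d * d / 2.
Proof.
  rewrite Cmod_sqr. unfold zz. simpl. pose proof rt_sqr.
  replace ((d / 2 + rt * v) * (d / 2 + rt * v) + (d / 2 - rt * v) * (d / 2 - rt * v)) with (d * d / 2 + 2 * (rt * rt) * (v * v)) by field.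
  rewrite H. field.
Qed.

Lemma gau_zz (e : C) (d v : R) : Cmod (gau (2 * PI) e (e + zz d v)) = exp (PI * (d * d) - 2 * PI * (v * v)).
Proof.
  unfold gau. rewrite Cmod_cexp. f_equal. replace (e + zz d v - e)%C with (zz d v) by ring. unfold zz, ci, Re. simpl. pose proof rt_sqr.
  replace (PI * (d * d) - 2 * PI * (v * v)) with (PI * (d * d) - 4 * PI * (/ 2) * (v * v)) by field. rewrite <- H. field.
Qed.

Lemma cos_Lip (x y : R) : cos (x - y) <= cos x + Rabs y.
Proof.
  destruct (MVT_gen cos (x - y) x (fun t => - sin t)) as [c [_ Hc]].
  - intros t _. auto_derive; [exact I | ring].
  - intros t _. apply continuity_cos.
  - cbv beta in Hc. pose proof (SIN_bound c) as [S1 S2].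
    assert (A : Rabs (- sin c * (x - (x - y))) <= Rabs y).
    { rewrite Rabs_mult. replace (x - (x - y)) with y by ring. pose proof (Rabs_pos y). assert (Rabs (- sin c) <= 1) by (apply Rabs_le; lra). nra. }
    pose proof (Rle_abs (- (- sin c * (x - (x - y))))) as B. rewrite Rabs_Ropp in B. lra.
Qed.

Lemma exp_lin_lower (Y : R) : 0 <= Y -> 2 * Y <= 2 / 3 * exp Y + exp (- Y).
Proof.
  (* tangent lines at [ln (7/2)], close to the minimum of the difference *)
  intros HY. set (L := ln (7 / 2)).
  assert (HL : L <= 1275 / 1000).
  { unfold L. rewrite <- (ln_exp (1275 / 1000)). apply ln_le; [lra|].
    replace (1275 / 1000) with (1275/4000 + 1275/4000 + (1275/4000 + 1275/4000)) by field. rewrite !exp_plus.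
    pose proof (exp_ge_quadratic (1275 / 4000) ltac:(lra)) as Q.
    assert (137 / 100 - 1 / 2000 <= exp (1275 / 4000)) by lra.
    assert (1.3695 * 1.3695 <= exp (1275 / 4000) * exp (1275 / 4000)) by (apply Rmult_le_compat; lra). nra. }
  pose proof (exp_ineq1_le (Y - L)) as A. pose proof (exp_ineq1_le (- (Y - L))) as B.
  assert (EL : exp L = 7 / 2) by (apply exp_ln; lra).
  replace (exp Y) with (7 / 2 * exp (Y - L)) by (rewrite <- EL, <- exp_plus; f_equal; ring).
  replace (exp (- Y)) with (2 / 7 * exp (- (Y - L))).
  2:{ replace (- Y) with (- L + - (Y - L)) by ring. rewrite (exp_plus (- L)), (exp_Ropp L), EL. f_equal. field. }
  lra.
Qed.

(** With Y = 2 pi |B| one has |den|^2 = exp Y + exp (-Y) - 2 cos (2 pi A). As cos (2 pi (A + B)) <=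
    0 and cos is 1-Lipschitz, cos (2 pi A) <= Y, and [exp_lin_lower] leaves exp Y / 3. The full
    exponential growth of [den] is thus kept on the whole line. *)
Lemma den_lower_exp (n : Z) (A B : R) : IZR n + / 4 <= A + B <= IZR n + 3 / 4 -> exp (PI * Rabs B) <= sqrt 3 * Cmod (den (A, B)).
Proof.
  intros H. pose proof PI_RGT_0 as HP. pose proof (Cmod_den_sqr A B) as S. set (D := Cmod (den (A, B))) in *. assert (HD : 0 <= D) by apply Cmod_ge_0.
  set (Y := 2 * PI * Rabs B). assert (HY : 0 <= Y) by (unfold Y; apply Rmult_le_pos; [lra | apply Rabs_pos]).
  assert (E1 : exp (PI * B) * exp (PI * B) + exp (- (PI * B)) * exp (- (PI * B)) = exp Y + exp (- Y)).
  { rewrite <- !exp_plus. unfold Y. unfold Rabs. destruct (Rcase_abs B); [rewrite Rplus_comm|]; f_equal; f_equal; ring. }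
  assert (E2 : exp (PI * B) * exp (- (PI * B)) = 1) by (rewrite <- exp_plus, Rplus_opp_r; apply exp_0).
  assert (E3 : cos (2 * PI * A) = 1 - 2 * (sin (PI * A) * sin (PI * A))).
  { replace (2 * PI * A) with (2 * (PI * A)) by ring. rewrite cos_2a_sin. ring. }
  assert (E4 : cos (2 * PI * (A + B)) <= 0).
  { set (f := A + B - IZR n). replace (2 * PI * (A + B)) with (2 * PI * f + 2 * IZR n * PI) by (unfold f; ring).
    replace (cos (2 * PI * f + 2 * IZR n * PI)) with (cos (2 * PI * f)).
    - apply cos_le_0; unfold f; nra.
    - pose proof (cexp_2pi_Z n) as Z. unfold cexp in Z.
      rewrite cos_plus. assert (Q : cos (2 * IZR n * PI) = 1 /\ sin (2 * IZR n * PI) = 0).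
      { replace (2 * (PI * ci * IZR n))%C with ((0, 2 * IZR n * PI) : C) in Z by (unfold ci; apply injective_projections; simpl; ring).
        simpl in Z. rewrite exp_0, !Rmult_1_l in Z. now inversion Z. }
      destruct Q as [-> ->]. ring. }
  pose proof (cos_Lip (2 * PI * (A + B)) (2 * PI * B)) as L. replace (2 * PI * (A + B) - 2 * PI * B) with (2 * PI * A) in L by ring.
  rewrite (Rabs_mult (2 * PI)), (Rabs_pos_eq (2 * PI)) in L by lra. fold Y in L.
  pose proof (exp_lin_lower Y HY) as X.
  assert (Q : exp Y <= 3 * (D * D)).
  { rewrite S. set (u := exp (PI * B)) in *. set (v := exp (- (PI * B))) in *.
    replace ((u - v) * (u - v)) with (u * u + v * v - 2 * (u * v)) by ring. rewrite E1, E2. lra. }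
  assert (S3 : sqrt 3 * sqrt 3 = 3) by (apply sqrt_sqrt; lra). assert (0 <= sqrt 3) by apply sqrt_pos.
  replace (exp Y) with (exp (PI * Rabs B) * exp (PI * Rabs B)) in Q by (rewrite <- exp_plus; f_equal; unfold Y; ring).
  pose proof (exp_pos (PI * Rabs B)). apply Rsqr_incr_0; unfold Rsqr; [nra | lra | now apply Rmult_le_pos].
Qed.

Definition rho (q : C) : C := (clog (1 + q) - q + q * q / 2)%C.

(** The derivative v^2 / (1 + v) is estimated in two ways on the segment: |1 + v| >= mu gives the
    cubic bound, |v| <= S |1 + v| the quadratic one. *)
Lemma rho_bound (q : C) (mu S : R) : 0 < mu ->
  (forall t : R, 0 <= t <= 1 -> slit (1 + t * q)%C /\ mu <= Cmod (1 + t * q) /\ t * Cmod q <= S * Cmod (1 + t * q)) ->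
  Cmod (rho q) <= Cmod q * Cmod q * Cmod q / (3 * mu) /\ Cmod (rho q) <= S * (Cmod q * Cmod q) / 2.
Proof.
  intros Hmu H. set (f' := fun v : C => (v * v / (1 + v))%C).
  assert (F : is_RIntC (fun t => f' (0 + t * q) * q)%C 0 1 (rho (0 + 1 * q) - rho (0 + 0 * q))%C).
  { apply RIntC_FTC.
    - intros t Ht. rewrite Rmin_left, Rmax_right in Ht by lra. destruct (H t Ht) as [Sl _]. pose proof (slit_neq_0 _ Sl) as N0.
      replace (0 + t * q)%C with (t * q)%C by ring. set (x := (t * q)%C) in *.
      unfold rho. eapply holo_eq.
      + apply (holo_plus (fun q => clog (1 + q) - q)%C (fun q => q * q / 2)%C).
        * apply (holo_minus (fun q => clog (1 + q))%C (fun q => q)); [|apply holo_id].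
          apply (holo_clog_comp (fun q => 1 + q)%C); [holo_tac | exact Sl].
        * holo_tac. apply C2_neq_0.
      + unfold f'. field. exact N0.
    - intros t Ht. rewrite Rmin_left, Rmax_right in Ht by lra. destruct (H t Ht) as [Sl _]. pose proof (slit_neq_0 _ Sl) as N0.
      replace (0 + t * q)%C with (t * q)%C by ring. unfold f'. ccont. exact N0. }
  replace (rho (0 + 1 * q) - rho (0 + 0 * q))%C with (rho q) in F.
  2:{ replace (0 + 1 * q)%C with q by ring. replace (0 + 0 * q)%C with (RtoC 0) by ring. unfold rho at 3.
      replace (1 + 0)%C with (RtoC 1) by ring. rewrite clog_RtoC, ln_1 by lra. field. }
  assert (B : forall t : R, 0 <= t <= 1 -> Cmod (f' (0 + t * q)%C * q) * Cmod (1 + t * q) = t * t * (Cmod q * Cmod q * Cmod q)).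
  { intros t Ht. destruct (H t Ht) as [Sl _]. pose proof (slit_neq_0 _ Sl) as N0. replace (0 + t * q)%C with (t * q)%C by ring.
    rewrite <- Cmod_mult. replace (f' (t * q) * q * (1 + t * q))%C with (t * t * (q * q * q))%C by (unfold f'; field; exact N0).
    rewrite !Cmod_mult, Cmod_R, Rabs_pos_eq by lra. ring. }
  pose proof (Cmod_ge_0 q) as Hq. set (r := Cmod q) in *. assert (Hr3 : 0 <= r * r * r) by (repeat apply Rmult_le_pos; auto).
  split.
  - replace (r * r * r / (3 * mu)) with ((fun t => r * r * r / mu * (t * t * t / 3)) 1 - (fun t => r * r * r / mu * (t * t * t / 3)) 0) by (cbv beta; field; lra).
    refine (RIntC_bound _ (fun t => r * r * r / mu * (t * t)) 0 1 _ _ ltac:(lra) _ F _).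
    + intros t Ht. specialize (B t Ht). destruct (H t Ht) as [_ [M _]]. set (X := Cmod (f' _ * q)) in *. assert (0 <= X) by apply Cmod_ge_0.
      apply (Rmult_le_reg_r mu); auto. replace (r * r * r / mu * (t * t) * mu) with (t * t * (r * r * r)) by (field; lra). rewrite <- B. now apply Rmult_le_compat_l.
    + apply (is_RInt_poly (fun t => r * r * r / mu * (t * t * t / 3)) (fun t => r * r * r / mu * (t * t)));
      [intros x; auto_derive; [exact I | field; lra] | intros x; ccont].
  - replace (S * (r * r) / 2) with ((fun t => S * (r * r) * (t * t / 2)) 1 - (fun t => S * (r * r) * (t * t / 2)) 0) by (cbv beta; field).
    refine (RIntC_bound _ (fun t => S * (r * r) * t) 0 1 _ _ ltac:(lra) _ F _).
    + intros t Ht. specialize (B t Ht). destruct (H t Ht) as [_ [M1 M2]]. set (X := Cmod (f' _ * q)) in *. set (P := Cmod (1 + t * q)) in *.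
      apply (Rmult_le_reg_r P); [lra|]. rewrite B. replace (t * t * (r * r * r)) with (t * (r * r) * (t * r)) by ring.
      replace (S * (r * r) * t * P) with (t * (r * r) * (S * P)) by ring. apply Rmult_le_compat_l; auto. repeat apply Rmult_le_pos; lra.
    + apply (is_RInt_poly (fun t => S * (r * r) * (t * t / 2)) (fun t => S * (r * r) * t));
      [intros x; auto_derive; [exact I | field] | intros x; ccont].
Qed.

(** Each point of the segment from (a, b) to the line lies on a parallel SE line. If these lines
    cross the positive axis, the segment avoids 0 and all its arguments stay in the range of
    [carg_SE_line]. *)
Lemma SE_of_point (a b t d v : R) :
  ((a, b) + t * zz d v)%C = ((a + b + t * d)%R + (- (2 * rt * (b + t * (d / 2 - rt * v))))%R * dir_SE)%C.
Proof.
  rewrite SE_point. unfold zz. pose proof rt_sqr. apply injective_projections; simpl.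
  - replace (rt * - (2 * rt * (b + t * (d / 2 - rt * v)))) with (- (2 * (rt * rt) * (b + t * (d / 2 - rt * v)))) by ring. rewrite H. field.
  - replace (- (rt * - (2 * rt * (b + t * (d / 2 - rt * v))))) with (2 * (rt * rt) * (b + t * (d / 2 - rt * v))) by ring. rewrite H. field.
Qed.

(* The points [x] with [|x - e| <= S |x|] form the outside of an Apollonius circle; [HS] says that the line stays outside. *)
Lemma apollonius (a b p r S E d : R) : 1 < S -> E * E = a * a + b * b -> E <= a + b -> p + r = a + b + d -> - / 4 <= d ->
  0 <= S * S * E - (S * S - 1) / 4 ->
  2 * (S * S) * (E * E) <= (S * S * E - (S * S - 1) / 4) * (S * S * E - (S * S - 1) / 4) ->
  (p - a) * (p - a) + (r - b) * (r - b) <= S * S * (p * p + r * r).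
Proof.
  intros HS1 HE Hab Hpr Hd H0 HS. set (k := S * S - 1) in *. assert (Hk : 0 < k) by (unfold k; nra).
  assert (HS2 : S * S = k + 1) by (unfold k; ring). rewrite HS2 in *.
  (* Multiplied by k, the claim reads |k P + e|^2 >= (k + 1) |e|^2 with P = (p, r) and e = (a, b).
     [X] is the sum of the coordinates of k P + e, and X^2 is at most twice the squared modulus. *)
  set (X := k * (p + r) + (a + b)). assert (HX : (k + 1) * E - k / 4 <= X) by (unfold X; rewrite Hpr; nra).
  assert (HX2 : 2 * (k + 1) * (E * E) <= X * X) by nra.
  assert (H2 : X * X <= 2 * ((k * p + a) * (k * p + a) + (k * r + b) * (k * r + b))).
  { replace X with ((k * p + a) + (k * r + b)) by (unfold X; ring). pose proof (Rle_0_sqr ((k * p + a) - (k * r + b))). unfold Rsqr in *. lra. }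
  apply (Rmult_le_reg_l k); [lra|]. rewrite HE in HX2. nra.
Qed.

(** A lower bound for |x / eta| on the segments from eta to the line: the SE lines met there cross
    the axis no earlier than |eta| - 1/4, and their distance from 0 is [rt] times the crossing
    point. *)
Definition mu_eta (s : C) : R := (1 - / (4 * Cmod (eta s))) * rt.

(** Of the two bounds for the exponent, the cubic one is used in the linear factor of |exp z - 1|,
    where it yields 1 / |eta|, and the quadratic one inside the exponential, where it must compete
    with the Gaussian. *)
Lemma wfun_bound (s : C) (d v S : R) : Re s < 1 -> 4 * PI <= Cmod (s - 1) -> - / 4 <= d <= / 4 -> 1 < S ->
  let E := Cmod (eta s) in let r := Cmod (zz d v) in
  0 <= S * S * E - (S * S - 1) / 4 ->
  2 * (S * S) * (E * E) <= (S * S * E - (S * S - 1) / 4) * (S * S * E - (S * S - 1) / 4) ->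
  0 < mu_eta s /\
  Cmod (wfun s (zz d v)) <= 2 * PI * (r * r * r) / (3 * mu_eta s * E) * ((1 + exp (PI * S * (r * r))) / 2).
Proof.
  intros Hs H4 Hd HS1 E r HS0 HS. pose proof PI_RGT_0 as HP. pose proof rt_pos as Hrt.
  destruct (eta_facts s Hs) as [_ [Ha [Hb Harg]]]. pose proof (eta_neq_0 s Hs) as N0. pose proof (Cmod_eta s Hs H4) as E2. pose proof (eta_sum_ge s Hs) as Eab.
  pose proof (Cmod_sqr (eta s)) as Esq. unfold wfun, mu_eta. cbv zeta. fold E in E2, Eab, Esq |- *. set (e := eta s) in *.
  assert (HE1 : 1 < E) by (assert (0 <= E) by apply Cmod_ge_0; nra).
  set (mu := (1 - / (4 * E)) * rt).
  assert (HiE : / (4 * E) < 1) by (rewrite <- Rinv_1; apply Rinv_lt_contravar; lra).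
  assert (Hmu : 0 < mu) by (apply Rmult_lt_0_compat; lra). split; [exact Hmu|].
  set (a := Re e) in *. set (b := Im e) in *. assert (Ee : e = (a, b)) by (unfold a, b; destruct e; reflexivity).
  set (q := (zz d v / e)%C). assert (Cq : Cmod q = r / E) by (unfold q; rewrite Cmod_div by exact N0; reflexivity).
  assert (R0 : 0 <= r) by apply Cmod_ge_0.
  destruct (rho_bound q mu S Hmu) as [B1 B2].
  { intros t Ht. assert (Htd : - / 4 <= t * d <= / 4) by nra. set (P := (e + t * zz d v)%C).
    assert (EP : (1 + t * q)%C = (P / e)%C) by (unfold q, P; field; exact N0).
    assert (LP : P = ((a + b + t * d)%R + (- (2 * rt * (b + t * (d / 2 - rt * v))))%R * dir_SE)%C) by (unfold P; rewrite Ee; apply SE_of_point).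
    assert (Hc : 0 < a + b + t * d) by lra.
    destruct (carg_SE_line (a + b + t * d) (- (2 * rt * (b + t * (d / 2 - rt * v)))) Hc) as [P0 Pa]. rewrite <- LP in P0, Pa.
    pose proof (Cmod_SE_line_ge (a + b + t * d) (- (2 * rt * (b + t * (d / 2 - rt * v)))) Hc) as Pm. rewrite <- LP in Pm.
    assert (MP : Cmod (1 + t * q) = Cmod P / E) by (rewrite EP, Cmod_div by exact N0; reflexivity).
    split; [|split].
    - rewrite EP. pose proof (clog_div P e P0 N0 ltac:(lra)) as L. apply (f_equal snd) in L. simpl in L.
      apply slit_of_carg; [|rewrite L; lra]. unfold Cdiv. apply Cmult_neq_0; auto. intros Z.
      assert (Q : (e * / e)%C = RtoC 0) by (rewrite Z; ring). rewrite Cinv_r in Q by exact N0. inversion Q; lra.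
    - rewrite MP. apply (Rmult_le_reg_r E); [lra|]. unfold Rdiv. rewrite Rmult_assoc, Rinv_l, Rmult_1_r by lra.
      eapply Rle_trans; [|exact Pm]. unfold mu. replace ((1 - / (4 * E)) * rt * E) with ((E - / 4) * rt) by (field; lra).
      apply Rmult_le_compat_r; lra.
    - rewrite MP, Cq. unfold Rdiv. rewrite <- !Rmult_assoc. apply Rmult_le_compat_r; [left; apply Rinv_0_lt_compat; lra|].
      assert (Q1 : t * r = Cmod (P - e)).
      { replace (P - e)%C with (t * zz d v)%C by (unfold P; ring). rewrite Cmod_mult, Cmod_R, Rabs_pos_eq by lra. reflexivity. }
      pose proof (Cmod_sqr P) as SP. pose proof (Cmod_sqr (P - e)) as SPe.
      pose proof (apollonius a b (Re P) (Im P) S E (t * d) HS1 Esq Eab) as Ap.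
      assert (Rp : Re P + Im P = a + b + t * d) by (rewrite LP, SE_point; simpl; ring). specialize (Ap Rp ltac:(lra) HS0 HS).
      replace (Re (P - e)%C) with (Re P - a) in SPe by (unfold a, Re; simpl; ring). replace (Im (P - e)%C) with (Im P - b) in SPe by (unfold b, Im; simpl; ring).
      rewrite <- SP, <- SPe, <- Q1 in Ap. pose proof (Cmod_ge_0 P).
      apply Rsqr_incr_0; unfold Rsqr; [nra | apply Rmult_le_pos; lra | apply Rmult_le_pos; lra]. }
  rewrite Cq in B1, B2.
  match goal with |- Cmod (cexp ?X - _)%C <= _ => set (Phi := X) end.
  assert (MPhi : Cmod Phi = 2 * PI * (E * E) * Cmod (rho q)).
  { unfold Phi. fold q. replace (2 * PI * ci * e * e * (clog (1 + q) - q + q * q / 2))%C with (2 * PI * ci * (e * e) * rho q)%C by (unfold rho; ring).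
    rewrite !Cmod_mult, !Cmod_R, !Rabs_pos_eq by lra. change ci with Ci. rewrite Cmod_Ci. fold E. ring. }
  assert (HEE : 0 < 2 * PI * (E * E)) by nra.
  assert (P1 : Cmod Phi <= 2 * PI * (r * r * r) / (3 * mu * E)).
  { rewrite MPhi. apply (Rmult_le_compat_l (2 * PI * (E * E))) in B1; [|lra]. eapply Rle_trans; [exact B1|]. right. field. lra. }
  assert (P2 : Cmod Phi <= PI * S * (r * r)).
  { rewrite MPhi. apply (Rmult_le_compat_l (2 * PI * (E * E))) in B2; [|lra]. eapply Rle_trans; [exact B2|]. right. field. lra. }
  eapply Rle_trans; [apply Cmod_cexp_minus_1_convex|]. apply Rmult_le_compat; auto; [apply Cmod_ge_0 | |].
  - pose proof (exp_pos (Cmod Phi)). lra.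
  - pose proof (exp_le _ _ P2). lra.
Qed.

Lemma Rrem_param (s : C) (c1 : R) : Re s < 1 -> 4 * PI <= Cmod (s - 1) -> IZR (mZ s) < c1 < IZR (mZ s) + 1 ->
  exists d M : R, - / 4 <= d <= / 4 /\ IZR (mZ s) + / 4 <= Re (eta s) + Im (eta s) + d <= IZR (mZ s) + 3 / 4 /\
    dom M (fun v => gW s (eta s + zz d v)%C / den (eta s + zz d v))%C /\
    Rrem c1 s = (CInt_line (fun v => gW s (eta s + zz d v)%C / den (eta s + zz d v))%C * dir_SE)%C.
Proof.
  intros Hs H4 Hc1. pose proof PI_RGT_0 as HP. pose proof (mZ_bounds s) as Bm. pose proof (mZ_ge_1 s Hs H4) as Hm.
  assert (Hm1 : 1 <= IZR (mZ s)) by now apply IZR_le. set (n := mZ s) in *. set (ab := Re (eta s) + Im (eta s)) in *.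
  (* eta_1 + eta_2 lies in [m, m + 1), so the nearest point of [m + 1/4, m + 3/4] is at distance at
     most 1/4. *)
  assert (Hd : exists d, - / 4 <= d <= / 4 /\ IZR n + / 4 <= ab + d <= IZR n + 3 / 4).
  { destruct (Rle_dec ab (IZR n + / 4)); [exists (IZR n + / 4 - ab); lra|].
    destruct (Rle_dec ab (IZR n + 3 / 4)); [exists 0; lra | exists (IZR n + 3 / 4 - ab); lra]. }
  destruct Hd as [d [Hd1 Hd2]]. set (c := ab + d) in *.
  assert (Hc : IZR n < c < IZR n + 1) by lra.
  destruct (gW_over_den_dom s n c Hs ltac:(lra) Hc) as [[M D] L1]. destruct (gW_over_den_dom s n c1 Hs ltac:(lra) Hc1) as [_ L2].
  set (u0 := - (2 * rt * Im (eta s)) - rt * d).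
  assert (E : forall v : R, (eta s + zz d v)%C = (c + (v + u0)%R * dir_SE)%C).
  { intros v. pose proof (SE_of_point (Re (eta s)) (Im (eta s)) 1 d v) as Q.
    replace ((Re (eta s), Im (eta s)) : C) with (eta s) in Q by (destruct (eta s); reflexivity). rewrite Cmult_1_l in Q. rewrite Q.
    f_equal; [f_equal; unfold c, ab; ring|]. f_equal. f_equal. unfold u0. pose proof rt_sqr.
    replace (- (2 * rt * (Im (eta s) + 1 * (d / 2 - rt * v)))) with (- (2 * rt * Im (eta s)) - rt * d + 2 * (rt * rt) * v) by field. rewrite H. field. }
  exists d, (M * (2 * (1 + u0 * u0))). split; [exact Hd1|]. split; [exact Hd2|].
  split.
  - refine (dom_ext _ _ _ _ (dom_shift _ _ u0 D)). intros v. now rewrite E.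
  - rewrite (Rrem_LI s n c1 Hs ltac:(lra) Hc1).
    destruct (nice_gP (1 - s) (IZR n + 1) ltac:(unfold Re in *; simpl; lra)) as [g' G].
    rewrite (LI_const _ _ n c1 c (nice_sub _ _ 0 (IZR n + 1) (IZR n) (IZR n + 1) ltac:(lra) ltac:(lra) G) Hc1 Hc), L1 in L2.
    rewrite (LI_const _ _ n c c1 (nice_gau (2 * PI) (eta s) _ _ ltac:(lra)) Hc Hc1) in L2.
    (* The line for [gW] is moved without studying [wfun] in the strip: the integrals of [gP] and of
       the Gaussian do not depend on the crossing point, hence neither does the part that
       remains. *)
    assert (Eq : LI (gW s) c1 = LI (gW s) c).
    { pose proof (saddle_neq_0 s). apply (f_equal (fun z => (z / saddle s)%C)) in L2.
      set (g1 := LI (gau (2 * PI) (eta s)) c1) in *. set (x1 := LI (gW s) c1) in *. set (x0 := LI (gW s) c) in *.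
      replace x1 with (saddle s * (g1 + x1) / saddle s - g1)%C by (field; auto). rewrite <- L2. field. auto. }
    rewrite Eq. unfold LI. f_equal. rewrite <- (IntR_shift M _ u0 D). apply IntR_ext. intros v. now rewrite E.
Qed.

(** * Gaussian integrals with polynomial weights *)

Definition exp_bounded (f : R -> C) : Prop :=
  (forall t, continuous f t) /\ exists A B, 0 <= A /\ 0 <= B /\ forall t, Cmod (f t) <= A * exp (B * Rabs t).

Lemma exp_bounded_const k : exp_bounded (fun _ => k).
Proof.
  split; [intros t; apply continuous_const|]. exists (Cmod k), 0. split; [apply Cmod_ge_0|]. split; [lra|].
  intros t. rewrite Rmult_0_l, exp_0. lra.
Qed.

Lemma exp_bounded_id : exp_bounded (fun t => RtoC t).
Proof.
  split; [intros t; ccont|]. exists 1, 1. split; [lra|]. split; [lra|]. intros t. rewrite Cmod_R. pose proof (exp_ineq1_le (Rabs t)). rewrite !Rmult_1_l. lra.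
Qed.

Lemma exp_bounded_plus f g : exp_bounded f -> exp_bounded g -> exp_bounded (fun t => f t + g t)%C.
Proof.
  intros [Cf [A [B [HA [HB F]]]]] [Cg [A' [B' [HA' [HB' G]]]]]. split; [intros t; now apply continuous_Cplus|].
  exists (A + A'), (B + B'). split; [lra|]. split; [lra|]. intros t. eapply Rle_trans; [apply Cmod_triangle|].
  specialize (F t). specialize (G t). pose proof (Rabs_pos t).
  assert (exp (B * Rabs t) <= exp ((B + B') * Rabs t)) by (apply exp_le; nra).
  assert (exp (B' * Rabs t) <= exp ((B + B') * Rabs t)) by (apply exp_le; nra). nra.
Qed.

Lemma exp_bounded_mult f g : exp_bounded f -> exp_bounded g -> exp_bounded (fun t => f t * g t)%C.
Proof.
  intros [Cf [A [B [HA [HB F]]]]] [Cg [A' [B' [HA' [HB' G]]]]]. split; [intros t; now apply continuous_Cmult|].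
  exists (A * A'), (B + B'). split; [now apply Rmult_le_pos|]. split; [lra|]. intros t. rewrite Cmod_mult, Rmult_plus_distr_r, exp_plus.
  replace (A * A' * (exp (B * Rabs t) * exp (B' * Rabs t))) with (A * exp (B * Rabs t) * (A' * exp (B' * Rabs t))) by ring.
  apply Rmult_le_compat; auto; apply Cmod_ge_0.
Qed.

Ltac exp_bounded_tac := repeat match goal with
  | |- exp_bounded (fun t => ?c) => apply (exp_bounded_const c)
  | |- exp_bounded (fun t => RtoC t) => apply exp_bounded_id
  | |- exp_bounded (fun t => Cplus (@?f t) (@?g t)) => apply (exp_bounded_plus f g)
  | |- exp_bounded (fun t => Cmult (@?f t) (@?g t)) => apply (exp_bounded_mult f g)
  end.

(** [exp_bounded] is closed under sums and products, so polynomial weights need no majorants made by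
    hand. *)
Lemma dom_exp_bounded_gauss (f : R -> C) (kap beta : R) : 0 < kap -> exp_bounded f ->
  exists M, dom M (fun t : R => f t * cexp (beta * t - kap * (t * t)))%C.
Proof.
  intros Hk [Cf [A [B [HA [HB F]]]]]. exists (A * (4 * exp ((B + Rabs beta + 1) * (B + Rabs beta + 1) / (4 * kap)))). split.
  - intros t. apply continuous_Cmult; [apply Cf | ccont].
  - intros t. rewrite Cmod_mult, Cmod_cexp. replace (Re (beta * t - kap * (t * t))%C) with (beta * t - kap * (t * t)) by (unfold Re; simpl; ring).
    pose proof (exp_gauss_dom kap (B + Rabs beta) t Hk) as G. specialize (F t).
    apply Rle_trans with (A * exp (B * Rabs t) * exp (beta * t - kap * (t * t))).
    + apply Rmult_le_compat_r; [left; apply exp_pos | exact F].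
    + rewrite Rmult_assoc, <- exp_plus. unfold Rdiv in *. rewrite Rmult_assoc. apply Rmult_le_compat_l; auto.
      eapply Rle_trans; [|exact G]. apply exp_le. pose proof (Rle_abs (beta * t)) as Q. rewrite Rabs_mult in Q. lra.
Qed.

Lemma gaussian_linear (kap beta : R) : 0 < kap ->
  CInt_line (fun t : R => cexp (beta * t - kap * (t * t)))%C = RtoC (sqrt (PI / kap) * exp (beta * beta / (4 * kap))).
Proof.
  intros Hk. assert (Hs : 0 < sqrt kap) by now apply sqrt_lt_R0. pose proof (sqrt_sqrt kap ltac:(lra)) as S. pose proof PI_RGT_0.
  set (k := sqrt kap) in *. set (q := - (beta / (2 * k))).
  rewrite (IntR_ext _ (fun u => exp (beta * beta / (4 * kap)) * cexp (- ((k * u + q) * (k * u + q))))%C).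
  - rewrite (IntR_scal (4 * exp ((2 * k * Rabs q + 1) * (2 * k * Rabs q + 1) / (4 * kap)))).
    + rewrite gaussian by auto. rewrite <- RtoC_mult. f_equal. rewrite sqrt_div by lra. fold k. ring.
    + split; [intros t; ccont|]. intros t. rewrite Cmod_cexp.
      replace (Re (- ((k * t + q) * (k * t + q)))%C) with (- ((k * t + q) * (k * t + q))) by (unfold Re; simpl; ring).
      pose proof (exp_gauss_dom kap (2 * k * Rabs q) t Hk) as G. eapply Rle_trans; [|exact G]. apply exp_le.
      rewrite <- S. pose proof (Rle_abs (- (q * t))) as Q. rewrite Rabs_Ropp, Rabs_mult in Q. nra.
  - intros u. rewrite <- cexp_R, <- cexp_plus. f_equal.
    rewrite <- !RtoC_mult, <- !RtoC_plus, <- RtoC_mult, <- RtoC_opp, <- RtoC_minus, <- RtoC_plus. f_equal.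
    rewrite <- S. unfold q. field. lra.
Qed.

(* The number [/ 32] bounds [d^2/2] for the offset [|d| <= 1/4] of the line from the saddle point. *)
Definition Gk (kap beta : R) (v : R) : C :=
  (((v * v + / 32) + (v * v + / 32) * (v * v + / 32)) * cexp (beta * v - kap * (v * v)))%C.

(** Moments of the normal law with mean [h] and variance [g]: [q] is the mean of v^2 + 1/32, and the
    last bracket is the mean of its square, v^4 having the mean h^4 + 6 h^2 g + 3 g^2. The factors
    in front are the total mass. *)
Definition Jk (kap beta : R) : R :=
  let h := beta / (2 * kap) in let g := / (2 * kap) in let q := h * h + g + / 32 in
  sqrt (PI / kap) * exp (beta * beta / (4 * kap)) *
  (q + (h * h * (h * h) + 6 * (h * h) * g + 3 * (g * g) + / 16 * (h * h + g) + / 1024)).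

Lemma Gk_integral (kap beta : R) : 0 < kap -> (exists M, dom M (Gk kap beta)) /\ CInt_line (Gk kap beta) = RtoC (Jk kap beta).
Proof.
  intros Hk. set (h := beta / (2 * kap)). set (g := / (2 * kap)). assert (K0 : RtoC kap <> RtoC 0) by (intros E; inversion E; lra).
  (* [Gk] minus a constant multiple of the Gaussian is the derivative of [f] *)
  set (A0 := g * (4 * (h * h * h) + 2 * h * (17 / 16)) + 2 * g * (g * (4 * h))).
  set (A1 := g * (6 * (h * h) + 17 / 16) + 3 * g * g). set (A2 := g * (4 * h)).
  set (M := h * h * (h * h) + 17 / 16 * (h * h) + / 1024 + / 32 + A1).
  set (P := fun x : C => (A0 + A1 * x + A2 * (x * x) + g * (x * (x * x)))%C).
  set (f := fun T : C => ((- (1)) * P (T - h) * cexp (beta * T - kap * (T * T)))%C).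
  set (f' := fun T : C => (((T * T + / 32) + (T * T + / 32) * (T * T + / 32) - M) * cexp (beta * T - kap * (T * T)))%C).
  assert (Hholo : forall T, holo f T (f' T)).
  { intros T. unfold f, P. eapply holo_eq; [holo_tac|]. unfold f'.
    set (EE := cexp (beta * T - kap * (T * T))). set (x := (T - h)%C).
    replace (RtoC beta) with (2 * kap * h)%C.
    2:{ unfold h. rewrite RtoC_div, RtoC_mult by lra. field. auto. }
    assert (Eg : (2 * kap * g = 1)%C) by (unfold g; rewrite RtoC_inv, RtoC_mult by lra; field; auto).
    unfold M, A0, A1, A2.
    repeat first [rewrite RtoC_plus | rewrite RtoC_mult | rewrite RtoC_div by lra | rewrite RtoC_inv by lra].
    replace T with (x + h)%C by (unfold x; ring). clearbody x EE h.
    generalize (RtoC g) Eg. intros gg Eg'.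
    assert (G0 : gg <> RtoC 0) by (intros Z; rewrite Z in Eg'; rewrite Cmult_0_r in Eg'; inversion Eg'; lra).
    assert (Ek : RtoC kap = (/ (2 * gg))%C).
    { replace (RtoC kap) with (2 * kap * gg / (2 * gg))%C by (field; auto). rewrite Eg'. field. auto. }
    rewrite Ek. field. auto. }
  assert (EP : forall c0 c1 c2 c3 : C, exp_bounded (fun t => c0 + c1 * (t + - h) + c2 * ((t + - h) * (t + - h)) + c3 * ((t + - h) * ((t + - h) * (t + - h))))%C).
  { intros c0 c1 c2 c3. exp_bounded_tac. }
  destruct (dom_exp_bounded_gauss _ kap beta Hk (exp_bounded_mult _ _ (exp_bounded_const (- (1))%C) (EP A0 A1 A2 g))) as [N1 D1].
  assert (EQ : exp_bounded (fun t => ((t * t + / 32) + (t * t + / 32) * (t * t + / 32))%C)).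
  { exp_bounded_tac. }
  destruct (dom_exp_bounded_gauss _ kap beta Hk EQ) as [N2 D2]. destruct (dom_exp_bounded_gauss _ kap beta Hk (exp_bounded_const 1)) as [N3 D3].
  change (dom N2 (Gk kap beta)) in D2. split; [exists N2; exact D2|].
  assert (E' : forall t : R, (Gk kap beta t - M * (1 * cexp (beta * t - kap * (t * t))))%C = f' t) by (intros t; unfold Gk, f'; ring).
  pose proof (dom_minus _ _ _ _ D2 (dom_scal _ _ M D3)) as D4. cbv beta in D4.
  assert (Z : CInt_line (fun t : R => f' t) = RtoC 0).
  { eapply (IntR_derivative f f' _ N1).
    - intros t. apply Hholo.
    - intros t. unfold f'. ccont.
    - refine (dom_ext _ _ _ E' D4).
    - exact D1. }
  rewrite <- (IntR_ext _ _ E'), (IntR_minus _ _ _ _ D2 (dom_scal _ _ M D3)), (IntR_scal _ _ _ D3) in Z.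
  rewrite (IntR_ext (fun t => 1 * _)%C (fun t => cexp (beta * t - kap * (t * t)))%C) in Z by (intros; ring).
  rewrite gaussian_linear in Z by auto.
  apply (f_equal (fun z => (z + M * RtoC (sqrt (PI / kap) * exp (beta * beta / (4 * kap))))%C)) in Z.
  replace (CInt_line (Gk kap beta)) with (CInt_line (Gk kap beta) - M * RtoC (sqrt (PI / kap) * exp (beta * beta / (4 * kap))) + M * RtoC (sqrt (PI / kap) * exp (beta * beta / (4 * kap))))%C by ring.
  rewrite Z, Cplus_0_l, <- RtoC_mult. f_equal. unfold Jk. cbv zeta. fold h g. unfold M, A1. field.
Qed.

Lemma Gk_real (kap beta v : R) :
  Gk kap beta v = RtoC (((v * v + / 32) + (v * v + / 32) * (v * v + / 32)) * exp (beta * v - kap * (v * v))).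
Proof.
  unfold Gk. rewrite !RtoC_mult, !RtoC_plus, !RtoC_mult, !RtoC_plus, !RtoC_mult, RtoC_inv by lra. f_equal.
  rewrite <- cexp_R. f_equal. rewrite RtoC_minus, !RtoC_mult. reflexivity.
Qed.

(** sqrt 3 comes from [den_lower_exp], the fraction from the cubic bound, [W] from the weight, exp
    (pi / 16) from the offset d of the line, and 1 / 4 from two halves: one of AM-GM for r^3, one of
    the convexity bound. *)
Definition Rrem_factor (s : C) (W : R) : R := sqrt 3 * (2 * PI / (3 * mu_eta s * Cmod (eta s))) * W * exp (PI / 16) / 4.

(** [W] and [beta] describe a majorant of exp (- pi |Im x|), which bounds 1 / den up to sqrt 3; beta
    = 0 leads to the constant 4, beta = pi / sqrt 2 to the decay in eta_2. The two values of [Jk]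
    stem from the summands 1 and exp of the convexity bound, which leave the Gaussian exponents 2 pi
    and (2 - S) pi. *)
Lemma Rrem_bound (s : C) (c1 S W beta : R) : Re s < 1 -> 4 * PI <= Cmod (s - 1) -> IZR (mZ s) < c1 < IZR (mZ s) + 1 -> 1 < S < 2 -> 0 < W ->
  let E := Cmod (eta s) in
  0 <= S * S * E - (S * S - 1) / 4 ->
  2 * (S * S) * (E * E) <= (S * S * E - (S * S - 1) / 4) * (S * S * E - (S * S - 1) / 4) ->
  (forall d v, - / 4 <= d <= / 4 -> exp (- (PI * Rabs (Im (eta s) + d / 2 - rt * v))) <= W * exp (beta * v)) ->
  Cmod (Rrem c1 s) <= Rrem_factor s W * (Jk (2 * PI) beta + exp (PI * S / 32) * Jk ((2 - S) * PI) beta).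
Proof.
  intros Hs H4 Hc1 HS HW E HS0 HS1 HB. pose proof PI_RGT_0 as HP.
  destruct (Rrem_param s c1 Hs H4 Hc1) as [d [M [Hd [Hcr [D ->]]]]]. rewrite Cmod_mult, Cmod_dir_SE, Rmult_1_r.
  destruct (wfun_bound s d 0 S Hs H4 Hd ltac:(lra) HS0 HS1) as [Hmu _].
  assert (HE : 0 < E) by (apply Cmod_gt_0, eta_neq_0, Hs).
  destruct (Gk_integral (2 * PI) beta ltac:(lra)) as [[M1 D1] J1].
  destruct (Gk_integral ((2 - S) * PI) beta ltac:(apply Rmult_lt_0_compat; lra)) as [[M2 D2] J2].
  pose proof (dom_scal _ _ (exp (PI * S / 32)) D2) as D3. pose proof (dom_plus _ _ _ _ D1 D3) as D4. cbv beta in D4.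
  pose proof (dom_scal _ _ (Rrem_factor s W) D4) as D5. cbv beta in D5.
  eapply Rle_trans; [apply (IntR_le_Re _ _ _ _ D D5)|].
  2:{ rewrite (IntR_scal _ _ _ D4), (IntR_plus _ _ _ _ D1 D3), (IntR_scal _ _ _ D2), J1, J2, <- RtoC_mult, <- RtoC_plus, <- RtoC_mult. simpl. lra. }
  intros v. rewrite !Gk_real, <- RtoC_mult, <- RtoC_plus, <- RtoC_mult. change (Re (RtoC ?x)) with x. simpl Re.
  destruct (wfun_bound s d v S Hs H4 Hd ltac:(lra) HS0 HS1) as [_ Bw]. cbv zeta in Bw. fold E in Bw.
  set (e := eta s) in *. set (a := Re e) in *. set (b := Im e) in *.
  set (B := b + d / 2 - rt * v) in *. set (A := a + d / 2 + rt * v).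
  assert (EX : (e + zz d v)%C = (A, B)) by (unfold A, B, a, b, zz; destruct e; apply injective_projections; simpl; ring).
  pose proof (den_lower_exp (mZ s) A B ltac:(unfold A, B; lra)) as Bd. rewrite <- EX in Bd.
  specialize (HB d v Hd). fold B in HB.
  set (Dn := Cmod (den (e + zz d v))) in *.
  assert (S3 : 0 < sqrt 3) by (apply sqrt_lt_R0; lra).
  assert (HDn : 0 < Dn) by (pose proof (exp_pos (PI * Rabs B)); nra).
  assert (Bd2 : / Dn <= sqrt 3 * (W * exp (beta * v))).
  { apply Rle_trans with (sqrt 3 * exp (- (PI * Rabs B))); [|now apply Rmult_le_compat_l; [lra|]].
    rewrite exp_Ropp. pose proof (exp_pos (PI * Rabs B)) as Q. apply (Rmult_le_reg_r Dn); auto. rewrite Rinv_l by lra.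
    apply (Rmult_le_reg_r (exp (PI * Rabs B))); auto. replace (sqrt 3 * / exp (PI * Rabs B) * Dn * exp (PI * Rabs B)) with (sqrt 3 * Dn) by (field; lra). lra. }
  rewrite Cmod_div by (apply Cmod_gt_0; exact HDn). fold Dn. unfold gW. rewrite Cmod_mult. fold e. rewrite gau_zz.
  replace (e + zz d v - e)%C with (zz d v) by ring.
  set (w := Cmod (wfun s (zz d v))) in *. assert (Hw : 0 <= w) by apply Cmod_ge_0.
  pose proof (Cmod_zz d v) as Zr. set (r := Cmod (zz d v)) in *. assert (Hr : 0 <= r) by apply Cmod_ge_0.
  set (q := v * v + / 32). assert (Hq : r * r <= q) by (unfold q; rewrite Zr; nra).
  (* AM-GM replaces the odd power r^3, so that only polynomials in v^2 have to be integrated. *)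
  assert (Hr3 : r * r * r <= (q + q * q) / 2).
  { assert (0 <= r * r) by nra. assert (r * r * (r * r) <= q * q) by (apply Rmult_le_compat; auto).
    assert (2 * (r * r * r) <= r * r + r * r * (r * r)) by (pose proof (pow2_ge_0 (r - r * r)); nra). lra. }
  assert (Hd2 : d * d <= / 16) by nra.
  assert (X1 : exp (PI * (d * d) - 2 * PI * (v * v)) <= exp (PI / 16) * exp (- (2 * PI * (v * v)))) by (rewrite <- exp_plus; apply exp_le; nra).
  assert (X2 : exp (PI * S * (r * r)) <= exp (PI * S / 32) * exp (PI * S * (v * v))).
  { rewrite <- exp_plus. apply exp_le. rewrite Zr. assert (0 < PI * S) by nra. nra. }
  set (cc := 2 * PI / (3 * mu_eta s * E)) in *.
  assert (Hcc : 0 < cc) by (unfold cc; apply Rdiv_lt_0_compat; [lra | apply Rmult_lt_0_compat; [lra | exact HE]]).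
  replace (2 * PI * (r * r * r) / (3 * mu_eta s * E)) with (cc * (r * r * r)) in Bw by (unfold cc, Rdiv; ring).
  set (U := exp (PI * S / 32)) in *. set (V := exp (PI * S * (v * v))) in *. assert (HU : 0 < U) by apply exp_pos. assert (HV : 0 < V) by apply exp_pos.
  assert (Bw2 : w <= cc * ((q + q * q) / 2) * ((1 + U * V) / 2)).
  { eapply Rle_trans; [exact Bw|]. apply Rmult_le_compat; [apply Rmult_le_pos; [lra | repeat apply Rmult_le_pos; auto] | pose proof (exp_pos (PI * S * (r * r))); lra | apply Rmult_le_compat_l; lra | lra]. }
  set (Y := exp (- (2 * PI * (v * v)))) in *. assert (HY : 0 < Y) by apply exp_pos. set (Z := exp (beta * v)) in *. assert (HZ : 0 < Z) by apply exp_pos.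
  replace (exp (beta * v - 2 * PI * (v * v))) with (Z * Y) by (unfold Z, Y; rewrite <- exp_plus; f_equal; ring).
  replace (exp (beta * v - (2 - S) * PI * (v * v))) with (Z * Y * V) by (unfold Z, Y, V; rewrite <- !exp_plus; f_equal; ring).
  unfold Rrem_factor. fold e. fold E. fold cc. set (T := exp (PI / 16)) in *. assert (HT : 0 < T) by apply exp_pos.
  assert (H0q : 0 <= q) by (unfold q; nra). assert (0 <= q * q) by nra.
  apply Rle_trans with ((T * Y) * (cc * ((q + q * q) / 2) * ((1 + U * V) / 2)) * (sqrt 3 * (W * Z))).
  - unfold Rdiv at 1. apply Rmult_le_compat; [apply Rmult_le_pos; [left; apply exp_pos | exact Hw] | left; now apply Rinv_0_lt_compat | | exact Bd2].
    apply Rmult_le_compat; [left; apply exp_pos | exact Hw | exact X1 | exact Bw2].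
  - right. field.
Qed.

(** * Numerical constants *)

Lemma PI_upper : PI <= 315 / 100.
Proof.
  (* sin (pi / 6) = 1 / 2 is compared with x - x^3 / 6 at x = pi / 6; this cubic already exceeds 1 /
     2 at x = 0.525. *)
  pose proof PI_4 as H4. pose proof PI2_3_2 as H3. pose proof (pre_sin_bound (PI / 6) 0 ltac:(lra) ltac:(lra)) as [L _].
  rewrite sin_PI6 in L. unfold sin_approx, sin_term in L. simpl in L. set (x := PI / 6) in *.
  destruct (Rle_dec PI (315 / 100)) as [|N]; [assumption|exfalso].
  assert (Hx : 525 / 1000 <= x) by (unfold x; lra). assert (Hx2 : x <= 2 / 3) by (unfold x; lra).
  assert (x - x * x * x / 6 <= 1 / 2) by lra.
  assert ((x - 525 / 1000) * (1 - (x * x + 525 / 1000 * x + 525 / 1000 * (525 / 1000)) / 6) >= 0) by (apply Rle_ge, Rmult_le_pos; nra).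
  nra.
Qed.

Lemma sqrt_upper (x y : R) : 0 <= y -> x <= y * y -> sqrt x <= y.
Proof. intros Hy H. rewrite <- (sqrt_square y Hy). now apply sqrt_le_1_alt. Qed.

Lemma exp_PI16_upper : exp (PI / 16) <= 1221 / 1000.
Proof.
  (* The bound exp x <= 1 / (1 - x) is used at pi / 128, followed by three squarings, to keep the
     loss small. *)
  pose proof PI_upper. pose proof PI_RGT_0. set (x := PI / 128). assert (E : exp x <= 1 / (1 - 315 / 12800)).
  { replace x with (- - x) by ring. rewrite exp_Ropp. unfold Rdiv at 1. rewrite Rmult_1_l. apply Rinv_le_contravar; [lra|].
    pose proof (exp_ineq1_le (- x)). unfold x in *. lra. }
  replace (PI / 16) with (x + x + (x + x) + (x + x + (x + x))) by (unfold x; field). rewrite !exp_plus.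
  set (y := exp x) in *. assert (0 < y) by apply exp_pos. assert (y <= 102524 / 100000) by lra.
  assert (y * y <= 10512 / 10000) by nra. assert (y * y * (y * y) <= 110503 / 100000) by (assert (0 < y * y) by nra; nra).
  assert (0 < y * y * (y * y)) by (assert (0 < y * y) by nra; nra). nra.
Qed.

Lemma rt_lower : 707 / 1000 <= rt.
Proof. pose proof rt_pos. pose proof rt_sqr. nra. Qed.

Lemma inv_PI_upper : / PI <= / 3.
Proof. pose proof PI2_3_2. apply Rinv_le_contravar; lra. Qed.

(** The polynomial factor of [Jk] in terms of H = h^2 and of an upper bound G for the variance. *)
Definition Jpoly (H G : R) : R := H + G + / 32 + (H * H + 6 * H * G + 3 * (G * G) + / 16 * (H + G) + / 1024).

Lemma Jk_le (kap beta H G Q X : R) : 0 < kap -> beta / (2 * kap) * (beta / (2 * kap)) = H -> / (2 * kap) <= G ->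
  PI / kap <= Q * Q -> 0 <= Q -> exp (beta * beta / (4 * kap)) <= X -> Jk kap beta <= Q * X * Jpoly H G.
Proof.
  intros Hk EH HG HQ Q0 HX. unfold Jk. cbv zeta. rewrite EH. set (g := / (2 * kap)) in *.
  assert (H0 : 0 <= H) by (rewrite <- EH; apply Rle_0_sqr). assert (g0 : 0 < g) by (apply Rinv_0_lt_compat; lra).
  assert (0 <= sqrt (PI / kap)) by apply sqrt_pos. pose proof (exp_pos (beta * beta / (4 * kap))).
  apply Rmult_le_compat; [apply Rmult_le_pos; lra | | apply Rmult_le_compat; auto; [lra | now apply sqrt_upper] |].
  - assert (0 <= H * H) by nra. assert (0 <= H * g) by nra. assert (0 <= g * g) by nra. lra.
  - unfold Jpoly. assert (H * g <= H * G) by nra. assert (g * g <= G * G) by nra. lra.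
Qed.

Lemma sqrt3_upper : sqrt 3 <= 1733 / 1000.
Proof. apply sqrt_upper; lra. Qed.

Lemma Rrem_factor_le (s : C) (W m0 : R) : 0 < m0 <= mu_eta s -> 0 < Cmod (eta s) -> 0 < W ->
  Rrem_factor s W <= 1112 / 1000 / m0 * W / Cmod (eta s).
Proof.
  intros [Hm0 Hm] HE HW. unfold Rrem_factor. set (E := Cmod (eta s)) in *. set (mu := mu_eta s) in *.
  pose proof PI_upper. pose proof PI_RGT_0. pose proof sqrt3_upper. pose proof (sqrt_pos 3). pose proof exp_PI16_upper. pose proof (exp_pos (PI / 16)).
  (* 1.733 * 2.1 * 1.221 / 4 is just below 1.112. *)
  assert (A : sqrt 3 * (2 * PI / 3) * exp (PI / 16) / 4 <= 1112 / 1000 / m0 * m0).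
  { replace (1112 / 1000 / m0 * m0) with (1112 / 1000) by (field; lra).
    assert (sqrt 3 * (2 * PI / 3) <= 1733 / 1000 * (21 / 10)) by (apply Rmult_le_compat; lra).
    assert (0 <= sqrt 3 * (2 * PI / 3)) by (apply Rmult_le_pos; lra).
    assert (sqrt 3 * (2 * PI / 3) * exp (PI / 16) <= 1733 / 1000 * (21 / 10) * (1221 / 1000)) by (apply Rmult_le_compat; lra). lra. }
  replace (sqrt 3 * (2 * PI / (3 * mu * E)) * W * exp (PI / 16) / 4) with (sqrt 3 * (2 * PI / 3) * exp (PI / 16) / 4 * (W / E) * / mu) by (field; lra).
  assert (HWE : 0 < W / E) by now apply Rdiv_lt_0_compat.
  replace (1112 / 1000 / m0 * W / E) with (1112 / 1000 * (W / E) * / m0) by (field; lra).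
  replace (1112 / 1000 / m0 * m0) with (1112 / 1000) in A by (field; lra).
  apply Rmult_le_compat; [| left; apply Rinv_0_lt_compat; lra | apply Rmult_le_compat_r; lra | now apply Rinv_le_contravar].
  apply Rmult_le_pos; [|lra]. apply Rmult_le_pos; [|lra]. apply Rmult_le_pos; [apply Rmult_le_pos; lra | lra].
Qed.

Lemma Rrem_bound_numeric (s : C) (c1 S W beta m0 J1 J2 : R) : Re s < 1 -> 4 * PI <= Cmod (s - 1) -> IZR (mZ s) < c1 < IZR (mZ s) + 1 ->
  1 < S < 2 -> 0 < W ->
  let E := Cmod (eta s) in
  0 <= S * S * E - (S * S - 1) / 4 ->
  2 * (S * S) * (E * E) <= (S * S * E - (S * S - 1) / 4) * (S * S * E - (S * S - 1) / 4) ->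
  (forall d v, - / 4 <= d <= / 4 -> exp (- (PI * Rabs (Im (eta s) + d / 2 - rt * v))) <= W * exp (beta * v)) ->
  0 < m0 <= mu_eta s -> Jk (2 * PI) beta <= J1 -> 0 <= J2 -> Jk ((2 - S) * PI) beta <= J2 ->
  Cmod (Rrem c1 s) <= 1112 / 1000 / m0 * (J1 + 1221 / 1000 * J2) * W / E.
Proof.
  intros Hs H4 Hc1 HS HW E HS0 HS1 HB Hm HJ1 HJ20 HJ2. pose proof PI_RGT_0 as HP.
  assert (HE : 0 < E) by (apply Cmod_gt_0, eta_neq_0, Hs).
  eapply Rle_trans; [exact (Rrem_bound s c1 S W beta Hs H4 Hc1 HS HW HS0 HS1 HB)|].
  pose proof (Rrem_factor_le s W m0 Hm HE HW) as K. fold E in K.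
  assert (K0 : 0 <= Rrem_factor s W).
  { unfold Rrem_factor. fold E. assert (0 < 3 * mu_eta s * E) by (apply Rmult_lt_0_compat; lra). pose proof (exp_pos (PI / 16)). pose proof (sqrt_pos 3).
    assert (0 < 2 * PI / (3 * mu_eta s * E)) by (apply Rdiv_lt_0_compat; lra).
    apply (Rmult_le_pos _ (/ 4)); [|lra]. apply Rmult_le_pos; [|lra]. apply Rmult_le_pos; [|lra]. apply Rmult_le_pos; lra. }
  assert (X : exp (PI * S / 32) <= 1221 / 1000) by (eapply Rle_trans; [|apply exp_PI16_upper]; apply exp_le; nra).
  pose proof (exp_pos (PI * S / 32)).
  assert (J : Jk (2 * PI) beta + exp (PI * S / 32) * Jk ((2 - S) * PI) beta <= J1 + 1221 / 1000 * J2).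
  { assert (exp (PI * S / 32) * Jk ((2 - S) * PI) beta <= exp (PI * S / 32) * J2) by (apply Rmult_le_compat_l; lra). nra. }
  assert (JJ : 0 <= J1 + 1221 / 1000 * J2).
  { assert (0 <= Jk (2 * PI) beta); [|lra].
    unfold Jk. cbv zeta. set (g := / (2 * (2 * PI))). assert (0 < g) by (apply Rinv_0_lt_compat; lra).
    set (h := beta / (2 * (2 * PI))). assert (0 <= h * h) by apply Rle_0_sqr. assert (0 <= h * h * (h * h)) by nra. assert (0 <= h * h * g) by nra. assert (0 <= g * g) by nra.
    apply Rmult_le_pos; [apply Rmult_le_pos; [apply sqrt_pos | left; apply exp_pos] | lra]. }
  apply Rle_trans with (Rrem_factor s W * (J1 + 1221 / 1000 * J2)); [now apply Rmult_le_compat_l|].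
  apply (Rmult_le_compat_r _ _ _ JJ) in K. eapply Rle_trans; [exact K|]. right. field. lra.
Qed.

Lemma Jk_2PI_0 : Jk (2 * PI) 0 <= 101 / 1000.
Proof.
  pose proof PI_RGT_0. pose proof inv_PI_upper.
  eapply Rle_trans; [apply (Jk_le (2 * PI) 0 0 (/ 12) (7072 / 10000) 1); try lra|].
  - replace (/ (2 * (2 * PI))) with (/ 4 * / PI) by (field; lra). lra.
  - replace (PI / (2 * PI)) with (/ 2) by (field; lra). lra.
  - replace (0 * 0 / (4 * (2 * PI))) with 0 by (field; lra). rewrite exp_0. lra.
  - unfold Jpoly. lra.
Qed.

Lemma Jk_0 (S G Q : R) : S < 2 -> / (2 * (2 - S)) * / 3 <= G -> / (2 - S) <= Q * Q -> 0 <= Q -> Jk ((2 - S) * PI) 0 <= Q * Jpoly 0 G.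
Proof.
  intros HS HG HQ Q0. pose proof PI_RGT_0. pose proof inv_PI_upper.
  rewrite <- (Rmult_1_r Q) at 1. apply Jk_le; auto.
  - apply Rmult_lt_0_compat; lra.
  - field. lra.
  - replace (/ (2 * ((2 - S) * PI))) with (/ (2 * (2 - S)) * / PI) by (field; lra). eapply Rle_trans; [|exact HG].
    apply Rmult_le_compat_l; [left; apply Rinv_0_lt_compat; lra | lra].
  - replace (PI / ((2 - S) * PI)) with (/ (2 - S)) by (field; lra). lra.
  - replace (0 * 0 / (4 * ((2 - S) * PI))) with 0 by (field; lra). rewrite exp_0. lra.
Qed.

Lemma Jk_2PI_rt : Jk (2 * PI) (PI * rt) <= 166 / 1000.
Proof.
  pose proof PI_RGT_0. pose proof inv_PI_upper. pose proof rt_sqr.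
  eapply Rle_trans; [apply (Jk_le (2 * PI) (PI * rt) (/ 32) (/ 12) (7072 / 10000) (1221 / 1000)); try lra|].
  - replace (PI * rt / (2 * (2 * PI)) * (PI * rt / (2 * (2 * PI)))) with (rt * rt / 16) by (field; lra). lra.
  - replace (/ (2 * (2 * PI))) with (/ 4 * / PI) by (field; lra). lra.
  - replace (PI / (2 * PI)) with (/ 2) by (field; lra). lra.
  - replace (PI * rt * (PI * rt) / (4 * (2 * PI))) with (PI * (rt * rt) / 8) by (field; lra). rewrite H1.
    replace (PI * / 2 / 8) with (PI / 16) by field. apply exp_PI16_upper.
  - unfold Jpoly. lra.
Qed.

Lemma exp_PI8_upper : exp (PI / 8) <= 1491 / 1000.
Proof.
  replace (PI / 8) with (PI / 16 + PI / 16) by field. rewrite exp_plus. pose proof exp_PI16_upper. pose proof (exp_pos (PI / 16)). nra.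
Qed.

Lemma exp_PI4_upper : exp (PI / 4) <= 2224 / 1000.
Proof.
  replace (PI / 4) with (PI / 8 + PI / 8) by field. rewrite exp_plus. pose proof exp_PI8_upper. pose proof (exp_pos (PI / 8)). nra.
Qed.

Lemma Jk_half_rt : Jk ((2 - 3 / 2) * PI) (PI * rt) <= 7870 / 1000.
Proof.
  pose proof PI_RGT_0. pose proof inv_PI_upper. pose proof rt_sqr.
  eapply Rle_trans; [apply (Jk_le ((2 - 3 / 2) * PI) (PI * rt) (/ 2) (/ 3) (14143 / 10000) (2224 / 1000)); try lra|].
  - replace (PI * rt / (2 * ((2 - 3 / 2) * PI)) * (PI * rt / (2 * ((2 - 3 / 2) * PI)))) with (rt * rt) by (field; lra). lra.
  - replace (/ (2 * ((2 - 3 / 2) * PI))) with (/ PI) by (field; lra). lra.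
  - replace (PI / ((2 - 3 / 2) * PI)) with 2 by (field; lra). lra.
  - replace (PI * rt * (PI * rt) / (4 * ((2 - 3 / 2) * PI))) with (PI * (rt * rt) / 2) by (field; lra). rewrite H1.
    replace (PI * / 2 / 2) with (PI / 4) by field. apply exp_PI4_upper.
  - unfold Jpoly. lra.
Qed.

Lemma den_weight_const (b d v : R) : exp (- (PI * Rabs (b + d / 2 - rt * v))) <= 1 * exp (0 * v).
Proof.
  rewrite Rmult_0_l, Rmult_1_l. apply exp_le. pose proof PI_RGT_0. pose proof (Rabs_pos (b + d / 2 - rt * v)). nra.
Qed.

(** |y| >= y with y the imaginary part on the line: exp (- pi eta_2) is extracted at the price of a
    drift in the Gaussian, and exp (pi / 8) is the worst effect of the offset d / 2. *)
Lemma den_weight_exp (b d v : R) : - / 4 <= d <= / 4 ->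
  exp (- (PI * Rabs (b + d / 2 - rt * v))) <= exp (PI / 8) * exp (- PI * b) * exp (PI * rt * v).
Proof.
  intros Hd. rewrite <- !exp_plus. apply exp_le. pose proof PI_RGT_0. pose proof (Rle_abs (b + d / 2 - rt * v)). nra.
Qed.

Lemma Rrem_estimate (s : C) (c1 : R) : Re s < 1 -> 4 * PI <= Cmod (s - 1) -> IZR (mZ s) < c1 < IZR (mZ s) + 1 ->
  Cmod (Rrem c1 s) <= Rmin 4 (29 * exp (- PI * Im (eta s))) / Cmod (eta s) + 15 * exp (- (PI / 32) * Cmod (eta s) ^ 2) / Cmod (eta s).
Proof.
  intros Hs H4 Hc1. pose proof PI_RGT_0 as HP. pose proof PI_upper as HPu. pose proof rt_lower as Hrt. pose proof rt_pos.
  pose proof (Cmod_eta s Hs H4) as E2. set (X := exp (- PI * Im (eta s))). assert (HX : 0 < X) by apply exp_pos.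
  pose proof (fun S => Rrem_bound_numeric s c1 S) as RF. unfold mu_eta in RF. set (E := Cmod (eta s)) in *. cbv zeta in RF.
  assert (HE : 14 / 10 <= E) by (assert (0 <= E) by apply Cmod_ge_0; nra).
  assert (HEi : 0 < / E) by (apply Rinv_0_lt_compat; lra).
  assert (Hmin : 0 < Rmin 4 (29 * X)) by (apply Rmin_pos; lra).
  assert (Hexp : 0 < exp (- (PI / 32) * E ^ 2)) by apply exp_pos.
  destruct (Rle_dec E (5 / 2)) as [L|L].
  (* S = 8/5 meets the circle condition from |eta| = 1.4 on. The resulting constant is about 3.9,
     while the second term of the bound alone has at least 15 * 0.38 = 5.7 here, whatever eta_2
     is. *)
  - assert (M : 58 / 100 <= (1 - / (4 * E)) * rt).
    { assert (/ (4 * E) <= / (56 / 10)) by (apply Rinv_le_contravar; lra).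
      apply Rle_trans with ((1 - / (56 / 10)) * (707 / 1000)); [lra | apply Rmult_le_compat; lra]. }
    pose proof (RF (8 / 5) 1 0 (58 / 100) (101 / 1000) (158 / 100) Hs H4 Hc1 ltac:(lra) ltac:(lra) ltac:(lra) ltac:(nra)
      (fun d v _ => den_weight_const _ d v) ltac:(lra) Jk_2PI_0 ltac:(lra)) as B.
    assert (J : Jk ((2 - 8 / 5) * PI) 0 <= 158 / 100).
    { eapply Rle_trans; [apply (Jk_0 (8 / 5) (5 / 12) (15812 / 10000)); lra|]. unfold Jpoly. lra. }
    specialize (B J). assert (EX : 38 / 100 <= exp (- (PI / 32) * E ^ 2)).
    { pose proof (exp_ineq1_le (- (PI / 32) * E ^ 2)) as I. assert (E ^ 2 <= 25 / 4) by nra. assert (0 <= E ^ 2) by nra.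
      assert (PI / 32 * E ^ 2 <= 315 / 3200 * (25 / 4)) by (apply Rmult_le_compat; lra). lra. }
    eapply Rle_trans; [exact B|]. unfold Rdiv. rewrite <- Rmult_plus_distr_r. apply Rmult_le_compat_r; lra.
  (* S = 3/2 meets the circle condition from |eta| = 5/2 on. The two choices of the weight give
     constants of about 2.4 and 25.5, below 4 and 29. *)
  - assert (M : 636 / 1000 <= (1 - / (4 * E)) * rt).
    { assert (/ (4 * E) <= / 10) by (apply Rinv_le_contravar; lra).
      apply Rle_trans with ((1 - / 10) * (707 / 1000)); [lra | apply Rmult_le_compat; lra]. }
    assert (B1 : Cmod (Rrem c1 s) <= 4 / E).
    { pose proof (RF (3 / 2) 1 0 (636 / 1000) (101 / 1000) (105 / 100) Hs H4 Hc1 ltac:(lra) ltac:(lra) ltac:(lra) ltac:(nra)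
        (fun d v _ => den_weight_const _ d v) ltac:(lra) Jk_2PI_0 ltac:(lra)) as B.
      assert (J : Jk ((2 - 3 / 2) * PI) 0 <= 105 / 100).
      { eapply Rle_trans; [apply (Jk_0 (3 / 2) (/ 3) (14143 / 10000)); lra|]. unfold Jpoly. lra. }
      specialize (B J). eapply Rle_trans; [exact B|]. unfold Rdiv. apply Rmult_le_compat_r; lra. }
    assert (B2 : Cmod (Rrem c1 s) <= 29 * X / E).
    { pose proof exp_PI8_upper as P8. pose proof (exp_pos (PI / 8)).
      pose proof (RF (3 / 2) (exp (PI / 8) * X) (PI * rt) (636 / 1000) (166 / 1000) (787 / 100) Hs H4 Hc1 ltac:(lra) ltac:(apply Rmult_lt_0_compat; lra) ltac:(lra) ltac:(nra)
        (fun d v Hd => den_weight_exp _ d v Hd) ltac:(lra) Jk_2PI_rt ltac:(lra)) as B.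
      pose proof Jk_half_rt as J. specialize (B ltac:(lra)). eapply Rle_trans; [exact B|]. unfold Rdiv. apply Rmult_le_compat_r; [lra|].
      rewrite <- Rmult_assoc. apply Rmult_le_compat_r; lra. }
    apply Rle_trans with (Rmin 4 (29 * X) / E).
    + unfold Rmin. destruct (Rle_dec 4 (29 * X)); assumption.
    + assert (0 < 15 * exp (- (PI / 32) * E ^ 2) / E) by (apply Rdiv_lt_0_compat; lra). lra.
Qed.

Theorem mainTheorem4 :
  forall s : C,
    Re s < 1 ->
    4 * PI <= Cmod (s - 1)%C ->
    s <> RtoC 0 ->
    forall k : Z, (mZ s <= k)%Z ->
    forall c0 : R, 0 < c0 < 1 ->
    forall c1 : R, IZR (mZ s) < c1 < IZR (mZ s) + 1 ->
    let e := eta s in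
    Rcal c0 s =
      (chi s *
       (zeta (1 - s)
        - CsumZ (fun n => cpow (RtoC (IZR n)) (s - 1)%C) 1 k
        - cpow e (s - 1) * cexp (- (RtoC PI * ci * e * e)) *
          ((RtoC (sqrt 2) * cexp (RtoC (3 * PI / 8) * ci) * csin (RtoC PI * e)
            - RtoC (powerRZ (-1) k)
              * cexp (2 * RtoC PI * ci * e
                      - 2 * RtoC PI * ci * (e - RtoC (IZR k)) * (e - RtoC (IZR k))))
           / (2 * ccos (2 * RtoC PI * e))
           + CsumZ (fun j => RtoC (powerRZ (-1) (j - 1))
                             * cexp (- (2 * RtoC PI * ci * (RtoC (IZR j) - e) * (RtoC (IZR j) - e)))
                             * wfun s (RtoC (IZR j) - e))%C
                   (mZ s + 1) k
           + Rrem c1 s)))%C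
    /\
    Cmod (Rrem c1 s) <=
      Rmin 4 (29 * exp (- PI * Im e)) / Cmod e
      + 15 * exp (- (PI / 32) * Cmod e ^ 2) / Cmod e.
Proof.
  intros s Hs H4 S0 k Hk c0 Hc0 c1 Hc1 e. split.
  - exact (main_identity s k c0 c1 Hs H4 S0 Hk Hc0 Hc1).
  - exact (Rrem_estimate s c1 Hs H4 Hc1).
Qed.
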